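(* Let $\Omega$ be an open set in $\mathbb{R}^n$, with $n\ge2$. Let $A$ and $B$ be Young functions. Assume that $A$ is non-degenerate and $$\int^{\infty}\Big(\frac{t}{A(t)}\Big)^{\frac1{n-1}}dt=\infty .$$ Let $f:\mathbb{R}\to\mathbb{R}$ be a locally Lipschitz continuous function such that $f(0)=0$ and $|f'(t)|\le\kappa E(\kappa|t|)$ for a.e. $t\in\mathbb{R}$, for some constant $\kappa>0$ and some non-decreasing continuous function $E:[0,\infty)\to[0,\infty)$ not identically $0$. Let $T_f(u)=f\circ u$. (i) Assume that $|\Omega|<\infty$. If there exists $t_0\ge 0$ such that $$B\big(tE(H_n(t))\big)\le A(t)\quad\text{for }t\ge t_0,$$ then $T_f$ maps $V^{1,A}_0(\Omega)$ into $V^{1,B}_0(\Omega)$ and is continuous in the modular topology. (ii) Assume that $$\int_{0}\Big(\frac{t}{A(t)}\Big)^{\frac1{n-1}}dt<\infty .$$ If $B\big(tE(H_n(t))\big)\le A(t)$ for every $t\ge0$, then $T_f$ maps $V^{1,A}_0(\Omega)$ into $V^{1,B}_0(\Omega)$ and is continuous in the modular topology.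
   Context: A Young function is a convex, left-continuous function $A:[0,\infty)\to[0,\infty]$ with $A(0)=0$ which is non-constant in $(0,\infty)$; it is non-degenerate if $A(t)>0$ for $t>0$. Two Young functions $A,\widehat A$ are equivalent near infinity if there are $c,t_0>0$ with $A(t/c)\le\widehat A(t)\le A(ct)$ for $t\ge t_0$. The symbols $\int^\infty$ and $\int_0$ refer to convergence or divergence of the integral at infinity and at zero, respectively. $L^A(\Omega)$ consists of the measurable functions $u$ on $\Omega$ with $\int_\Omega A(|u|/\lambda)\,dx<\infty$ for some $\lambda>0$ (for vector-valued $u$, $|u|$ is the Euclidean length); $u_k\to u$ modularly in $L^A(\Omega)$ if there is $\lambda>0$ with $\lim_k\int_\Omega A(|u_k-u|/\lambda)\,dx=0$. For $u:\Omega\to\mathbb{R}$ let $\widehat u:\mathbb{R}^n\to\mathbb{R}$ be its extension by $0$ outside $\Omega$. The homogeneous Orlicz-Sobolev space $V^{1,A}_0(\Omega)$ consists of the measurable $u$ on $\Omega$ such that $\widehat u\in W^{1,1}_{loc}(\mathbb{R}^n)$, $\nabla\widehat u\in L^A(\mathbb{R}^n)$ and $|\{x\in\mathbb{R}^n:|\widehat u(x)|>t\}|<\infty$ for every $t>0$; its norm is $\|\nabla u\|_{L^A(\Omega)}$, and $u_k\to u$ modularly in $V^{1,A}_0(\Omega)$ means $\nabla u_k\to\nabla u$ modularly in $L^A(\Omega)$. Continuity of $T_f$ in the modular topology means that modular convergence $u_k\to u$ in the domain space implies modular convergence $f(u_k)\to f(u)$ in the target space. $n'=n/(n-1)$ and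 $H_n(s)=\Big(\int_0^s\big(\tfrac{t}{A(t)}\big)^{\frac1{n-1}}dt\Big)^{1/n'}$ for $s\ge0$. If $\int_0\big(\tfrac{t}{A(t)}\big)^{1/(n-1)}dt=\infty$ (which may occur in part (i)), then $H_n$ is defined with $A$ replaced by a Young function equivalent to $A$ near infinity for which this integral converges at $0$. *)

(* Defs.v *)
From HB Require Import structures.
From mathcomp Require Import all_boot all_order all_algebra.
From mathcomp Require Import all_classical all_reals all_analysis.

Set Implicit Arguments.
Unset Strict Implicit.
Unset Printing Implicit Defensive.

Import Order.TTheory GRing.Theory Num.Theory.
Import numFieldNormedType.Exports.

Local Open Scope classical_set_scope.
Local Open Scope ring_scope.

Definition measure_rV_display : measure_display.
Proof. exact: default_measure_display. Qed.

Section borel_rV.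
Context (R : realType) (n : nat).

Let coor (i : 'I_n) (x : 'rV[R]_n) : measurableTypeR R := x ord0 i.

Let rV_set0 : g_sigma_preimage coor set0.
Proof. exact: sigma_algebra0. Qed.

Let rV_setC A : g_sigma_preimage coor A -> g_sigma_preimage coor (~` A).
Proof. exact: sigma_algebraC. Qed.

Let rV_bigcup (F : (set 'rV[R]_n)^nat) :
  (forall i, g_sigma_preimage coor (F i)) ->
  g_sigma_preimage coor (\bigcup_i (F i)).
Proof. exact: sigma_algebra_bigcup. Qed.

HB.instance Definition _ := @isMeasurable.Build measure_rV_display
  'rV[R]_n (g_sigma_preimage coor) rV_set0 rV_setC rV_bigcup.

Lemma measurable_coor (i : 'I_n) :
  measurable_fun [set: 'rV[R]_n] (fun x : 'rV[R]_n => x ord0 i : measurableTypeR R).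
Proof.
move=> _ Y mY; rewrite setTI; apply: sub_sigma_algebra => /=.
rewrite -bigcup_seq/=; exists i => /=; first by rewrite mem_index_enum.
by exists Y => //; rewrite setTI.
Qed.

Lemma measurable_fun_rVP d (T : measurableType d) (g : T -> 'rV[R]_n) :
  (forall i, measurable_fun [set: T] (fun x => g x ord0 i : measurableTypeR R)) ->
  measurable_fun [set: T] g.
Proof.
move=> mg _ Y; rewrite setTI.
have : <<s \big[setU/set0]_(i < n)
   preimage_set_system setT (coor i) measurable >> `<=`
   [set Z : set 'rV[R]_n | measurable (g @^-1` Z)].
  apply: smallest_sub.
    split => /=.
    - by rewrite preimage_set0.
    - by move=> Z mZ; rewrite setTD preimage_setC; exact: measurableC.
    - by move=> F mF; rewrite preimage_bigcup; exact: bigcupT_measurable.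
  rewrite -bigcup_seq => Z [i _ [W mW <-]] /=; rewrite setTI.
  by have := mg i measurableT _ mW; rewrite setTI.
exact.
Qed.

End borel_rV.

Section lebesgue_cons.
Local Open Scope ereal_scope.
Context (R : realType) (n : nat).

Definition cons_rV (x : measurableTypeR R * 'rV[R]_n) : 'rV[R]_n.+1 :=
  row_mx (x.1 : R)%:M x.2.

Definition uncons_rV (x : 'rV[R]_n.+1) : measurableTypeR R * 'rV[R]_n :=
  (x ord0 ord0, rsubmx (x : 'rV[R]_(1 + n))).

Lemma cons_rVK : cancel cons_rV uncons_rV.
Proof.
case=> a v; rewrite /cons_rV /uncons_rV row_mxKr /=; congr pair.
by rewrite mxE; case: splitP => // j _; rewrite (ord1 j) mxE eqxx mulr1n.
Qed.

Lemma uncons_rVK : cancel uncons_rV cons_rV.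
Proof.
move=> v; rewrite -[RHS](@hsubmxK R 1 1 n v) /cons_rV /uncons_rV /=.
suff -> : (v ord0 ord0)%:M = lsubmx (v : 'rV[R]_(1 + n)) by [].
apply/matrixP => i j; rewrite !ord1 !mxE eqxx mulr1n; congr (v _ _).
exact/val_inj.
Qed.

Lemma measurable_cons_rV : measurable_fun setT cons_rV.
Proof.
apply: measurable_fun_rVP => i.
case: (splitP (i : 'I_(1 + n))) => [j ij|j ij].
  rewrite (_ : (fun _ => _) = fst); first exact: measurable_fst.
  apply/funext => -[a v] /=; rewrite /cons_rV /=.
  rewrite (_ : i = lshift n j); last exact/val_inj.
  apply: etrans (@row_mxEl R 1 1 n (a : R)%:M v ord0 j) _.
  by rewrite (ord1 j) mxE eqxx mulr1n.
rewrite (_ : (fun _ => _) =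
    (fun x : 'rV[R]_n => x ord0 j : measurableTypeR R) \o snd).
  by apply: measurableT_comp; [exact: measurable_coor|exact: measurable_snd].
apply/funext => -[a v] /=; rewrite /cons_rV /=.
rewrite (_ : i = rshift 1 j); last exact/val_inj.
exact: (@row_mxEr R 1 1 n (a : R)%:M v ord0 j).
Qed.

Lemma measurable_uncons_rV : measurable_fun setT uncons_rV.
Proof.
apply/measurable_fun_pairP; split; first exact: (measurable_coor ord0).
apply: measurable_fun_rVP => i.
rewrite (_ : (fun _ => _) =
    fun x : 'rV[R]_n.+1 => x ord0 (rshift 1 i) : measurableTypeR R).
  exact: measurable_coor.
by apply/funext => x /=; rewrite mxE.
Qed.

Variable m : {sigma_finite_measure set 'rV[R]_n -> \bar R}.

Definition lebesgue_cons : set 'rV[R]_n.+1 -> \bar R :=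
  pushforward (@lebesgue_measure R \x m) cons_rV.

Let lebesgue_cons0 : lebesgue_cons set0 = 0.
Proof. by rewrite /lebesgue_cons /pushforward preimage_set0 measure0. Qed.

Let lebesgue_cons_ge0 A : 0 <= lebesgue_cons A.
Proof. by rewrite /lebesgue_cons /pushforward; exact: measure_ge0. Qed.

Let lebesgue_cons_sigma_additive : semi_sigma_additive lebesgue_cons.
Proof.
rewrite /lebesgue_cons => F mF tF mUF.
exact: (@measure_semi_sigma_additive _ _ _
  (measure_function_pushforward__canonical__measure_function_Measure
    (@lebesgue_measure R \x m) measurable_cons_rV)).
Qed.

HB.instance Definition _ := isMeasure.Build _ _ _ lebesgue_cons
  lebesgue_cons0 lebesgue_cons_ge0 lebesgue_cons_sigma_additive.

Let lebesgue_cons_sigma_finite : sigma_finite setT lebesgue_cons.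
Proof.
have /sigma_finiteP[F [TF ndF Foo]] := sigma_finiteT (@lebesgue_measure R).
have /sigma_finiteP[G [TG ndG Goo]] := sigma_finiteT m.
exists (fun k => uncons_rV @^-1` (F k `*` G k)) => [|k].
  rewrite -preimage_bigcup -[LHS](preimage_setT uncons_rV); congr (_ @^-1` _).
  apply/esym; rewrite -subTset => -[x y] _.
  have [i _ Fx] : (\bigcup_k F k) x by rewrite -TF.
  have [j _ Gy] : (\bigcup_k G k) y by rewrite -TG.
  exists (maxn i j) => //; split.
    by apply/(subsetPset _ _ (ndF _ _ (leq_maxl i j))).
  by apply/(subsetPset _ _ (ndG _ _ (leq_maxr i j))).
have [mF Fk] := Foo k; have [mG Gk] := Goo k; split.
  rewrite -[X in measurable X]setTI; apply: measurable_uncons_rV => //.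
  exact: measurableX.
rewrite /lebesgue_cons /pushforward -comp_preimage.
rewrite (_ : uncons_rV \o cons_rV = idfun); last exact/funext/cons_rVK.
by rewrite preimage_id product_measure1E// lte_mul_pinfty// ge0_fin_numE.
Qed.

HB.instance Definition _ := Measure_isSigmaFinite.Build _ _ _ lebesgue_cons
  lebesgue_cons_sigma_finite.

End lebesgue_cons.

Fixpoint borel_lebesgue (R : realType) (n : nat) :
    {sigma_finite_measure set 'rV[R]_n -> \bar R} :=
  if n is k.+1 then lebesgue_cons (borel_lebesgue R k) else \d_(0 : 'rV[R]_0).

(* The Lebesgue sigma-algebra: the Caratheodory-measurable sets of the outer
   measure generated by [borel_lebesgue]. *)
Definition lebesgue_rV (R : realType) (n : nat) :=
  @completed_measure_extension _ _ _ (borel_lebesgue R n).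
Arguments lebesgue_rV : clear implicits.

HB.instance Definition _ (R : realType) (n : nat) :=
  Measure.on (lebesgue_rV R n).

Definition euclidean_norm (R : realType) (n : nat) (v : 'rV[R]_n) : R :=
  Num.sqrt (\sum_(i < n) v ord0 i ^+ 2).

Section sobolev.
Context {R : realType} {n : nat}.
Implicit Types (u phi : 'rV[R]_n -> R) (g : 'rV[R]_n -> 'rV[R]_n).
Implicit Types (D Omega : set 'rV[R]_n).

Local Notation mu := (lebesgue_rV R n).

Definition leb_measurable_fun D u :=
  @measurable_fun _ _ (caratheodory_type (borel_lebesgue R n)^*%mu) R D u.

Definition partial_derive (i : 'I_n) phi (x : 'rV[R]_n) : R :=
  'D_(delta_mx ord0 i) phi x.

Fixpoint Ck (k : nat) phi : Prop :=
  if k is k'.+1 then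
    [/\ continuous phi,
        (forall (i : 'I_n) x, derivable phi x (delta_mx ord0 i)) &
        (forall i : 'I_n, Ck k' (partial_derive i phi))]
  else continuous phi.

Definition test_function phi :=
  (forall k, Ck k phi) /\ compact (closure [set x | phi x != 0]).

Definition L1loc u := forall K : set 'rV[R]_n, compact K ->
  mu.-integrable K (EFin \o u).

Definition is_weak_gradient u g :=
  (forall i : 'I_n, L1loc (fun x => g x ord0 i)) /\
  (forall phi, test_function phi -> forall i : 'I_n,
     \int[mu]_(x in [set: 'rV[R]_n]) (u x * partial_derive i phi x) =
     - \int[mu]_(x in [set: 'rV[R]_n]) (g x ord0 i * phi x)).

Definition W11loc u := L1loc u /\ exists g, is_weak_gradient u g.

(* A representative of the weak gradient, which is unique up to null sets; only
   meaningful when [W11loc u] holds. *)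
Definition weak_gradient u : 'rV[R]_n -> 'rV[R]_n :=
  xget (fun=> 0) [set g | is_weak_gradient u g].

Section young_functions.
Local Open Scope ereal_scope.
Implicit Types (A B : R -> \bar R).

(* Functions on [0, +oo) are total functions on [R] whose values at negative
   arguments are irrelevant. *)
Record young A : Prop := Young {
  young0 : A 0%R = 0 ;
  young_ge0 : forall t : R, (0 <= t)%R -> 0 <= A t ;
  young_convex : forall s t a : R, (0 <= s)%R -> (0 <= t)%R ->
    (0 <= a <= 1)%R ->
    A (a * s + (1 - a) * t)%R <= a%:E * A s + (1 - a)%:E * A t ;
  young_left_continuous : forall t : R, (0 < t)%R ->
    A s @[s --> t^'-] --> A t ;
  young_non_constant : exists s t : R, [/\ (0 < s)%R, (0 < t)%R & A s <> A t]
}.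

Definition non_degenerate A := forall t : R, (0 < t)%R -> 0 < A t.

Definition equiv_near_infinity A B := exists c t0 : R,
  [/\ (0 < c)%R, (0 < t0)%R & forall t : R, (t0 <= t)%R ->
    A (t / c)%R <= B t /\ B t <= A (c * t)%R].

Definition orlicz A D g :=
  (forall i : 'I_n, leb_measurable_fun D (fun x => g x ord0 i)) /\
  exists2 lam : R, (0 < lam)%R &
    \int[mu]_(x in D) A (euclidean_norm (g x) / lam)%R < +oo.

Definition orlicz_modular_cvg A D (gk : nat -> 'rV[R]_n -> 'rV[R]_n) g :=
  exists2 lam : R, (0 < lam)%R &
    \int[mu]_(x in D) A (euclidean_norm (gk k x - g x)%R / lam)%R
      @[k --> \oo] --> 0.

(* A function on [Omega] is a total function whose values outside [Omega] are
   irrelevant; [u \_ Omega] is its extension by zero. *)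
Definition V01 A Omega u :=
  [/\ leb_measurable_fun Omega u,
      W11loc (u \_ Omega),
      orlicz A setT (weak_gradient (u \_ Omega)) &
      forall t : R, (0 < t)%R -> mu [set x | (t < `|(u \_ Omega) x|)%R] < +oo].

Definition V01_modular_cvg A Omega (uk : nat -> 'rV[R]_n -> R) u :=
  orlicz_modular_cvg A Omega
    (fun k => weak_gradient (uk k \_ Omega)) (weak_gradient (u \_ Omega)).

Definition maps_V01 A B Omega (T : ('rV[R]_n -> R) -> 'rV[R]_n -> R) :=
  forall u, V01 A Omega u -> V01 B Omega (T u).

Definition modular_continuous A B Omega
    (T : ('rV[R]_n -> R) -> 'rV[R]_n -> R) :=
  forall (uk : nat -> 'rV[R]_n -> R) u,
    (forall k, V01 A Omega (uk k)) -> V01 A Omega u ->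
    V01_modular_cvg A Omega uk u ->
    V01_modular_cvg B Omega (fun k => T (uk k)) (T u).

End young_functions.
End sobolev.

Section Hn.
Local Open Scope ereal_scope.
Context {R : realType} (n : nat).
Implicit Types (A : R -> \bar R) (h : R -> \bar R).

(* With [0^-1 = +oo] and [+oo^-1 = 0], this is [+oo] at [t > 0] if [A t = 0]
   and [0] if [A t = +oo]. *)
Definition Hn_integrand A (t : R) : \bar R :=
  (t%:E / A t) `^ (n.-1%:R^-1)%R.

Definition diverges_at_infinity h := forall a : R, (0 < a)%R ->
  \int[@lebesgue_measure R]_(t in `[a, +oo[) h t = +oo.

Definition converges_at_zero h := exists2 a : R, (0 < a)%R &
  \int[@lebesgue_measure R]_(t in `[0%R, a]) h t < +oo.

Definition conjugate_exponent : R := n%:R / n.-1%:R.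

(* Finite for every [s >= 0] when [Hn_integrand A] converges at zero. *)
Definition Hn A (s : R) : R :=
  fine ((\int[@lebesgue_measure R]_(t in `[0%R, s]) Hn_integrand A t)
          `^ (conjugate_exponent^-1)%R).

(* [Ah] may be used in place of [A] to define [H_n]. *)
Definition Hn_admissible A (Ah : R -> \bar R) :=
  (converges_at_zero (Hn_integrand A) -> Ah = A) /\
  (~ converges_at_zero (Hn_integrand A) ->
    [/\ young Ah, equiv_near_infinity A Ah &
        converges_at_zero (Hn_integrand Ah)]).

End Hn.

(* Main.v *)
(** The composition [f o u] has gradient [D(u) grad u], where [D] is a Borel derivative of [f] with
    |D| <= kappa E(kappa |.|); this chain rule is proved with weak derivatives characterized by the
    fundamental theorem of calculus on almost every line.  With T = H_n^-1 the growth condition gives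

      B(|grad u| E(s)) <= A(|grad u|) + A(T(c s)) + const,

    so that the theorem rests on a modular Sobolev inequality: the integral of A(T(K |u|)) is at most M
    whenever that of A(|grad u|) is at most M and M is small with respect to K.  It follows, by Maz'ya's
    truncation at the levels 2^j, from a weak type inequality, which in turn comes from the isoperimetric
    inequality between level sets whose volumes are dyadic.
    Finiteness for every K follows by treating small and large values of |u| separately.

    For continuity, the same inequality for u_k - u dominates the modulars, and it remains to show that
    D(u_k) grad u_k converges almost everywhere along a subsequence.  For bounded Borel theta,
    theta(u_k) d_i u_k converges weakly, as the derivative of a Lipschitz function of u_k.  Used for theta
    and theta^2, this shows that (theta(u_k) - theta(u))^2 |d_i u| tends to 0 in L^1 on cubes: D(u_k)
    converges to D(u) where grad u does not vanish, and elsewhere D(u_k) only has to stay bounded. *)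

Require Import Defs.
From HB Require Import structures.
From mathcomp Require Import all_boot all_order all_algebra.
From mathcomp Require Import all_classical all_reals all_analysis.
From mathcomp Require Import measurable_realfun.
From mathcomp Require Import ring lra.

Set Implicit Arguments.
Unset Strict Implicit.
Unset Printing Implicit Defensive.

Import Order.TTheory GRing.Theory Num.Theory.
Import numFieldNormedType.Exports.
Import HBNNSimple.

Local Open Scope classical_set_scope.
Local Open Scope ring_scope.


(** * Integrals of real functions *)

(** The parameter of a modular cannot be changed freely, as [A] and [B] may fail any doubling
    condition. This is why the potential must be finite for every factor [K], and why the limit is
    taken by domination with a moving majorant, one part of which tends to 0 in [L^1]. Crude
    constants then suffice: an isoperimetric inequality with the right power of the volume, obtained
    from translates, replaces the sharp one.

    The composition [f o u] is not known beforehand to be locally integrable, only its formal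
    gradient is; its integrability is extracted from the same isoperimetric inequality.

    Additive constants come from a growth condition that starts at a positive [t0], or from
    replacing [A] by an equivalent function. They are harmless in part (i), since gradients vanish
    almost everywhere outside the domain, whose measure is finite.

    The analysis is done for Borel functions and the Borel measure, for which Fubini on lines is
    available. The completion, and the arbitrary choice made in [weak_gradient], enter only at the
    end, through Borel versions. *)

Section measurable_levels.
Context d (T : measurableType d) (R : realType) (f g : T -> R).
Hypotheses (mf : measurable_fun setT f) (mg : measurable_fun setT g).

Lemma measurable_lt_set : measurable [set x | f x < g x].
Proof.
have := measurable_fun_ltr mf mg measurableT (I : measurable [set true]); rewrite setTI.
by congr measurable; apply/seteqP; split.
Qed.

Lemma measurable_le_set : measurable [set x | f x <= g x].
Proof.
have := measurable_fun_ler mf mg measurableT (I : measurable [set true]); rewrite setTI.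
by congr measurable; apply/seteqP; split.
Qed.

End measurable_levels.

Section integration.
Context d (T : measurableType d) (R : realType) (mu : {measure set T -> \bar R}).
Implicit Types (f g : T -> R).

(** Integrability in real-valued form for total functions, so that sums and integrals stay in
    [R]. *)
Definition summable_fun f := measurable_fun [set: T] f /\ (\int[mu]_x `|f x|%:E < +oo)%E.

Lemma summable_integrable f : summable_fun f <-> mu.-integrable setT (EFin \o f).
Proof.
split=> [[mf fi]|/integrableP[mf fi]].
  by apply/integrableP; split => //; exact/measurable_EFinP.
by split => //; exact/measurable_EFinP.
Qed.

Lemma summable_integrable1 f : summable_fun f -> mu.-integrable setT (EFin \o f).
Proof. by move/summable_integrable. Qed.

Lemma summable_measurable f : summable_fun f -> measurable_fun setT f.
Proof. by case. Qed.

Lemma summable_le f g : measurable_fun setT f -> (forall x, `|f x| <= g x) ->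
  summable_fun g -> summable_fun f.
Proof.
move=> mf fg [mg ig]; split => //; apply: le_lt_trans ig.
apply: ge0_le_integral => //=.
- by apply/measurable_EFinP; exact: measurableT_comp.
- by apply/measurable_EFinP; exact: measurableT_comp.
- by move=> x _; rewrite lee_fin (le_trans (fg x))// ler_norm.
Qed.

Lemma summable_abs f : summable_fun f -> summable_fun (fun x => `|f x|).
Proof.
move=> sf; apply: (@summable_le _ (fun x => `|f x|)).
- by apply: measurableT_comp => //; case: sf.
- by move=> x; rewrite normr_id.
- case: sf => mf fi; split; first exact: measurableT_comp.
  by under eq_integral do rewrite normr_id.
Qed.

Lemma summableD f g : summable_fun f -> summable_fun g -> summable_fun (fun x => f x + g x).
Proof.
move=> /summable_integrable sf /summable_integrable sg; apply/summable_integrable.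
have := integrableD measurableT sf sg; congr (_.-integrable _ _).
Qed.

Lemma summableZ (c : R) f : summable_fun f -> summable_fun (fun x => c * f x).
Proof.
move=> /summable_integrable sf; apply/summable_integrable.
have := integrableZl measurableT c sf; congr (_.-integrable _ _).
Qed.

Lemma summableN f : summable_fun f -> summable_fun (fun x => - f x).
Proof. by move=> /(summableZ (-1)); congr summable_fun; apply/funext => x; rewrite mulN1r. Qed.

Lemma summableB f g : summable_fun f -> summable_fun g -> summable_fun (fun x => f x - g x).
Proof. by move=> sf /summableN; exact: summableD. Qed.

Lemma summable0 : summable_fun (fun=> 0).
Proof. by split => //; rewrite integral0_eq// => x _; rewrite normr0. Qed.

Lemma summableMb (c : R) f g : measurable_fun setT g -> (forall x, `|g x| <= c) ->
  summable_fun f -> summable_fun (fun x => f x * g x).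
Proof.
move=> mg gc sf; apply: (@summable_le _ (fun x => c * `|f x|)).
- by apply: measurable_funM => //; case: sf.
- by move=> x; rewrite normrM mulrC ler_wpM2r.
- exact/summableZ/summable_abs.
Qed.

Lemma summable_indic (A : set T) : measurable A -> (mu A < +oo)%E -> summable_fun (\1_A).
Proof.
move=> mA Aoo; split; first exact: measurable_indic.
under eq_integral do rewrite ger0_norm ?indicE ?ler0n// -indicE.
by rewrite integral_indic// setIT.
Qed.

Lemma summable_sum (I : Type) (s : seq I) (F : I -> T -> R) :
  (forall i, summable_fun (F i)) -> summable_fun (fun x => \sum_(i <- s) F i x).
Proof.
move=> sF; elim: s => [|i s IH].
  by under eq_fun do rewrite big_nil; exact: summable0.
by under eq_fun do rewrite big_cons; exact: summableD.
Qed.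

Lemma RintD f g : summable_fun f -> summable_fun g ->
  \int[mu]_x (f x + g x) = \int[mu]_x f x + \int[mu]_x g x.
Proof. by move=> /summable_integrable sf /summable_integrable sg; exact: RintegralD. Qed.

Lemma RintZ (c : R) f : summable_fun f -> \int[mu]_x (c * f x) = c * \int[mu]_x f x.
Proof. by move=> /summable_integrable sf; exact: RintegralZl. Qed.

Lemma RintN f : summable_fun f -> \int[mu]_x (- f x) = - \int[mu]_x f x.
Proof.
by move=> sf; under eq_Rintegral do rewrite -mulN1r; rewrite RintZ// mulN1r.
Qed.

Lemma RintB f g : summable_fun f -> summable_fun g ->
  \int[mu]_x (f x - g x) = \int[mu]_x f x - \int[mu]_x g x.
Proof. by move=> sf sg; rewrite RintD ?RintN//; exact: summableN. Qed.

Lemma Rint_le f g : summable_fun f -> summable_fun g -> (forall x, f x <= g x) ->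
  \int[mu]_x f x <= \int[mu]_x g x.
Proof.
by move=> /summable_integrable sf /summable_integrable sg fg; exact: le_Rintegral.
Qed.

Lemma Rint_abs f : summable_fun f -> `|\int[mu]_x f x| <= \int[mu]_x `|f x|.
Proof. by move=> /summable_integrable sf; exact: le_normr_Rintegral. Qed.

Lemma Rint_EFin f : summable_fun f -> (\int[mu]_x f x)%:E = (\int[mu]_x (f x)%:E)%E.
Proof.
move=> /summable_integrable sf; rewrite /Rintegral fineK//.
exact: integrable_fin_num.
Qed.

Lemma Rint_ae f g : measurable_fun setT f -> measurable_fun setT g ->
  {ae mu, forall x, f x = g x} -> \int[mu]_x f x = \int[mu]_x g x.
Proof.
move=> mf mg fg; rewrite /Rintegral; congr fine; apply: ae_eq_integral => //.
- exact/measurable_EFinP.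
- exact/measurable_EFinP.
- by apply: filterS fg => x fgx _; rewrite fgx.
Qed.

Lemma summable_ae f g : summable_fun f -> measurable_fun setT g ->
  {ae mu, forall x, f x = g x} -> summable_fun g.
Proof.
move=> [mf sf] mg fg; split => //; rewrite (le_lt_trans _ sf)//.
apply: ae_ge0_le_integral => //=.
- by apply/measurable_EFinP; exact: measurableT_comp.
- by apply/measurable_EFinP; exact: measurableT_comp.
- by apply: filterS fg => x fgx _; rewrite fgx.
Qed.

Lemma Rint_dominated (f_ : nat -> T -> R) f g :
  (forall k, measurable_fun setT (f_ k)) -> measurable_fun setT f ->
  {ae mu, forall x, f_ k x @[k --> \oo] --> f x} ->
  summable_fun g -> (forall k x, `|f_ k x| <= g x) ->
  [/\ summable_fun f, \int[mu]_x `|f_ k x - f x| @[k --> \oo] --> 0 &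
      \int[mu]_x f_ k x @[k --> \oo] --> \int[mu]_x f x].
Proof.
move=> mf_ mf cf sg fg.
have sf_ k : summable_fun (f_ k) by exact: summable_le sg.
have /summable_integrable ig := sg.
have mE (h : T -> R) : measurable_fun setT h -> measurable_fun setT (EFin \o h).
  by move=> mh; exact/measurable_EFinP.
have [|||if_ d0 cd] := @dominated_convergence _ _ _ mu setT measurableT
  (fun k => EFin \o f_ k) (EFin \o f) (EFin \o g) (fun k => mE _ (mf_ k)) (mE _ mf).
- by apply: filterS cf => x cx _; apply: cvg_EFin => //; exact: nearW.
- exact: ig.
- by apply: aeW => x k _ /=; rewrite lee_fin.
have sf : summable_fun f by exact/summable_integrable.
split => //.
- apply: (@fine_cvg _ _ _ _ (fun k => (\int[mu]_x `|f_ k x - f x|%:E)%E) 0%R).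
  exact: d0.
- apply: (@fine_cvg _ _ _ _ (fun k => (\int[mu]_x (f_ k x)%:E)%E)).
  by rewrite -/(Rintegral mu setT f) Rint_EFin.
Qed.

End integration.

Section fubini.
Context d1 d2 (T1 : measurableType d1) (T2 : measurableType d2) (R : realType).
Variables (m1 : {sigma_finite_measure set T1 -> \bar R})
  (m2 : {sigma_finite_measure set T2 -> \bar R}).

(** The integrals of the positive and negative parts are measurable in [x], and [fine] of their
    difference assigns a default value where it is infinite; hence measurability without
    integrability of the sections. *)
Lemma measurable_Rint (f : T1 * T2 -> R) : measurable_fun setT f ->
  measurable_fun setT (fun x => \int[m2]_y f (x, y)).
Proof.
move=> mf; have mEf : measurable_fun setT (EFin \o f) by exact/measurable_EFinP.
rewrite (_ : (fun _ => _) = fine \o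
    (fun x => fubini_F m2 (EFin \o f)^\+ x - fubini_F m2 (EFin \o f)^\- x)%E).
  apply: measurableT_comp => //; apply: emeasurable_funB.
    by apply: measurable_fun_fubini_tonelli_F => //; exact: measurable_funepos.
  by apply: measurable_fun_fubini_tonelli_F => //; exact: measurable_funeneg.
apply/funext => x; rewrite /Rintegral integralE /fubini_F /=.
by congr (fine (_ - _)%E); apply: eq_integral => y _; rewrite ?funeposE ?funenegE.
Qed.

Lemma RFubini (f : T1 * T2 -> R) : measurable_fun setT f ->
  (\int[m1]_x \int[m2]_y `|f (x, y)|%:E < +oo)%E ->
  [/\ summable_fun m1 (fun x => \int[m2]_y f (x, y)),
      summable_fun m2 (fun y => \int[m1]_x f (x, y)),
      {ae m1, forall x, summable_fun m2 (fun y => f (x, y))} &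
      \int[m1]_x \int[m2]_y f (x, y) = \int[m2]_y \int[m1]_x f (x, y)].
Proof.
move=> mf fi; have mEf : measurable_fun setT (EFin \o f) by exact/measurable_EFinP.
have fint : (m1 \x m2)%E.-integrable setT (EFin \o f) by exact/(integrable12ltyP m1 m2 mEf).
have mEf' : measurable_fun setT (fun p : T2 * T1 => (f (p.2, p.1))%:E).
  apply/measurable_EFinP.
  by apply: (@measurableT_comp _ _ _ _ _ _ f _ (fun p => (p.2, p.1))) => //; exact: measurable_swap.
have fint' : (m2 \x m1)%E.-integrable setT (fun p : T2 * T1 => (f (p.2, p.1))%:E).
  apply/(integrable12ltyP m2 m1 mEf') => /=.
  rewrite -(@fubini_tonelli _ _ _ _ _ m1 m2 (fun p => `|f p|%:E))//.
  by apply/measurable_EFinP; exact: measurableT_comp.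
have iF := integrable_fubini_F fint; have iG := integrable_fubini_F fint'.
(* An integrable section integral is finite almost everywhere, so replacing it by its [fine] changes
   neither integrability nor value. *)
have fineE d (T : measurableType d) (m : {measure set T -> \bar R}) (F : T -> \bar R) :
    m.-integrable setT F -> summable_fun m (fine \o F) /\
    fine (\int[m]_x F x)%E = \int[m]_x fine (F x).
  move=> iF'; have mF := measurable_int _ iF'.
  have mfF : measurable_fun setT (fine \o F) by exact: measurableT_comp.
  have aeF : {ae m, forall x, setT x -> F x = (fine (F x))%:E}.
    by apply: filterS (integrable_ae measurableT iF') => x Fx _; rewrite fineK//; exact: Fx.
  split; last first.
    rewrite /Rintegral; congr fine; apply: ae_eq_integral => //.
    exact/measurable_EFinP.
  split => //; have /integrableP[_] := iF'.
  apply: le_lt_trans; apply: ae_ge0_le_integral => //.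
  - by apply/measurable_EFinP; exact: measurableT_comp.
  - exact: measurableT_comp.
  - by apply: filterS aeF => x Fx _; rewrite [in leRHS]Fx.
have [sF eF] := fineE _ _ _ _ iF; have [sG eG] := fineE _ _ _ _ iG.
split => //.
- apply: filterS (ae_integrable1 fint) => x ix.
  by apply/summable_integrable.
- have := Fubini fint; rewrite /= => /(congr1 fine).
  by rewrite /Rintegral [X in X = _]eF [X in _ = X]eG.
Qed.

End fubini.

Definition bounded_measurable d (T : measurableType d) (R : realType) (f : T -> R) :=
  measurable_fun [set: T] f /\ exists C : R, forall x, `|f x| <= C.

Section monotone_class.
Context d (T : measurableType d) (R : realType).
Implicit Types (f g : T -> R).

Lemma bounded_measurable_cst (c : R) : bounded_measurable ((fun=> c) : T -> R).
Proof. by split => //; exists `|c|. Qed.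

Lemma bounded_measurable_comb f g (c : R) : bounded_measurable f -> bounded_measurable g ->
  bounded_measurable (fun x => f x + c * g x).
Proof.
move=> [mf [C fC]] [mg [K gK]]; split.
  by apply: measurable_funD => //; exact: measurable_funM.
exists (C + `|c| * K) => x; rewrite (le_trans (ler_normD _ _))// lerD// normrM.
by rewrite ler_wpM2l.
Qed.

Lemma bounded_measurableM f g : bounded_measurable f -> bounded_measurable g ->
  bounded_measurable (fun x => f x * g x).
Proof.
move=> [mf [C fC]] [mg [K gK]]; split; first exact: measurable_funM.
by exists (C * K) => x; rewrite normrM ler_pM.
Qed.

Lemma bounded_measurable_indic (S : set T) : measurable S -> bounded_measurable (\1_S : T -> R).
Proof.
move=> mS; split; first exact: measurable_indic.
by exists 1 => x; rewrite indicE ger0_norm// lern1 leq_b1.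
Qed.

(** Functional monotone class theorem: Dynkin induction reaches the indicators, linearity the simple
    functions, a bounded limit the nonnegative functions, and adding the bound [C] reduces the
    general case to that one. Closure is asked for bounded pointwise limits, which is what dominated
    convergence provides. *)
Lemma bounded_measurable_ind (G : set (set T)) (P : (T -> R) -> Prop) :
  measurable = <<s G >> -> setI_closed G -> P (fun=> 1) ->
  (forall A, G A -> P (\1_A : T -> R)) ->
  (forall f g c, bounded_measurable f -> bounded_measurable g -> P f -> P g ->
     P (fun x => f x + c * g x)) ->
  (forall (f_ : nat -> T -> R) f (C : R), (forall k, bounded_measurable (f_ k)) ->
     bounded_measurable f -> (forall k x, `|f_ k x| <= C) ->
     (forall x, f_ k x @[k --> \oo] --> f x) -> (forall k, P (f_ k)) -> P f) ->
  forall f, bounded_measurable f -> P f.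
Proof.
move=> mG GI P1 PG Pcomb Plim.
have P0 : P (fun=> 0).
  have := Pcomb _ _ (-1) (bounded_measurable_cst 1) (bounded_measurable_cst 1) P1 P1.
  by congr P; apply/funext => x; rewrite mulr1 subrr.
have bsum (I : Type) (s : seq I) (F : I -> T -> R) (c : I -> R) :
    (forall i, bounded_measurable (F i)) -> bounded_measurable (fun x => \sum_(i <- s) c i * F i x).
  move=> bF; elim: s => [|i s IH].
    by under eq_fun do rewrite big_nil; exact: bounded_measurable_cst.
  under eq_fun do rewrite big_cons addrC; exact: bounded_measurable_comb.
have Psum (I : Type) (s : seq I) (F : I -> T -> R) (c : I -> R) :
    (forall i, bounded_measurable (F i)) -> (forall i, P (F i)) ->
    P (fun x => \sum_(i <- s) c i * F i x).
  move=> bF PF; elim: s => [|i s IH].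
    by under eq_fun do rewrite big_nil.
  by under eq_fun do rewrite big_cons addrC; apply: Pcomb => //; exact: bsum.
have PS S : measurable S -> P (\1_S : T -> R).
  move=> mS; have : <<s G >> S by rewrite -mG.
  apply: (@dynkin_induction _ T G (fun S => P (\1_S : T -> R))) => //.
  - by rewrite indicT.
  - move=> S' mS' PS'.
    have := Pcomb _ _ (-1) (bounded_measurable_cst 1) (bounded_measurable_indic mS') P1 PS'.
    congr P; apply/funext => x; rewrite !indicE in_setC.
    by case: (x \in S'); rewrite ?mulr1 ?mulr0 ?subrr ?addr0.
  - move=> F mF tF PF.
    have mU : measurable (\bigcup_k F k) by exact: bigcupT_measurable.
    have ind_le k x : \sum_(i <- iota 0 k) 1 * \1_(F i) x = \1_(\bigcup_(i < k) F i) x :> R.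
      elim: k => [|k IH]; first by rewrite big_nil bigcup_mkord big_ord0 indicE in_set0.
      rewrite -addn1 iotaD big_cat/= IH big_seq1 mul1r add0n addn1.
      have -> : \bigcup_(i < k.+1) F i = (\bigcup_(i < k) F i) `|` F k.
        by rewrite !bigcup_mkord big_ord_recr.
      rewrite !indicE in_setU.
      have [/set_mem[i /= ik Fi]|_] := boolP (x \in \bigcup_(i < k) F i); last by rewrite add0r.
      have [/set_mem Fk|_] := boolP (x \in F k); last by rewrite addr0.
      by have := tF i k I I (ex_intro _ x (conj Fi Fk)) => ki; rewrite ki ltnn in ik.
    apply: (Plim (fun k x => \sum_(i <- iota 0 k) 1 * \1_(F i) x) _ 1).
    + by move=> k; apply: bsum => i; exact: bounded_measurable_indic.
    + exact: bounded_measurable_indic.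
    + move=> k x; rewrite ind_le indicE ger0_norm// lern1 leq_b1 //.
    + move=> x; have [[k _ Fk]|nF] := pselect ((\bigcup_k F k) x).
        rewrite indicE mem_set; last by exists k.
        apply: cvg_near_cst; exists k.+1 => // j /= kj.
        by rewrite ind_le indicE mem_set//; exists k.
      rewrite indicE memNset//; apply: cvg_near_cst; apply: nearW => j.
      by rewrite ind_le indicE memNset// => -[i _ Fi]; apply: nF; exists i.
    + by move=> k; apply: Psum => // i; exact: bounded_measurable_indic.
have Pge0 f : bounded_measurable f -> (forall x, 0 <= f x) -> P f.
  move=> bf f0; have [mf [C fC]] := bf.
  have mEf : measurable_fun setT (EFin \o f) by exact/measurable_EFinP.
  have ap0 k x : 0 <= (nnsfun_approx measurableT mEf k : T -> R) x by [].
  have apc x : (nnsfun_approx measurableT mEf k : T -> R) x @[k --> \oo] --> f x.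
    apply: (@fine_cvg _ _ _ _ (fun k => ((nnsfun_approx measurableT mEf k : T -> R) x)%:E)).
    have := @cvg_nnsfun_approx _ _ _ _ measurableT _ mEf _ x I.
    by apply => y _; rewrite lee_fin.
  have apC k x : (nnsfun_approx measurableT mEf k : T -> R) x <= f x.
    have nd : nondecreasing_seq (fun k => (nnsfun_approx measurableT mEf k : T -> R) x).
      by move=> i j ij; have /lefP := nd_nnsfun_approx measurableT mEf ij; exact.
    have := nondecreasing_cvgn_le nd (cvgP _ (apc x)) k.
    by rewrite (cvg_lim _ (apc x)).
  apply: (Plim (fun k => nnsfun_approx measurableT mEf k : T -> R) f C) => //.
  - move=> k; split; first exact: measurable_funPT.
    by exists C => x; rewrite ger0_norm// (le_trans (apC _ _))// (le_trans (ler_norm _)).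
  - by move=> k x; rewrite ger0_norm// (le_trans (apC _ _))// (le_trans (ler_norm _)).
  - move=> k; set h := nnsfun_approx _ _ _.
    have -> : (h : T -> R) = fun x => \sum_(y <- finmap.enum_fset (fset_set (range h)))
        y * \1_(h @^-1` [set y]) x.
      by apply/funext => x; rewrite [LHS]fimfunE fsbig_finite.
    have mh (y : R) : measurable (h @^-1` [set y]) by exact: measurable_sfunP.
    apply: Psum => y; first exact: bounded_measurable_indic.
    exact: PS.
move=> f [mf [C fC]].
have bf : bounded_measurable (fun x => f x + C * 1).
  by apply: bounded_measurable_comb; [split => //; exists C|exact: bounded_measurable_cst].
have Pf : P (fun x => f x + C * 1).
  apply: Pge0 => // x; rewrite mulr1 -lerBlDr sub0r lerNl (le_trans _ (fC x))// -normrN.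
  exact: ler_norm.
have := Pcomb _ _ (- C) bf (bounded_measurable_cst 1) Pf P1.
by congr P; apply/funext => x; rewrite !mulr1 addrK.
Qed.

End monotone_class.

(** * Lebesgue measure on row vectors *)

Section lebesgue_translation.
Variable R : realType.
Local Notation lam := (@lebesgue_measure R).

Lemma measurable_shift (a : R) : measurable_fun [set: R] (fun x : R => x + a).
Proof. exact: measurable_funD. Qed.

(** Lebesgue measure is determined by its values on half-open intervals, and its image under a
    translation has the same ones. *)
Lemma lebesgue_measure_shift (a : R) (A : set R) : measurable A ->
  lam [set x | A (x + a)] = lam A.
Proof.
move=> mA.
have ms : measurable_fun [set: measurableTypeR R] (fun x : measurableTypeR R => x + a : measurableTypeR R).
  exact: measurable_shift.
pose nu := (measure_function_pushforward__canonical__measure_function_Measure lam ms).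
have := @lebesgue_measure_unique R nu.
move=> /(_ _ A mA) -> // X [[b c] /= bc <-].
rewrite /nu /= /pushforward.
have -> : (fun x => x + a) @^-1` `]b, c]%classic = `]b - a, c - a]%classic.
  by apply/seteqP; split => x /=; rewrite !in_itv/= ltrBlDr lerBrDr.
rewrite !lebesgue_measure_itv/= !lte_fin ltrD2r; case: ifPn => // _.
by rewrite -!EFinD; congr EFin; ring.
Qed.

Lemma ge0_integral_shift (a : R) (f : R -> \bar R) : measurable_fun setT f ->
  (forall x, 0 <= f x)%E -> (\int[lam]_x f (x + a)%R = \int[lam]_x f x)%E.
Proof.
move=> mf f0.
have ms : measurable_fun [set: measurableTypeR R] (fun x : measurableTypeR R => x + a : measurableTypeR R).
  exact: measurable_shift.
have := @ge0_integral_pushforward _ _ _ _ R _ ms lam setT f measurableT mf (fun x _ => f0 x).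
rewrite preimage_setT => <-.
by apply: eq_measure_integral => A mA _; rewrite /pushforward /= -[RHS](lebesgue_measure_shift a).
Qed.

End lebesgue_translation.

Section borel.
Context (R : realType) (n : nat).
Local Notation V := 'rV[R]_n.

Definition obox (a b : 'I_n -> R) : set V := [set x | forall i, a i < x ord0 i < b i].

Definition cube (r : R) : set V := [set x | forall i, `|x ord0 i| <= r].

Lemma measurable_coordinate (i : 'I_n) (Y : set R) : measurable Y ->
  measurable [set x : V | Y (x ord0 i)].
Proof. by move=> mY; have := @measurable_coor R n i measurableT Y mY; rewrite setTI. Qed.

Lemma measurable_forall_coord (Y : 'I_n -> set R) : (forall i, measurable (Y i)) ->
  measurable [set x : V | forall i, Y i (x ord0 i)].
Proof.
move=> mY; rewrite (_ : mkset _ = \bigcap_i [set x : V | Y i (x ord0 i)]).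
  by apply: fin_bigcap_measurable => // i _; exact: measurable_coordinate.
by apply/seteqP; split => x /= h i; [move=> _; exact: h|exact: (h i I)].
Qed.

Lemma measurable_obox a b : measurable (obox a b).
Proof.
rewrite (_ : obox a b = [set x | forall i, `]a i, b i[%classic (x ord0 i)]).
  by apply: (@measurable_forall_coord (fun i => `]a i, b i[%classic)) => i; exact: measurable_itv.
by apply/seteqP; split => x h i; have := h i; rewrite /= in_itv.
Qed.

Lemma measurable_cube r : measurable (cube r).
Proof.
rewrite (_ : cube r = [set x | forall i, `[(- r)%R, r]%classic (x ord0 i)]).
  by apply: (@measurable_forall_coord (fun i => `[(- r)%R, r]%classic)) => i; exact: measurable_itv.
by apply/seteqP; split => x h i; have := h i; rewrite /= in_itv/= ler_norml.
Qed.

Lemma cube_cover (x : V) : exists k : nat, cube k%:R x.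
Proof.
exists (Num.trunc (\sum_(i < n) `|x ord0 i|)).+1 => i.
have : `|x ord0 i| <= \sum_(i < n) `|x ord0 i|.
  by rewrite (bigD1 i)//= lerDl sumr_ge0.
by move=> /le_trans; apply; apply/ltW/truncnS_gt.
Qed.

Definition oboxes := [set B | exists a b, B = obox a b].

Lemma oboxes_setI : setI_closed oboxes.
Proof.
move=> A B [a [b ->]] [c [d ->]].
exists (fun i => Num.max (a i) (c i)), (fun i => Num.min (b i) (d i)).
apply/seteqP; split => x /=.
  by move=> [h k] i; rewrite gt_max lt_min; case/andP: (h i) => -> ->; case/andP: (k i) => -> ->.
move=> h; split => i; have := h i; rewrite gt_max lt_min.
  by move=> /andP[/andP[-> _] /andP[-> _]].
by move=> /andP[/andP[_ ->] /andP[_ ->]].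
Qed.

(** The monotone class argument needs a generator stable under intersection. A half-space [r < x_i]
    is the union of the boxes bounded by [k] in the other directions. *)
Lemma measurable_oboxes : measurable = <<s oboxes >> :> set (set V).
Proof.
apply/seteqP; split; last first.
  apply: smallest_sub; first exact: sigma_algebra_measurable.
  by move=> _ [a [b ->]]; exact: measurable_obox.
have sG : sigma_algebra setT <<s oboxes >> by exact: smallest_sigma_algebra.
apply: smallest_sub => // Z.
rewrite -bigcup_seq => -[i _ [W mW <-]]; rewrite setTI.
move: mW; rewrite /= RGenOInfty.measurableE => mW.
suff : [set Y : set R | <<s oboxes >> ((fun x : V => x ord0 i) @^-1` Y)] W by [].
move: W mW; apply: smallest_sub.
  split => /=.
  - by rewrite preimage_set0; exact: sigma_algebra0.
  - by move=> Z' H; have [_ + _] := sG; move=> /(_ _ H); rewrite !setTD.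
  - by move=> F mF; rewrite preimage_bigcup; have [_ _] := sG; exact.
move=> _ [r ->] /=.
rewrite (_ : _ @^-1` _ = \bigcup_k obox (fun j => if j == i then r else - k%:R) (fun j => k%:R)).
  have [_ _] := sG; apply => k; apply: sub_sigma_algebra.
  by exists (fun j => if j == i then r else - k%:R), (fun j => k%:R).
apply/seteqP; split => x /=; rewrite in_itv/= andbT.
  move=> rx; have [k kx] := cube_cover x; exists k.+1 => // j.
  have := kx j; rewrite ler_norml => /andP[h1 h2].
  have k1 : k%:R < k.+1%:R :> R by rewrite ltr_nat.
  rewrite (le_lt_trans h2 k1) andbT; case: eqP => [->//|_].
  by rewrite (lt_le_trans _ h1)// ltrN2.
by move=> [k _ /(_ i)]; rewrite eqxx => /andP[].
Qed.

(** The topology comes from the sup norm and the sigma-algebra from the coordinates; the countably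
    many rational boxes contained in an open set cover it. *)
Lemma open_measurable_rV (U : set V) : open U -> measurable U.
Proof.
move=> oU.
pose box (q : {ffun 'I_n -> rat} * {ffun 'I_n -> rat}) : set V :=
  obox (fun i => ratr (q.1 i)) (fun i => ratr (q.2 i)).
rewrite (_ : U = \bigcup_q (if pselect (box q `<=` U) then box q else set0)).
  apply: countable_bigcupT_measurable => // q.
  by case: (pselect _) => ? /=; [exact: measurable_obox|exact: measurable0].
apply/seteqP; split => x; last first.
  by move=> [q _]; case: (pselect (box q `<=` U)) => [h|h] //= bx; exact: h.
move=> Ux; have [e /= e0 eU] : \forall e \near 0^'+, ball x e `<=` U.
  have /nbhs_ballP[e e0 eU] : nbhs x U by exact: open_nbhs_nbhs.
  exists e => //= r /= re r0; apply: subset_trans eU; apply: le_ball.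
  by move: re; rewrite sub0r normrN => /ltW /(le_trans (ler_norm _)).
have e20 : 0 < e / 2 by rewrite divr_gt0.
have {}eU : ball x (e / 2) `<=` U.
  apply: eU => //=; rewrite sub0r normrN gtr0_norm// ltr_pdivrMr// ltr_pMr// ltr1n //.
have /choice[q qP] : forall i, exists q : rat, x ord0 i - e / 2 < ratr q /\ ratr q < x ord0 i.
  move=> i; have h : x ord0 i - e / 2 < x ord0 i by rewrite ltrBlDr ltrDl.
  by have [q] := rat_in_itvoo h; rewrite in_itv/= => /andP[? ?]; exists q.
have /choice[s sP] : forall i, exists q : rat, x ord0 i < ratr q /\ ratr q < x ord0 i + e / 2.
  move=> i; have h : x ord0 i < x ord0 i + e / 2 by rewrite ltrDl.
  by have [t] := rat_in_itvoo h; rewrite in_itv/= => /andP[? ?]; exists t.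
exists (finfun q, finfun s) => //; case: pselect => [_ i|nU]; first by rewrite !ffunE (qP i).2 (sP i).1.
exfalso; apply: nU => y yb; apply: eU; split => // i' i; rewrite (ord1 i').
have := yb i; rewrite !ffunE => /andP[y1 y2].
by rewrite /ball/= ltr_distlC (lt_trans (qP i).1 y1) (lt_trans y2 (sP i).2).
Qed.

Lemma continuous_measurable_rV (f : V -> R) : continuous f -> measurable_fun setT f.
Proof.
move=> /continuousP cf _; apply: (measurability _ (RGenOpens.measurableE R)) => // _ [B [a [b ->]] <-].
by rewrite setTI; apply: open_measurable_rV; apply: cf; exact: interval_open.
Qed.

Lemma compact_measurable_rV (K : set V) : compact K -> measurable K.
Proof.
move=> /compact_closed cK; rewrite -[K]setCK; apply: measurableC; apply: open_measurable_rV.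
by apply: closed_openC; apply: cK; exact: norm_hausdorff.
Qed.

Lemma compact_sub_cube (K : set V) : compact K -> exists k : nat, K `<=` cube k%:R.
Proof.
move=> /compact_bounded[M [Mr MK]]; exists (Num.trunc `|M|).+2 => x Kx i.
apply: le_trans (MK ((Num.trunc `|M|).+2%:R) _ x Kx).
  by rewrite [leRHS]/Num.norm/= mx_normrE (le_bigmax _ (fun p => `|x p.1 p.2|) (ord0, i)).
rewrite (le_lt_trans (ler_norm _))// (lt_trans (truncnS_gt _))// ltr_nat //.
Qed.

Lemma cube_compact (r : R) : compact (cube r).
Proof.
apply: bounded_closed_compact.
  exists `|r|; split; first exact: num_real.
  move=> M rM x cx /=; rewrite [leLHS]/Num.norm/= mx_normrE; apply/bigmax_leP; split.
    exact: le_trans (ltW rM).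
  by move=> [i j] _ /=; rewrite (ord1 i) (le_trans (cx j))// (le_trans (ler_norm r))// ltW.
have -> : cube r = \bigcap_(i : 'I_n) ((fun x : V => x ord0 i) @^-1` `[- r, r]%classic).
  apply/seteqP; split => x h i; first by move=> _; rewrite /= in_itv/= -ler_norml.
  by have := h i I; rewrite /= in_itv/= -ler_norml.
apply: closed_bigI => i _; apply: (@closed_comp _ _ (fun x : V => x ord0 i)).
  by move=> x _; exact: coord_continuous.
exact: itv_closed.
Qed.

Lemma measurable_translate (v : V) : measurable_fun setT (fun x : V => x + v).
Proof.
apply: measurable_fun_rVP => i.
under eq_fun do rewrite mxE.
by apply: measurable_funD => //; exact: measurable_coor.
Qed.

Lemma measurable_translate2 : measurable_fun setT (fun x : V * V => x.1 + x.2).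
Proof.
apply: measurable_fun_rVP => i.
under eq_fun do rewrite mxE.
apply: measurable_funD; apply: measurableT_comp (@measurable_coor R n i) _.
  exact: measurable_fst.
exact: measurable_snd.
Qed.

Lemma measurable_line (v : V) : measurable_fun setT (fun p : V * R => p.1 + p.2 *: v).
Proof.
apply: measurable_fun_rVP => i.
under eq_fun do rewrite !mxE.
apply: measurable_funD.
  by apply: measurableT_comp (@measurable_coor R n i) _; exact: measurable_fst.
by apply: measurable_funM => //; exact: measurable_snd.
Qed.

End borel.

Section lebesgue_rV_borel.
Context (R : realType).
Local Notation lam := (@lebesgue_measure R).
Local Notation m n := (borel_lebesgue R n).

Lemma ge0_integral_cons n (F : 'rV[R]_n.+1 -> \bar R) : measurable_fun setT F ->
  (forall x, 0 <= F x)%E ->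
  (\int[m n.+1]_x F x = \int[lam]_a \int[m n]_v F (cons_rV (a, v)))%E.
Proof.
move=> mF F0.
have := @ge0_integral_pushforward _ _ _ _ R _ (@measurable_cons_rV R n) (lam \x m n)%E setT F
  measurableT mF (fun x _ => F0 x).
have mFc : measurable_fun setT (F \o @cons_rV R n).
  by apply: measurableT_comp => //; exact: measurable_cons_rV.
rewrite preimage_setT (@fubini_tonelli1 _ _ _ _ R lam (m n) _ mFc (fun p => F0 _)).
move=> E; transitivity (\int[pushforward (lam \x m n) (@cons_rV R n)]_y F y)%E; last exact: E.
pose nu := measure_function_pushforward__canonical__measure_function_Measure (lam \x m n)%E (@measurable_cons_rV R n).
exact: (@eq_measure_integral _ _ _ _ nu (m n.+1) F (fun A mA _ => erefl)).
Qed.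

(** Induction on the dimension: the induction hypothesis translates the tail of the vector,
    one-dimensional invariance its head. *)
Lemma ge0_integral_translate n (F : 'rV[R]_n -> \bar R) v : measurable_fun setT F ->
  (forall x, 0 <= F x)%E -> (\int[m n]_x F (x + v)%R = \int[m n]_x F x)%E.
Proof.
elim: n F v => [|n IH] F v mF F0.
  by apply: eq_integral => x _; congr F; apply/rowP; case.
have mFv : measurable_fun setT (fun x : 'rV[R]_n.+1 => F (x + v)).
  by apply: measurableT_comp => //; exact: measurable_translate.
have mF' := ge0_integral_cons mF F0.
rewrite mF' (ge0_integral_cons mFv (fun x => F0 _)) {mF'}.
have [a0 [w0 ->]] : exists a0 w0, v = cons_rV (a0, w0).
  by exists (uncons_rV v).1, (uncons_rV v).2; rewrite -surjective_pairing uncons_rVK.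
have consD a w : cons_rV (a, w) + cons_rV (a0, w0) = cons_rV (a + a0, w + w0) :> 'rV[R]_n.+1.
  rewrite /cons_rV/=; apply: etrans (@add_row_mx R 1 1 n (a : R)%:M w (a0 : R)%:M w0) _.
  apply: (congr1 (fun z => @row_mx R 1 1 n z (w + w0))).
  by apply/matrixP => i j; rewrite !mxE mulrnDl.
have mFa (a : R) : measurable_fun setT (fun w => F (cons_rV (a, w))).
  apply: measurableT_comp => //; apply: measurableT_comp; first exact: measurable_cons_rV.
  exact: pair1_measurable.
transitivity (\int[lam]_a \int[m n]_w F (cons_rV (a + a0, w)%R))%E.
  apply: eq_integral => a _; under eq_integral do rewrite consD.
  exact: (IH (fun w => F (cons_rV (a + a0, w)%R))).
apply: (@ge0_integral_shift R a0 (fun a => \int[m n]_w F (cons_rV (a, w)))%E).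
  apply: (@measurable_fun_fubini_tonelli_F _ _ _ _ R (m n) (fun p => F (cons_rV p))) => //.
  by apply: measurableT_comp => //; exact: measurable_cons_rV.
by move=> a; apply: integral_ge0.
Qed.

Definition cbox n (a b : R) : set 'rV[R]_n := [set x | forall i, a <= x ord0 i <= b].

Arguments cbox : clear implicits.

Lemma measurable_cbox n a b : measurable (cbox n a b).
Proof.
rewrite (_ : cbox n a b = [set x | forall i, `[a, b]%classic (x ord0 i)]).
  by apply: (@measurable_forall_coord R n (fun=> `[a, b]%classic)) => i; exact: measurable_itv.
by apply/seteqP; split => x h i; have := h i; rewrite /= in_itv.
Qed.

Lemma lebesgue_pow n (a b : R) : a <= b -> m n (cbox n a b) = ((b - a) ^+ n)%:E.
Proof.
move=> ab; elim: n => [|n IH].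
  rewrite expr0 (_ : cbox 0 a b = setT); first by rewrite /= diracT.
  by apply/seteqP; split => x // _ [].
change (m n.+1 (cbox n.+1 a b)) with ((lam \x m n)%E ((@cons_rV R n) @^-1` (cbox n.+1 a b))).
rewrite (_ : _ @^-1` _ = `[a, b]%classic `*` cbox n a b).
  rewrite product_measure1E//; [|exact: measurable_cbox].
  rewrite [X in (_ * X)%E]IH [X in (X * _)%E](_ : _ = (b - a)%:E) ?exprS//.
  rewrite [LHS]lebesgue_measure_itv/= lte_fin; case: ltgtP ab => // -> _.
  by rewrite subrr.
apply/seteqP; split => -[c w] /=.
  have cE : (cons_rV (c, w) : 'rV[R]_n.+1) ord0 ord0 = c := congr1 fst (cons_rVK (c, w)).
  move=> h; split => [|i]; first by have := h ord0; rewrite cE in_itv.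
  by have := h (rshift 1 i); rewrite /cons_rV/= (@row_mxEr R 1 1 n).
move=> [/=]; rewrite in_itv/= => cab h i; rewrite /cons_rV/=.
case: (splitP (i : 'I_(1 + n))) => [j ij|j ij].
  have -> : i = lshift n j by exact/val_inj.
  by rewrite (@row_mxEl R 1 1 n) (ord1 j) mxE eqxx mulr1n.
have -> : i = rshift 1 j by exact/val_inj.
by rewrite (@row_mxEr R 1 1 n).
Qed.

Lemma cube_lty n (r : R) : (m n (cube r) < +oo)%E.
Proof.
have [r0|r0] := leP 0 r.
  rewrite (_ : cube r = cbox n (- r) r).
    by rewrite lebesgue_pow ?ltry// lerNl (le_trans _ r0)// oppr_le0.
  by apply/seteqP; split => x h i; have := h i; rewrite ler_norml.
have h : cube r `<=` cbox n 0 0.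
  by move=> x h i; have := h i; rewrite leNgt (lt_le_trans r0).
apply: le_lt_trans (le_measure _ _ _ h) _; rewrite ?inE.
- exact: measurable_cube.
- exact: measurable_cbox.
- by rewrite [X in (X < _)%E](lebesgue_pow n (lexx 0)) ltry.
Qed.

End lebesgue_rV_borel.

(** * Test functions *)

Section smooth1.
Variable R : realType.
Implicit Types (f g : R -> R).

(** Derivatives are carried as witnesses [g], so that sums, products and compositions follow by
    induction on [k]. *)
Fixpoint C1d (k : nat) f : Prop :=
  if k is k'.+1 then exists g, (forall x : R, is_derive x (1 : R) f (g x)) /\ C1d k' g
  else continuous f.

Definition smooth f := forall k, C1d k f.

Lemma is_derive_continuous f (df : R -> R) : (forall x : R, is_derive x (1 : R) f (df x)) ->
  continuous f.
Proof.
move=> dfx x; apply: differentiable_continuous; apply/derivable1_diffP.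
by have := dfx x.
Qed.

Lemma C1d_continuous k f : C1d k f -> continuous f.
Proof. by case: k => // k [g [fg _]]; exact: is_derive_continuous fg. Qed.

Lemma C1dS k f : C1d k.+1 f -> C1d k f.
Proof.
elim: k f => [|k IH] f; first exact: C1d_continuous.
by move=> [g [fg gk]]; exists g; split => //; exact: IH.
Qed.

Lemma C1d_cst k (c : R) : C1d k (fun=> c).
Proof.
elim: k c => [|k IH] c; first by move=> x; exact: cvg_cst.
by exists (fun=> 0); split => // x; exact: is_derive_cst.
Qed.

Lemma C1d_id k : C1d k (fun x : R => x).
Proof.
case: k => [|k]; first by move=> x; exact: cvg_id.
by exists (fun=> 1); split; [move=> x; exact: is_derive_id|exact: C1d_cst].
Qed.

Lemma C1dD k f g : C1d k f -> C1d k g -> C1d k (fun x => f x + g x).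
Proof.
elim: k f g => [|k IH] f g; first by move=> cf cg x; apply: cvgD; [exact: cf|exact: cg].
move=> [df [fd df_k]] [dg [gd dg_k]]; exists (fun x => df x + dg x); split; last exact: IH.
by move=> x; have := is_deriveD (fd x) (gd x).
Qed.

Lemma C1dM k f g : C1d k f -> C1d k g -> C1d k (fun x => f x * g x).
Proof.
elim: k f g => [|k IH] f g; first by move=> cf cg x; apply: cvgM; [exact: cf|exact: cg].
move=> fk gk; have [df [fd df_k]] := fk; have [dg [gd dg_k]] := gk.
exists (fun x => f x * dg x + g x * df x); split.
  by move=> x; have := is_deriveM (fd x) (gd x).
by apply: C1dD; apply: IH => //; exact: C1dS.
Qed.

Lemma C1d_comp k f g : C1d k f -> C1d k g -> C1d k (fun x => f (g x)).
Proof.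
elim: k f g => [|k IH] f g.
  by move=> cf cg x; apply: continuous_comp; [exact: cg|exact: cf].
move=> [df [fd df_k]] gk; have [dg [gd dg_k]] := gk.
exists (fun x => df (g x) * dg x); split.
  by move=> x; have := is_derive1_comp (fd (g x)) (gd x).
by apply: C1dM => //; apply: IH => //; exact: C1dS.
Qed.

Lemma C1d_expR k : C1d k (@expR R).
Proof.
elim: k => [|k IH]; first exact: continuous_expR.
by exists expR; split => // x; exact: is_derive_expR.
Qed.

(** The functions [x^(-j) exp(-1/x)], extended by 0. All exponents [j] are treated at once because
    the derivative of one member of the family combines those of index [j + 1] and [j + 2]. *)
Definition flat (j : nat) (x : R) : R := if 0 < x then x^-1 ^+ j * expR (- x^-1) else 0.

Lemma flat_ge0 j x : 0 <= flat j x.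
Proof. by rewrite /flat; case: ifP => // x0; rewrite mulr_ge0 ?expR_ge0 ?exprn_ge0// invr_ge0 ltW. Qed.

Lemma flat_gt0 j x : 0 < x -> 0 < flat j x.
Proof. by move=> x0; rewrite /flat x0 mulr_gt0 ?expR_gt0// exprn_gt0 ?invr_gt0. Qed.

(** The exponential of [1/x] dominates [x^-(j+2) / (j+2)!], which leaves a factor [x^2]; such a
    quadratic bound forces a zero derivative at the origin. *)
Lemma flat_le j (x : R) : flat j x <= ((j + 2)`!)%:R * x ^+ 2.
Proof.
rewrite /flat; case: ifPn => [x0|_]; last by rewrite mulr_ge0// sqr_ge0.
have y0 : 0 < x^-1 by rewrite invr_gt0.
rewrite expRN ler_pdivrMr ?expR_gt0//.
have := @expR_ge1Dxn R x^-1 (j + 1)%N (ltW y0).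
rewrite -addnS => he.
have {}he : x^-1 ^+ (j + 2) <= (j + 2)`!%:R * expR x^-1.
  rewrite -ler_pdivrMl ?ltr0n ?fact_gt0// mulrC (le_trans _ he)// lerDr ler01 //.
rewrite mulrAC -ler_pdivrMr ?exprn_gt0//.
by rewrite -[(x ^+ 2)^-1]exprVn -exprD.
Qed.

Lemma is_derive0_quadratic f (C : R) : 0 <= C -> f 0 = 0 ->
  (forall x, `|f x| <= C * x ^+ 2) -> is_derive (0 : R) (1 : R) f 0.
Proof.
move=> C0 f0 fC.
have H : h^-1 *: ((f \o shift 0) (h *: (1 : R)) - f 0) @[h --> (0 : R)^'] --> (0 : R).
  apply/cvgrPdist_le => e e0; near=> h.
  have h0 : h != 0 by near: h; exact: nbhs_dnbhs_neq.
  rewrite sub0r normrN /shift/= f0 subr0 addr0 /GRing.scale/= mulr1 normrM normfV.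
  rewrite ler_pdivrMl ?normr_gt0// (le_trans (fC h))// -real_normK ?num_real// expr2.
  rewrite mulrCA ler_wpM2l//.
  have : `|h| <= e / (C + 1).
    by near: h; apply: dnbhs0_le; rewrite divr_gt0// ltr_wpDl.
  rewrite ler_pdivlMr ?ltr_wpDl// => /(le_trans _); apply.
  by rewrite mulrC ler_wpM2l// lerDl.
apply: DeriveDef; first exact: (cvgP _ H).
exact: (cvg_lim _ H).
Unshelve. all: by end_near. Qed.

Lemma is_derive_flat j (x : R) :
  is_derive x 1 (flat j) (flat (j + 2) x - j%:R * flat (j + 1) x).
Proof.
have [x0|x0|->] := ltgtP x 0.
- have E : \near x, (cst 0 : R -> R) x = flat j x.
    near=> y; rewrite /flat ifF//; apply/negbTE; rewrite -leNgt; apply/ltW.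
    by near: y; exact: lt_nbhsl.
  rewrite /flat ltNge ltW//= mulr0 subrr; exact: near_eq_is_derive E (is_derive_cst _ _ _).
- have E : \near x, ((fun y => y^-1) ^+ j * (expR \o (fun y => - y^-1)) : R -> R) x = flat j x.
    near=> y; rewrite /flat ifT; first by rewrite !fctE.
    by near: y; exact: lt_nbhsr.
  apply: (near_eq_is_derive E).
  have dV : is_derive x (1 : R) (fun y : R => y^-1) (- x ^- 2).
    have := @is_deriveV R idfun x 1 1 (lt0r_neq0 x0) (is_derive_id _ _).
    by rewrite /GRing.scale/= mulr1.
  have dN : is_derive x (1 : R) (fun y : R => - y^-1) (x ^- 2).
    by have := is_deriveN dV; rewrite opprK.
  have de := @is_derive1_comp _ expR (fun y => - y^-1) x _ _ (is_derive_expR _) dN.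
  have := is_deriveM (is_deriveX j dV) de.
  move=> h; apply: is_derive_eq h _.
  rewrite /flat x0 /GRing.scale/= exprfctE -exprVn.
  case: j {E} => [|j]; first by rewrite !expr0 add0n; ring.
  rewrite /= addn2 addn1 !exprS; ring.
rewrite /flat ltxx mulr0 subrr.
apply: (@is_derive0_quadratic _ (j + 2)`!%:R) => //; first by rewrite /flat ltxx.
by move=> y; rewrite ger0_norm ?flat_ge0//; exact: flat_le.
Unshelve. all: by end_near. Qed.

Lemma smooth_flat j : smooth (flat j).
Proof.
move=> k; elim: k j => [|k IH] j.
  by apply: is_derive_continuous => x; exact: is_derive_flat.
exists (fun x => flat (j + 2) x - j%:R * flat (j + 1) x); split.
  by move=> x; exact: is_derive_flat.
rewrite (_ : (fun _ => _) = (fun x => flat (j + 2) x + (- j%:R) * flat (j + 1) x)); last first.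
  by apply/funext => x; rewrite mulNr.
by apply: C1dD => //; apply: C1dM => //; exact: C1d_cst.
Qed.

Definition bump (a b x : R) := flat 0 (x - a) * flat 0 (b - x).

Lemma bump_ge0 a b x : 0 <= bump a b x.
Proof. by rewrite mulr_ge0// flat_ge0. Qed.

Lemma bump_gt0 a b x : (0 < bump a b x) = (a < x < b).
Proof.
apply/idP/idP => [|/andP[ax xb]]; last by rewrite mulr_gt0 ?flat_gt0 ?subr_gt0.
by apply: contraTT => /nandP[] h; rewrite /bump /flat !subr_gt0 (negbTE h) ?mul0r ?mulr0 ltxx.
Qed.

Lemma smooth_bump a b : smooth (bump a b).
Proof.
move=> k; apply: C1dM; apply: C1d_comp; try exact: smooth_flat.
  by apply: C1dD; [exact: C1d_id|exact: C1d_cst].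
rewrite (_ : (fun _ => _) = (fun x => b + (-1) * x)); last by apply/funext => x; rewrite mulN1r.
apply: C1dD; first exact: C1d_cst.
by apply: C1dM; [exact: C1d_cst|exact: C1d_id].
Qed.

(** Since [bump] is positive exactly on []a, b[], these smooth functions take values in [[0, 1]] and
    converge to the indicator of that open interval as [N] grows. *)
Definition plateau (N : nat) (a b x : R) := 1 - expR (- N%:R * bump a b x).

Lemma smooth_plateau N a b : smooth (plateau N a b).
Proof.
move=> k; rewrite (_ : plateau N a b = (fun x => 1 + (-1) * expR (- N%:R * bump a b x))); last first.
  by apply/funext => x; rewrite mulN1r.
apply: C1dD; first exact: C1d_cst.
apply: C1dM; first exact: C1d_cst.
apply: C1d_comp; first exact: C1d_expR.
by apply: C1dM; [exact: C1d_cst|exact: smooth_bump].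
Qed.

Lemma plateau_ge0 N a b x : 0 <= plateau N a b x.
Proof. by rewrite subr_ge0 -expR0 ler_expR mulNr oppr_le0 mulr_ge0// bump_ge0. Qed.

Lemma plateau_le1 N a b x : plateau N a b x <= 1.
Proof. by rewrite gerBl expR_ge0. Qed.

Lemma plateau_out N a b x : ~~ (a < x < b) -> plateau N a b x = 0.
Proof.
rewrite -bump_gt0 -leNgt => b0.
have E : bump a b x = 0 by apply/eqP; rewrite eq_le b0 bump_ge0.
by rewrite /plateau E mulr0 expR0 subrr.
Qed.

Lemma plateau_cvg a b x : plateau N a b x @[N --> \oo] --> (if a < x < b then 1 else 0 : R).
Proof.
case: (boolP (a < x < b)) => [abx|nabx]; last first.
  by apply: cvg_near_cst; apply: nearW => N; exact: plateau_out.
have b0 : 0 < bump a b x by rewrite bump_gt0.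
rewrite /plateau -[X in _ --> X](subr0 1); apply: cvgB; first exact: cvg_cst.
have H : expR (- (N%:R * bump a b x)) @[N --> \oo] --> (0 : R).
  apply: (@cvg_comp _ _ _ (fun N : nat => N%:R : R) (fun y => expR (- (y * bump a b x))) _ +oo).
    exact: cvgr_idn.
  apply: (@cvg_comp _ _ _ (fun y : R => y * bump a b x) (fun y => expR (- y)) _ +oo).
    by apply: gt0_cvgMly => //; exact: cvg_id.
  exact: cvgr_expR.
by under eq_fun do rewrite mulNr.
Qed.

End smooth1.

Lemma cvg_bigprod (R : realType) (T I : Type) (G : set_system T) {FG : Filter G}
    (s : seq I) (f : I -> T -> R) (l : I -> R) :
  (forall i, f i x @[x --> G] --> l i) ->
  \prod_(i <- s) f i x @[x --> G] --> \prod_(i <- s) l i.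
Proof.
move=> fl; elim: s => [|i s IH].
  by under eq_fun do rewrite big_nil; rewrite big_nil; exact: cvg_cst.
by under eq_fun do rewrite big_cons; rewrite big_cons; exact: cvgM.
Qed.

Section product_test.
Context (R : realType) (n : nat).
Local Notation V := 'rV[R]_n.
Local Notation e i := (delta_mx ord0 i : V).
Implicit Types (F : 'I_n -> R -> R) (phi : V -> R).

Definition prodf F (x : V) : R := \prod_j F j (x ord0 j).

Lemma continuous_prodf F : (forall j, continuous (F j)) -> continuous (prodf F).
Proof.
move=> cF x; apply: (@cvg_bigprod R _ _ (nbhs x) _ _ (fun j x => F j (x ord0 j))) => j.
by apply: continuous_comp; [exact: coord_continuous|exact: cF].
Qed.

Definition upd F i g : 'I_n -> R -> R := fun j => if j == i then g else F j.

Lemma prodf_line F i (x : V) (t : R) :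
  prodf F (t *: e i + x) = (\prod_(j | j != i) F j (x ord0 j)) * F i (t + x ord0 i).
Proof.
rewrite /prodf (bigD1 i)//= mulrC; congr (_ * F i _); last by rewrite !mxE !eqxx mulr1.
by apply: eq_bigr => j /negbTE ji; rewrite !mxE ji andbF mulr0 add0r.
Qed.

Lemma is_derive_prodf F i g (x : V) : (forall s : R, is_derive s (1 : R) (F i) (g s)) ->
  is_derive x (e i) (prodf F) (prodf (upd F i g) x).
Proof.
move=> dF; set c := \prod_(j | j != i) F j (x ord0 j).
have H : h^-1 *: ((prodf F \o shift x) (h *: e i) - prodf F x) @[h --> (0 : R)^'] -->
    prodf (upd F i g) x.
  have [dFi dE] := dF (x ord0 i).
  have -> : prodf (upd F i g) x = c * 'D_1 (F i) (x ord0 i).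
    rewrite dE /prodf (bigD1 i)//= mulrC /upd eqxx; congr (_ * _).
    by apply: eq_bigr => j /negbTE ->.
  rewrite (_ : (fun _ => _) = fun h => c * (h^-1 *: ((F i \o shift (x ord0 i)) (h *: 1) - F i (x ord0 i)))).
    by apply: cvgMl_tmp; exact: dFi.
  apply/funext => h /=; rewrite prodf_line -/c -[x in prodf F x]add0r -(scale0r (e i)) prodf_line add0r -/c.
  by rewrite -mulrBr /GRing.scale/= mulr1 mulrCA.
by apply: DeriveDef; [exact: cvgP H|exact: cvg_lim H].
Qed.

Lemma Ck_prodf k F : (forall j, C1d k (F j)) -> Ck k (prodf F).
Proof.
elim: k F => [|k IH] F CF; first by apply: continuous_prodf => j; exact: CF.
have /choice[G GP] : forall j, exists g, (forall s : R, is_derive s (1 : R) (F j) (g s)) /\ C1d k g.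
  by move=> j; exact: CF.
have dF i x := @is_derive_prodf F i (G i) x (GP i).1.
split.
- by apply: continuous_prodf => j; exact: C1d_continuous (CF j).
- by move=> i x; have [] := dF i x.
- move=> i; rewrite (_ : partial_derive i (prodf F) = prodf (upd F i (G i))); last first.
    by apply/funext => x; have [_] := dF i x.
  apply: IH => j; rewrite /upd; case: ifP => _; first exact: (GP i).2.
  exact: C1dS.
Qed.

Lemma compact_support_cube phi (r : R) : (forall x, ~ cube r x -> phi x = 0) ->
  compact (closure [set x | phi x != 0]).
Proof.
move=> phi0; apply: (@subclosed_compact _ _ (cube r)).
- exact: closed_closure.
- exact: cube_compact.
- have cc : closed (cube r : set V).
    by apply: compact_closed; [exact: norm_hausdorff|exact: cube_compact].
  rewrite [X in _ `<=` X]((closure_id (cube r)).1 cc).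
  by apply: closure_subset => x /= /eqP px; apply: contrapT => /phi0.
Qed.

Lemma test_function_prodf F (r : R) : (forall j, smooth (F j)) ->
  (forall j s, r < `|s| -> F j s = 0) -> test_function (prodf F).
Proof.
move=> sF F0; split; first by move=> k; apply: Ck_prodf => j; exact: sF.
apply: (@compact_support_cube _ r) => x /existsNP[j /negP]; rewrite -ltNge => rx.
by rewrite /prodf (bigD1 j)//= F0// mul0r.
Qed.

Lemma bounded_of_cube phi (r : R) : continuous phi -> (forall x, ~ cube r x -> phi x = 0) ->
  bounded_measurable phi.
Proof.
move=> cphi phi0; split; first exact: continuous_measurable_rV.
have : compact (phi @` cube r).
  by apply: continuous_compact; [exact: continuous_subspaceT|exact: cube_compact].
move=> /compact_bounded[M [_ MP]]; exists (`|M| + 1) => x.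
have [cx|nx] := pselect (cube r x); last by rewrite phi0// normr0 addr_ge0.
apply: (MP (`|M| + 1)); last by exists x.
by rewrite (le_lt_trans (ler_norm M))// ltrDl.
Qed.

Lemma test_function_bounds phi i : test_function phi ->
  exists k : nat, [/\ bounded_measurable phi, bounded_measurable (partial_derive i phi),
    forall x, ~ cube k%:R x -> phi x = 0 & forall x, ~ cube k%:R x -> partial_derive i phi x = 0].
Proof.
move=> [Cphi] /compact_sub_cube[k kP]; exists k.
have phi0 x : ~ cube k%:R x -> phi x = 0.
  by move=> nx; apply/eqP/negPn/negP => px; apply: nx; apply/kP/subset_closure.
have dphi0 x : ~ cube k%:R x -> partial_derive i phi x = 0.
  move=> nx; rewrite /partial_derive -(derive_cst 0 x (e i)); apply: near_eq_derive.
  have : nbhs x (~` cube k%:R).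
    apply: open_nbhs_nbhs; split => //; apply: closed_openC.
    by apply: compact_closed; [exact: norm_hausdorff|exact: cube_compact].
  by apply: filterS => y; exact: phi0.
have [c0 _ c1] := Cphi 1.
split => //; first exact: bounded_of_cube phi0.
exact: bounded_of_cube (c1 i) dphi0.
Qed.

Lemma is_derive_line phi i (x : V) (t : R) : derivable phi (x + t *: e i) (e i) ->
  is_derive t (1 : R) (fun s => phi (x + s *: e i)) (partial_derive i phi (x + t *: e i)).
Proof.
move=> dphi.
have H : h^-1 *: (((fun s => phi (x + s *: e i)) \o shift t) (h *: (1 : R)) - phi (x + t *: e i))
    @[h --> (0 : R)^'] --> partial_derive i phi (x + t *: e i).
  rewrite (_ : (fun _ => _) = fun h => h^-1 *: ((phi \o shift (x + t *: e i)) (h *: e i) - phi (x + t *: e i))).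
    exact: dphi.
  apply/funext => h /=; congr (_ *: (phi _ - _)).
  have -> : h *: (1 : R) = h by exact: mulr1.
  by rewrite scalerDl addrCA.
by apply: DeriveDef; [exact: cvgP H|exact: cvg_lim H].
Qed.

Lemma test_function_line_cvg phi i (x : V) (h : nat -> R) : test_function phi ->
  (forall k, h k != 0) -> h k @[k --> \oo] --> (0 : R) ->
  (h k)^-1 * (phi (x + h k *: e i) - phi x) @[k --> \oo] --> partial_derive i phi x.
Proof.
move=> [Cphi _] h0 hc; have [_ dphi _] := Cphi 1.
have H : t^-1 *: ((phi \o shift x) (t *: e i) - phi x) @[t --> (0 : R)^'] --> partial_derive i phi x.
  exact: dphi.
have hc' : h k @[k --> \oo] --> (0 : R)^'.
  move=> A hA; have hA' : \forall k \near \oo, h k != 0 -> A (h k) by exact: (hc (fun t : R => t != 0 -> A t) hA).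
  by apply: (@filterS _ \oo _ _ _ _ hA') => k; apply; exact: h0.
rewrite (_ : (fun _ => _) = (fun t => t^-1 *: ((phi \o shift x) (t *: e i) - phi x)) \o h).
  exact: cvg_comp hc' H.
by apply/funext => k /=; rewrite [x + _]addrC.
Qed.

Lemma test_function_lipschitz phi i (C : R) (x : V) (t : R) : test_function phi ->
  (forall y, `|partial_derive i phi y| <= C) -> 0 <= t ->
  `|phi (x + t *: e i) - phi x| <= C * t.
Proof.
move=> [Cphi _] dC; rewrite le_eqVlt => /predU1P[<-|t0].
  by rewrite scale0r addr0 subrr normr0 mulr0.
have [_ dphi _] := Cphi 1.
have dl s := is_derive_line (dphi i (x + s *: e i)).
have [c _] := @MVT _ (fun s => phi (x + s *: e i)) _ 0 t t0 (fun s _ => dl s)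
  (continuous_subspaceT (is_derive_continuous dl)).
rewrite scale0r addr0 subr0 => ->; rewrite normrM (gtr0_norm t0) ler_wpM2r// ltW //.
Qed.

End product_test.

(** * Locally summable functions *)

Section loc_summable.
Context {R : realType} {n : nat}.
Local Notation V := 'rV[R]_n.
Local Notation m := (borel_lebesgue R n).
Local Notation lam := (@lebesgue_measure R).
Implicit Types (u g w phi : V -> R).

Lemma ge0_integral_translate' (F : V -> \bar R) v : measurable_fun setT F ->
  (forall x, 0 <= F x)%E -> (\int[m]_x F (x + v)%R = \int[m]_x F x)%E.
Proof. exact: ge0_integral_translate. Qed.

Lemma summable_translate g v : summable_fun m g -> summable_fun m (fun x => g (x + v)).
Proof.
move=> [mg gi]; split; first by apply: measurableT_comp => //; exact: measurable_translate.
rewrite (@ge0_integral_translate' (fun x => `|g x|%:E))//.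
by apply/measurable_EFinP; exact: measurableT_comp.
Qed.

Lemma Rint_translate g v : summable_fun m g -> \int[m]_x g (x + v) = \int[m]_x g x.
Proof.
move=> sg; have sgv := summable_translate v sg; apply: EFin_inj.
rewrite !Rint_EFin// integralE [in RHS]integralE.
have mg : measurable_fun setT (EFin \o g) by apply/measurable_EFinP; case: sg.
have := @ge0_integral_translate' ((EFin \o g)^\+)%E v (measurable_funepos mg) (fun x => funepos_ge0 _ x).
have := @ge0_integral_translate' ((EFin \o g)^\-)%E v (measurable_funeneg mg) (fun x => funeneg_ge0 _ x).
by move=> E1 E2; congr (_ - _)%E;   [apply: etrans E2|apply: etrans E1]; apply: eq_integral => x _; rewrite ?funeposE ?funenegE.
Qed.

(** The Borel counterpart of [L1loc]: cubes of integer half-side exhaust the space and contain every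
    compact set. *)
Definition loc_summable g := measurable_fun setT g /\
  forall k : nat, summable_fun m (fun x => g x * \1_(cube k%:R) x).

Definition cube_supported phi := exists k : nat, forall x, ~ cube k%:R x -> phi x = 0.

Lemma loc_summableM g phi : loc_summable g -> bounded_measurable phi -> cube_supported phi ->
  summable_fun m (fun x => g x * phi x).
Proof.
move=> [mg sg] [mphi [C phiC]] [k phi0].
rewrite (_ : (fun _ => _) = fun x => g x * \1_(cube k%:R) x * phi x).
  exact: (summableMb mphi phiC (sg k)).
apply/funext => x; rewrite indicE; have [cx|nx] := pselect (cube k%:R x).
  by rewrite mem_set// mulr1.
by rewrite phi0// !mulr0.
Qed.

Lemma cubeS (r s : R) : r <= s -> cube r `<=` (cube s : set V).
Proof. by move=> rs x cx i; exact: le_trans (cx i) rs. Qed.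

Lemma cube_supported_indic (k : nat) : cube_supported (\1_(cube k%:R)).
Proof. by exists k => x nx; rewrite indicE memNset. Qed.

Lemma cube_supportedMl f phi : cube_supported phi -> cube_supported (fun x => f x * phi x).
Proof. by move=> [k phi0]; exists k => x /phi0 ->; rewrite mulr0. Qed.

Lemma loc_summableD u w (c : R) : loc_summable u -> loc_summable w ->
  loc_summable (fun x => u x + c * w x).
Proof.
move=> [mu su] [mw sw]; split.
  by apply: measurable_funD => //; exact: measurable_funM.
move=> k; rewrite (_ : (fun _ => _) = fun x => u x * \1_(cube k%:R) x + c * (w x * \1_(cube k%:R) x)).
  by apply: summableD => //; exact: summableZ.
by apply/funext => x; rewrite mulrDl mulrA.
Qed.

Lemma loc_summable_le u w : measurable_fun setT u -> (forall x, `|u x| <= w x) ->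
  loc_summable w -> loc_summable u.
Proof.
move=> mu uw [mw sw]; split => // k; apply: summable_le (sw k).
  by apply: measurable_funM => //; apply: measurable_indic; exact: measurable_cube.
by move=> x; rewrite normrM ler_pM// indicE ger0_norm.
Qed.

Lemma summable_bounded_cube phi : bounded_measurable phi -> cube_supported phi -> summable_fun m phi.
Proof.
move=> [mphi [C phiC]] [k phi0].
have C0 : 0 <= C by exact: le_trans (phiC 0).
apply: (@summable_le _ _ _ _ _ (fun x => C * \1_(cube k%:R) x)) => //.
  move=> x; rewrite indicE; have [cx|nx] := pselect (cube k%:R x).
    by rewrite mem_set// mulr1.
  by rewrite phi0// normr0 mulr_ge0.
by apply: summableZ; apply: summable_indic; [exact: measurable_cube|exact: cube_lty].
Qed.

Lemma loc_summable_bounded u : bounded_measurable u -> loc_summable u.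
Proof.
move=> bu; split; first by case: bu.
move=> k; apply: summable_bounded_cube.
  by apply: bounded_measurableM => //; apply: bounded_measurable_indic; exact: measurable_cube.
exact/cube_supportedMl/cube_supported_indic.
Qed.

Lemma summable_loc u : summable_fun m u -> loc_summable u.
Proof.
move=> su; split; first by case: su.
move=> k; apply: (@summableMb _ _ _ _ 1) => //.
  by apply: measurable_indic; exact: measurable_cube.
by move=> x; rewrite indicE ger0_norm// lern1 leq_b1.
Qed.

Lemma loc_summableMb u phi : loc_summable u -> bounded_measurable phi ->
  loc_summable (fun x => u x * phi x).
Proof.
move=> [mu su] [mphi [C phiC]]; split; first exact: measurable_funM.
move=> k; under eq_fun do rewrite mulrAC.
exact: (summableMb mphi phiC (su k)).
Qed.

Lemma cube_translate (k : nat) (v : V) (h : R) : exists j : nat, forall x t, `|t| <= h ->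
  cube k%:R (x + t *: v) -> cube j%:R x.
Proof.
have [j vj] := cube_cover (h *: v); exists (k + j)%N => x t t1 cx i.
have -> : x ord0 i = (x + t *: v) ord0 i - t * v ord0 i by rewrite !mxE addrK.
rewrite (le_trans (ler_normB _ _))// natrD lerD// (le_trans _ (vj i))// mxE !normrM.
by rewrite ler_wpM2r// (le_trans t1)// ler_norm.
Qed.

Lemma bounded_measurable_translate phi (v : V) : bounded_measurable phi ->
  bounded_measurable (fun x : V => phi (x + v)).
Proof.
move=> [mphi [C phiC]]; split; last by exists C => x; exact: phiC.
by apply: measurableT_comp => //; exact: measurable_translate.
Qed.

Lemma loc_summable_translate u v : loc_summable u -> loc_summable (fun x => u (x + v)).
Proof.
move=> lu; split.
  by apply: measurableT_comp; [case: lu|exact: measurable_translate].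
move=> k.
have [j jP] := cube_translate k (- v) 1.
have : summable_fun m (fun x => u x * \1_(cube k%:R) (x - v)).
  apply: loc_summableM => //.
    apply: (@bounded_measurable_translate (\1_(cube k%:R)) (- v)).
    by apply: bounded_measurable_indic; exact: measurable_cube.
  exists j => x nx; rewrite indicE memNset// => cx; apply: nx; apply: (jP x 1).
    by rewrite normr1.
  by rewrite scale1r.
move=> /(summable_translate v); congr summable_fun; apply/funext => x.
by rewrite addrK.
Qed.

End loc_summable.

Section half_open_intervals.
Variable R : realType.
Local Notation lam := (@lebesgue_measure R).
Implicit Types a b : R.

Lemma indic_itv_oc a b (t : R) : \1_`]a, b]%classic t = (nat_of_bool (a < t <= b)%R)%:R :> R.
Proof.
rewrite indicE; congr (nat_of_bool _)%:R.
by apply/idP/idP => [/set_mem/=|h]; [rewrite in_itv|apply/mem_set; rewrite /= in_itv].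
Qed.

Lemma lebesgue_itv_oc a b : lam `]a, b]%classic = (if (a < b)%R then (b - a)%:E else 0)%E.
Proof. by rewrite lebesgue_measure_itv/= lte_fin; case: ifP => // _; rewrite -EFinB. Qed.

Lemma summable_itv a b : summable_fun lam (\1_`]a, b]%classic).
Proof.
apply: summable_indic; first exact: measurable_itv.
by rewrite [X in (X < _)%E]lebesgue_itv_oc; case: ifP => _; rewrite ltry.
Qed.

Lemma Rint_itv a b : a <= b -> \int[lam]_t (\1_`]a, b]%classic t : R) = b - a.
Proof.
move=> ab; rewrite /Rintegral integral_indic// setIT [X in fine X]lebesgue_itv_oc.
by case: ltgtP ab => // -> _; rewrite subrr.
Qed.

End half_open_intervals.

(** * Fundamental lemma of the calculus of variations *)

Section fundamental_lemma.
Context {R : realType} {n : nat}.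
Local Notation V := 'rV[R]_n.
Local Notation m := (borel_lebesgue R n).
Implicit Types (u g w phi : V -> R).

Definition ocube (k : nat) : set V := obox (fun=> - k%:R) (fun=> k%:R).

Lemma ocube_sub k : ocube k `<=` cube k%:R.
Proof. by move=> x ox i; have /andP[h1 h2] := ox i; rewrite ler_norml !ltW. Qed.

Lemma cube_ocube (k : nat) : cube k%:R `<=` ocube k.+1.
Proof.
move=> x cx i; have := cx i; rewrite ler_norml => /andP[h1 h2].
have k1 : k%:R < k.+1%:R :> R by rewrite ltr_nat.
by rewrite (le_lt_trans h2 k1) andbT (lt_le_trans _ h1)// ltrN2.
Qed.

(* The plateau functions of a box increase to its indicator, so an identity against smooth
   products passes to boxes, and from there to all bounded Borel functions. *)
Definition separating (P : (V -> R) -> Prop) := forall F : 'I_n -> R -> R,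
  (forall j, smooth (F j)) -> (exists r : R, forall j s, r < `|s| -> F j s = 0) -> P (prodf F).

(** The common majorant [G] makes the passage to the limit uniform in [j]: replacing a test function
    [f] by [f_i] costs at most the integral of [G |f_i - f|]. This lets the class of admissible test
    functions be closed under bounded limits. *)
Lemma separating_bounded (w_ : nat -> V -> R) w G :
  (forall j, measurable_fun setT (w_ j)) -> measurable_fun setT w -> loc_summable G ->
  (forall j x, `|w_ j x| <= G x) -> (forall x, `|w x| <= G x) ->
  separating (fun phi => \int[m]_x (w_ j x * phi x) @[j --> \oo] --> \int[m]_x (w x * phi x)) ->
  forall phi, bounded_measurable phi -> cube_supported phi ->
    \int[m]_x (w_ j x * phi x) @[j --> \oo] --> \int[m]_x (w x * phi x).
Proof.
move=> mw_ mw lG w_G wG sep.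
pose Q phi := \int[m]_x (w_ j x * phi x) @[j --> \oo] --> \int[m]_x (w x * phi x).
have lw_ j : loc_summable (w_ j) by exact: loc_summable_le (w_G j) lG.
have lw : loc_summable w by exact: loc_summable_le wG lG.
have Qlim (f_ : nat -> V -> R) (f : V -> R) (C : R) (k : nat) : (forall k, bounded_measurable (f_ k)) -> bounded_measurable f ->
    (forall i x, `|f_ i x| <= C) -> (forall x, f_ i x @[i --> \oo] --> f x) ->
    (forall i x, ~ cube k%:R x -> f_ i x = 0) -> (forall i, Q (f_ i)) -> Q f.
  move=> bf_ bf f_C cf f0 Qf; have f00 x : ~ cube k%:R x -> f x = 0.
    move=> nx; have := cf x; under eq_fun do rewrite f0//.
    by move/(cvg_unique (@Rhausdorff R)); apply; exact: cvg_cst.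
  have sf_ i : cube_supported (f_ i) by exists k => x; exact: f0.
  have sf : cube_supported f by exists k.
  have C0 : 0 <= C by exact: le_trans (f_C 0%N 0).
  have fC x : `|f x| <= C.
    rewrite -(cvg_lim (@Rhausdorff R) (cvg_norm (cf x))); apply: limr_le.
      exact: cvgP (cvg_norm (cf x)).
    exact: nearW.
  pose D i := \int[m]_x (G x * `|f_ i x - f x|).
  have sGf i : summable_fun m (fun x => G x * `|f_ i x - f x|).
    apply: loc_summableM => //.
      have [mm [K KP]] := @bounded_measurable_comb _ V R (f_ i) f (-1) (bf_ i) bf.
      split; last by exists K => x; rewrite normr_id; have := KP x; rewrite mulN1r.
      by apply: measurableT_comp => //; apply: measurable_funB; [case: (bf_ i)|case: bf].
    by exists k => x nx; rewrite f0// f00// subrr normr0.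
  have Dc : D i @[i --> \oo] --> (0 : R).
    have sGC : summable_fun m (fun x => G x * (2 * C * \1_(cube k%:R) x)).
      apply: loc_summableM => //; last exact/cube_supportedMl/cube_supported_indic.
      apply: bounded_measurableM; first exact: bounded_measurable_cst.
      by apply: bounded_measurable_indic; exact: measurable_cube.
    have G0 x : 0 <= G x by exact: le_trans (wG x).
    have [||||_ _] := @Rint_dominated _ _ _ m (fun i x => G x * `|f_ i x - f x|) (fun=> 0) _ _ _ _ sGC.
    - by move=> i; case: (sGf i).
    - exact: measurable_cst.
    - apply: aeW => x; rewrite -(mulr0 (G x)); apply: cvgMr.
      rewrite -(@normr0 _ R); apply: cvg_norm; rewrite -(subrr (f x)).
      by apply: cvgB => //; exact: cvg_cst.
    - move=> i x; rewrite ger0_norm ?mulr_ge0// ler_wpM2l// indicE.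
      have [cx|nx] := pselect (cube k%:R x).
        by rewrite mem_set// mulr1 (le_trans (ler_normB _ _))// mulr_natl mulr2n lerD.
      by rewrite f0// f00// subrr normr0 mulr_ge0// mulr_ge0.
    - by rewrite Rintegral_cst ?mul0r//; apply.
  have est (v : V -> R) i : (forall x, `|v x| <= G x) -> loc_summable v ->
      `|\int[m]_x (v x * f_ i x) - \int[m]_x (v x * f x)| <= D i.
    move=> vG lv; rewrite -RintB; [|exact: loc_summableM|exact: loc_summableM].
    have sB : summable_fun m (fun x => v x * f_ i x - v x * f x).
      by apply: summableB; exact: loc_summableM.
    apply: (le_trans (Rint_abs sB)); apply: Rint_le => //; first exact: summable_abs.
    by move=> x; rewrite -mulrBr normrM ler_wpM2r.
  apply/cvgrPdist_le => e e0.
  have e3 : 0 < e / 3 by rewrite divr_gt0.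
  have /cvgrPdist_le /(_ _ e3) [i _ /(_ i (leqnn i)) Di] := Dc.
  rewrite sub0r normrN in Di.
  have /cvgrPdist_le /(_ _ e3) := Qf i; apply: filterS => j hj.
  have E1 := est _ i (w_G j) (lw_ j); have E2 := est _ i wG lw.
  have Di' : D i <= e / 3 by exact: le_trans (ler_norm _) Di.
  set a := \int[m]_x (w x * f x); set b := \int[m]_x (w_ j x * f x).
  set a' := \int[m]_x (w x * f_ i x) in hj E2; set b' := \int[m]_x (w_ j x * f_ i x) in hj E1.
  have -> : a - b = - (a' - a) + (a' - b') + (b' - b) by ring.
  have -> : e = e / 3 + e / 3 + e / 3 by field.
  rewrite (le_trans (ler_normD _ _))// lerD//; last exact: le_trans E1 Di'.
  rewrite (le_trans (ler_normD _ _))// lerD// normrN; exact: le_trans E2 Di'.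
have Qbox a b k : Q (\1_(obox a b `&` ocube k)).
  have [c [d E]] := @oboxes_setI R n (obox a b) (ocube k) (ex_intro _ a (ex_intro _ b erefl))
    (ex_intro _ _ (ex_intro _ _ erefl)).
  pose F N j := plateau N (Num.max (a j) (- k%:R)) (Num.min (b j) k%:R).
  have E' : obox a b `&` ocube k = obox (fun j => Num.max (a j) (- k%:R)) (fun j => Num.min (b j) k%:R).
    apply/seteqP; split => x /=.
      by move=> [h h'] i; rewrite gt_max lt_min; case/andP: (h i) => -> ->; case/andP: (h' i) => -> ->.
    move=> h; split => i; have := h i; rewrite gt_max lt_min.
      by move=> /andP[/andP[-> _] /andP[-> _]].
    by move=> /andP[/andP[_ ->] /andP[_ ->]].
  have F0 N j s : k%:R < `|s| -> F N j s = 0.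
    move=> ks; apply: plateau_out; rewrite gt_max lt_min; apply: contraTN ks.
    move=> /andP[/andP[_ s1] /andP[_ s2]]; rewrite -leNgt ler_norml !ltW//.
  have F01 N x : 0 <= prodf (F N) x <= 1.
    rewrite /prodf; elim/big_rec: _ => [|j y _ /andP[y0 y1]]; first by rewrite ler01 lexx.
    rewrite mulr_ge0 ?plateau_ge0//=; apply: mulr_ile1 => //; [exact: plateau_ge0|exact: plateau_le1].
  have suppF N x : ~ cube k%:R x -> prodf (F N) x = 0.
    move=> /existsNP[j /negP]; rewrite -ltNge => kx.
    by rewrite /prodf (bigD1 j)//= F0// mul0r.
  apply: (@Qlim (fun N => prodf (F N)) _ 1 k).
  - move=> N; apply: (@bounded_of_cube _ _ _ k%:R) => //.
      by apply: continuous_prodf => j; exact: (C1d_continuous (smooth_plateau _ _ _ 0)).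
    exact: suppF.
  - apply: bounded_measurable_indic; rewrite E'; exact: measurable_obox.
  - by move=> N x; case/andP: (F01 N x) => h1 h2; rewrite ger0_norm.
  - move=> x; rewrite E' (_ : \1__ x = \prod_j (if Num.max (a j) (- k%:R) < x ord0 j < Num.min (b j) k%:R then 1 else 0)).
      by apply: cvg_bigprod => j; exact: plateau_cvg.
    rewrite indicE; have [bx|nbx] := pselect (obox (fun j => Num.max (a j) (- k%:R)) (fun j => Num.min (b j) k%:R) x).
      by rewrite mem_set// big1// => j _; rewrite bx.
    rewrite memNset//; move: nbx => /existsNP[j /negP nj].
    by rewrite (bigD1 j)//= (negbTE nj) mul0r.
  - by move=> N x; exact: suppF.
  - move=> N; apply: sep; first by move=> j; exact: smooth_plateau.
    by exists k%:R => j s; exact: F0.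
have mO k : measurable (ocube k) by exact: measurable_obox.
(* Multiplication by the indicator of a fixed open cube keeps all supports bounded throughout the
   monotone class argument. *)
have main k phi : bounded_measurable phi -> Q (fun x => phi x * \1_(ocube k) x).
  move: phi; apply: (@bounded_measurable_ind _ V R (@oboxes R n)).
  - exact: measurable_oboxes.
  - exact: oboxes_setI.
  - rewrite (_ : (fun _ => _) = \1_(ocube k `&` ocube k)); first exact: Qbox.
    by apply/funext => x; rewrite mul1r setIid.
  - move=> _ [a [b ->]]; rewrite (_ : (fun _ => _) = \1_(obox a b `&` ocube k)); first exact: Qbox.
    by apply/funext => x; rewrite !indicE in_setI; case: (_ \in _); case: (_ \in _); rewrite ?mulr1 ?mul1r ?mulr0.
  - move=> f g c bf bg Qf Qg; rewrite /Q.
    have bO h : bounded_measurable h -> bounded_measurable (fun x => h x * \1_(ocube k) x).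
      by move=> bh; apply: bounded_measurableM => //; exact: bounded_measurable_indic.
    have sO (h : V -> R) : cube_supported (fun x => h x * \1_(ocube k) x).
      apply: cube_supportedMl; exists k => x nx; rewrite indicE memNset//.
      by move/ocube_sub.
    have E v : loc_summable v -> \int[m]_x (v x * ((f x + c * g x) * \1_(ocube k) x)) =
        \int[m]_x (v x * (f x * \1_(ocube k) x)) + c * \int[m]_x (v x * (g x * \1_(ocube k) x)).
      move=> lv; rewrite -RintZ; last by apply: loc_summableM => //; exact: bO.
      rewrite -RintD; [|by apply: loc_summableM => //; exact: bO|].
        by apply: eq_Rintegral => x _; ring.
      by apply: summableZ; apply: loc_summableM => //; exact: bO.
    rewrite E//; under eq_fun do rewrite E//.
    by apply: cvgD => //; apply: cvgMr.
  - move=> f_ f C bf_ bf f_C cf Qf.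
    apply: (@Qlim (fun i x => f_ i x * \1_(ocube k) x) _ C k) => //.
    + by move=> i; apply: bounded_measurableM => //; exact: bounded_measurable_indic.
    + by apply: bounded_measurableM => //; exact: bounded_measurable_indic.
    + move=> i x; rewrite normrM -[leRHS]mulr1 ler_pM//.
      by rewrite indicE ger0_norm// lern1 leq_b1.
    + by move=> x; apply: cvgMl.
    + by move=> i x nx; rewrite indicE memNset ?mulr0// => /ocube_sub.
move=> phi bphi [k phi0]; have := main k.+1 phi bphi.
suff -> : (fun x => phi x * \1_(ocube k.+1) x) = phi by [].
apply/funext => x; have [cx|nx] := pselect (cube k%:R x); last by rewrite phi0// mul0r.
by rewrite indicE mem_set ?mulr1//; exact: cube_ocube.
Qed.

(** The extension to bounded Borel test functions, for the constant sequence [w] with limit 0,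
    permits the test function [sg(w)] on a cube; the integral of [|w|] over every cube is therefore
    0. *)
Lemma loc_summable_eq0 w : loc_summable w ->
  separating (fun phi => \int[m]_x (w x * phi x) = 0) -> {ae m, forall x, w x = 0}.
Proof.
move=> lw sep; have [mw sw] := lw.
have H phi : bounded_measurable phi -> cube_supported phi -> \int[m]_x (w x * phi x) = 0.
  move=> bphi sphi.
  have la : loc_summable (fun x => `|w x|).
    split; first exact: measurableT_comp.
    move=> k; have := summable_abs (sw k); congr summable_fun; apply/funext => x.
    by rewrite normrM [`|\1__ _|]ger0_norm.
  have := @separating_bounded (fun=> w) (fun=> 0) (fun x => `|w x|) (fun=> mw) _ la (fun _ _ => lexx _) _ _ phi bphi sphi.
  have z0 (psi : V -> R) : \int[m]_x (0 * psi x) = 0.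
    by under eq_Rintegral => x _ do rewrite mul0r; rewrite Rintegral_cst// mul0r.
  rewrite z0 => h.
  have h' : (fun _ : nat => \int[m]_x (w x * phi x)) @ \oo --> (0 : R).
    apply: h => //; first by move=> x; rewrite normr0.
    by move=> F sF rF; rewrite sep// z0; exact: cvg_cst.
  exact: (cvg_unique (@Rhausdorff R) (cvg_cst _) h').
have bs : bounded_measurable (fun x => Num.sg (w x)).
  split; last by exists 1 => x; rewrite normr_sg lern1 leq_b1.
  rewrite (_ : (fun _ => _) = fun x => \1_[set y | 0 < w y] x + (-1) * \1_[set y | w y < 0] x).
    apply: measurable_funD; last apply: measurable_funM => //; apply: measurable_indic.
      by apply: measurable_lt_set => //; exact: measurable_cst.
    by apply: measurable_lt_set => //; exact: measurable_cst.
  apply/funext => x; rewrite !indicE.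
  have -> : (x \in [set y | 0 < w y]) = (0 < w x) by apply/idP/idP => [/set_mem//|/mem_set].
  have -> : (x \in [set y | w y < 0]) = (w x < 0) by apply/idP/idP => [/set_mem//|/mem_set].
  case: (ltgtP (w x) 0) => [h|h|->]; last by rewrite sgr0 mulr0 addr0.
    by rewrite ltr0_sg// mulr1 add0r.
  by rewrite gtr0_sg// mulr0 addr0.
have E k : \int[m]_x (`|w x| * \1_(cube k%:R) x) = 0.
  rewrite -[RHS](H (fun x => Num.sg (w x) * \1_(cube k%:R) x)).
  - by apply: eq_Rintegral => x _; rewrite normrEsg mulrA [w x * _]mulrC.
  - by apply: bounded_measurableM => //; apply: bounded_measurable_indic; exact: measurable_cube.
  - exact/cube_supportedMl/cube_supported_indic.
have ae k : {ae m, forall x, w x * \1_(cube k%:R) x = 0}.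
  have mk : measurable_fun setT (EFin \o (fun x => w x * \1_(cube k%:R) x)).
    by apply/measurable_EFinP; case: (sw k).
  have /(ae_eq_integral_abs m measurableT mk) : (\int[m]_x `|(w x * \1_(cube k%:R) x)%:E| = 0)%E.
    rewrite -[RHS](congr1 EFin (E k)) Rint_EFin; last first.
      have := summable_abs (sw k); congr summable_fun; apply/funext => x.
      by rewrite normrM [`|\1__ _|]ger0_norm.
    by apply: eq_integral => x _; rewrite /= normrM [`|\1__ _|]ger0_norm.
  by apply: filterS => x /(_ I)[].
have := ae_foralln ae; apply: filterS => x wx.
have [k kx] := cube_cover x; have := wx k.
by rewrite indicE mem_set// mulr1.
Qed.

End fundamental_lemma.

(** * Weak derivatives *)

Section lineint.
Context {R : realType} {n : nat}.
Local Notation V := 'rV[R]_n.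
Local Notation m := (borel_lebesgue R n).
Local Notation lam := (@lebesgue_measure R).
Local Notation e i := (delta_mx ord0 i : V).
Implicit Types (u g w phi : V -> R).

Definition lineint v (h : R) g (x : V) : R := \int[lam]_t (g (x + t *: v) * \1_`]0, h]%classic t).

Lemma measurable_line1 (x v : V) : measurable_fun setT (fun t : measurableTypeR R => x + t *: v).
Proof.
apply: measurable_fun_rVP => i; under eq_fun do rewrite !mxE.
by apply: measurable_funD => //; exact: measurable_funM.
Qed.

Lemma loc_measurable g : (forall k : nat, measurable_fun setT (fun x => g x * \1_(cube k%:R) x)) ->
  measurable_fun setT g.
Proof.
move=> mg; apply: (@measurable_fun_cvg _ _ _ setT (fun (k : nat) x => g x * \1_(cube k%:R) x)) => //.
move=> x _; have [k kx] := cube_cover x.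
apply: cvg_near_cst; exists k => // j /= kj.
by rewrite indicE mem_set ?mulr1//; apply: (cubeS _ kx); rewrite ler_nat.
Qed.

(** Fubini and the translation by [t v] transpose integration along [v] into integration along
    [- v]. Summability is checked on the translated integrand [f2], which has a majorant of product
    form, and carried to [f1] by translation invariance. *)
Lemma lineint_adjoint v h g phi : 0 <= h -> loc_summable g -> bounded_measurable phi ->
  cube_supported phi ->
  [/\ summable_fun m (fun x => lineint v h g x * phi x),
      {ae m, forall x, phi x <> 0 -> summable_fun lam (fun t => g (x + t *: v) * \1_`]0, h]%classic t)} &
      \int[m]_x (lineint v h g x * phi x) = \int[m]_x (g x * lineint (- v) h phi x)].
Proof.
move=> h0 lg [mphi [C phiC]] [k phi0]; have [mg sg] := lg.
have C0 : 0 <= C by exact: le_trans (phiC 0).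
pose I (t : measurableTypeR R) : R := \1_`]0, h]%classic t.
have mI : measurable_fun setT I by exact: measurable_indic.
have I0 t : 0 <= I t by rewrite /I indicE.
pose f1 (p : V * measurableTypeR R) := g (p.1 + p.2 *: v) * I p.2 * phi p.1.
pose f2 (p : V * measurableTypeR R) := g p.1 * I p.2 * phi (p.1 + p.2 *: (- v)).
have mI2 : measurable_fun setT (fun p : V * measurableTypeR R => I p.2).
  by apply: measurableT_comp => //; exact: measurable_snd.
have mf1 : measurable_fun setT f1.
  apply: measurable_funM; last by apply: measurableT_comp => //; exact: measurable_fst.
  apply: measurable_funM => //.
  by apply: measurableT_comp => //; exact: measurable_line.
have mf2 : measurable_fun setT f2.
  apply: measurable_funM; last by apply: measurableT_comp => //; exact: measurable_line.
  by apply: measurable_funM => //; apply: measurableT_comp => //; exact: measurable_fst.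
have [j jP] := cube_translate k (- v) h.
pose K (x : V) := C * `|g x| * \1_(cube j%:R) x.
have f2K x t : `|f2 (x, t)| <= K x * I t.
  rewrite /f2/= /I indicE; have [/= it|nt] := pselect (`]0, h]%classic t); last first.
    by rewrite memNset// !mulr0 mul0r normr0.
  rewrite mem_set// !mulr1 /K indicE; have [cx|nx] := pselect (cube j%:R x).
    by rewrite mem_set// mulr1 normrM mulrC ler_wpM2r.
  rewrite memNset// mulr0 phi0 ?mulr0 ?normr0// => cx; apply: nx; apply: (jP x t) => //.
  by move: it; rewrite in_itv/= => /andP[t0 th]; rewrite gtr0_norm.
have lh : lam `]0, h]%classic = h%:E.
  by rewrite lebesgue_itv_oc subr0; case: (ltgtP 0 h) h0 => // <-.
have sI : summable_fun lam I by exact: summable_itv.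
have sK : summable_fun m K.
  rewrite (_ : K = fun x => C * `|g x * \1_(cube j%:R) x|); first exact/summableZ/summable_abs.
  by apply/funext => x; rewrite /K normrM [`|\1__ _|]ger0_norm// mulrA.
have fin2 : (\int[m]_x \int[lam]_t `|f2 (x, t)|%:E < +oo)%E.
  have K0 x : 0 <= K x by rewrite /K !mulr_ge0.
  apply: (@le_lt_trans _ _ (\int[m]_x (h%:E * (K x)%:E))%E).
    apply: ge0_le_integral => //=.
    - by move=> x _; apply: integral_ge0.
    - apply: (@measurable_fun_fubini_tonelli_F _ _ _ _ R lam (fun p => `|f2 p|%:E)) => //.
      by apply/measurable_EFinP; exact: measurableT_comp.
    - apply/measurable_EFinP; apply: measurable_funM => //; exact: summable_measurable sK.
    - move=> x _; apply: (@le_trans _ _ (\int[lam]_t ((K x)%:E * (I t)%:E))%E).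
        apply: ge0_le_integral => //=.
        + by apply/measurable_EFinP; apply: measurableT_comp => //; exact: measurableT_comp mf2 (pair1_measurable _).
        + by apply/measurable_EFinP; exact: measurable_funM.
        + by move=> t _; rewrite -EFinM lee_fin f2K.
      rewrite ge0_integralZl//; last 3 first.
        by apply/measurable_EFinP.
        by move=> t _; rewrite lee_fin.
        by rewrite lee_fin.
      by rewrite integral_indic// setIT [X in (_ * X)%E]lh muleC.
  rewrite ge0_integralZl//; last 2 first.
  - by apply/measurable_EFinP; exact: summable_measurable sK.
  - by move=> x _; rewrite lee_fin.
  have [_ sK2] := sK; apply: lte_mul_pinfty => //.
  rewrite (_ : (\int[m]_x (K x)%:E = \int[m]_x `|K x|%:E)%E)//.
  by apply: eq_integral => x _; rewrite ger0_norm.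
have fin1 : (\int[m]_x \int[lam]_t `|f1 (x, t)|%:E < +oo)%E.
  have mEabs (f : V * measurableTypeR R -> R) : measurable_fun setT f -> measurable_fun setT (fun p : V * measurableTypeR R => `|f p|%:E).
    by move=> mf; apply/measurable_EFinP; exact: measurableT_comp.
  have FT (f : V * measurableTypeR R -> R) (mf : measurable_fun setT f) :=
    @fubini_tonelli _ _ _ _ R m lam (fun p => `|f p|%:E) (mEabs f mf) (fun=> normr_ge0 _).
  rewrite (FT f1 mf1).
  have fin2' := fin2; rewrite (FT f2 mf2) in fin2'.
  apply: le_lt_trans fin2'; rewrite le_eqVlt; apply/orP; left; apply/eqP.
  apply: eq_integral => t _.
  have mt : measurable_fun setT (fun x => `|f2 (x, t)|%:E).
    by apply/measurable_EFinP; apply: measurableT_comp => //; exact: measurableT_comp mf2 (pair2_measurable _).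
  rewrite -(@ge0_integral_translate' _ _ (fun x => `|f2 (x, t)|%:E) (t *: v) mt (fun=> normr_ge0 _)).
  by apply: eq_integral => x _; rewrite /f1 /f2/= scalerN addrK.
have [s1 s1' ae1 E1] := RFubini mf1 fin1; have [s2 s2' _ E2] := RFubini mf2 fin2.
have int1 : {ae m, forall x, \int[lam]_t f1 (x, t) = lineint v h g x * phi x}.
  apply: filterS ae1 => x sx; have [p0|p0] := eqVneq (phi x) 0.
    rewrite p0 mulr0 /f1 /=; under eq_Rintegral do rewrite p0 mulr0.
    by rewrite Rintegral_cst// mul0r.
  rewrite mulrC /lineint -RintZ.
    by apply: eq_Rintegral => t _; rewrite /f1/= mulrC.
  have := summableZ (phi x)^-1 sx; congr summable_fun; apply/funext => t.
  by rewrite /f1/= mulrC mulfK.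
have aeS : {ae m, forall x, phi x <> 0 -> summable_fun lam (fun t => g (x + t *: v) * \1_`]0, h]%classic t)}.
  apply: filterS ae1 => x sx /eqP p0.
  have := summableZ (phi x)^-1 sx; congr summable_fun; apply/funext => t.
  by rewrite /f1/= mulrC mulfK.
have mlin : measurable_fun setT (lineint v h g).
  apply: (@measurable_Rint _ _ _ _ R lam (fun p : V * measurableTypeR R => g (p.1 + p.2 *: v) * I p.2)).
  apply: measurable_funM => //.
  by apply: measurableT_comp => //; exact: measurable_line.
have mlp : measurable_fun setT (fun x => lineint v h g x * phi x) by exact: measurable_funM.
split => //; first by apply: (summable_ae s1) => //; exact: int1.
rewrite -(Rint_ae (summable_measurable s1) mlp int1) E1.
transitivity (\int[lam]_t \int[m]_x f2 (x, t)).
  apply: eq_Rintegral => t _.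
  have st : summable_fun m (fun x => f2 (x, t)).
    apply: (summable_le _ (fun x => f2K x t)).
      exact: measurableT_comp mf2 (pair2_measurable _).
    have := summableZ (I t) sK; congr summable_fun; apply/funext => x.
    by rewrite mulrC.
  rewrite -(Rint_translate (t *: v) st).
  by apply: eq_Rintegral => x _; rewrite /f1 /f2/= scalerN addrK.
rewrite -E2; apply: eq_Rintegral => x _; rewrite /lineint -RintZ.
  by apply: eq_Rintegral => t _; rewrite /f2/= mulrA mulrAC.
under eq_fun do rewrite mulrC.
apply: (@summableMb _ _ _ _ C) => //.
apply: measurableT_comp => //; exact: measurable_line1.
Qed.

End lineint.

(** * Steklov averages on the line *)

Section steklov.
Variable R : realType.
Local Notation lam := (@lebesgue_measure R).
Implicit Types f : R -> R.

Lemma smooth_primitive f (r : R) : continuous f -> (forall s, r < `|s| -> f s = 0) ->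
  exists P : R -> R, forall s : R, is_derive s (1 : R) P (f s).
Proof.
move=> cf f0.
have fint : lam.-integrable setT (EFin \o f).
  rewrite (_ : EFin \o f = (EFin \o f) \_ `[- r, r]%classic).
    apply/(integrable_mkcond _ _).1; first exact: measurable_itv.
    apply: continuous_compact_integrable; first exact: segment_compact.
    exact: continuous_subspaceT.
  apply/funext => s; rewrite patchE; case: ifPn => // /negP ns /=.
  rewrite f0// ltNge; apply/negP => h; apply: ns.
  by rewrite inE /= in_itv/= -ler_norml.
exists (fun s => \int[lam]_(t in [set` `]-oo, s]]) f t) => s.
have [||||dF FE] := @continuous_FTC1 R f -oo%O s (s + 1).
- by rewrite ltrDl.
- by apply: (@integrableS _ _ _ _ setT) => //; exact: measurable_itv.
- by rewrite /Order.lt/=.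
- exact: cf.
by apply: DeriveDef; [exact: dF|rewrite -derive1E].
Qed.

Lemma summable_segment f (h : R) : continuous f ->
  summable_fun lam (fun t => f t * \1_`]0, h]%classic t).
Proof.
move=> cf; apply/summable_integrable.
rewrite (_ : EFin \o _ = (EFin \o f) \_ `]0, h]%classic).
  apply/(integrable_mkcond _ _).1; first exact: measurable_itv.
  have ic : lam.-integrable `[0, h]%classic (EFin \o f).
    apply: continuous_compact_integrable; first exact: segment_compact.
    exact: continuous_subspaceT.
  apply: integrableS ic; [exact: measurable_itv|exact: measurable_itv|].
  exact: subset_itv_oc_cc.
apply/funext => t; rewrite patchE /= indicE.
by case: ifP => _; rewrite ?mulr1 ?mulr0.
Qed.

Lemma continuous_reflect f s : continuous f -> continuous (fun t => f (s - t)).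
Proof.
move=> cf t; apply: continuous_comp; last exact: cf.
by apply: cvgB; [exact: cvg_cst|exact: cvg_id].
Qed.

(** Integration over the segment from [s - h] to [s] gives an increment of a primitive. The
    derivative of the averaged function is thus a difference of translates of [f]. *)
Lemma steklov_primitive f P (h s : R) : 0 < h -> continuous f ->
  (forall s : R, is_derive s (1 : R) P (f s)) ->
  \int[lam]_t (f (s - t) * \1_`]0, h]%classic t) = P s - P (s - h).
Proof.
move=> h0 cf dP.
have dQ t : is_derive t (1 : R) (fun t => - P (s - t)) (f (s - t)).
  have d1 : is_derive t (1 : R) (fun t : R => s - t) (-1).
    have := is_deriveB (is_derive_cst s t (1 : R)) (is_derive_id t (1 : R)).
    by rewrite sub0r.
  have := is_deriveN (@is_derive1_comp _ P (fun t : R => s - t) t _ _ (dP (s - t)) d1).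
  by rewrite mulrN1 opprK.
have cfs : continuous (fun t => f (s - t)) by exact: continuous_reflect.
have := @continuous_FTC2 R (fun t => f (s - t)) (fun t => - P (s - t)) 0 h h0.
have cQ := is_derive_continuous dQ.
move=> /(_ (continuous_subspaceT cfs)) H.
rewrite -[RHS](_ : fine ((- P (s - h))%:E - (- P (s - 0))%:E)%E = _); last first.
  by rewrite /= subr0 opprK addrC.
rewrite -H.
- rewrite -[RHS]/(\int[lam]_(x in `[0, h]%classic) f (s - x)) -Rintegral_itv_obnd_cbnd.
    rewrite [RHS]Rintegral_mkcond.
    apply: eq_Rintegral => t _; rewrite patchE indicE.
    by case: ifPn => ti; rewrite ?mulr1 ?mulr0.
  apply/(integrable_mkcond _ _).2; first exact: measurable_itv.
  have := summable_integrable1 (summable_segment h cfs); congr (_.-integrable _ _).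
  apply/funext => t; rewrite patchE /= indicE.
  by case: ifP => _; rewrite ?mulr1 ?mulr0.
- split.
  + by move=> t _; have [] := dQ t.
  + exact: cvg_at_right_filter (cQ 0).
  + exact: cvg_at_left_filter (cQ h).
- by move=> t _; rewrite derive1E; have [_] := dQ t.
Qed.

End steklov.

Section weak_derivative.
Context {R : realType} {n : nat}.
Local Notation V := 'rV[R]_n.
Local Notation m := (borel_lebesgue R n).
Local Notation lam := (@lebesgue_measure R).
Local Notation e i := (delta_mx ord0 i : V).
Implicit Types (u g w phi : V -> R) (i : 'I_n).

(* For Borel functions, [g] is the [i]-th weak partial derivative of [u] exactly when the
   fundamental theorem of calculus holds on almost every line parallel to the [i]-th axis. *)
Definition wder i u g := [/\ loc_summable u, loc_summable g &
  forall h, 0 < h -> {ae m, forall x, u (x + h *: e i) - u x = lineint (e i) h g x}].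

Lemma loc_summable_abs u : loc_summable u -> loc_summable (fun x => `|u x|).
Proof.
move=> [mu su]; split; first exact: measurableT_comp.
move=> k; have := summable_abs (su k); congr summable_fun; apply/funext => x.
by rewrite normrM [`|\1__ _|]ger0_norm.
Qed.

Lemma lineint_loc_summable v h g : 0 <= h -> loc_summable g -> loc_summable (lineint v h g).
Proof.
move=> h0 lg.
have H (k : nat) : summable_fun m (fun x => lineint v h g x * \1_(cube k%:R) x).
  have bI : bounded_measurable (\1_(cube k%:R) : V -> R).
    by apply: bounded_measurable_indic; exact: measurable_cube.
  by have [] := lineint_adjoint v h0 lg bI (cube_supported_indic k).
split => //; apply: loc_measurable => k; exact: summable_measurable (H k).
Qed.

Lemma lineint_bound v h phi (c C : R) x : 0 <= h -> bounded_measurable phi ->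
  (forall t, 0 <= t <= h -> `|phi (x + t *: v) - c| <= C) ->
  `|lineint v h phi x - h * c| <= h * C.
Proof.
move=> h0 [mphi [K phiK]] phic.
pose I (t : measurableTypeR R) : R := \1_`]0, h]%classic t.
have mI : measurable_fun setT I by exact: measurable_indic.
have sI : summable_fun lam I by exact: summable_itv.
have iI : \int[lam]_t I t = h by rewrite Rint_itv// subr0.
have mp : measurable_fun setT (fun t : measurableTypeR R => phi (x + t *: v)).
  by apply: measurableT_comp => //; exact: measurable_line1.
have s1 : summable_fun lam (fun t => phi (x + t *: v) * I t).
  by under eq_fun do rewrite mulrC; exact: (summableMb (c := K) mp).
have sc := summableZ c sI; have sC := summableZ C sI.
have -> : lineint v h phi x - h * c = \int[lam]_t (phi (x + t *: v) * I t - c * I t).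
  by rewrite RintB// RintZ// iI mulrC.
rewrite (le_trans (Rint_abs (summableB s1 sc)))// [leRHS]mulrC -iI -RintZ//.
apply: Rint_le => //; first exact/summable_abs/summableB.
move=> t; rewrite -mulrBl normrM /I indicE.
have [/= it|nt] := pselect (`]0, h]%classic t); last by rewrite memNset// normr0 !mulr0.
rewrite mem_set// normr1 !mulr1 phic//; move: it; rewrite in_itv/= => /andP[t0 ->].
by rewrite ltW.
Qed.

Lemma lineint_summable v h g : 0 <= h -> loc_summable g ->
  {ae m, forall x, summable_fun lam (fun t => g (x + t *: v) * \1_`]0, h]%classic t)}.
Proof.
move=> h0 lg.
have H (k : nat) : {ae m, forall x, \1_(cube k%:R) x <> 0 :> R ->
    summable_fun lam (fun t => g (x + t *: v) * \1_`]0, h]%classic t)}.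
  have bI : bounded_measurable (\1_(cube k%:R) : V -> R).
    by apply: bounded_measurable_indic; exact: measurable_cube.
  by have [] := lineint_adjoint v h0 lg bI (cube_supported_indic k).
have := ae_foralln H; apply: filterS => x; have [k kx] := cube_cover x.
by move=> /(_ k); apply; rewrite indicE mem_set//; apply/eqP; rewrite oner_eq0.
Qed.

(** The weak identity is tested with the average of a product [phi] over segments in direction
    [- e_i]. Averaging acts on the factor of index [i] only, and the derivative of the result is
    [phi(x) - phi(x - h e_i)]; transposing both sides leaves the increment of [u] minus the line
    integral of [g], orthogonal to every [phi]. *)
Lemma wder_of_weak i u g : loc_summable u -> loc_summable g ->
  (forall phi, test_function phi ->
     \int[m]_x (u x * partial_derive i phi x) = - \int[m]_x (g x * phi x)) ->
  wder i u g.
Proof.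
move=> lu lg weak; split => // h h0.
have h0' := ltW h0.
have lD : loc_summable (fun x => u (x + h *: e i) - u x - lineint (e i) h g x).
  have := loc_summableD (-1) (loc_summableD (-1) (loc_summable_translate (h *: e i) lu) lu)
    (lineint_loc_summable (e i) h0' lg).
  by congr loc_summable; apply/funext => x; rewrite !mulN1r.
have := @loc_summable_eq0 R n _ lD; move=> /(_ _) H.
suff /H : separating (fun phi => \int[m]_x ((u (x + h *: e i) - u x - lineint (e i) h g x) * phi x) = 0).
  by apply: filterS => x /eqP; rewrite subr_eq0 => /eqP.
move=> F sF [r rF].
have cF j : continuous (F j) := C1d_continuous (sF j 0).
have [P dP] := smooth_primitive (cF i) (rF i).
pose S s := P s - P (s - h).
have dS s : is_derive s (1 : R) S (F i s - F i (s - h)).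
  have d1 : is_derive s (1 : R) (fun s : R => s - h) 1.
    have := is_deriveB (is_derive_id s (1 : R)) (is_derive_cst h s (1 : R)).
    by rewrite subr0.
  have := is_deriveB (dP s) (@is_derive1_comp _ P (fun s : R => s - h) s _ _ (dP (s - h)) d1).
  by rewrite mulr1.
have sS : smooth S.
  case=> [|k]; first exact: is_derive_continuous dS.
  exists (fun s => F i s - F i (s - h)); split => //.
  rewrite (_ : (fun _ => _) = fun s => F i s + (-1) * F i (s + (- h))); last first.
    by apply/funext => s; rewrite mulN1r.
  apply: C1dD; first exact: sF.
  apply: C1dM; first exact: C1d_cst.
  apply: C1d_comp; first exact: sF.
  by apply: C1dD; [exact: C1d_id|exact: C1d_cst].
have rS s : r + h < `|s| -> S s = 0.
  move=> rs; rewrite /S -steklov_primitive//.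
  rewrite (_ : (fun t => _) = fun=> 0); first by rewrite Rintegral_cst// mul0r.
  apply/funext => t; rewrite indicE; case: (boolP (t \in _)) => [/set_mem/=|_]; last by rewrite mulr0.
  rewrite in_itv/= => /andP[/ltW t0 th]; rewrite rF ?mul0r//.
  have : `|s| <= `|s - t| + `|t| by rewrite -[X in `|X| <= _](subrK t) ler_normD.
  by move=> /(lt_le_trans rs); rewrite (ger0_norm t0) -ltrBlDr => /(le_lt_trans _); apply; rewrite lerBrDr lerD.
pose F1 := upd F i S.
have sF1 j : smooth (F1 j) by rewrite /F1 /upd; case: ifP.
have rF1 j s : r + h < `|s| -> F1 j s = 0.
  rewrite /F1 /upd; case: ifP => _; first exact: rS.
  by move=> rs; apply: rF; rewrite (le_lt_trans _ rs)// lerDl.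
have tF1 : test_function (prodf F1) by exact: test_function_prodf sF1 rF1.
have bF : bounded_measurable (prodf F).
  apply: (@bounded_of_cube _ _ _ r); first exact: continuous_prodf.
  move=> x /existsNP[j /negP]; rewrite -ltNge => rx.
  by rewrite /prodf (bigD1 j)//= rF// mul0r.
have suppF : cube_supported (prodf F).
  exists (Num.trunc r).+1 => x /existsNP[j /negP]; rewrite -ltNge => rx.
  by rewrite /prodf (bigD1 j)//= rF ?mul0r// (lt_trans (truncnS_gt r)).
have E1 x : prodf F1 x = lineint (- e i) h (prodf F) x.
  rewrite /lineint.
  rewrite /prodf (bigD1 i)//= {1}/F1 /upd eqxx /S -steklov_primitive//.
  rewrite mulrC -RintZ.
    apply: eq_Rintegral => t _; rewrite mulrA; congr (_ * _).
    have -> : x + t *: - e i = (- t) *: e i + x by rewrite scalerN -scaleNr addrC.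
    apply: etrans (esym (prodf_line F i x (- t))); congr (_ * F i _); last by rewrite addrC.
    by apply: eq_bigr => j /negbTE ji; rewrite /F1 /upd ji.
  have cr := @continuous_reflect R (F i) (x ord0 i) (cF i).
  by move: (summable_segment h cr).
have E2 x : partial_derive i (prodf F1) x = prodf F x - prodf F (x - h *: e i).
  have d1 := @is_derive_prodf _ _ F1 i (fun s => F i s - F i (s - h)) x.
  have [|_] := d1; first by move=> s; rewrite /F1 /upd eqxx; exact: dS.
  rewrite /partial_derive => ->.
  have Ex : x = 0 *: e i + x by rewrite scale0r add0r.
  rewrite -scaleNr [x + _]addrC prodf_line {2}Ex prodf_line add0r -mulrBr [- h + _]addrC.
  rewrite /prodf (bigD1 i)//= mulrC /upd eqxx; congr (_ * _).
  by apply: eq_bigr => j /negbTE ji; rewrite /F1 /upd ji.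
set phi := prodf F in bF suppF E1 E2 *.
have bT : bounded_measurable (fun x : V => phi (x - h *: e i)) by exact: bounded_measurable_translate.
have sT : cube_supported (fun x => phi (x - h *: e i)).
  have [k kP] := suppF; have [j jP] := cube_translate k (- e i) h.
  exists j => x nx; apply: kP => cx; apply: nx; apply: (jP x h); first by rewrite ger0_norm.
  by rewrite scalerN.
have s1 := loc_summableM lu bT sT; have s2 := loc_summableM lu bF suppF.
have [s3 _ A] := lineint_adjoint (e i) h0' lg bF suppF.
have s1' : summable_fun m (fun x => u (x + h *: e i) * phi x).
  have := summable_translate (h *: e i) s1; congr summable_fun.
  by apply/funext => x; rewrite addrK.
have T1 : \int[m]_x (u (x + h *: e i) * phi x) = \int[m]_x (u x * phi (x - h *: e i)).
  by rewrite -(Rint_translate (h *: e i) s1); apply: eq_Rintegral => x _; rewrite addrK.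
have W := weak _ tF1.
have W1 : \int[m]_x (u x * partial_derive i (prodf F1) x) =
    \int[m]_x (u x * phi x) - \int[m]_x (u x * phi (x - h *: e i)).
  by rewrite -RintB//; apply: eq_Rintegral => x _; rewrite E2 mulrBr.
have W2 : \int[m]_x (g x * prodf F1 x) = \int[m]_x (lineint (e i) h g x * phi x).
  by rewrite A; apply: eq_Rintegral => x _; rewrite E1.
transitivity (\int[m]_x (u (x + h *: e i) * phi x - u x * phi x) - \int[m]_x (lineint (e i) h g x * phi x)).
  rewrite -RintB//; last exact: summableB.
  by apply: eq_Rintegral => x _; rewrite !mulrBl.
rewrite RintB// T1 -W2; move: W; rewrite W1 => W.
by lra.
Qed.

(** For the steps [1/(j+1)], the fundamental theorem on lines is transposed onto difference
    quotients and averages of [phi]. These are bounded, because [phi] is Lipschitz along the axis,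
    and converge to its derivative and to [phi]. *)
Lemma weak_of_wder i u g phi : wder i u g -> test_function phi ->
  \int[m]_x (u x * partial_derive i phi x) = - \int[m]_x (g x * phi x).
Proof.
move=> [lu lg ug] tphi.
have [k [bphi bdphi sphi sdphi]] := test_function_bounds i tphi.
have [mphi [C phiC]] := bphi; have [mdphi [C' dphiC]] := bdphi.
have C'0 : 0 <= C' by exact: le_trans (dphiC 0).
have cphi : cube_supported phi by exists k.
pose h j : R := j.+1%:R^-1.
have h0 j : 0 < h j by rewrite invr_gt0 ltr0n.
have h0' j := ltW (h0 j).
have h1 j : h j <= 1 by rewrite invf_le1 ?ltr0n// ler1n.
have hc : h j @[j --> \oo] --> (0 : R) by exact: cvg_harmonic.
(* One cube contains the supports of all translates of [phi] by at most 1, and hence those of all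
   averages. *)
have [K KP] := cube_translate k (- e i) 1.
have bT j : bounded_measurable (fun x : V => phi (x - h j *: e i)) by exact: bounded_measurable_translate.
have nK j x t : ~ cube K%:R x -> 0 <= t <= h j -> phi (x - t *: e i) = 0.
  move=> nx /andP[t0 th]; apply: sphi => cx; apply: nx; apply: (KP x t).
    by rewrite ger0_norm// (le_trans th).
  by rewrite scalerN.
have nK0 x : ~ cube K%:R x -> phi x = 0.
  by move=> nx; rewrite -(nK 0%N x 0 nx) ?scale0r ?subr0// lexx h0'.
have sT j : cube_supported (fun x => phi (x - h j *: e i)).
  by exists K => x nx; apply: (nK j) => //; rewrite h0' lexx.
have lip x t : 0 <= t -> `|phi x - phi (x - t *: e i)| <= C' * t.
  by move=> t0; have := test_function_lipschitz (x - t *: e i) tphi dphiC t0; rewrite subrK.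
have bL j : bounded_measurable (lineint (- e i) (h j) phi).
  split; first by have [] := lineint_loc_summable (- e i) (h0' j) (loc_summable_bounded bphi).
  exists (h j * C) => x; have := @lineint_bound (- e i) (h j) phi 0 C x (h0' j) bphi.
  by rewrite mulr0 subr0; apply => t _; rewrite subr0.
have nL j x : ~ cube K%:R x -> lineint (- e i) (h j) phi x = 0.
  move=> nx; have := @lineint_bound (- e i) (h j) phi 0 0 x (h0' j) bphi.
  rewrite !mulr0 subr0 normr_le0 => H; apply/eqP; apply: H => t th.
  by rewrite scalerN (nK j)// subr0 normr0.
have sL j : cube_supported (lineint (- e i) (h j) phi) by exists K => x; exact: nL.
have E j : \int[m]_x (u x * ((h j)^-1 * (phi x - phi (x - h j *: e i)))) =
    - \int[m]_x (g x * ((h j)^-1 * lineint (- e i) (h j) phi x)).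
  have s1 := loc_summableM lu (bT j) (sT j); have s2 := loc_summableM lu bphi cphi.
  have [s3 _ A] := lineint_adjoint (e i) (h0' j) lg bphi cphi.
  have s1' : summable_fun m (fun x => u (x + h j *: e i) * phi x).
    have := summable_translate (h j *: e i) s1; congr summable_fun.
    by apply/funext => x; rewrite addrK.
  have T1 : \int[m]_x (u (x + h j *: e i) * phi x) = \int[m]_x (u x * phi (x - h j *: e i)).
    by rewrite -(Rint_translate (h j *: e i) s1); apply: eq_Rintegral => x _; rewrite addrK.
  have D : \int[m]_x (u (x + h j *: e i) * phi x - u x * phi x) = \int[m]_x (lineint (e i) (h j) g x * phi x).
    apply: Rint_ae; [by case: (summableB s1' s2)|by case: s3|].
    by apply: filterS (ug _ (h0 j)) => x <-; rewrite mulrBl.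
  transitivity ((h j)^-1 * (\int[m]_x (u x * phi x) - \int[m]_x (u x * phi (x - h j *: e i)))).
    rewrite -RintB// -RintZ; last exact: summableB.
    by apply: eq_Rintegral => x _; ring.
  transitivity (- ((h j)^-1 * \int[m]_x (g x * lineint (- e i) (h j) phi x))).
    by rewrite -A -D RintB// T1 -mulrN opprB.
  congr (- _); rewrite -RintZ; first by apply: eq_Rintegral => x _; ring.
  exact: loc_summableM.
have G1 : summable_fun m (fun x => `|u x| * (C' * \1_(cube K%:R) x)).
  apply: loc_summableM.
  - exact: loc_summable_abs.
  - by apply: bounded_measurableM; [exact: bounded_measurable_cst|apply: bounded_measurable_indic; exact: measurable_cube].
  - exact/cube_supportedMl/cube_supported_indic.
have L1 : \int[m]_x (u x * ((h j)^-1 * (phi x - phi (x - h j *: e i)))) @[j --> \oo] -->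
    \int[m]_x (u x * partial_derive i phi x).
  have [||||_ _] := @Rint_dominated _ _ _ m (fun j x => u x * ((h j)^-1 * (phi x - phi (x - h j *: e i))))
    (fun x => u x * partial_derive i phi x) _ _ _ _ G1.
  - move=> j; apply: measurable_funM; first by case: lu.
    by apply: measurable_funM => //; apply: measurable_funB => //; case: (bT j).
  - by apply: measurable_funM => //; case: lu.
  - apply: aeW => x; apply: cvgMr.
    have hN : (- h j) @[j --> \oo] --> (0 : R) by rewrite -oppr0; exact: cvgN.
    have hN0 j : - h j != 0 by rewrite oppr_eq0 gt_eqF.
    have := @test_function_line_cvg R n phi i x _ tphi hN0 hN.
    suff -> : (fun j => (- h j)^-1 * (phi (x + - h j *: e i) - phi x)) =
        (fun j => (h j)^-1 * (phi x - phi (x - h j *: e i))) by [].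
    by apply/funext => j; rewrite scaleNr invrN mulNr -mulrN opprB.
  - move=> j x; rewrite normrM ler_wpM2l//.
    have [cx|nx] := pselect (cube K%:R x).
      rewrite indicE mem_set// mulr1 normrM normfV (gtr0_norm (h0 j)) ler_pdivrMl// mulrC.
      exact: lip.
    rewrite nK0// (nK j)//; last by rewrite h0' lexx.
    by rewrite subrr mulr0 normr0 mulr_ge0.
  - by [].
have L2 : (- \int[m]_x (g x * ((h j)^-1 * lineint (- e i) (h j) phi x))) @[j --> \oo] -->
    - \int[m]_x (g x * phi x).
  have G2 : summable_fun m (fun x => `|g x| * (C * \1_(cube K%:R) x)).
    apply: loc_summableM.
    - exact: loc_summable_abs.
    - by apply: bounded_measurableM; [exact: bounded_measurable_cst|apply: bounded_measurable_indic; exact: measurable_cube].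
    - exact/cube_supportedMl/cube_supported_indic.
  apply: cvgN.
  have [||||_ _] := @Rint_dominated _ _ _ m (fun j x => g x * ((h j)^-1 * lineint (- e i) (h j) phi x))
    (fun x => g x * phi x) _ _ _ _ G2.
  - move=> j; apply: measurable_funM; first by case: lg.
    by apply: measurable_funM => //; case: (bL j).
  - by apply: measurable_funM => //; case: lg.
  - apply: aeW => x; apply: cvgMr; apply/cvgrPdist_le => ep ep0.
    have /cvgr0_norm_le : C' * h j @[j --> \oo] --> (0 : R) by rewrite -(mulr0 C'); exact: cvgMr.
    move=> /(_ _ ep0); apply: filterS => j hj.
    have := @lineint_bound (- e i) (h j) phi (phi x) (C' * h j) x (h0' j) bphi.
    have H t : 0 <= t <= h j -> `|phi (x + t *: - e i) - phi x| <= C' * h j.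
      move=> /andP[t0 th]; rewrite distrC scalerN (le_trans (lip x t t0))// ler_wpM2l//.
    move=> /(_ H) B; rewrite distrC -[phi x](mulKf (lt0r_neq0 (h0 j))) -mulrBr.
    rewrite normrM normfV (gtr0_norm (h0 j)) ler_pdivrMl// (le_trans B)// ler_wpM2l//.
    exact: le_trans (ler_norm _) hj.
  - move=> j x; rewrite normrM ler_wpM2l//.
    have [cx|nx] := pselect (cube K%:R x); last first.
      by rewrite nL// mulr0 normr0 indicE memNset// mulr0.
    rewrite indicE mem_set// mulr1 normrM normfV (gtr0_norm (h0 j)) ler_pdivrMl//.
    have := @lineint_bound (- e i) (h j) phi 0 C x (h0' j) bphi.
    by rewrite mulr0 subr0; apply => t _; rewrite subr0.
  - by [].
rewrite (_ : (fun j => \int[m]_x (u x * _)) = (fun j => - \int[m]_x (g x * ((h j)^-1 * lineint (- e i) (h j) phi x)))) in L1; last first.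
  by apply/funext => j; exact: E.
exact: (cvg_unique (@Rhausdorff R) L1 L2).
Qed.

End weak_derivative.

(** * Chain rule for bounded Borel derivatives *)

Section quadratic_increment.
Variable R : realType.
Local Notation lam := (@lebesgue_measure R).

(* Splitting [0, h] at points where the continuous function Ga takes equally spaced values
   makes the sum of the squared increments of Ga arbitrarily small. *)
Lemma quadratic_increment (Phi Ga : R -> R) (h C : R) : 0 <= h ->
  {within `[0, h], continuous Ga} ->
  (forall s t, 0 <= s <= h -> 0 <= t <= h -> `|Phi t - Phi s| <= C * (Ga t - Ga s) ^+ 2) ->
  Phi h = Phi 0.
Proof.
move=> h0 cG PG.
have C0 : 0 <= C \/ Ga h = Ga 0.
  have := PG 0 h; rewrite !lexx h0 => /(_ isT isT) H.
  have [->|ne] := eqVneq (Ga h) (Ga 0); [by right|left].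
  rewrite -(pmulr_lge0 _ (_ : 0 < (Ga h - Ga 0) ^+ 2)); first exact: le_trans H.
  by rewrite lt_neqAle sqr_ge0 eq_sym sqrf_eq0 subr_eq0 ne.
have H0 := PG 0 h; rewrite !lexx h0 in H0; have {}H0 := H0 isT isT.
case: C0 => [C0|E]; last first.
  move: H0; rewrite E subrr expr0n mulr0 normr_le0 subr_eq0 => /eqP //.
set d := Ga h - Ga 0 in H0.
have H (N : nat) : `|Phi h - Phi 0| <= C * d ^+ 2 / N.+1%:R.
  pose y (k : nat) := Ga 0 + k%:R / N.+1%:R * d.
  have yb (k : nat) : (k <= N.+1)%N -> Num.min (Ga 0) (Ga h) <= y k <= Num.max (Ga 0) (Ga h).
    move=> kN; have q0 : 0 <= k%:R / N.+1%:R :> R by rewrite divr_ge0.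
    have q1 : k%:R / N.+1%:R <= 1 :> R by rewrite ler_pdivrMr ?ltr0n// mul1r ler_nat.
    rewrite /y /d; set q := _ / _ in q0 q1 *.
    have q1' : 0 <= 1 - q by rewrite subr_ge0.
    have [G|/ltW G] := leP (Ga 0) (Ga h).
      have G' : 0 <= Ga h - Ga 0 by rewrite subr_ge0.
      by have := mulr_ge0 q0 G'; have := mulr_ge0 q1' G'; lra.
    have G' : 0 <= Ga 0 - Ga h by rewrite subr_ge0.
    by have := mulr_ge0 q0 G'; have := mulr_ge0 q1' G'; lra.
  have ex (k : nat) : exists t, [/\ 0 <= t <= h, ((k <= N.+1)%N -> Ga t = y k),
      (k = 0%N -> t = 0) & (k = N.+1 -> t = h)].
    have [->|k0] := eqVneq k 0%N.
      by exists 0; split => //; rewrite ?lexx// => _; rewrite /y mul0r mul0r addr0.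
    have [->|kN1] := eqVneq k N.+1.
      exists h; split; [by rewrite h0 lexx| |by []|by []].
      by move=> _; rewrite /y divff ?pnatr_eq0// mul1r /d addrC subrK.
    have [kN|kN] := leqP k N.+1; last first.
      by exists 0; split => //; [rewrite lexx| move=> E; rewrite E eqxx in kN1].
    have [c] := IVT h0 cG (yb k kN); rewrite in_itv/= => c0h Gc.
    by exists c; split => // E; [rewrite E eqxx in k0|rewrite E eqxx in kN1].
  have [t tP] := choice ex.
  have step k : (k <= N.+1)%N -> `|Phi (t k) - Phi 0| <= k%:R * (C * (d / N.+1%:R) ^+ 2).
    elim: k => [|k IH] kN; first by have [_ _ -> // _] := tP 0%N; rewrite subrr normr0 mul0r.
    have := IH (ltnW kN); have [tk Gk _ _] := tP k; have [tk1 Gk1 _ _] := tP k.+1.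
    have := PG _ _ tk tk1; rewrite (Gk (ltnW kN)) (Gk1 kN).
    have -> : y k.+1 - y k = d / N.+1%:R by rewrite /y -[k.+1%:R]natr1; field.
    move=> A B; have -> : Phi (t k.+1) - Phi 0 = (Phi (t k.+1) - Phi (t k)) + (Phi (t k) - Phi 0) by ring.
    by rewrite (le_trans (ler_normD _ _))// -natr1 mulrDl mul1r addrC lerD.
  have := step N.+1 (leqnn _); have [_ _ _ ->//] := tP N.+1.
  by move/le_trans; apply; rewrite le_eqVlt; apply/orP; left; apply/eqP; field.
apply/eqP; rewrite -subr_eq0 -normr_le0.
have L : C * d ^+ 2 / N.+1%:R @[N --> \oo] --> (0 : R).
  by rewrite -(mulr0 (C * d ^+ 2)); apply: cvgMr; exact: cvg_harmonic.
by apply: (ler_cvg_to (cvg_cst _) L); exact: nearW.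
Qed.

Lemma measurable_interval_indic : measurable_fun setT
  (fun p : measurableTypeR R * measurableTypeR R => \1_`]0, p.1]%classic p.2 : R).
Proof.
rewrite (_ : (fun _ => _) = \1_([set p : measurableTypeR R * measurableTypeR R | 0 < p.2] `&`
   [set p | p.2 <= p.1])).
  apply: measurable_indic; apply: measurableI.
    by apply: measurable_lt_set => //; exact: measurable_snd.
  by apply: measurable_le_set; [exact: measurable_snd|exact: measurable_fst].
apply/funext => -[s t] /=; rewrite !indicE; congr (nat_of_bool _)%:R.
by apply/idP/idP => /set_mem h; apply/mem_set; move: h; rewrite /= in_itv/= => /andP.
Qed.

(** The defect between [F(v t)] and the integral of [D(v) q] varies from [s] to [t] by at most [2 L]
    times the square of the increment of the integral of [|q|]: one [L] comes from the Taylor bound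
    on [F], the other from freezing [D(v)] at [s]. A function with quadratically small increments is
    constant. *)
Lemma chain_line (q : R -> R) (c h L : R) (F D : R -> R) (v := fun t => c + \int[lam]_s (q s * \1_`]0, t]%classic s)) :
  0 <= h -> summable_fun lam q -> bounded_measurable D -> 0 <= L ->
  (forall a b, `|D b - D a| <= L * `|b - a|) ->
  (forall a b, `|F b - F a - D a * (b - a)| <= L * (b - a) ^+ 2) ->
  F (v h) - F c = \int[lam]_t (D (v t) * q t * \1_`]0, h]%classic t).
Proof.
move=> h0 sq bD L0 LD LF.
have mv : measurable_fun setT v.
  apply: measurable_funD => //.
  apply: (@measurable_Rint _ _ _ _ R lam (fun p : measurableTypeR R * measurableTypeR R =>
    q p.2 * \1_`]0, p.1]%classic p.2)).
  apply: measurable_funM; last exact: measurable_interval_indic.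
  by apply: measurableT_comp; [case: sq|exact: measurable_snd].
have mI (a b : R) : measurable_fun setT (\1_`]a, b]%classic : measurableTypeR R -> R).
  by apply: measurable_indic; exact: measurable_itv.
have sI f (a b : R) : summable_fun lam f -> summable_fun lam (fun t => f t * \1_`]a, b]%classic t).
  move=> sf; apply: (@summableMb _ _ _ _ 1) => // t.
  by rewrite indicE ger0_norm// lern1 leq_b1.
have split_ f (s t : R) : summable_fun lam f -> 0 <= s <= t ->
    \int[lam]_r (f r * \1_`]0, t]%classic r) - \int[lam]_r (f r * \1_`]0, s]%classic r) =
    \int[lam]_r (f r * \1_`]s, t]%classic r).
  move=> sf /andP[s0 st]; rewrite -RintB; [|exact: sI|exact: sI].
  apply: eq_Rintegral => r _; rewrite -mulrBr; congr (_ * _); rewrite !indicE.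
  have E (a b : R) : (r \in `]a, b]%classic) = (a < r <= b).
    by apply/idP/idP => [/set_mem/=|h']; [rewrite in_itv|apply/mem_set; rewrite /= in_itv].
  rewrite !E; have [r0|r0] := ltP 0 r => /=.
    have [rs|rs] := leP r s => /=; last by rewrite subr0.
    by rewrite (le_trans rs st) subrr.
  by rewrite (ltNge s) (le_trans r0 s0) subrr.
pose Dv t := D (v t) * q t.
have mDv : measurable_fun setT (fun t => D (v t)) by apply: measurableT_comp; [case: bD|].
have sDv : summable_fun lam Dv.
  have [_ [C DC]] := bD; rewrite (_ : Dv = fun t => q t * D (v t)); last first.
    by apply/funext => t; rewrite mulrC.
  by apply: (@summableMb _ _ _ _ C).
pose aq t := `|q t|; have saq : summable_fun lam aq by exact: summable_abs.
pose Ga t := \int[lam]_s (aq s * \1_`]0, t]%classic s).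
pose Phi t := F (v t) - \int[lam]_s (Dv s * \1_`]0, t]%classic s).
have int0 f : \int[lam]_s (f s * \1_`]0, (0 : R)]%classic s) = 0.
  under eq_Rintegral => s _.
    rewrite indicE memNset; last by rewrite /= in_itv/= => /andP[a b]; have := lt_le_trans a b; rewrite ltxx.
    rewrite mulr0; over.
  by rewrite Rintegral_cst// mul0r.
have vB s t : 0 <= s <= t -> v t - v s = \int[lam]_r (q r * \1_`]s, t]%classic r).
  by move=> st; rewrite -split_// /v; ring.
have GB s t : 0 <= s <= t -> Ga t - Ga s = \int[lam]_r (aq r * \1_`]s, t]%classic r).
  by move=> st; rewrite -split_.
have GBge s t : 0 <= s <= t -> 0 <= Ga t - Ga s.
  by move=> st; rewrite GB//; apply: Rintegral_ge0 => r _; rewrite /aq mulr_ge0.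
have vG s t : 0 <= s <= t -> `|v t - v s| <= Ga t - Ga s.
  move=> st; rewrite vB// GB//; have s1 := sI q s t sq.
  rewrite (le_trans (Rint_abs s1))//; apply: Rint_le; [exact: summable_abs|exact: sI|].
  by move=> r; rewrite normrM [`|\1__ _|]ger0_norm.
have key s t : 0 <= s <= t -> `|Phi t - Phi s| <= (2 * L) * (Ga t - Ga s) ^+ 2.
  move=> st; have G0 := GBge _ _ st.
  have E : Phi t - Phi s = (F (v t) - F (v s) - D (v s) * (v t - v s)) -
      \int[lam]_r ((Dv r - D (v s) * q r) * \1_`]s, t]%classic r).
    have sDq : summable_fun lam (fun r => D (v s) * q r) by exact: summableZ.
    transitivity (F (v t) - F (v s) - \int[lam]_r (Dv r * \1_`]s, t]%classic r)).
      by rewrite -split_// /Phi; ring.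
    rewrite vB// -RintZ; last exact: sI.
    have -> : \int[lam]_r ((Dv r - D (v s) * q r) * \1_`]s, t]%classic r) =
       \int[lam]_r (Dv r * \1_`]s, t]%classic r) - \int[lam]_r (D (v s) * (q r * \1_`]s, t]%classic r)).
      rewrite -RintB; [|exact: sI|by apply: summableZ; exact: sI].
      by apply: eq_Rintegral => r _; ring.
    by ring.
  rewrite E (le_trans (ler_normB _ _))//.
  have -> : 2 * L * (Ga t - Ga s) ^+ 2 = L * (Ga t - Ga s) ^+ 2 + L * (Ga t - Ga s) * (Ga t - Ga s) by ring.
  apply: lerD.
    rewrite (le_trans (LF _ _))// ler_wpM2l// -[leLHS]real_normK ?num_real// lerXn2r ?nnegrE//.
    exact: vG.
  have s1 : summable_fun lam (fun r => (Dv r - D (v s) * q r) * \1_`]s, t]%classic r).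
    exact: (sI _ _ _ (summableB sDv (summableZ (D (v s)) sq))).
  rewrite (le_trans (Rint_abs s1))// [X in _ <= _ * X](GB _ _ st) -RintZ; last exact: sI.
  apply: Rint_le; [exact: summable_abs|by apply: summableZ; exact: sI|].
  move=> r; rewrite indicE; have [/= |nr] := pselect (`]s, t]%classic r); last first.
    by rewrite memNset// !mulr0 normr0.
  rewrite in_itv/= => /andP[sr rt]; rewrite mem_set ?mulr1; last by rewrite /= in_itv/= sr.
  have [s0 _] := andP st.
  rewrite /Dv -mulrBl normrM ler_wpM2r// (le_trans (LD _ _))// ler_wpM2l//.
  rewrite (le_trans (vG s r _))//; first by rewrite s0 ltW.
  have := GBge r t; rewrite rt (le_trans s0 (ltW sr)) => /(_ isT); lra.
have cG : {within `[0, h], continuous Ga}.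
  have ih : lam.-integrable `[0, h]%classic (EFin \o aq).
    by apply: (@integrableS _ _ _ _ setT) => //; exact: summable_integrable1.
  have := @parameterized_integral_continuous R 0 h aq h0 ih.
  suff -> : parameterized_integral lam 0 ^~ aq = Ga by [].
  apply/funext => t; rewrite /parameterized_integral -Rintegral_itv_obnd_cbnd.
    rewrite Rintegral_mkcond; apply: eq_Rintegral => r _; rewrite patchE /= indicE.
    by case: ifP => _; rewrite ?mulr1 ?mulr0.
  by apply: (@integrableS _ _ _ _ setT) => //; exact: summable_integrable1.
have : Phi h = Phi 0.
  apply: (@quadratic_increment Phi Ga h (2 * L) h0 cG) => s t /andP[s0 sh] /andP[t0 th].
  have [st|ts] := leP s t; first by apply: key; rewrite s0.
  have := key t s; rewrite t0 (ltW ts) => /(_ isT); rewrite distrC => /le_trans -> //.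
  by suff -> : (Ga s - Ga t) ^+ 2 = (Ga t - Ga s) ^+ 2 by []; ring.
rewrite /Phi int0 subr0 [X in _ = F X](_ : _ = c); last by rewrite /v int0 addr0.
by move=> <-; rewrite opprB addrC subrK.
Qed.

End quadratic_increment.

Section primitive.
Variable R : realType.
Local Notation lam := (@lebesgue_measure R).
Implicit Types (D : R -> R) (a b s : R).

(** The oriented indicator of the interval from 0 to [s], which makes [prim D] a primitive on both
    half-lines. *)
Definition kern s (t : measurableTypeR R) : R := \1_`]0, s]%classic t - \1_`]s, 0]%classic t.

Definition prim D s : R := \int[lam]_t (D t * kern s t).

Definition locally_bounded D := measurable_fun setT D /\
  forall r : R, exists C : R, forall s, `|s| <= r -> `|D s| <= C.

Lemma locally_bounded_summable D a b : locally_bounded D ->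
  summable_fun lam (fun t => D t * \1_`]a, b]%classic t).
Proof.
move=> [mD bD]; have [C DC] := bD (`|a| + `|b|).
apply: (@summable_le _ _ _ _ _ (fun t : measurableTypeR R => C * \1_`]a, b]%classic t)).
- by apply: measurable_funM => //; apply: measurable_indic; exact: measurable_itv.
- move=> t; rewrite normrM indic_itv_oc; have [/andP[h1 h2]|_] := boolP (a < t <= b); last by rewrite normr0 !mulr0.
  rewrite normr1 !mulr1 DC// ler_norml.
  have := ler_norm b; have := ler_norm (- a); rewrite normrN.
  by have := normr_ge0 a; have := normr_ge0 b; lra.
- exact/summableZ/summable_itv.
Qed.

Lemma kern_summable D s : locally_bounded D -> summable_fun lam (fun t => D t * kern s t).
Proof.
move=> bD; have := summableB (locally_bounded_summable 0 s bD) (locally_bounded_summable s 0 bD).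
by congr summable_fun; apply/funext => t; rewrite -mulrBr.
Qed.

Lemma bounded_locally_bounded D : bounded_measurable D -> locally_bounded D.
Proof. by move=> [mD [C DC]]; split => // r; exists C. Qed.

Lemma primB D a b : locally_bounded D -> a <= b ->
  prim D b - prim D a = \int[lam]_t (D t * \1_`]a, b]%classic t).
Proof.
move=> bD ab; rewrite -RintB; [|exact: kern_summable|exact: kern_summable].
apply: eq_Rintegral => t _; rewrite -mulrBr; congr (_ * _); rewrite /kern !indic_itv_oc.
have [t0|t0] := ltP 0 t; have [ta|ta] := leP t a; have [tb|tb] := leP t b => /=;
  rewrite ?subrr ?subr0 ?sub0r ?opprK ?add0r ?addr0 //; exfalso; lra.
Qed.

Lemma prim0 D : prim D 0 = 0.
Proof.
rewrite /prim; under eq_Rintegral do rewrite /kern subrr mulr0.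
by rewrite Rintegral_cst// mul0r.
Qed.

Lemma prim_bound D a b (C : R) : locally_bounded D -> (forall t, `|D t| <= C) ->
  `|prim D b - prim D a| <= C * `|b - a|.
Proof.
move=> bD DC; wlog ab : a b / a <= b.
  move=> H; have [/H//|/ltW/H] := leP a b.
  by rewrite distrC [`|a - b|]distrC.
rewrite primB// [`|b - a|]ger0_norm ?subr_ge0// -(Rint_itv ab) -RintZ; last exact: summable_itv.
have s1 := locally_bounded_summable a b bD.
rewrite (le_trans (Rint_abs s1))//; apply: Rint_le; [exact: summable_abs|exact/summableZ/summable_itv|].
by move=> t; rewrite normrM [`|\1__ _|]ger0_norm// ler_wpM2r.
Qed.

Lemma prim_continuous_bound D (s C : R) : bounded_measurable D -> (forall t, `|D t| <= C) ->
  `|prim D s| <= C * `|s|.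
Proof.
move=> bD DC; have := @prim_bound D 0 s C (bounded_locally_bounded bD) DC.
by rewrite prim0 !subr0.
Qed.

Lemma primD D1 D2 (c : R) : bounded_measurable D1 -> bounded_measurable D2 ->
  prim (fun t => D1 t + c * D2 t) = fun s => prim D1 s + c * prim D2 s.
Proof.
move=> b1 b2; apply/funext => s.
have k1 := kern_summable s (bounded_locally_bounded b1).
have k2 := kern_summable s (bounded_locally_bounded b2).
rewrite /prim -RintZ// -RintD//; last exact: summableZ.
by apply: eq_Rintegral => t _; ring.
Qed.

Lemma prim_cvg (D_ : nat -> R -> R) D (C : R) s :
  (forall k, bounded_measurable (D_ k)) -> bounded_measurable D ->
  (forall k t, `|D_ k t| <= C) -> (forall t, D_ k t @[k --> \oo] --> D t) ->
  prim (D_ k) s @[k --> \oo] --> prim D s.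
Proof.
move=> bD_ bD DC cD.
have sC : summable_fun lam (fun t => C * `|kern s t|).
  apply/summableZ/summable_abs.
  exact: (summableB (summable_itv 0 s) (summable_itv s 0)).
have mk : measurable_fun setT (kern s).
  by have [] := summableB (summable_itv 0 s) (summable_itv s 0).
have [||||_ _] := @Rint_dominated _ _ _ lam (fun k t => D_ k t * kern s t) (fun t => D t * kern s t) _ _ _ _ sC.
- by move=> k; apply: measurable_funM => //; case: (bD_ k).
- by apply: measurable_funM => //; case: bD.
- by apply: aeW => t; apply: cvgMl.
- by move=> k t; rewrite normrM ler_wpM2r.
- by [].
Qed.

Lemma prim_taylor D (L a b : R) : bounded_measurable D -> 0 <= L ->
  (forall s t, `|D t - D s| <= L * `|t - s|) ->
  `|prim D b - prim D a - D a * (b - a)| <= L * (b - a) ^+ 2.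
Proof.
move=> bD L0 LD; have lbD := bounded_locally_bounded bD.
have gen (c x y : R) : x <= y -> (forall t, x < t <= y -> `|D t - c| <= L * (y - x)) ->
    `|prim D y - prim D x - c * (y - x)| <= L * (y - x) ^+ 2.
  move=> xy H; rewrite primB// -(Rint_itv xy) -RintZ; last exact: summable_itv.
  have s1 := locally_bounded_summable x y lbD; have s2 := summableZ c (summable_itv x y).
  rewrite -RintB// (le_trans (Rint_abs (summableB s1 s2)))//.
  rewrite Rint_itv// expr2 mulrA -[X in _ <= _ * X](Rint_itv xy) -RintZ; last exact: summable_itv.
  apply: Rint_le; [exact/summable_abs/summableB|exact/summableZ/summable_itv|].
  move=> t; rewrite -mulrBl normrM [`|\1__ _|]ger0_norm// indic_itv_oc.
  by have [xt|_] := boolP (x < t <= y); rewrite ?mulr0// !mulr1 H.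
have [ab|/ltW ba] := leP a b.
  apply: gen => // t /andP[t1 t2]; rewrite (le_trans (LD _ _))// ler_wpM2l//.
  by rewrite ger0_norm; lra.
rewrite -normrN -sqrrN.
have -> : - (b - a) = a - b by ring.
have -> : - (prim D b - prim D a - D a * (b - a)) = prim D a - prim D b - D a * (a - b) by ring.
apply: gen => // t /andP[t1 t2]; rewrite (le_trans (LD _ _))// ler_wpM2l//.
by rewrite ler0_norm; lra.
Qed.

End primitive.

Section composition.
Context {R : realType} {n : nat}.
Local Notation V := 'rV[R]_n.
Local Notation m := (borel_lebesgue R n).
Local Notation lam := (@lebesgue_measure R).
Local Notation e i := (delta_mx ord0 i : V).
Implicit Types (u g w phi : V -> R) (i : 'I_n) (D : R -> R).

Lemma wder_comb i u1 g1 u2 g2 (c : R) : wder i u1 g1 -> wder i u2 g2 ->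
  wder i (fun x => u1 x + c * u2 x) (fun x => g1 x + c * g2 x).
Proof.
move=> [lu1 lg1 E1] [lu2 lg2 E2]; split; [exact: loc_summableD|exact: loc_summableD|].
move=> h h0; have s1 := lineint_summable (e i) (ltW h0) lg1; have s2 := lineint_summable (e i) (ltW h0) lg2.
move: (E1 h h0) (E2 h h0) => A1 A2.
apply: filterS2 (filterI s1 s2) (filterI A1 A2) => x [t1 t2] [a1 a2].
rewrite /lineint.
transitivity (lineint (e i) h g1 x + c * lineint (e i) h g2 x); first by rewrite -a1 -a2; ring.
rewrite /lineint -RintZ// -RintD//; last exact: summableZ.
by apply: eq_Rintegral => t _; ring.
Qed.

(** Convergence holds at every point, so dominated convergence applies on each line along which the
    majorant [G] is summable, and these are almost all lines. *)
Lemma wder_cvg i (u_ g_ : nat -> V -> R) u g U G : (forall k, wder i (u_ k) (g_ k)) ->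
  measurable_fun setT u -> measurable_fun setT g -> loc_summable U -> loc_summable G ->
  (forall k x, `|u_ k x| <= U x) -> (forall k x, `|g_ k x| <= G x) ->
  (forall x, u_ k x @[k --> \oo] --> u x) -> (forall x, g_ k x @[k --> \oo] --> g x) ->
  wder i u g.
Proof.
move=> wu mu mg lU lG uU gG cu cg.
have lim_le (a : nat -> R) (l b : R) : (forall k, `|a k| <= b) -> a k @[k --> \oo] --> l -> `|l| <= b.
  move=> ab al; rewrite -(cvg_lim (@Rhausdorff R) (cvg_norm al)); apply: limr_le.
    exact: cvgP (cvg_norm al).
  exact: nearW.
split.
- by apply: (loc_summable_le mu _ lU) => x; exact: lim_le (cu x).
- by apply: (loc_summable_le mg _ lG) => x; exact: lim_le (cg x).
move=> h h0; have sG := lineint_summable (e i) (ltW h0) lG.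
have A k : {ae m, forall x, u_ k (x + h *: e i) - u_ k x = lineint (e i) h (g_ k) x}.
  by have [_ _] := wu k; exact.
apply: filterS2 sG (ae_foralln A) => x sx ax.
have L1 : u_ k (x + h *: e i) - u_ k x @[k --> \oo] --> u (x + h *: e i) - u x.
  by apply: cvgB; exact: cu.
have L2 : lineint (e i) h (g_ k) x @[k --> \oo] --> lineint (e i) h g x.
  have [||||_ _] := @Rint_dominated _ _ _ lam (fun k t => g_ k (x + t *: e i) * \1_`]0, h]%classic t)
    (fun t => g (x + t *: e i) * \1_`]0, h]%classic t) _ _ _ _ sx.
  - move=> k; apply: measurable_funM => //.
    apply: measurableT_comp; last exact: measurable_line1.
    by have [_ []] := wu k.
  - by apply: measurable_funM => //; apply: measurableT_comp => //; exact: measurable_line1.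
  - by apply: aeW => t; apply: cvgMl; exact: cg.
  - by move=> k t; rewrite normrM [`|\1__ _|]ger0_norm// ler_wpM2r.
  - by [].
rewrite (_ : (fun k => u_ k (x + h *: e i) - u_ k x) = (fun k => lineint (e i) h (g_ k) x)) in L1.
  exact: (cvg_unique (@Rhausdorff R) L1 L2).
by apply/funext => k; exact: ax.
Qed.

End composition.

Section nonnegative_integrals.
Local Open Scope ereal_scope.
Context d (T : measurableType d) (R : realType) (mu : {measure set T -> \bar R}).
Implicit Types (f g : T -> \bar R).

Lemma ge0_le_integralT f g : measurable_fun setT f -> measurable_fun setT g ->
  (forall x, 0 <= f x) -> (forall x, f x <= g x) -> \int[mu]_x f x <= \int[mu]_x g x.
Proof. by move=> mf mg f0 fg; apply: ge0_le_integral. Qed.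

Lemma integral_indicT (A : set T) : measurable A -> \int[mu]_x (\1_A x)%:E = mu A.
Proof. by move=> mA; rewrite integral_indic// setIT. Qed.

Lemma ge0_integralZlT (k : \bar R) f : measurable_fun setT f -> (forall x, 0 <= f x) -> 0 <= k ->
  \int[mu]_x (k * f x) = k * \int[mu]_x f x.
Proof. by move=> mf f0 k0; rewrite ge0_integralZl. Qed.

Lemma measurable_EFin_indic (A : set T) : measurable A -> measurable_fun setT (fun x => (\1_A x : R)%:E).
Proof. by move=> mA; apply/measurable_EFinP; exact: measurable_indic. Qed.

Lemma ge0_integral_mkindic (A : set T) f : \int[mu]_(x in A) f x = \int[mu]_x ((\1_A x)%:E * f x).
Proof.
rewrite integral_mkcond; apply: eq_integral => x _; rewrite patchE indicE.
by case: ifP => _; rewrite ?mul1e ?mul0e.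
Qed.

Lemma lee_mul_cancel (x I : \bar R) (l P Q c : R) : (0 < l)%R -> (P * Q = c * l)%R ->
  x * l%:E <= P%:E * Q%:E * I -> x <= c%:E * I.
Proof.
move=> l0 PQ H; rewrite -(@lee_pmul2r _ l%:E) ?lte_fin//; apply: (le_trans H).
by rewrite -EFinM -muleA [(I * _)]muleC muleA -EFinM PQ.
Qed.

Lemma measure_setD_ge (A B : set T) (c : R) : measurable A -> measurable B ->
  (c + c)%:E <= mu A -> mu B <= c%:E -> c%:E <= mu (A `\` B).
Proof.
move=> mA mB cA Bc.
have : mu A <= mu (A `\` B) + c%:E.
  rewrite -[A in mu A](setUIDK A B) (le_trans (measureU2 _ _ _))//.
  - exact: measurableI.
  - exact: measurableD.
  rewrite addeC leeD2l// (le_trans _ Bc)// le_measure ?inE//; exact: measurableI.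
by move=> /(le_trans cA); rewrite EFinD leeD2rE.
Qed.

End nonnegative_integrals.

Section chain_rule.
Context {R : realType} {n : nat}.
Local Notation V := 'rV[R]_n.
Local Notation m := (borel_lebesgue R n).
Local Notation lam := (@lebesgue_measure R).
Local Notation e i := (delta_mx ord0 i : V).
Implicit Types (u g w phi : V -> R) (i : 'I_n) (D : R -> R).

Lemma measurable_lineint_joint v g : measurable_fun setT g ->
  measurable_fun setT (fun p : V * measurableTypeR R => lineint v p.2 g p.1).
Proof.
move=> mg.
apply: (@measurable_Rint _ _ _ _ R lam (fun q : (V * measurableTypeR R) * measurableTypeR R =>
  g (q.1.1 + q.2 *: v) * \1_`]0, q.1.2]%classic q.2)).
have m1 : measurable_fun setT (fun q : (V * measurableTypeR R) * measurableTypeR R => q.1.1).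
  by apply: (measurableT_comp measurable_fst); exact: measurable_fst.
have m2 : measurable_fun setT (fun q : (V * measurableTypeR R) * measurableTypeR R => q.1.2).
  by apply: (measurableT_comp measurable_snd); exact: measurable_fst.
apply: measurable_funM.
  apply: measurableT_comp => //.
  apply: (@measurableT_comp _ _ _ _ _ _ (fun p : V * measurableTypeR R => p.1 + p.2 *: v) _
    (fun q : (V * measurableTypeR R) * measurableTypeR R => (q.1.1, q.2))).
    exact: measurable_line.
  by apply: measurable_fun_pair => //; exact: measurable_snd.
apply: (@measurableT_comp _ _ _ _ _ _ (fun p : measurableTypeR R * measurableTypeR R =>
  \1_`]0, p.1]%classic p.2 : R) _ (fun q : (V * measurableTypeR R) * measurableTypeR R => (q.1.2, q.2))).
  exact: measurable_interval_indic.
by apply: measurable_fun_pair => //; exact: measurable_snd.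
Qed.

(** The exceptional null set in [wder] depends on the step [h]. Tonelli exchanges the two variables:
    for almost every base point the identity holds for almost every step, which is enough under an
    integral in the step. *)
Lemma wder_line_ae i u g : wder i u g -> {ae m, forall x, {ae lam, forall t : measurableTypeR R,
  0 < t -> u (x + t *: e i) - u x = lineint (e i) t g x}}.
Proof.
move=> [[mu _] [mg _] ug].
pose f (p : V * measurableTypeR R) : \bar R :=
  (`|u (p.1 + p.2 *: e i) - u p.1 - lineint (e i) p.2 g p.1| * \1_[set t : R | 0 < t] p.2)%:E.
have mf : measurable_fun setT f.
  apply/measurable_EFinP; apply: measurable_funM.
    apply: measurableT_comp => //; apply: measurable_funB.
      apply: measurable_funB; first by apply: measurableT_comp => //; exact: measurable_line.
      by apply: measurableT_comp => //; exact: measurable_fst.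
    exact: measurable_lineint_joint.
  apply: measurableT_comp; last exact: measurable_snd.
  by apply: measurable_indic; exact: measurable_lt_set.
have f0 p : (0 <= f p)%E by rewrite lee_fin mulr_ge0.
have FT := @fubini_tonelli _ _ _ _ R m lam f mf f0.
have z : (\int[m]_x \int[lam]_t f (x, t) = 0)%E.
  rewrite FT integral0_eq// => t _; have [t0|t0] := ltP 0 t; last first.
    rewrite integral0_eq// => x _; rewrite /f/= indicE memNset ?mulr0//=.
    by apply/negP; rewrite -leNgt.
  have mft : measurable_fun setT (fun x => f (x, t)) by exact: measurableT_comp mf (pair2_measurable _).
  rewrite (@ae_eq_integral _ _ _ m _ (cst 0%E))//; first by rewrite integral0.
  apply: filterS (ug t t0) => x E _ /=.
  by rewrite /f/= E subrr normr0 mul0r.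
have mF : measurable_fun setT (fun x => \int[lam]_t f (x, t))%E.
  exact: (@measurable_fun_fubini_tonelli_F _ _ _ _ R lam f mf f0).
have /(ae_eq_integral_abs m measurableT mF) : (\int[m]_x `|\int[lam]_t f (x, t)| = 0)%E.
  by rewrite -[RHS]z; apply: eq_integral => x _; rewrite gee0_abs// integral_ge0.
apply: filterS => x /(_ I) /= fx.
have mfx : measurable_fun setT (fun t => f (x, t)) by exact: measurableT_comp mf (pair1_measurable _).
have /(ae_eq_integral_abs lam measurableT mfx) : (\int[lam]_t `|f (x, t)| = 0)%E.
  by rewrite -[RHS]fx; apply: eq_integral => t _; rewrite gee0_abs.
apply: filterS => t /(_ I) /= + t0; rewrite /f/= indicE mem_set// mulr1 => -[] /eqP.
by rewrite normr_eq0 subr_eq0 => /eqP.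
Qed.

Lemma loc_summable_prim u D (C : R) : loc_summable u -> bounded_measurable D ->
  (forall t, `|D t| <= C) -> measurable_fun setT (prim D) -> loc_summable (fun x => prim D (u x)).
Proof.
move=> lu bD DC mp; apply: (@loc_summable_le _ _ _ (fun x => 0 + C * `|u x|)).
- by apply: measurableT_comp => //; case: lu.
- by move=> x; rewrite add0r; exact: prim_continuous_bound.
- by apply: loc_summableD; [exact/loc_summable_bounded/bounded_measurable_cst|exact: loc_summable_abs].
Qed.

Lemma continuous_prim D : bounded_measurable D -> continuous (prim D).
Proof.
move=> bD; have [_ [C DC]] := bD.
have C0 : 0 <= C by exact: le_trans (DC 0).
move=> s; apply/cvgrPdist_le => ep ep0; near=> t.
rewrite (le_trans (prim_bound t s (bounded_locally_bounded bD) DC))//.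
rewrite (@le_trans _ _ ((C + 1) * `|s - t|))//; first by rewrite ler_wpM2r// lerDl.
rewrite -ler_pdivlMl ?ltr_wpDl//.
near: t; apply: cvgr_dist_le; first exact: cvg_id.
by rewrite mulr_gt0 ?invr_gt0 ?ltr_wpDl.
Unshelve. all: by end_near. Qed.

Lemma measurable_prim D : bounded_measurable D -> measurable_fun setT (prim D).
Proof. by move=> /continuous_prim; exact: continuous_measurable_fun. Qed.

(** From almost every base point, [u] agrees along the line with the absolutely continuous function
    of [chain_line]: at almost every step inside the integral, and exactly at the step [h]. *)
Lemma wder_prim_lipschitz i u g D (L : R) : wder i u g -> bounded_measurable D -> 0 <= L ->
  (forall s t, `|D t - D s| <= L * `|t - s|) ->
  wder i (fun x => prim D (u x)) (fun x => g x * D (u x)).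
Proof.
move=> wu bD L0 LD; have [lu lg ug] := wu; have [mD [C DC]] := bD.
have bDu : bounded_measurable (fun x => D (u x)).
  by split; [apply: measurableT_comp => //; case: lu|exists C].
split.
- exact: loc_summable_prim (measurable_prim bD).
- exact: loc_summableMb.
move=> h h0; have sg := lineint_summable (e i) (ltW h0) lg.
apply: filterS2 (filterI sg (ug h h0)) (wder_line_ae wu) => x [sx ux] ax.
pose q (t : measurableTypeR R) := g (x + t *: e i) * \1_`]0, h]%classic t.
have qI t : 0 < t <= h -> \int[lam]_s (q s * \1_`]0, t]%classic s) = lineint (e i) t g x.
  move=> /andP[t0 th]; apply: eq_Rintegral => s _; rewrite /q -mulrA; congr (_ * _).
  rewrite !indic_itv_oc; have [s0|s0] := ltP 0 s => /=; last by rewrite mul0r.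
  by have [st|st] := leP s t; rewrite ?mulr0// (le_trans st th) mulr1.
have := @chain_line R q (u x) h L (prim D) D (ltW h0) sx bD L0 LD (fun a b => prim_taylor a b bD L0 LD).
rewrite qI ?h0 ?lexx// -ux [u x + (_ - _)]addrC subrK => ->.
rewrite /lineint; apply: Rint_ae.
- apply: measurable_funM; last by apply: measurable_indic; exact: measurable_itv.
  apply: measurable_funM; last by case: sx.
  apply: measurableT_comp => //; apply: measurable_funD => //.
  apply: (@measurable_Rint _ _ _ _ R lam (fun p : measurableTypeR R * measurableTypeR R =>
    q p.2 * \1_`]0, p.1]%classic p.2)).
  apply: measurable_funM; last exact: measurable_interval_indic.
  by apply: measurableT_comp; [case: sx|exact: measurable_snd].
- apply: measurable_funM; last by apply: measurable_indic; exact: measurable_itv.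
  apply: measurable_funM.
    by apply: measurableT_comp; [case: lg|exact: measurable_line1].
  apply: (@measurableT_comp _ _ _ _ _ _ (fun y : V => D (u y)) _ (fun t : measurableTypeR R => x + t *: e i)).
    by case: bDu.
  exact: measurable_line1.
apply: filterS ax => t at_; rewrite indic_itv_oc.
have [th|_] := boolP (0 < t <= h); last by rewrite !mulr0.
rewrite qI// -at_; last by case/andP: th.
by rewrite /q indic_itv_oc th !mulr1 [u x + (_ - _)]addrC subrK mulrC.
Qed.

Lemma prim_cst1 : prim (fun=> 1) = id :> (R -> R).
Proof.
have b1 : locally_bounded ((fun=> 1) : R -> R) by apply: bounded_locally_bounded; exact: bounded_measurable_cst.
have E (a b : R) : a <= b -> prim (fun=> 1) b - prim (fun=> 1) a = b - a.
  move=> ab; rewrite primB// -(Rint_itv ab); apply: eq_Rintegral => t _; exact: mul1r.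
apply/funext => s /=; have [s0|/ltW s0] := leP 0 s.
  by have := E _ _ s0; rewrite prim0 !subr0.
by have := E _ _ s0; rewrite prim0; lra.
Qed.

(* Rays are limits of Lipschitz functions, so the functional monotone class argument extends the
   chain rule from Lipschitz to arbitrary bounded Borel derivatives. *)
Lemma wder_prim_bounded i u g D : wder i u g -> bounded_measurable D ->
  wder i (fun x => prim D (u x)) (fun x => g x * D (u x)).
Proof.
move=> wu; have [lu lg _] := wu; have [mu _] := lu; have [mg _] := lg.
have lim_ (f_ : nat -> R -> R) f (C : R) : (forall k, bounded_measurable (f_ k)) ->
    bounded_measurable f -> (forall k x, `|f_ k x| <= C) -> (forall x, f_ k x @[k --> \oo] --> f x) ->
    (forall k, wder i (fun x => prim (f_ k) (u x)) (fun x => g x * f_ k (u x))) ->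
    wder i (fun x => prim f (u x)) (fun x => g x * f (u x)).
  move=> bf_ bf f_C cf wf.
  apply: (@wder_cvg _ _ i (fun k x => prim (f_ k) (u x)) (fun k x => g x * f_ k (u x)) _ _
    (fun x => 0 + C * `|u x|) (fun x => 0 + C * `|g x|)) => //.
  - by apply: measurableT_comp => //; exact: measurable_prim.
  - by apply: measurable_funM => //; apply: measurableT_comp => //; case: bf.
  - by apply: loc_summableD; [exact/loc_summable_bounded/bounded_measurable_cst|exact: loc_summable_abs].
  - by apply: loc_summableD; [exact/loc_summable_bounded/bounded_measurable_cst|exact: loc_summable_abs].
  - by move=> k x; rewrite add0r; exact: prim_continuous_bound.
  - by move=> k x; rewrite add0r normrM mulrC ler_wpM2r.
  - by move=> x; exact: prim_cvg cf.
  - by move=> x; apply: cvgMr.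
move: D; apply: (@bounded_measurable_ind _ R R (@RGenOInfty.G R)).
- exact: RGenOInfty.measurableE.
- move=> _ _ [a ->] [b ->]; exists (Num.max a b).
  by apply/seteqP; split => x /=; rewrite !in_itv/= !andbT gt_max => /andP.
- rewrite prim_cst1; have -> : (fun x => g x * 1) = g by apply/funext => x; rewrite mulr1.
  exact: wu.
- move=> _ [a ->].
  pose f_ (k : nat) (s : R) := Num.min 1 (Num.max 0 (k%:R * (s - a))).
  have f01 k s : 0 <= f_ k s <= 1.
    by rewrite /f_ le_min ler01 le_max lexx ge_min lexx.
  have Lf k s t : `|f_ k t - f_ k s| <= k%:R * `|t - s|.
    have k0 : 0 <= k%:R :> R by [].
    have -> : k%:R * `|t - s| = `|k%:R * (t - a) - k%:R * (s - a)|.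
      by rewrite -mulrBr normrM (ger0_norm k0); congr (_ * `|_|); ring.
    rewrite /f_; set A := k%:R * (t - a); set B := k%:R * (s - a).
    have H (x y : R) : x <= y -> `|Num.min 1 (Num.max 0 y) - Num.min 1 (Num.max 0 x)| <= `|y - x|.
      have cP (z : R) : [\/ z <= 0 /\ Num.min 1 (Num.max 0 z) = 0,
          (0 <= z <= 1) /\ Num.min 1 (Num.max 0 z) = z | 1 <= z /\ Num.min 1 (Num.max 0 z) = 1].
        have [z0|] := boolP (z <= 0); first by constructor 1; rewrite max_l// min_r.
        rewrite -ltNge => /ltW z0.
        have [z1|] := boolP (z <= 1); first by constructor 2; rewrite z0 max_r// min_r.
        by rewrite -ltNge => /ltW z1; constructor 3; rewrite max_r// min_l.
      move=> xy; rewrite [leRHS]ger0_norm ?subr_ge0// ler_norml.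
      case: (cP y) => -[? ->]; case: (cP x) => -[? ->]; apply/andP; split; lra.
    by have [/H//|/ltW/H] := leP B A; rewrite distrC [`|B - A|]distrC.
  have bf k : bounded_measurable (f_ k).
    split; last by exists 1 => s; case/andP: (f01 k s) => ? ?; rewrite ger0_norm.
    apply: continuous_measurable_fun => s; apply/cvgrPdist_le => ep ep0; near=> t.
    rewrite (le_trans (Lf _ _ _))// (@le_trans _ _ (k.+1%:R * `|s - t|))//.
      by rewrite ler_wpM2r// ler_nat.
    rewrite -ler_pdivlMl ?ltr0n//.
    near: t; apply: cvgr_dist_le; first exact: cvg_id.
    by rewrite mulr_gt0 ?invr_gt0 ?ltr0n.
  apply: (lim_ f_ _ 1) => //.
  + by apply: bounded_measurable_indic; exact: measurable_itv.
  + by move=> k s; case/andP: (f01 k s) => ? ?; rewrite ger0_norm.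
  + move=> s; rewrite indicE; have [sa|sa] := ltP a s.
      rewrite mem_set; last by rewrite /= in_itv/= sa.
      apply: cvg_near_cst; exists (Num.trunc ((s - a)^-1)).+1 => // k /= kk.
      have : 1 <= k%:R * (s - a).
        rewrite -ler_pdivrMr ?subr_gt0// mul1r (le_trans (ltW (truncnS_gt _)))// ler_nat //.
      by move=> h; rewrite /f_ max_r ?(le_trans ler01 h)// min_l.
    rewrite memNset; last by rewrite /= in_itv/= andbT => h; have := lt_le_trans h sa; rewrite ltxx.
    apply: cvg_near_cst; apply: nearW => k.
    by rewrite /f_ max_l ?min_r ?ler01// mulr_ge0_le0// subr_le0.
  + by move=> k; exact: (wder_prim_lipschitz wu (bf k) (ler0n _ k) (Lf k)).
- move=> f1 f2 c b1 b2 w1 w2; rewrite primD//.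
  have := wder_comb c w1 w2; congr wder; apply/funext => x; ring.
- move=> f_ f C; exact: lim_.
Unshelve. all: by end_near. Qed.

Lemma wder_unique0 i g : wder i (fun=> 0) g -> {ae m, forall x, g x = 0}.
Proof.
move=> wg; have [_ lg _] := wg; apply: (loc_summable_eq0 lg) => F sF [r rF].
have tF : test_function (prodf F) by exact: test_function_prodf sF rF.
have := weak_of_wder wg tF; under eq_Rintegral do rewrite mul0r.
by rewrite Rintegral_cst// mul0r => /eqP; rewrite eq_sym oppr_eq0 => /eqP.
Qed.

(** The primitive of the indicator of a null set is identically 0, so the chain rule makes [g] times
    this indicator, evaluated at [u], a weak derivative of 0. For the set reduced to 0, it localizes
    gradients. *)
Lemma wder_null i u g (N : set R) : wder i u g -> measurable N -> lam N = 0%E ->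
  {ae m, forall x, N (u x) -> g x = 0}.
Proof.
move=> wu mN N0; have := wder_prim_bounded wu (bounded_measurable_indic R mN).
have -> : (fun x => prim \1_N (u x)) = fun=> 0.
  apply/funext => x; rewrite /prim (@Rint_ae _ _ _ _ _ (fun=> 0)).
  - by rewrite Rintegral_cst// mul0r.
  - apply: measurable_funM; first exact: measurable_indic.
    by have [] := summableB (summable_itv 0 (u x)) (summable_itv (u x) 0).
  - exact: measurable_cst.
  - exists N; split => // t /= H; apply: contrapT => Nt; apply: H.
    by rewrite indicE memNset// mul0r.
move=> /wder_unique0; apply: filterS => x + Nx.
by rewrite indicE mem_set// mulr1.
Qed.

End chain_rule.

(** * Isoperimetric inequality for superlevel sets *)

Section isoperimetric.
Context {R : realType} {n : nat}.
Local Notation V := 'rV[R]_n.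
Local Notation m := (borel_lebesgue R n).
Local Notation lam := (@lebesgue_measure R).
Local Notation e i := (delta_mx ord0 i : V).
Implicit Types (u g w : V -> R) (i : 'I_n).

Lemma measurable_translate_set (A : set V) v : measurable A -> measurable [set x | A (x + v)].
Proof.
by move=> mA; rewrite -[X in measurable X]setTI; exact: (@measurable_translate R n v measurableT A mA).
Qed.

Lemma measure_translate (A : set V) v : measurable A -> m [set x | A (x + v)] = m A.
Proof.
move=> mA; have mAv := measurable_translate_set v mA.
have m1 : measurable_fun setT (fun x => (\1_A x : R)%:E) by exact: measurable_EFin_indic.
apply: etrans (esym (integral_indicT m mAv)) _; apply: etrans _ (integral_indicT m mA).
rewrite -(ge0_integral_translate' v m1); last by move=> x; rewrite lee_fin.
by apply: eq_integral => x _; rewrite !indicE.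
Qed.

Lemma wder_shift_bound i w g (h : R) : 0 <= h -> wder i w g ->
  (\int[m]_x `|w (x + h *: e i) - w x|%:E <= h%:E * \int[m]_x `|g x|%:E)%E.
Proof.
rewrite le_eqVlt => /predU1P[<-|h0] [[mw _] lg ug].
  by under eq_integral do rewrite scale0r addr0 subrr normr0; rewrite integral0 mul0e.
have [mg _] := lg.
pose f (p : V * measurableTypeR R) : \bar R :=
  (`|g (p.1 + p.2 *: e i)| * \1_`]0, h]%classic p.2)%:E.
have mf : measurable_fun setT f.
  apply/measurable_EFinP; apply: measurable_funM.
    by do 2 apply: measurableT_comp => //; exact: measurable_line.
  apply: measurableT_comp; last exact: measurable_snd.
  by apply: measurable_indic; exact: measurable_itv.
have f0 p : (0 <= f p)%E by rewrite lee_fin mulr_ge0.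
have FT := @fubini_tonelli _ _ _ _ R m lam f mf f0.
have mF : measurable_fun setT (fun x => \int[lam]_t f (x, t))%E.
  exact: (@measurable_fun_fubini_tonelli_F _ _ _ _ R lam f mf f0).
apply: (@le_trans _ _ (\int[m]_x \int[lam]_t f (x, t))%E).
  apply: ae_ge0_le_integral => //.
  - apply/measurable_EFinP; apply: measurableT_comp => //; apply: measurable_funB => //.
    by apply: measurableT_comp => //; exact: measurable_translate.
  - by move=> x _; exact: integral_ge0.
  apply: filterS2 (ug h h0) (lineint_summable (e i) (ltW h0) lg) => x -> sx _.
  rewrite (@le_trans _ _ (\int[lam]_t `|g (x + t *: e i) * \1_`]0, h]%classic t|)%:E)//.
    by rewrite lee_fin; exact: Rint_abs.
  rewrite Rint_EFin; last exact: summable_abs.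
  rewrite le_eqVlt; apply/orP; left; apply/eqP; apply: eq_integral => t _; rewrite /f/= normrM; congr (_ * _)%:E.
  by rewrite ger0_norm.
rewrite FT.
have fE (t : measurableTypeR R) : (\int[m]_x f (x, t) = (\1_`]0, h]%classic t)%:E * \int[m]_x `|g x|%:E)%E.
  have m1 : measurable_fun setT (fun x => `|g x|%:E) by apply/measurable_EFinP; apply: measurableT_comp.
  rewrite -(ge0_integral_translate' (t *: e i) m1)//.
  rewrite -ge0_integralZl ?lee_fin//.
    by apply: eq_integral => x _; rewrite /f mulrC EFinM.
  by apply: (measurableT_comp m1); exact: measurable_translate.
under eq_integral do rewrite fE.
under eq_integral do rewrite muleC.
have mI : measurable (`]0, h]%classic : set R) by exact: measurable_itv.
rewrite ge0_integralZlT; [|exact: measurable_EFin_indic|by move=> t; rewrite lee_fin|exact: integral_ge0].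
rewrite muleC [X in (X * _)%E](_ : _ = h%:E)//.
apply: etrans (integral_indicT lam mI) _; apply: etrans (lebesgue_itv_oc 0 h) _.
by rewrite h0 subr0.
Qed.

(** The translation is performed one coordinate at a time; each move costs at most [c] times the
    [L^1] norm of the corresponding derivative. *)
Lemma wder_translation_bound w (g : 'I_n -> V -> R) (c : R) (s : V) : (forall i, wder i w (g i)) ->
  (forall i, 0 <= s ord0 i <= c) ->
  (\int[m]_x `|w (x + s) - w x|%:E <= c%:E * \int[m]_x (\sum_i `|g i x|)%:E)%E.
Proof.
move=> wg sc.
have mg i : measurable_fun setT (g i) by have [_ [? _] _] := wg i.
have mab (v v' : V) : 'I_n -> measurable_fun setT (fun x : V => `|w (x + v) - w (x + v')|%:E).
  move=> i; have [[mw _] _ _] := wg i.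
  apply/measurable_EFinP; apply: measurableT_comp => //.
  by apply: measurable_funB; apply: measurableT_comp => //; exact: measurable_translate.
have H (l : seq 'I_n) : (\int[m]_x `|w (x + \sum_(i <- l) s ord0 i *: e i) - w x|%:E <=
    \sum_(i <- l) (c%:E * \int[m]_x `|g i x|%:E))%E.
  elim: l => [|i l IH].
    rewrite !big_nil; under eq_integral do rewrite addr0 subrr normr0.
    by rewrite integral0.
  rewrite !big_cons; set v := \sum_(j <- l) _ in IH *.
  have [si sic] := andP (sc i).
  apply: (@le_trans _ _ (\int[m]_x (`|w (x + v + s ord0 i *: e i) - w (x + v)|%:E + `|w (x + v) - w x|%:E))%E).
    apply: ge0_le_integral => //.
    - by have := mab (s ord0 i *: e i + v) 0 i; under eq_fun do rewrite addr0.
    - apply: emeasurable_funD.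
        by have := mab (v + s ord0 i *: e i) v i; under eq_fun do rewrite addrA.
      by have := mab v 0 i; under eq_fun do rewrite addr0.
    move=> x _; rewrite -EFinD lee_fin [s _ _ *: _ + v]addrC addrA.
    have -> : w (x + v + s ord0 i *: e i) - w x =
      (w (x + v + s ord0 i *: e i) - w (x + v)) + (w (x + v) - w x) by ring.
    exact: ler_normD.
  rewrite ge0_integralD//; [|by have := mab (v + s ord0 i *: e i) v i; under eq_fun do rewrite addrA
    |by have := mab v 0 i; under eq_fun do rewrite addr0].
  apply: leeD => //.
  have mm : measurable_fun setT (fun x : V => `|w (x + s ord0 i *: e i) - w x|%:E).
    by have := mab (s ord0 i *: e i) 0 i; under eq_fun do rewrite addr0.
  rewrite (ge0_integral_translate' v mm)// (le_trans (wder_shift_bound si (wg i)))//.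
  by rewrite lee_wpmul2r ?lee_fin// integral_ge0.
have := H (index_enum 'I_n); have <- : s = \sum_i s ord0 i *: e i by exact: row_sum_delta.
move=> /le_trans; apply; rewrite -ge0_sume_distrr; last by move=> i _; exact: integral_ge0.
rewrite [X in (_ <= _ * X)%E](_ : _ = \int[m]_x \sum_i `|g i x|%:E)%E; last first.
  by apply: eq_integral => x _; rewrite sumEFin.
by rewrite ge0_integral_sum// => i; apply/measurable_EFinP; apply: measurableT_comp.
Qed.

(* Averaging the translates of the truncation of u over a cube whose volume is twice that of
   the superlevel set {a < u}: at least half of the translates leave that set. *)
Lemma isoperimetric_half u (g : 'I_n -> V -> R) (a b l : R) : (0 < n)%N -> (forall i, wder i u (g i)) ->
  0 <= a -> a < b -> 0 < l -> (m [set x | (a < u x)%R] <= (l ^+ n)%:E)%E ->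
  ((b - a)%:E * m [set x | (b <= u x)%R] <=
   (2 ^+ n.+1 * l)%:E * \int[m]_(x in [set x | (a < u x <= b)%R]) (\sum_i `|g i x|)%:E)%E.
Proof.
move=> n0 ug a0 ab l0 mS.
pose D : R -> R := \1_`]a, b]%classic.
have bD : bounded_measurable D by apply: bounded_measurable_indic; exact: measurable_itv.
have lD := bounded_locally_bounded bD.
pose w x := prim D (u x).
have [mu _] : loc_summable u by have [] := ug (Ordinal n0).
have mg i : measurable_fun setT (g i) by have [_ [? _] _] := ug i.
have wg i : wder i w (fun x => g i x * D (u x)) := wder_prim_bounded (ug i) bD.
have mw : measurable_fun setT w by have [[]] := wg (Ordinal n0).
have wlow s : s <= a -> prim D s = 0.
  move=> sa; have z (r t : R) : t <= a -> r <= t -> prim D t - prim D r = 0.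
    move=> ta rt; rewrite primB//; apply: etrans (_ : \int[lam]_t (0 : R) = 0); last first.
      by rewrite Rintegral_cst// mul0r.
    apply: eq_Rintegral => y _; rewrite /D !indic_itv_oc.
    have [/andP[ry yt]|_] := boolP (r < y <= t); last by rewrite mulr0.
    by rewrite ltNge (le_trans yt ta) mul0r.
  have [s0|/ltW s0] := leP 0 s; first by have := z 0 s sa s0; rewrite prim0 subr0.
  by have := z s 0 a0 s0; rewrite prim0 sub0r => /eqP; rewrite oppr_eq0 => /eqP.
have whigh s : b <= s -> prim D s = b - a.
  move=> bs; have s0 : 0 <= s by rewrite (le_trans a0)// (le_trans (ltW ab)).
  have := primB lD s0; rewrite prim0 subr0 => ->; rewrite -(Rint_itv (ltW ab)).
  apply: eq_Rintegral => t _; rewrite /D !indic_itv_oc.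
  have [/andP[A B]|H] := boolP (a < t <= b); last by rewrite mul0r.
  by rewrite (le_lt_trans a0 A) (le_trans B bs) mul1r.
(* A cube of side [2 l] has volume [2^n l^n], at least twice the bound [l^n] on the volume of the
   superlevel set since [n >= 1]. *)
pose L := 2 * l; have L0 : 0 < L by rewrite mulr_gt0.
have ln0 : 0 < l ^+ n by rewrite exprn_gt0.
have lL : l ^+ n + l ^+ n <= L ^+ n.
  have n2 : 2 <= 2 ^+ n :> R by rewrite -[leLHS]expr1 ler_weXn2l// ler1n.
  rewrite /L exprMn; have := ler_wpM2r (ltW ln0) n2.
  by rewrite (_ : 2 * l ^+ n = l ^+ n + l ^+ n)//; ring.
have LE : L ^+ n * L = 2 ^+ n.+1 * l * l ^+ n.
  by rewrite -exprSr /L exprMn [l ^+ n.+1]exprS mulrA.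
pose S := [set x | a < u x]; pose T := [set x | b <= u x]; pose Q : set V := cbox 0 L.
have mS' : measurable S by exact: measurable_lt_set.
have mT : measurable T by exact: measurable_le_set.
have mQ : measurable Q by exact: measurable_cbox.
have mQE : m Q = (L ^+ n)%:E by rewrite lebesgue_pow ?subr0// ltW.
pose I : \bar R := (\int[m]_(x in [set x | (a < u x <= b)%R]) (\sum_i `|g i x|)%:E)%E; rewrite -/I.
have IE : (\int[m]_x (\sum_i `|g i x * D (u x)|)%:E = I)%E.
  rewrite /I [RHS]integral_mkcond; apply: eq_integral => x _; rewrite patchE.
  have Dx : D (u x) = (nat_of_bool (a < u x <= b)%R)%:R by exact: indic_itv_oc.
  have -> : (x \in [set x | a < u x <= b]) = (a < u x <= b).
    by apply/idP/idP => [/set_mem|/mem_set].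
  case: ifP => H; rewrite Dx H; first by under eq_bigr do rewrite mulr1.
  by rewrite big1// => i _; rewrite mulr0 normr0.
(* The double integral of [F] is estimated in both orders. For fixed [s] it is at most [L] times the
   gradient integral; for fixed [x] with [u x >= b], a set of translations of measure at least [l^n]
   leads out of the superlevel set and contributes [b - a] each. Dividing [L^n L] by [l^n] gives the
   constant [2^(n+1) l]. *)
pose F (p : V * V) : \bar R := (\1_Q p.2 * `|w (p.1 + p.2) - w p.1|)%:E.
have mF : measurable_fun setT F.
  apply/measurable_EFinP; apply: measurable_funM.
    apply: measurableT_comp; last exact: measurable_snd.
    exact: measurable_indic.
  apply: measurableT_comp => //; apply: measurable_funB.
    by apply: measurableT_comp => //; exact: measurable_translate2.
  by apply: measurableT_comp => //; exact: measurable_fst.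
have F0 p : (0 <= F p)%E by rewrite lee_fin mulr_ge0.
have FT := @fubini_tonelli _ _ _ _ R m m F mF F0.
have key s : (\int[m]_x F (x, s) <= L%:E * I * (\1_Q s)%:E)%E.
  have [sQ|sQ] := pselect (Q s); last first.
    have z x : F (x, s) = 0%E by rewrite /F /= indicE (memNset sQ) mul0r.
    by under eq_integral do rewrite z; rewrite integral0 indicE (memNset sQ) mule0.
  have o x : F (x, s) = `|w (x + s) - w x|%:E by rewrite /F /= indicE (mem_set sQ) mul1r.
  under eq_integral do rewrite o.
  rewrite indicE (mem_set sQ) mule1 -IE; exact: wder_translation_bound wg sQ.
have I0 : (0 <= I)%E by apply: integral_ge0 => x _; rewrite lee_fin sumr_ge0.
clearbody I.
have up : (\int[m]_s \int[m]_x F (x, s) <= (L ^+ n)%:E * (L%:E * I))%E.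
  have L0' : (0 <= L%:E)%E by rewrite lee_fin; exact: ltW L0.
  have iQ : (\int[m]_x (\1_Q x : R)%:E = (L ^+ n)%:E)%E := etrans (integral_indicT m mQ) mQE.
  rewrite [leRHS]muleC -iQ -ge0_integralZlT; last 3 first.
  - exact: measurable_EFin_indic.
  - by move=> t; rewrite lee_fin.
  - exact: mule_ge0.
  apply: ge0_le_integralT.
  - exact: (@measurable_fun_fubini_tonelli_G _ _ _ _ R m F mF F0).
  - by apply: emeasurable_funM; [exact: measurable_cst|exact: measurable_EFin_indic].
  - by move=> s; exact: integral_ge0.
  - exact: key.
clear key.
have low : ((b - a)%:E * (l ^+ n)%:E * m T <= \int[m]_x \int[m]_s F (x, s))%E.
  have ba0 : 0 <= b - a by rewrite subr_ge0; exact: ltW ab.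
  have c0 := mulr_ge0 ba0 (ltW ln0).
  have iT : (m T = \int[m]_x (\1_T x : R)%:E)%E := esym (integral_indicT m mT).
  rewrite iT -EFinM -ge0_integralZlT; [|exact: measurable_EFin_indic|by move=> t; rewrite lee_fin|by rewrite lee_fin].
  apply: ge0_le_integralT.
  - by apply: emeasurable_funM; [exact: measurable_cst|exact: measurable_EFin_indic].
  - exact: (@measurable_fun_fubini_tonelli_F _ _ _ _ R m F mF F0).
  - by move=> x; rewrite -EFinM lee_fin mulr_ge0.
  move=> x; have [xT|xT] := pselect (T x); last first.
    by rewrite indicE (memNset xT) mule0; exact: integral_ge0.
  rewrite indicE (mem_set xT) mule1.
  pose Sx := [set s | S (x + s)].
  have mSx : measurable Sx.
    rewrite (_ : Sx = [set s | S (s + x)]); first exact: measurable_translate_set.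
    by apply/seteqP; split => s; rewrite /Sx /= addrC.
  have mSxE : m Sx = m S.
    rewrite -(measure_translate x mS'); congr (m _).
    by apply/seteqP; split => s; rewrite /Sx /= addrC.
  have H : ((l ^+ n)%:E <= m (Q `\` Sx))%E.
    apply: (measure_setD_ge mQ mSx); last by apply: le_trans mS; rewrite -mSxE.
    rewrite [leRHS](_ : _ = (L ^+ n)%:E); last exact: mQE.
    by rewrite lee_fin.
  apply: (@le_trans _ _ ((b - a)%:E * m (Q `\` Sx))%E).
    by rewrite EFinM; apply: lee_wpmul2l; [rewrite lee_fin; exact: ba0|exact: H].
  have mD : measurable (Q `\` Sx) by exact: measurableD.

  have iD : (m (Q `\` Sx) = \int[m]_x (\1_(Q `\` Sx) x : R)%:E)%E := esym (integral_indicT m mD).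
  rewrite iD -ge0_integralZlT; [|exact: measurable_EFin_indic|by move=> t; rewrite lee_fin|by rewrite lee_fin].
  apply: ge0_le_integralT.
  - by apply: emeasurable_funM; [exact: measurable_cst|exact: measurable_EFin_indic].
  - exact: measurableT_comp mF (pair1_measurable _).
  - by move=> s; rewrite -EFinM lee_fin mulr_ge0.
  move=> s; have [[sQ sS]|sD] := pselect ((Q `\` Sx) s); last first.
    by rewrite indicE (memNset sD) mule0; exact: F0.
  have sD : (Q `\` Sx) s := conj sQ sS.
  rewrite indicE (mem_set sD) mule1 lee_fin /F /= indicE (mem_set sQ) mul1r /w (whigh (u x) xT).
  rewrite wlow; last by rewrite leNgt; apply/negP; exact: sS.
  by rewrite sub0r normrN (ger0_norm ba0); exact: le_refl.
rewrite FT in low; have {up low} := le_trans low up; rewrite -muleA [((l ^+ n)%:E * _)%E]muleC muleA muleA => H.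
exact: (lee_mul_cancel ln0 LE H).
Qed.

(** The one-sided inequalities for [u] and [- u] are added; the two layers are disjoint because
    [a >= 0]. *)
Lemma isoperimetric u (g : 'I_n -> V -> R) (a b l : R) : (0 < n)%N -> (forall i, wder i u (g i)) ->
  0 <= a -> a < b -> 0 < l -> (m [set x | (a < `|u x|)%R] <= (l ^+ n)%:E)%E ->
  ((b - a)%:E * m [set x | (b <= `|u x|)%R] <=
   (2 ^+ n.+1 * l)%:E * \int[m]_(x in [set x | (a < `|u x| <= b)%R]) (\sum_i `|g i x|)%:E)%E.
Proof.
move=> n0 ug a0 ab l0 mS.
have [mu _] : loc_summable u by have [] := ug (Ordinal n0).
have mg i : measurable_fun setT (g i) by have [_ [? _] _] := ug i.
have b0 : 0 < b by exact: le_lt_trans ab.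
pose g' i x := - g i x; pose u' x := - u x.
have ug' i : wder i u' (g' i).
  have := wder_comb (- 2) (ug i) (ug i).
  by congr wder; apply/funext => x; rewrite /u' /g'; ring.
have mu' : measurable_fun setT u' by exact: measurableT_comp.
have mG : measurable_fun setT (fun x => (\sum_i `|g i x|)%:E).
  by apply/measurable_EFinP; apply: measurable_sum => i; exact: measurableT_comp.
have h1 : (m [set x | (a < u x)%R] <= (l ^+ n)%:E)%E.
  apply: le_trans mS; apply: le_measure; rewrite ?inE; [exact: measurable_lt_set| |].
    by apply: measurable_lt_set => //; exact: measurableT_comp.
  by move=> x /= H; rewrite (lt_le_trans H)// ler_norm.
have h2 : (m [set x | (a < u' x)%R] <= (l ^+ n)%:E)%E.
  apply: le_trans mS; apply: le_measure; rewrite ?inE; [exact: measurable_lt_set| |].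
    by apply: measurable_lt_set => //; exact: measurableT_comp.
  by move=> x /= H; rewrite (lt_le_trans H)// -normrN ler_norm.
have H1 := isoperimetric_half n0 ug a0 ab l0 h1; have H2 := isoperimetric_half n0 ug' a0 ab l0 h2.
pose S1 := [set x | (a < u x <= b)%R]; pose S2 := [set x | (a < u' x <= b)%R].
have mI (v : V -> R) : measurable_fun setT v -> measurable [set x | (a < v x <= b)%R].
  move=> mv; rewrite (_ : [set x | _] = [set x | a < v x] `&` [set x | v x <= b]).
    by apply: measurableI; [exact: measurable_lt_set|exact: measurable_le_set].
  by apply/seteqP; split => x /= => [/andP|[-> ->]].
have -> : [set x | (a < `|u x| <= b)%R] = S1 `|` S2.
  apply/seteqP; split => x; rewrite /S1 /S2 /u' /=.
    have [x0|x0] := leP 0 (u x); [by left; rewrite -(ger0_norm x0)|by right; rewrite -(ltr0_norm x0)].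
  case=> /andP[A B]; first by rewrite ger0_norm ?A// (le_trans a0 (ltW A)).
  by rewrite ler0_norm ?A// -oppr_ge0 (le_trans a0 (ltW A)).
rewrite ge0_integral_setU; last 5 first.
- exact: mI.
- exact: mI.
- exact: measurable_funS mG.
- by move=> x _; rewrite lee_fin sumr_ge0.
- apply/disj_set2P; apply/seteqP; split => x //= -[/andP[A _] /andP[B _]]; move: A B; rewrite /u'; lra.
have mT1 : measurable [set x | b <= u x] by exact: measurable_le_set.
have mT2 : measurable [set x | b <= u' x] by exact: measurable_le_set.
rewrite muleDr//; last first.
  by rewrite ge0_adde_def// inE integral_ge0// => x _; rewrite lee_fin sumr_ge0.
have {}H2 : ((b - a)%:E * m [set x | (b <= u' x)%R] <=
    (2 ^+ n.+1 * l)%:E * \int[m]_(x in S2) (\sum_i `|g i x|)%:E)%E.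
  apply: (le_trans H2); rewrite le_eqVlt; apply/orP; left; apply/eqP; congr (_ * _)%E.
  by apply: eq_integral => x _; congr EFin; apply: eq_bigr => i _; rewrite normrN.
apply: le_trans (leeD H1 H2).
rewrite -muleDr//; last by rewrite ge0_adde_def// inE measure_ge0.
rewrite lee_wpmul2l//; first by rewrite lee_fin subr_ge0 ltW.
apply: le_trans (measureU2 m mT1 mT2); apply: le_measure; rewrite ?inE//.
- by apply: measurable_le_set => //; exact: measurableT_comp.
- exact: measurableU.
move=> x /=; have [x0|x0] := leP 0 (u x); first by rewrite ger0_norm//; left.
by rewrite ltr0_norm//; right.
Qed.

End isoperimetric.

(** * Continuity of volumes of superlevel sets *)

Section level_sets.
Context d (T : measurableType d) (R : realType) (mu : {measure set T -> \bar R}).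
Implicit Types (v : T -> R) (f : T -> \bar R).

Lemma harmonic_small (c e : R) : 0 < e -> exists N : nat, forall k, (N <= k)%N -> c / k.+1%:R < e.
Proof.
move=> e0; have L : c / k.+1%:R @[k --> \oo] --> (0 : R).
  by rewrite -(mulr0 c); apply: cvgMr; exact: cvg_harmonic.
have /cvgrPdist_lt /(_ e e0) [N _ HN] := L; exists N => k Nk.
by have := HN k Nk; rewrite /= sub0r normrN; apply: le_lt_trans; exact: ler_norm.
Qed.

Lemma level_right v (s b c : R) : measurable_fun setT v -> s < b ->
  (forall r, s < r <= b -> (mu [set x | (r <= v x)%R] <= c%:E)%E) -> (mu [set x | (s < v x)%R] <= c%:E)%E.
Proof.
move=> mv sb H; pose q (k : nat) := s + (b - s) / k.+1%:R.
pose F k := [set x | q k <= v x].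
have mF k : measurable (F k) by exact: measurable_le_set.
have bs : 0 < b - s by rewrite subr_gt0.
have -> : [set x | s < v x] = \bigcup_k F k.
  apply/seteqP; split => x /= => [sv|[k _]]; last first.
    by apply: lt_le_trans; rewrite /q ltrDl divr_gt0.
  have [|k /(_ k (leqnn _)) kv] := harmonic_small (b - s) (_ : 0 < v x - s); first by rewrite subr_gt0.
  by exists k => //; rewrite /F /= /q addrC -lerBrDr ltW.
have nF : {homo F : i j / (i <= j)%N >-> (i <= j)%O}.
  move=> i j ij; apply/subsetPset => x /= /(le_trans _); apply.
  by rewrite lerD2l ler_wpM2l ?(ltW bs)// lef_pV2 ?posrE// ler_nat.
have L := @nondecreasing_cvg_mu _ _ _ mu _ mF (bigcup_measurable (fun k _ => mF k)) nF.
rewrite -(cvg_lim (@ereal_hausdorff R) L); apply: lime_le.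
  by apply/cvg_ex; eexists; exact: L.
apply: nearW => k /=; apply: H; rewrite ltrDl divr_gt0//= /q addrC -lerBrDr.
by rewrite ler_pdivrMr// ler_peMr ?(ltW bs)// ler1n.
Qed.

Lemma level_left v (s r c : R) : measurable_fun setT v -> r < s -> (mu [set x | (r < v x)%R] < +oo)%E ->
  (forall t, r < t < s -> (c%:E <= mu [set x | (t <= v x)%R])%E) -> (c%:E <= mu [set x | (s <= v x)%R])%E.
Proof.
move=> mv rs foo H; pose q (k : nat) := s - (s - r) / k.+2%:R.
pose F k := [set x | q k <= v x].
have mF k : measurable (F k) by exact: measurable_le_set.
have sr : 0 < s - r by rewrite subr_gt0.
have qs k : r < q k < s.
  rewrite /q ltrBlDr ltrDl divr_gt0// andbT ltrBrDl -ltrBrDr ltr_pdivrMr//.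
  by rewrite ltr_pMr// ltr1n.
have -> : [set x | s <= v x] = \bigcap_k F k.
  apply/seteqP; split => x /= => [sv k _|H']; first by rewrite /F/= (le_trans _ sv)// ltW//; case/andP: (qs k).
  rewrite leNgt; apply/negP => vs.
  have [|k /(_ k.+1 (leqnSn k))] := harmonic_small (s - r) (_ : 0 < s - v x); first by rewrite subr_gt0.
  by rewrite ltrBrDl -ltrBrDr ltNge; have := H' k I; rewrite /F/= => ->.
have nF : {homo F : i j / (i <= j)%N >-> (j <= i)%O}.
  move=> i j ij; apply/subsetPset => x /= /(le_trans _); apply.
  by rewrite lerB// ler_wpM2l ?(ltW sr)// lef_pV2 ?posrE// ler_nat.
have F0 : (mu (F 0%N) < +oo)%E.
  apply: le_lt_trans foo; apply: le_measure; rewrite ?inE; [exact: mF|exact: measurable_lt_set|].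
  by move=> x /=; apply: lt_le_trans; case/andP: (qs 0%N).
have L := @nonincreasing_cvg_mu _ _ _ mu _ F0 mF (bigcap_measurableType (fun k _ => mF k)) nF.
rewrite -(cvg_lim (@ereal_hausdorff R) L); apply: lime_ge.
  by apply/cvg_ex; eexists; exact: L.
by apply: nearW => k /=; exact: H.
Qed.

(** The volume of superlevel sets may jump over the value [c]. At the supremum of the levels of
    volume at least [c], the strict and the non-strict superlevel sets lie on the two sides of [c];
    at an end point of [[r, b]] one of the two bounds is void. *)
Lemma level_split v (r b c : R) : measurable_fun setT v -> r < b -> (mu [set x | (r < v x)%R] < +oo)%E ->
  exists s, [/\ r <= s <= b, s < b -> (mu [set x | (s < v x)%R] <= c%:E)%E &
    r < s -> (c%:E <= mu [set x | (s <= v x)%R])%E].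
Proof.
move=> mv rb foo.
pose S := [set t | r < t <= b /\ (c%:E <= mu [set x | (t <= v x)%R])%E].
have dec t t' : t <= t' -> (mu [set x | (t' <= v x)%R] <= mu [set x | (t <= v x)%R])%E.
  move=> tt'; apply: le_measure; rewrite ?inE; [exact: measurable_le_set|exact: measurable_le_set|].
  by move=> x; exact: le_trans.
have nS t : r < t <= b -> ~ S t -> (mu [set x | (t <= v x)%R] <= c%:E)%E.
  move=> rt St; case/orP: (le_total (mu [set x | (t <= v x)%R]) c%:E) => // H.
  by exfalso; apply: St.
have [[t0 St0]|S0] := pselect (exists t, S t); last first.
  exists r; rewrite lexx (ltW rb) ltxx; split => // _; apply: level_right rb _ => // t rt.
  by apply: nS => // St; apply: S0; exists t.
have hS : has_sup S by split; [exists t0|exists b => t [/andP[]]].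
have rs : r < sup S by have [/andP[r0 _] _] := St0; exact: lt_le_trans r0 (sup_upper_bound hS St0).
have sb : sup S <= b by apply: ge_sup; [exists t0|move=> t [/andP[]]].
exists (sup S); rewrite (ltW rs) sb; split => // H.
  apply: level_right H _ => // t /andP[st tb]; apply: nS; first by rewrite (lt_trans rs st) tb.
  by move=> /(sup_upper_bound hS) /(lt_le_trans st); rewrite ltxx.
apply: level_left (H) foo _ => // t /andP[rt ts].
have [|t' [_ St'] tt'] := sup_adherent (_ : 0 < sup S - t) hS; first by rewrite subr_gt0.
by apply: le_trans St' (dec _ _ _); move: tt'; rewrite subKr => /ltW.
Qed.

Lemma fatou_le (f_ : nat -> T -> \bar R) f (M : \bar R) : (forall k, measurable_fun setT (f_ k)) ->
  (forall k x, (0 <= f_ k x)%E) -> {ae mu, forall x, f_ k x @[k --> \oo] --> f x} -> measurable_fun setT f ->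
  (forall k, (\int[mu]_x f_ k x <= M)%E) -> (\int[mu]_x f x <= M)%E.
Proof.
move=> mf_ f_0 cf mf fM.
have -> : (\int[mu]_x f x = \int[mu]_x limn_einf (f_^~ x))%E.
  apply: ae_eq_integral => //.
    rewrite (_ : (fun _ => _) = fun x => - limn_esup (fun k => - f_ k x))%E.
      by apply: measurableT_comp => //; apply: measurable_fun_limn_esup => k; exact: measurableT_comp.
    apply/funext => x; have -> : (fun k => - f_ k x)%E = (-%E \o (f_^~ x)) by [].
    by rewrite limn_esupN oppeK.
  apply: filterS cf => x L _; rewrite is_cvg_limn_einfE; first by apply/esym/cvg_lim.
  by apply/cvg_ex; exists (f x).
apply: le_trans (fatou mu measurableT mf_ (fun k x _ => f_0 k x)) _.
rewrite limn_einf_lim; apply: lime_le; first exact: is_cvg_einfs.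
by apply: nearW => k; apply: (@le_trans _ _ (\int[mu]_x f_ k x)%E) => //; apply: ereal_inf_lbound; exists k => /=.
Qed.

End level_sets.

(** * Weak and strong type inequalities *)

(* With [G t = int_0^t h], the function [G `^ ((n - 1) / n)] is the function H_n of the Young
   function [al]. *)
Record capacity (R : realType) (n : nat) (al h : R -> R) : Prop := Capacity {
  cap_nondec : {homo al : s t / s <= t} ;
  cap_neg : forall s, s <= 0 -> al s = 0 ;
  cap_gt0 : forall s, 0 < s -> 0 < h s ;
  cap_noninc : forall s t, 0 < s -> s <= t -> h t <= h s ;
  cap_dual : forall s, 0 < s -> s = h s ^+ n.-1 * al s ;
  cap_measurable : measurable_fun setT h ;
  cap_summable : forall t, summable_fun (@lebesgue_measure R) (fun s => h s * \1_`]0, t]%classic s)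
}.

Section weak_type.
Context {R : realType} {n : nat}.
Local Notation V := 'rV[R]_n.
Local Notation m := (borel_lebesgue R n).
Local Notation lam := (@lebesgue_measure R).
Local Notation e i := (delta_mx ord0 i : V).
Implicit Types (u : V -> R) (g : 'I_n -> V -> R) (al h : R -> R).

Definition cap_int h (t : R) : R := \int[lam]_s (h s * \1_`]0, t]%classic s).

Lemma capacity_ge0 al h : capacity n al h -> forall s, 0 <= al s.
Proof.
move=> C s; have [s0|/ltW s0] := leP s 0; first by rewrite (cap_neg C).
by rewrite -(cap_neg C (lexx 0)); exact: cap_nondec C _ _ s0.
Qed.

Lemma capacity_measurable al h : capacity n al h -> measurable_fun setT al.
Proof. by move=> C; apply: nondecreasing_measurable => //; exact: cap_nondec C. Qed.

Definition gnorm g (x : V) : R := \sum_i `|g i x|.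

Lemma gnorm_ge0 g x : 0 <= gnorm g x.
Proof. exact: sumr_ge0. Qed.

Lemma measurable_gnorm g : (forall i, measurable_fun setT (g i)) -> measurable_fun setT (gnorm g).
Proof. by move=> mg; apply: measurable_sum => i; exact: measurableT_comp. Qed.

Definition energy al u g (a b : R) : \bar R := (\int[m]_(x in [set x | (a < `|u x| <= b)%R]) (al (gnorm g x))%:E)%E.

(** Only the terms [2^i l] below [y] count, and a geometric sum of ratio 2 is at most twice its
    largest term. *)
Lemma dyadic_sum_le (l y : R) (N : nat) : 0 <= l -> 0 <= y ->
  \sum_(i < N) 2 ^+ i * l * (nat_of_bool (2 ^+ i * l < y)%R)%:R <= 2 * y.
Proof.
move=> l0 y0.
have H (k : nat) : \sum_(i < k) 2 ^+ i * l * (nat_of_bool (2 ^+ i * l < y)%R)%:R <= 2 ^+ k * l.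
  elim: k => [|k IH]; first by rewrite big_ord0 expr0 mul1r.
  rewrite big_ord_recr/= (_ : 2 ^+ k.+1 * l = 2 ^+ k * l + 2 ^+ k * l); last by rewrite exprS; ring.
  by apply: lerD => //; rewrite ler_piMr// ?mulr_ge0 ?exprn_ge0//; case: (_ < _).
elim: N => [|N IH]; first by rewrite big_ord0 mulr_ge0.
have [lt|ge] := ltP (2 ^+ N * l) y.
  by apply: le_trans (H _) _; rewrite exprS -mulrA ler_wpM2l// ltW.
by rewrite big_ord_recr/= ltNge ge/= mulr0 addr0.
Qed.

Section annulus.
Variables (u : V -> R) (g : 'I_n -> V -> R) (al h : R -> R).
Hypotheses (n1 : (1 < n)%N) (ug : forall i, wder i u (g i)) (cap : capacity n al h).

Let mu_ : measurable_fun setT u.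
Proof. by have [[]] := ug (Ordinal (ltnW n1)). Qed.

Let mabs : measurable_fun setT (fun x => `|u x|).
Proof. exact: measurableT_comp. Qed.

Lemma measurable_annulus a b : measurable [set x | a < `|u x| <= b].
Proof.
rewrite (_ : [set x | _] = [set x | a < `|u x|] `&` [set x | `|u x| <= b]).
  by apply: measurableI; [exact: measurable_lt_set|exact: measurable_le_set].
by apply/seteqP; split => x /= => [/andP|[-> ->]].
Qed.

Lemma measurable_density : measurable_fun setT (fun x => (al (gnorm g x))%:E).
Proof.
apply/measurable_EFinP; apply: measurableT_comp; first exact: capacity_measurable cap.
by apply: measurable_gnorm => i; have [_ []] := ug i.
Qed.

Lemma energy_ge0 a b : (0 <= energy al u g a b)%E.
Proof. by apply: integral_ge0 => x _; rewrite lee_fin; exact: capacity_ge0 cap _. Qed.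

Lemma energyS a a' b b' : a' <= a -> b <= b' -> (energy al u g a b <= energy al u g a' b')%E.
Proof.
move=> aa bb; apply: ge0_subset_integral; [exact: measurable_annulus|exact: measurable_annulus| | |].
- exact: measurable_funS measurable_density.
- by move=> x _; rewrite lee_fin; exact: capacity_ge0 cap _.
- by move=> x /= /andP[ax xb]; rewrite (le_lt_trans aa ax) (le_trans xb bb).
Qed.

Lemma energyD a b c : a <= b -> b <= c ->
  energy al u g a c = (energy al u g a b + energy al u g b c)%E.
Proof.
move=> ab bc; rewrite /energy -ge0_integral_setU//.
- congr (integral _ _ _); apply/seteqP; split => x /=.
    by move=> /andP[-> H]; have [h'|h'] := leP `|u x| b; [left|right].
  by move=> [/andP[h1 h2]|/andP[h1 h2]]; [rewrite h1 (le_trans h2)|rewrite (le_lt_trans ab h1)].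
- exact: measurable_annulus.
- exact: measurable_annulus.
- exact: measurable_funS measurable_density.
- by move=> x _; rewrite lee_fin; exact: capacity_ge0 cap _.
- apply/disj_set2P; apply/seteqP; split => x //= -[/andP[_ A] /andP[B _]].
  by have := le_lt_trans A B; rewrite ltxx.
Qed.

End annulus.

Section weak_type_estimate.
Variables (u : V -> R) (g : 'I_n -> V -> R) (al h : R -> R) (t eta : R).
Hypotheses (n1 : (1 < n)%N) (ug : forall i, wder i u (g i)) (cap : capacity n al h).
Hypotheses (t0 : 0 < t) (eta0 : 0 < eta).

Let n0 : (0 < n)%N := ltnW n1.
Let l (i : nat) : R := 2 ^+ i * (eta * h t).
(* Levels are grouped by the dyadic scale [l i] of their volume, and [tau i] is the length of the part
   of [0, t] on which [eta * h] exceeds [l i]: the sum of [l i * tau i] is at most 2 eta G(t). *)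
Let tau (i : nat) : R := \int[lam]_s (\1_[set s | l i < eta * h s] s * \1_`]0, t]%classic s).

Let l_gt0 i : 0 < l i.
Proof. by apply: mulr_gt0; [rewrite exprn_gt0|exact: mulr_gt0 eta0 (cap_gt0 cap t0)]. Qed.

Let mtau i : measurable [set s : R | l i < eta * h s].
Proof.
by apply: measurable_lt_set; [exact: measurable_cst|apply: measurable_funM => //; exact: cap_measurable cap].
Qed.

Let sI : summable_fun lam (\1_`]0, t]%classic : R -> R).
Proof. exact: summable_itv. Qed.

Let stau i : summable_fun lam (fun s => \1_[set s | l i < eta * h s] s * \1_`]0, t]%classic s).
Proof.
under eq_fun do rewrite mulrC.
apply: (@summableMb _ _ _ _ 1) => //; first exact: measurable_indic (mtau i).
by move=> s; rewrite indicE ger0_norm// lern1 leq_b1.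
Qed.

Let tau_ge0 i : 0 <= tau i.
Proof. by apply: Rintegral_ge0 => s _; rewrite mulr_ge0. Qed.

(** A substitute for Young's inequality. If [eta h(a) > l i], then [a <= t] and, [h] being
    nonincreasing, all of []0, a]] is counted in [tau i]. Otherwise [h(a) <= l i / eta], and
    [a = h(a)^(n-1) al(a)] gives the second term. *)
Let young_split i (a : R) : 0 <= a -> a <= tau i + (l i / eta) ^+ n.-1 * al a.
Proof.
move=> a0; have al0 := capacity_ge0 cap; have li := l_gt0 i.
have q0 : 0 <= (l i / eta) ^+ n.-1 * al a.
  by rewrite mulr_ge0// exprn_ge0// divr_ge0// ltW.
move: a0; rewrite le_eqVlt => /predU1P[<-|a0]; first by rewrite addr_ge0 ?tau_ge0 // (cap_neg cap)// mulr0.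
have [ha|ha] := ltP (l i) (eta * h a); last first.
  apply: ler_wpDl; first exact: tau_ge0.
  rewrite [leLHS](cap_dual cap a0) ler_wpM2r//; apply: lerXn2r; rewrite ?nnegrE.
  - exact: ltW (cap_gt0 cap a0).
  - by rewrite divr_ge0// ltW.
  - by rewrite ler_pdivlMr// mulrC.
apply: ler_wpDr => //.
have at_ : a <= t.
  rewrite leNgt; apply/negP => /ltW ta; have := cap_noninc cap t0 ta; rewrite leNgt => /negP; apply.
  rewrite -(ltr_pM2l eta0); apply: le_lt_trans ha; rewrite /l ler_peMl//.
    exact: ltW (mulr_gt0 eta0 (cap_gt0 cap t0)).
  by rewrite exprn_ege1// ler1n.
rewrite -[leLHS]subr0 -(Rint_itv (ltW a0)); apply: Rint_le; [exact: summable_itv|exact: stau|].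
move=> s; rewrite !indic_itv_oc; have [/andP[s0 sa]|_] := boolP (0 < s <= a); last by rewrite mulr_ge0.
rewrite s0 (le_trans sa at_) mulr1 indicE mem_set//=.
by rewrite (lt_le_trans ha)// ler_wpM2l ?(ltW eta0)//; exact: (cap_noninc cap s0 sa).
Qed.

Let tau_sum N : \sum_(i < N) l i * tau i <= 2 * (eta * cap_int h t).
Proof.
have sh := cap_summable cap t.
under eq_bigr do rewrite -RintZ//.
rewrite -[eta * _]RintZ// -RintZ; last exact: summableZ.
rewrite (_ : \sum_(i < N) _ = \int[lam]_s (\sum_(i < N) l i * (\1_[set s | l i < eta * h s] s * \1_`]0, t]%classic s))).
  apply: Rint_le.
  - by apply: summable_sum => i; exact: summableZ.
  - by do 2 apply: summableZ.
  move=> s; rewrite indic_itv_oc; have [/andP[s0 st]|_] := boolP (0 < s <= t); last first.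
    by rewrite !mulr0 big1// => i _; rewrite mulr0 mulr0.
  rewrite mulr1; under eq_bigr do rewrite mulr1.
  have hs : 0 <= eta * h s by rewrite mulr_ge0 ?ltW// (cap_gt0 cap s0).
  have ht : 0 <= eta * h t by rewrite mulr_ge0 ?ltW// (cap_gt0 cap t0).
  apply: le_trans (dyadic_sum_le N ht hs); apply: ler_sum => i _.
  rewrite indicE; have [H|H] := boolP (2 ^+ i * (eta * h t) < eta * h s); first by rewrite mem_set.
  by rewrite memNset//; apply/negP.
elim: N => [|N IH].
  by rewrite big_ord0; under eq_Rintegral do rewrite big_ord0; rewrite Rintegral_cst// mul0r.
rewrite big_ord_recr/= IH -RintD; last 2 first.
- by apply: summable_sum => i; exact: summableZ.
- exact: summableZ.
by apply: eq_Rintegral => s _; rewrite big_ord_recr.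
Qed.

Let mu_ : measurable_fun setT u.
Proof. by have [[]] := ug (Ordinal n0). Qed.

Let mg : measurable_fun setT (gnorm g).
Proof. by apply: measurable_gnorm => i; have [_ []] := ug i. Qed.

Let mabs : measurable_fun setT (fun x => `|u x|).
Proof. exact: measurableT_comp. Qed.

Let mE a b : measurable [set x | a < `|u x| <= b].
Proof. exact: (measurable_annulus n1 ug). Qed.

Let malg := measurable_density ug cap.

Let J_ge0 a b : (0 <= energy al u g a b)%E.
Proof. exact: (energy_ge0 _ _ cap). Qed.

Let energy_gnorm i a b (c : R) : (m [set x | (a < `|u x|)%R] <= c%:E)%E ->
  (\int[m]_(x in [set x | (a < `|u x| <= b)%R]) (gnorm g x)%:E <=
   (tau i * c)%:E + ((l i / eta) ^+ n.-1)%:E * energy al u g a b)%E.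
Proof.
move=> mc; have q0 : 0 <= (l i / eta) ^+ n.-1 by rewrite exprn_ge0// divr_ge0 ?ltW.
have S : measurable [set x | a < `|u x| <= b] by exact: mE.
apply: (@le_trans _ _ (\int[m]_(x in [set x | (a < `|u x| <= b)%R])
    ((tau i)%:E + ((l i / eta) ^+ n.-1)%:E * (al (gnorm g x))%:E))%E).
  apply: ge0_le_integral => //.
  - by move=> x _; rewrite lee_fin gnorm_ge0.
  - by apply/measurable_EFinP; exact: measurable_funS mg.
  - apply: emeasurable_funD; first exact: measurable_cst.
    by apply: measurable_funeM; exact: measurable_funS malg.
  - by move=> x _; rewrite -EFinM -EFinD lee_fin; apply: young_split; exact: gnorm_ge0.
rewrite ge0_integralD//; last 3 first.
- by move=> x _; rewrite lee_fin.
- by move=> x _; rewrite -EFinM lee_fin mulr_ge0//; exact: capacity_ge0 cap _.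
- by apply: measurable_funeM; exact: measurable_funS malg.
rewrite integral_cst// ge0_integralZl//; last 2 first.
- exact: measurable_funS malg.
- by move=> x _; rewrite lee_fin; exact: capacity_ge0 cap _.
apply: leeD; last exact: lexx.
rewrite EFinM; apply: lee_wpmul2l; first by rewrite lee_fin.
apply: le_trans mc; apply: le_measure; rewrite ?inE//; first exact: measurable_lt_set.
by move=> x /= /andP[].
Qed.

(** Both volumes are comparable to [l N ^+ n], so this factor cancels in the isoperimetric
    inequality. What remains is [l N * tau N], summable over the scales, and an energy term whose
    coefficient does not depend on [N]. *)
Let step N (r s : R) : 0 <= r -> r < s -> (m [set x | (r < `|u x|)%R] <= (l N.+1 ^+ n)%:E)%E ->
  ((l N ^+ n)%:E <= m [set x | (s <= `|u x|)%R])%E ->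
  ((s - r)%:E <= (2 ^+ n.+2)%:E * ((2 ^+ n * (l N * tau N))%:E + (eta ^- n.-1)%:E * energy al u g r s))%E.
Proof.
move=> r0 rs mr ms; have lN := l_gt0 N; have lS : l N.+1 = 2 * l N by rewrite /l exprS -mulrA.
have iso := isoperimetric n0 ug r0 rs (l_gt0 N.+1) mr.
have J0 := J_ge0 r s; have E1 := @energy_gnorm N r s _ mr.
have H : ((s - r)%:E * (l N ^+ n)%:E <= (2 ^+ n.+1 * l N.+1)%:E *
    ((tau N * l N.+1 ^+ n)%:E + ((l N / eta) ^+ n.-1)%:E * energy al u g r s))%E.
  apply: le_trans (lee_wpmul2l _ ms) _; first by rewrite lee_fin subr_ge0 ltW.
  apply: le_trans iso _; apply: lee_wpmul2l => //.
  by rewrite lee_fin mulr_ge0 ?exprn_ge0// ltW.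
move: J0 H; case: (energy al u g r s) => [J||] //; last first.
  move=> _ _; rewrite gt0_muley; last by rewrite lte_fin invr_gt0 exprn_gt0.
  by rewrite addey// gt0_muley ?leey// lte_fin exprn_gt0.
move=> J0 H.
have {}H : (s - r) * l N ^+ n <= 2 ^+ n.+1 * l N.+1 * (tau N * l N.+1 ^+ n + (l N / eta) ^+ n.-1 * J).
  by rewrite -lee_fin; exact: H.
suff : s - r <= 2 ^+ n.+2 * (2 ^+ n * (l N * tau N) + eta ^- n.-1 * J) by rewrite -lee_fin.
have lnn : 0 < l N ^+ n by rewrite exprn_gt0.
rewrite -(ler_pM2r lnn); apply: (le_trans H); rewrite lS exprMn expr_div_n.
have -> : l N ^+ n = l N * l N ^+ n.-1 by rewrite -exprS prednK.
rewrite le_eqVlt; apply/orP; left; apply/eqP.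
rewrite [2 ^+ n.+2]exprS [2 ^+ n.+1]exprS.
by field; rewrite expf_neq0// gt_eqF.
Qed.

(** Induction on the dyadic scale of the volume: [level_split] provides a level at which the volume
    crosses [l N ^+ n], [step] treats the layer below it and the induction hypothesis the layer
    above. *)
Let level_energy N (r b : R) : 0 <= r -> r < b -> (m [set x | (r < `|u x|)%R] <= (l N ^+ n)%:E)%E ->
  ((l 0 ^+ n)%:E < m [set x | (b <= `|u x|)%R])%E ->
  ((b - r)%:E <= (2 ^+ n.+2)%:E * ((2 ^+ n * \sum_(i < N) l i * tau i)%:E +
     (eta ^- n.-1)%:E * energy al u g r b))%E.
Proof.
elim: N r => [|N IH] r r0 rb mr mb.
  have H : (m [set x | (b <= `|u x|)%R] <= m [set x | (r < `|u x|)%R])%E.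
    apply: le_measure; rewrite ?inE; [exact: measurable_le_set|exact: measurable_lt_set|].
    by move=> x; exact: lt_le_trans.
  by have := lt_le_trans mb (le_trans H mr); rewrite ltxx.
have [s [/andP[rs sb] sH rH]] := level_split (l N ^+ n) mabs rb (le_lt_trans mr (ltry _)).
have s0 := le_trans r0 rs.
have K0 : (0 <= (2 ^+ n.+2 : R)%:E)%E by rewrite lee_fin exprn_ge0.
have e0 : (0 <= (eta ^- n.-1)%:E)%E by rewrite lee_fin invr_ge0 exprn_ge0// ltW.
have t_ge0 k : 0 <= 2 ^+ n * \sum_(i < k) l i * tau i.
  by rewrite mulr_ge0 ?exprn_ge0// sumr_ge0// => i _; rewrite mulr_ge0// ltW.
have S1 : ((s - r)%:E <= (2 ^+ n.+2)%:E * ((2 ^+ n * (l N * tau N))%:E + (eta ^- n.-1)%:E * energy al u g r s))%E.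
  move: rs; rewrite le_eqVlt => /predU1P[rs|rs]; last exact: (step r0 rs mr (rH rs)).
  rewrite -rs subrr mule_ge0// adde_ge0 ?mule_ge0 ?J_ge0// lee_fin.
  by rewrite mulr_ge0 ?exprn_ge0// mulr_ge0// ltW.
have S2 : ((b - s)%:E <= (2 ^+ n.+2)%:E * ((2 ^+ n * \sum_(i < N) l i * tau i)%:E +
     (eta ^- n.-1)%:E * energy al u g s b))%E.
  move: sb; rewrite le_eqVlt => /predU1P[sb|sb]; last by apply: IH => //; exact: sH.
  by rewrite sb subrr mule_ge0// adde_ge0 ?mule_ge0 ?J_ge0// lee_fin.
have -> : (b - r)%:E = ((s - r)%:E + (b - s)%:E)%E by rewrite -EFinD; congr EFin; ring.
apply: le_trans (leeD S1 S2) _.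
rewrite -ge0_muleDr; last 2 first.
- by rewrite adde_ge0 ?mule_ge0 ?J_ge0// lee_fin mulr_ge0 ?exprn_ge0// mulr_ge0// ltW.
- by rewrite adde_ge0 ?mule_ge0 ?J_ge0// lee_fin.
apply: lee_wpmul2l => //; rewrite addeACA -EFinD -mulrDr (energyD n1 ug cap rs sb).
rewrite (ge0_muleDr _ (J_ge0 r s) (J_ge0 s b)).
by rewrite big_ord_recr/= [X in 2 ^+ n * X]addrC.
Qed.

(** If the volume at level [b] exceeded the bound, the layers between [r] and [b] would have total
    height at most [2^(n+2) (2^n 2 eta G(t) + eta G(t))], with [G] for [cap_int h]. The first term
    is the sum of the [l i * tau i]; the second is the energy, since [M <= eta^n G(t)]. *)
Lemma weak_type_level (r b M : R) : 0 <= r -> r < b -> (m [set x | (r < `|u x|)%R] < +oo)%E ->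
  (energy al u g r b <= M%:E)%E -> M <= eta ^+ n * cap_int h t ->
  2 ^+ n.+2 * (2 ^+ n.+1 + 1) * (eta * cap_int h t) < b - r ->
  (m [set x | (b <= `|u x|)%R] <= ((eta * h t) ^+ n)%:E)%E.
Proof.
move=> r0 rb mr JM MG; apply: contraPle => mb; apply/negP; rewrite -leNgt.
have mfin : m [set x | r < `|u x|] \is a fin_num by rewrite ge0_fin_numE.
have [N HN] : exists N, (m [set x | (r < `|u x|)%R] <= (l N ^+ n)%:E)%E.
  pose c := fine (m [set x | r < `|u x|]) / l 0 ^+ n.
  exists (Num.trunc c).+1; rewrite -(fineK mfin) lee_fin.
  have l00 : 0 < l 0 ^+ n by rewrite exprn_gt0.
  have -> : l (Num.trunc c).+1 = 2 ^+ (Num.trunc c).+1 * l 0 by rewrite /l expr0 mul1r.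
  rewrite exprMn -ler_pdivrMr// -/c -exprM.
  apply: (le_trans (ltW (truncnS_gt c))); rewrite -natrX ler_nat.
  rewrite (leq_trans (ltnW (ltn_expl _ (ltnSn 1))))// leq_pexp2l//.
  by rewrite leq_pmulr.
have := level_energy r0 rb HN; rewrite {1}/l expr0 mul1r => /(_ mb) H.
have e0 : 0 < eta ^- n.-1 by rewrite invr_gt0 exprn_gt0.
have eM : eta ^- n.-1 * M <= eta * cap_int h t.
  rewrite ler_pdivrMl ?exprn_gt0//; apply: (le_trans MG).
  by rewrite mulrA -exprSr prednK.
have K0 : 0 <= 2 ^+ n.+2 :> R by rewrite exprn_ge0.
have H2 : ((b - r)%:E <= (2 ^+ n.+2)%:E * ((2 ^+ n * (2 * (eta * cap_int h t)))%:E + (eta ^- n.-1 * M)%:E))%E.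
  apply: (le_trans H); apply: lee_wpmul2l; first by rewrite lee_fin.
  apply: leeD; first by rewrite lee_fin ler_wpM2l ?exprn_ge0//; exact: tau_sum.
  by rewrite EFinM; apply: lee_wpmul2l JM; rewrite lee_fin ltW.
move: H2; rewrite -EFinD -EFinM lee_fin => /le_trans; apply.
set X := eta * cap_int h t.
have -> : 2 ^+ n.+2 * (2 ^+ n.+1 + 1) * X = 2 ^+ n.+2 * (2 ^+ n * (2 * X) + X).
  by rewrite [2 ^+ n.+1]exprS; ring.
by rewrite ler_wpM2l// lerD2l.
Qed.

End weak_type_estimate.

Section strong_type.
Variables (u : V -> R) (g : 'I_n -> V -> R) (al h : R -> R).
Hypotheses (n1 : (1 < n)%N) (ug : forall i, wder i u (g i)) (cap : capacity n al h).

Definition weak_const : R := 2 ^+ n.+2 * (2 ^+ n.+1 + 1).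

Let mabs : measurable_fun setT (fun x => `|u x|).
Proof. by have [[mu _] _ _] := ug (Ordinal (ltnW n1)); exact: measurableT_comp. Qed.

Let J_ge0 a b : (0 <= energy al u g a b)%E.
Proof. exact: (energy_ge0 _ _ cap). Qed.

Lemma cap_int_ge t : 0 < t -> t * h t <= cap_int h t.
Proof.
move=> t0; rewrite -[X in X * _]subr0 -(Rint_itv (ltW t0)) mulrC -RintZ; last exact: summable_itv.
apply: Rint_le; [by apply: summableZ; exact: summable_itv|exact: cap_summable cap t|].
move=> s; rewrite !indic_itv_oc; have [/andP[s0 st]|_] := boolP (0 < s <= t); last by rewrite !mulr0.
by rewrite !mulr1; exact: (cap_noninc cap s0 st).
Qed.

(** The free parameter is fixed by [eta^n G(t) = M'] with [M'] close to the energy and at most [M],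
    where [G] stands for [cap_int h]. Then [al(t) (eta h(t))^n = M' t h(t) / G(t)], which is at most
    [M'] because [t h(t) <= G(t)]. *)
Lemma weak_type (r b M t : R) : 0 <= r -> r < b -> 0 < t -> 0 < M -> (m [set x | (r < `|u x|)%R] < +oo)%E ->
  (energy al u g r b <= M%:E)%E -> weak_const ^+ n * (M * cap_int h t ^+ n.-1) < (b - r) ^+ n ->
  ((al t)%:E * m [set x | (b <= `|u x|)%R] <= energy al u g r b)%E.
Proof.
move=> r0 rb t0 M0 mr JM H; have n0 := ltnW n1.
have G0 : 0 < cap_int h t by apply: lt_le_trans (cap_int_ge t0); rewrite mulr_gt0// (cap_gt0 cap).
have ht := cap_gt0 cap t0; have alt := capacity_ge0 cap t.
have W0 : 0 < weak_const by rewrite mulr_gt0 ?exprn_gt0// addr_gt0// exprn_gt0.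
have J0 := J_ge0 r b.
have Jfin : energy al u g r b \is a fin_num by rewrite ge0_fin_numE// (le_lt_trans JM)// ltry.
apply/lee_addgt0Pr => ep ep0.
(* The energy may be 0 while [eta] has to be positive, hence the added [ep]. *)
pose M' := Num.min (fine (energy al u g r b) + ep) M.
have J0' : 0 <= fine (energy al u g r b) by rewrite fine_ge0.
have M'0 : 0 < M' by rewrite lt_min M0 andbT ltr_wpDl.
have JM' : (energy al u g r b <= M'%:E)%E.
  rewrite -[leLHS]fineK// lee_fin le_min lerDl (ltW ep0) -lee_fin fineK//.
have M'M : M' <= M by rewrite ge_min lexx orbT.
pose eta := (M' / cap_int h t) `^ n%:R^-1.
have eta0 : 0 < eta by rewrite powR_gt0// divr_gt0.
have etaE : eta ^+ n = M' / cap_int h t.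
  rewrite -powR_mulrn ?powR_ge0// -powRrM mulVf ?pnatr_eq0 -?lt0n// powRr1// divr_ge0// ltW//.
have MG : eta ^+ n * cap_int h t = M' by rewrite etaE divfK// gt_eqF.
have M'G : M' <= eta ^+ n * cap_int h t by rewrite MG.
have cond : weak_const * (eta * cap_int h t) < b - r.
  rewrite -(@ltr_pXn2r _ n)// ?nnegrE ?subr_ge0 ?(ltW rb)//; last first.
    by rewrite mulr_ge0 ?(ltW W0)// mulr_ge0 ?(ltW eta0) ?(ltW G0).
  apply: le_lt_trans H; rewrite exprMn ler_wpM2l ?exprn_ge0 ?(ltW W0)// exprMn.
  have -> : cap_int h t ^+ n = cap_int h t * cap_int h t ^+ n.-1 by rewrite -exprS prednK.
  by rewrite mulrA MG ler_wpM2r// exprn_ge0// ltW.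
have := weak_type_level n1 ug cap t0 eta0 r0 rb mr JM' M'G cond.
have al0 : (0 <= (al t)%:E)%E by rewrite lee_fin.
move=> /(lee_wpmul2l al0) /le_trans; apply; rewrite -EFinM.
apply: (@le_trans _ _ M'%:E); last first.
  by rewrite -[X in (_ <= X + _)%E]fineK// -EFinD lee_fin ge_min lexx.
rewrite lee_fin exprMn etaE -[n in h t ^+ n](prednK n0) exprS.
have -> : al t * (M' / cap_int h t * (h t * h t ^+ n.-1)) = M' * ((h t ^+ n.-1 * al t) * h t / cap_int h t) by ring.
rewrite -(cap_dual cap t0) ler_piMr ?(ltW M'0)// ler_pdivrMr// mul1r.
exact: cap_int_ge.
Qed.

Variable (T : R -> R).
Hypotheses (T_nondec : {homo T : s t / s <= t}) (T_gt0 : forall s, 0 < s -> 0 < T s) (T0 : T 0 = 0)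
  (T_inv : forall s, 0 < s -> cap_int h (T s) ^+ n.-1 <= s ^+ n).
Hypothesis u_level : forall s, 0 < s -> (m [set x | (s < `|u x|)%R] < +oo)%E.

Variables (K M : R).
Hypotheses (K0 : 0 < K) (M0 : 0 < M) (KM : weak_const ^+ n * (M * (4 * K) ^+ n) < 1).

Let P x := al (T (K * `|u x|)).

Let P0 x : 0 <= P x.
Proof. exact: capacity_ge0 cap _. Qed.

Lemma measurable_potential : measurable_fun setT (fun x => (P x)%:E).
Proof.
apply/measurable_EFinP; apply: measurableT_comp; first exact: capacity_measurable cap.
apply: measurableT_comp; first exact: nondecreasing_measurable.
exact: measurable_funM.
Qed.

(** On [2 p <= |u| < 4 p] the potential is at most [al(T(4 K p))], and the weak type inequality
    between the levels [p] and [2 p] bounds its integral by the energy of that layer. By [T_inv]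
    both sides of the smallness condition scale like [p^n], so one condition on [M] serves all
    layers, whose energies add up. *)
Lemma strong_type_range (r : R) N : 0 < r -> (energy al u g r (2 ^+ N * r) <= M%:E)%E ->
  (\int[m]_(x in [set x | (2 * r <= `|u x| < 2 ^+ N.+1 * r)%R]) (P x)%:E <= energy al u g r (2 ^+ N * r))%E.
Proof.
move=> r0; have mS a b : measurable [set x | a <= `|u x| < b].
  rewrite (_ : [set x | _] = [set x | a <= `|u x|] `&` [set x | `|u x| < b]).
    by apply: measurableI; [exact: measurable_le_set|exact: measurable_lt_set].
  by apply/seteqP; split => x /= => [/andP|[-> ->]].
elim: N => [|N IH] JM.
  rewrite expr1 (_ : [set x | _] = set0) ?integral_set0 ?J_ge0//.
  by apply/seteqP; split => x //= /andP[A B]; have := le_lt_trans A B; rewrite ltxx.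
pose p := 2 ^+ N * r; have p0 : 0 < p by rewrite mulr_gt0 ?exprn_gt0.
have pE : 2 ^+ N.+1 * r = 2 * p by rewrite exprS mulrA.
have rp : r <= p by rewrite ler_peMl ?(ltW r0)// exprn_ege1// ler1n.
have p2 : p < 2 * p by rewrite ltr_pMl// ltr1n.
rewrite pE in JM *; rewrite [2 ^+ N.+2 * r](_ : _ = 4 * p); last by rewrite 2!exprS /p; ring.
have J1 : (energy al u g r p <= M%:E)%E.
  by apply: le_trans JM; apply: (energyS n1 ug cap) => //; exact: ltW.
have J2 : (energy al u g p (2 * p) <= M%:E)%E by apply: le_trans JM; exact: (energyS n1 ug cap).
have := IH J1; rewrite pE -/p => {}IH.
have t0 : 0 < T (K * (4 * p)) by apply: T_gt0; rewrite !mulr_gt0.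
have W0 : 0 < weak_const by rewrite mulr_gt0 ?exprn_gt0// addr_gt0// exprn_gt0.
have := weak_type (ltW p0) p2 t0 M0 (u_level p0) J2.
have -> : 2 * p - p = p by ring.
have C : weak_const ^+ n * (M * cap_int h (T (K * (4 * p))) ^+ n.-1) < p ^+ n.
  apply: (@le_lt_trans _ _ (weak_const ^+ n * (M * (K * (4 * p)) ^+ n))).
    by rewrite ler_wpM2l ?exprn_ge0 ?(ltW W0)// ler_wpM2l ?(ltW M0)// T_inv// !mulr_gt0.
  have -> : (K * (4 * p)) ^+ n = (4 * K) ^+ n * p ^+ n by rewrite -exprMn; congr (_ ^+ _); ring.
  by rewrite !mulrA -[X in _ < X]mul1r ltr_pM2r ?exprn_gt0// -mulrA.
move=> /(_ C) W.
rewrite (energyD n1 ug cap rp (ltW p2)).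
rewrite (_ : [set x | _] = [set x | 2 * r <= `|u x| < 2 * p] `|` [set x | 2 * p <= `|u x| < 4 * p]); last first.
  apply/seteqP; split => x /=.
    by move=> /andP[-> ->]; have [?|?] := ltP `|u x| (2 * p); [left|right].
  have h2 : 2 * p <= 4 * p by rewrite ler_wpM2r ?(ltW p0)// ler_nat.
  have h3 : 2 * r <= 2 * p by rewrite ler_wpM2l.
  by move=> [/andP[-> A]|/andP[A ->]]; [rewrite (lt_le_trans A h2)|rewrite (le_trans h3 A)].
rewrite ge0_integral_setU//; last 3 first.
- exact: measurable_funS measurable_potential.
- by move=> x _; rewrite lee_fin.
- apply/disj_set2P; apply/seteqP; split => x //= -[/andP[_ A] /andP[B _]].
  by have := lt_le_trans A B; rewrite ltxx.
apply: leeD => //; apply: le_trans W.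
apply: (@le_trans _ _ (\int[m]_(x in [set x | (2 * p <= `|u x| < 4 * p)%R]) (al (T (K * (4 * p))))%:E)%E).
  apply: ge0_le_integral => //.
  - by move=> x _; rewrite lee_fin.
  - exact: measurable_funS measurable_potential.
  - move=> x /= /andP[_ xp]; rewrite lee_fin; apply: (cap_nondec cap); apply: T_nondec.
    by rewrite ler_wpM2l ?(ltW K0)// ltW.
rewrite integral_cst//; apply: lee_wpmul2l; first by rewrite lee_fin; exact: capacity_ge0 cap _.
apply: le_measure; rewrite ?inE//; first exact: measurable_le_set.
by move=> x /= /andP[].
Qed.

(* Nothing is lost at u x = 0, where the potential vanishes. *)
Lemma strong_type (S : set V) (r : nat -> R) (k : nat -> nat) : measurable S ->
  (forall j, 0 < r j) -> (forall j, (energy al u g (r j) (2 ^+ k j * r j) <= M%:E)%E) ->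
  (forall x, S x -> u x <> 0 -> exists j0, forall j, (j0 <= j)%N -> 2 * r j <= `|u x| < 2 ^+ (k j).+1 * r j) ->
  (\int[m]_(x in S) (P x)%:E <= M%:E)%E.
Proof.
move=> mS r0 JM Sx.
pose A j := [set x | 2 * r j <= `|u x| < 2 ^+ (k j).+1 * r j].
have mA j : measurable (A j).
  rewrite (_ : A j = [set x | 2 * r j <= `|u x|] `&` [set x | `|u x| < 2 ^+ (k j).+1 * r j]).
    by apply: measurableI; [exact: measurable_le_set|exact: measurable_lt_set].
  by apply/seteqP; split => x /= => [/andP|[? ?]]//; apply/andP.
have mSA j : measurable (S `&` A j) by exact: measurableI.
rewrite ge0_integral_mkindic.
apply: (@fatou_le _ _ _ m (fun j x => (\1_(S `&` A j) x)%:E * (P x)%:E)%E).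
- by move=> j; apply: emeasurable_funM; [exact: measurable_EFin_indic|exact: measurable_potential].
- by move=> j x; rewrite -EFinM lee_fin mulr_ge0.
- apply: aeW => x; have [xS|xS] := pselect (S x); last first.
    rewrite indicE memNset// mul0e; apply: cvg_near_cst; apply: nearW => j.
    by rewrite indicE memNset ?mul0e// => -[].
  have [ux|ux] := eqVneq (u x) 0.
    have -> : P x = 0 by rewrite /P ux normr0 mulr0 T0 (cap_neg cap).
    by rewrite mule0; apply: cvg_near_cst; apply: nearW => j; rewrite mule0.
  have [j0 Hj] := Sx x xS (elimN eqP ux).
  apply: cvg_near_cst; exists j0 => // j /= jj; rewrite !indicE !mem_set//.
  by split => //; exact: Hj.
- by apply: emeasurable_funM; [exact: measurable_EFin_indic|exact: measurable_potential].
move=> j; rewrite -ge0_integral_mkindic; apply: le_trans (JM j).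
apply: le_trans (strong_type_range (r0 j) (JM j)).
apply: ge0_subset_integral; [exact: mSA|exact: mA|exact: measurable_funS measurable_potential| |].
  by move=> x _; rewrite lee_fin.
by move=> x [].
Qed.

End strong_type.
End weak_type.

(** * Locally Lipschitz functions as primitives *)

Section lipschitz_primitive.
Variable R : realType.
Local Notation lam := (@lebesgue_measure R).
Implicit Types (f : R -> R).

Definition lipschitz_itv f a b := exists2 L : R, 0 <= L &
  forall x y, a <= x -> x <= y -> y <= b -> `|f y - f x| <= L * (y - x).

Lemma lipschitz_itv_near f x : (exists2 U : set R, nbhs x U & [lipschitz f y | y in U]) ->
  exists2 e : R, 0 < e & lipschitz_itv f (x - e) (x + e).
Proof.
move=> [U /nbhs_ballP[e /= e0 eU]] [M [_ HM]]; exists (e / 2); first by rewrite divr_gt0.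
exists (Num.max 0 M + 1); first by rewrite addr_ge0// le_max lexx.
move=> s t xs st tx.
have inU r : x - e / 2 <= r -> r <= x + e / 2 -> U r.
  by move=> h1 h2; apply: eU; rewrite /ball/= ltr_norml; apply/andP; split; lra.
have M1 : M < Num.max 0 M + 1 by rewrite (@le_lt_trans _ _ (Num.max 0 M)) ?le_max ?lexx ?orbT// ltrDl.
have := HM _ M1 (t, s); rewrite /= (ger0_norm (_ : 0 <= t - s)) ?subr_ge0//; apply.
by split; apply: inU; rewrite ?(le_trans xs)// (le_trans st).
Qed.

Lemma lipschitz_itv_cat f a b c : a <= b -> b <= c -> lipschitz_itv f a b -> lipschitz_itv f b c -> lipschitz_itv f a c.
Proof.
move=> ab bc [L1 L10 H1] [L2 L20 H2]; exists (L1 + L2); first exact: addr_ge0.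
move=> x y ax xy yc; have xy0 : 0 <= y - x by rewrite subr_ge0.
have [yb|/ltW yb] := leP y b.
  by apply: (le_trans (H1 x y ax xy yb)); rewrite ler_wpM2r// lerDl.
have [xb|/ltW xb] := leP x b; last first.
  by apply: (le_trans (H2 x y xb xy yc)); rewrite ler_wpM2r// lerDr.
have -> : f y - f x = (f y - f b) + (f b - f x) by ring.
apply: le_trans (ler_normD _ _) _; apply: le_trans (lerD (H2 _ _ (lexx b) yb yc) (H1 _ _ ax xb (lexx b))) _.
have A : 0 <= L2 * (b - x) by rewrite mulr_ge0// subr_ge0.
have B : 0 <= L1 * (y - b) by rewrite mulr_ge0// subr_ge0.
have -> : (L1 + L2) * (y - x) = L2 * (y - b) + L1 * (b - x) + (L2 * (b - x) + L1 * (y - b)) by ring.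
by rewrite lerDl addr_ge0.
Qed.

Lemma lipschitz_itvS f a b a' b' : a <= a' -> b' <= b -> lipschitz_itv f a b -> lipschitz_itv f a' b'.
Proof.
by move=> aa bb [L L0 H]; exists L => // x y ax xy yb; apply: H => //; [exact: le_trans ax|exact: le_trans bb].
Qed.

(** Compactness of the segment by a supremum: a Lipschitz constant up to [t] and one near the
    supremum combine into one for the union. *)
Lemma lipschitz_compact f a b : a <= b ->
  (forall x : R, exists2 U : set R, nbhs x U & [lipschitz f y | y in U]) -> lipschitz_itv f a b.
Proof.
move=> ab fl; pose S := [set t | a <= t <= b /\ lipschitz_itv f a t].
have Sa : S a.
  split; first by rewrite lexx.
  exists 0 => // x y ax xy ya; have -> : x = a by apply/le_anti; rewrite ax (le_trans xy ya).
  have -> : y = a by apply/le_anti; rewrite ya (le_trans ax xy).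
  by rewrite !subrr normr0 mulr0.
have hS : has_sup S by split; [exists a|exists b => t [/andP[]]].
set s := sup S; have as_ : a <= s := sup_upper_bound hS Sa.
have sb : s <= b by apply: ge_sup; [exists a|move=> t [/andP[]]].
have [e e0 Le] := lipschitz_itv_near (fl s).
have [t [/andP[a_t tb] Lt] tt'] := sup_adherent e0 hS; rewrite -/s in tt'.
have ts : t <= s by apply: (sup_upper_bound hS); split => //; rewrite a_t.
pose r := Num.min b (s + e).
have tr : t <= r by rewrite le_min tb (le_trans ts)// lerDl ltW.
have Lr : lipschitz_itv f a r.
  apply: (lipschitz_itv_cat a_t tr Lt); apply: lipschitz_itvS Le; first exact: ltW.
  by rewrite ge_min lexx orbT.
have [H|H] := leP b (s + e); first by move: Lr; rewrite /r min_l.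
have : S r by split => //; rewrite (le_trans a_t tr) ge_min lexx.
move=> /(sup_upper_bound hS); rewrite -/s /r min_r; last exact: ltW.
move=> H2.
by exfalso; move: H2 e0; rewrite gerDl leNgt => /negP.
Qed.

Lemma lipschitz_itv_continuous f : (forall k : nat, lipschitz_itv f (- k%:R) k%:R) -> continuous f.
Proof.
move=> Lf x; apply/cvgrPdist_le => ep ep0.
pose k := (Num.trunc `|x|).+2.
have xk : `|x| + 1 < k%:R by rewrite -natr1 ltrD2r truncnS_gt.
have [L L0 H] := Lf k; near=> y.
have yx : `|x - y| < 1 by near: y; apply: cvgr_dist_lt => //; exact: cvg_id.
have xy : (L + 1) * `|x - y| <= ep.
  rewrite -ler_pdivlMl ?ltr_wpDl//; near: y; apply: cvgr_dist_le; first exact: cvg_id.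
  by rewrite mulr_gt0 ?invr_gt0 ?ltr_wpDl.
apply: le_trans xy; apply: (@le_trans _ _ (L * `|x - y|)); last by rewrite ler_wpM2r// lerDl.
move: xk yx; rewrite ltr_norml => xk /andP[y1 y2].
have /andP[x1 x2] : - `|x| <= x <= `|x| by rewrite -ler_norml.
have [xy|/ltW xy] := leP x y.
  by rewrite distrC [`|x - y|]distrC [X in _ * X]ger0_norm ?subr_ge0//; apply: H => //; lra.
by rewrite [X in _ * X]ger0_norm ?subr_ge0//; apply: H => //; lra.
Unshelve. all: by end_near. Qed.

(** Once [f] is frozen outside [[-k, k]], adding [L x] on that interval makes it nondecreasing,
    hence the distribution function of a Stieltjes measure. The Lipschitz bound makes this measure
    absolutely continuous, and the density of [f] is its Radon-Nikodym derivative minus [L]. *)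
Lemma bounded_variation_density f (k : nat) : lipschitz_itv f (- k%:R) k%:R ->
  exists g : R -> R, summable_fun lam g /\
    forall a b, - k%:R <= a -> a <= b -> b <= k%:R -> f b - f a = \int[lam]_t (g t * \1_`]a, b]%classic t).
Proof.
move=> [L L0 H]; set K := k%:R in H *; have K0 : - K <= K :> R by rewrite ge0_cp// /K ler0n.
pose c (x : R) := Num.max (- K) (Num.min K x).
have c1 x : - K <= c x by rewrite /c le_max lexx.
have c2 x : c x <= K by rewrite /c ge_max K0 ge_min lexx.
have cid_ x : - K <= x -> x <= K -> c x = x by move=> h1 h2; rewrite /c min_r// max_r.
have cle x y : x <= y -> c x <= c y.
  by move=> xy; rewrite /c ge_max le_max lexx/= le_max le_min !ge_min lexx xy !orbT.
have clip x y : x <= y -> c y - c x <= y - x.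
  move=> xy; have cP z : [\/ z <= - K /\ c z = - K, (- K <= z <= K) /\ c z = z | K <= z /\ c z = K].
    have [h1|/ltW h1] := lerP z (- K).
      by constructor 1; split=> //; rewrite /c min_r ?(le_trans h1 K0)// max_l.
    have [h2|/ltW h2] := lerP z K; first by constructor 2; rewrite h1; split => //; exact: cid_.
    by constructor 3; split => //; rewrite /c min_l// max_r.
  by have [[? ->]|[/andP[? ?] ->]|[? ->]] := cP x; have [[? ->]|[/andP[? ?] ->]|[? ->]] := cP y; lra.
pose F x := f (c x) + L * c x.
have FB x y : x <= y -> 0 <= F y - F x <= 2 * L * (y - x).
  move=> xy; have := H _ _ (c1 x) (cle _ _ xy) (c2 y); rewrite ler_norml => /andP[h1 h2].
  have := ler_wpM2l L0 (clip _ _ xy); have := cle _ _ xy; rewrite /F; set d := c y; set e := c x.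
  move=> ed; move: h1 h2; rewrite -/d -/e => h1 h2 h3; apply/andP; split; lra.
have Fnd : {homo F : x y / x <= y} by move=> x y /FB /andP[]; rewrite subr_ge0.
have Frc : right_continuous F.
  move=> x; apply/cvgrPdist_le => ep ep0; near=> y.
  have xy : x <= y by near: y; exact: nbhs_right_ge.
  have /andP[h1 h2] := FB _ _ xy; rewrite distrC ger0_norm//; apply: (le_trans h2).
  rewrite (@le_trans _ _ ((2 * L + 1) * (y - x)))//; first by rewrite ler_wpM2r ?subr_ge0// lerDl.
  rewrite -ler_pdivlMl ?ltr_wpDl ?mulr_ge0// lerBlDl ltW//.
  by near: y; apply: nbhs_right_lt; rewrite ltrDl mulr_gt0 ?invr_gt0 ?ltr_wpDl ?mulr_ge0.
pose cF : cumulative R R := HB.pack F (isCumulative.Build R _ R F Fnd Frc).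
pose nu := lebesgue_stieltjes_measure cF.
have nuE a b : a <= b -> nu `]a, b]%classic = (F b - F a)%:E.
  move=> ab; rewrite /nu /lebesgue_stieltjes_measure/= /measure_extension measurable_mu_extE/=; last exact: is_ocitv.
  rewrite wlength_itv/= lte_fin; case: ltP => // ba.
  have -> : a = b by apply/le_anti; rewrite ab ba.
  by rewrite subrr.
pose J := `]- K, K]%classic : set R.
have mJ : measurable (J : set (measurableTypeR R)) by exact: measurable_itv.
have nuJ : (nu J < +oo)%E by rewrite nuE// ltry.
pose nuJ_ := mfrestr mJ nuJ.
have dom : nuJ_ `<< lam.
  apply/null_content_dominatesP => A mA A0.
  apply/eqP; rewrite -measure_le0 /nuJ_ /mfrestr /mrestr.
  apply: (@le_trans _ _ (nu A)).
    by apply: le_measure; rewrite ?inE//; exact: measurableI.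
  apply/lee_addgt0Pr => ep ep0; rewrite add0e.
  pose ep' := ep / (2 * L + 1).
  have L1 : 0 < 2 * L + 1 by rewrite ltr_wpDl ?mulr_ge0.
  have ep'0 : 0 < ep' by rewrite divr_gt0.
  have : (lam A < ep'%:E)%E by rewrite A0 lte_fin.
  (* A null set is covered by half-open intervals of total length below [ep']; the increment of [F]
     on each is at most [2 L + 1] times its length. The 1 keeps the divisor positive when
     [L = 0]. *)
  move=> /ereal_inf_lt[_ [C CA <-] Cep].
  have [mC AC] := CA.
  apply: (@le_trans _ _ (\sum_(i <oo) wlength F (C i))%E).
    by apply: ereal_inf_lbound; exists C.
  apply: (@le_trans _ _ (\sum_(i <oo) ((2 * L + 1)%:E * wlength idfun (C i)))%E).
    apply: lee_nneseries => i _; first by move=> _; exact: (@wlength_ge0 R cF (C i)).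
    have [->|[[a b] /= ab ->]] := (ocitvP _).1 (mC i); first by rewrite !wlength0 mule0.
    rewrite !wlength_itv/= lte_fin ab -!EFinB -EFinM lee_fin.
    have /andP[_ h] := FB _ _ (ltW ab); apply: (le_trans h).
    by rewrite ler_wpM2r ?subr_ge0 ?(ltW ab)// lerDl.
  rewrite nneseriesZl//.
  apply: (@le_trans _ _ ((2 * L + 1)%:E * ep'%:E)%E).
    by apply: lee_wpmul2l; [rewrite lee_fin ltW|exact: ltW].
  by rewrite -EFinM lee_fin /ep' mulrC divfK// gt_eqF.
have [g [g0 gfin gint gE]] := radon_nikodym_sigma_finite dom.
pose r t := fine (g t).
have sr : summable_fun lam r.
  apply/summable_integrable; apply: eq_integrable gint => // t _.
  by rewrite /r /= fineK.
pose q (t : measurableTypeR R) := r t - L * \1_`]- K, K]%classic t.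
exists q; split.
  by apply: summableB => //; apply: summableZ; exact: summable_itv.
move=> a b Ka ab bK.
have mI : measurable (`]a, b]%classic : set (measurableTypeR R)) by exact: measurable_itv.
have E : \int[lam]_t (r t * \1_`]a, b]%classic t) = F b - F a.
  have s1 : summable_fun lam (fun t => r t * \1_`]a, b]%classic t).
    by apply: (@summableMb _ _ _ _ 1) => // t; rewrite indicE ger0_norm// lern1 leq_b1.
  apply: EFin_inj; rewrite Rint_EFin//.
  have -> : (F b - F a)%:E = nuJ_ `]a, b]%classic.
    rewrite /nuJ_ /mfrestr /mrestr -nuE//; congr (nu _).
    apply/seteqP; split => x /=; last by case.
    rewrite /J /= !in_itv/= => /andP[h1 h2]; rewrite h1 h2 (le_lt_trans Ka h1) (le_trans h2 bK).
    by split.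
  apply: etrans (esym (gE _ mI)); rewrite [RHS]integral_mkcond; apply: eq_integral => t _.
  by rewrite patchE indicE /r EFinM fineK//; case: ifP => _; rewrite ?mule1 ?mule0.
have -> : f b - f a = (F b - F a) - L * (b - a).
  rewrite /F (cid_ a) ?(le_trans ab)// (cid_ b) ?(le_trans Ka)//; ring.
rewrite -E -(Rint_itv ab) -RintZ; last exact: summable_itv.
rewrite -RintB; last 2 first.
- by apply: (@summableMb _ _ _ _ 1) => // t; rewrite indicE ger0_norm// lern1 leq_b1.
- by apply: summableZ; exact: summable_itv.
apply: eq_Rintegral => t _; rewrite /q !indic_itv_oc.
have [/andP[h1 h2]|_] := boolP (a < t <= b); last by rewrite !mulr0 subr0.
by rewrite (le_lt_trans Ka h1) (le_trans h2 bK) !mulr1.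
Unshelve. all: by end_near. Qed.

(** The bound on [derive1 f] holds almost everywhere, while [D] must be Borel and bounded by [be] at
    every point. [D] is therefore the upper limit of right difference quotients, set to 0 where it
    violates the bound; it agrees almost everywhere with the density of [f]. *)
Lemma lipschitz_primitive f be : (forall x : R, exists2 U : set R, nbhs x U & [lipschitz f y | y in U]) ->
  f 0 = 0 -> {ae lam, forall t : R, `|derive1 f t| <= be t} ->
  (forall t, 0 <= be t) -> measurable_fun setT be -> (forall r, exists C, forall s, `|s| <= r -> be s <= C) ->
  exists D, [/\ locally_bounded D, forall t, `|D t| <= be t & f = prim D].
Proof.
move=> fl f0 fb be0 mbe bel.
have Lf (k : nat) : lipschitz_itv f (- k%:R) k%:R by apply: lipschitz_compact => //; rewrite ge0_cp.
have cf := lipschitz_itv_continuous Lf.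
have [gk gkP] := choice (fun k => bounded_variation_density (Lf k)).
have sgk k : summable_fun lam (gk k) by case: (gkP k).
have gkE k := (gkP k).2.
have mf : measurable_fun setT f by exact: continuous_measurable_fun.
pose qt (k : nat) (x : R) : \bar R := (k.+1%:R * (f (x + k.+1%:R^-1) - f x))%:E.
pose d x := fine (limn_esup (qt ^~ x)).
have md : measurable_fun setT d.
  apply: measurableT_comp; first exact: fine_measurable.
  apply: measurable_fun_limn_esup => k; apply/measurable_EFinP; apply: measurable_funM => //.
  apply: measurable_funB => //; apply: measurableT_comp => //; exact: measurable_funD.
pose B := [set x | `|d x| <= be x].
have mB : measurable B by apply: measurable_le_set => //; exact: measurableT_comp.
pose D x := d x * \1_B x.
have mD : measurable_fun setT D by apply: measurable_funM => //; exact: measurable_indic.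
have Dbe x : `|D x| <= be x.
  rewrite /D indicE; have [xB|xB] := pselect (B x); first by rewrite mem_set// mulr1.
  by rewrite memNset// mulr0 normr0.
have lD : locally_bounded D.
  split => // r; have [C HC] := bel r; exists C => s /HC; exact: le_trans.
have dE x df : derivable f x 1 -> derive1 f x = df -> d x = df.
  move=> fx <-; rewrite /d.
  suff L : qt k x @[k --> \oo] --> (derive1 f x)%:E.
    rewrite is_cvg_limn_esupE; last by apply/cvg_ex; exists (derive1 f x)%:E.
    by rewrite (cvg_lim _ L).
  apply/fine_cvgP; split; first exact: nearW.
  have L : h^-1 *: (f (h + x) - f x) @[h --> 0^'] --> derive1 f x.
    have -> : (fun h : R => h^-1 *: (f (h + x) - f x)) = (fun h : R => h^-1 *: (f (h *: 1 + x) - f x)).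
      by apply/funext => h; rewrite [h *: 1]mulr1.
    rewrite derive1E; exact: fx.
  have := (cvg_at_rightP _ _ _).1 (cvg_dnbhs_at_right L) (fun k => k.+1%:R^-1).
  move=> /(_ (conj _ (@cvg_harmonic R))) H; have {}H := H (fun k => ltac:(by rewrite invr_gt0 ltr0n)).
  have -> // : fine \o qt^~ x = fun k : nat => k.+1%:R^-1^-1 *: (f (k.+1%:R^-1 + x) - f x).
  apply/funext => k; have -> : k.+1%:R^-1^-1 = k.+1%:R :> R by exact: invrK.
  by rewrite /= [_ + x]addrC.
(* Lebesgue differentiation of the integral of the density shows that [f] is differentiable almost
   everywhere, with the density as derivative. *)
have AE (k : nat) : {ae lam, forall x, - k%:R < x -> x < k%:R -> f^`()%classic x = gk k x /\ derivable f x 1}.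
  pose I : R -> R := \1_`]- k%:R, k%:R]%classic.
  pose q t := gk k t * I t.
  have sq : summable_fun lam q.
    apply: (@summableMb _ _ _ _ 1) => //; first by apply: measurable_indic; exact: measurable_itv.
    by move=> t; rewrite /I indicE ger0_norm// lern1 leq_b1.
  have iq : lam.-integrable setT (EFin \o q) by exact: summable_integrable1.
  have iq1 y : lam.-integrable `]-oo, y] (EFin \o q).
    by apply: integrableS iq => //; exact: measurable_itv.
  have lq : locally_integrable setT q by apply: open_integrable_locally => //; exact: openT.
  have FF : Filter (almost_everywhere lam) by exact: ae_filter_ringOfSetsType.
  apply: (@filterS _ _ FF _ _ _ (FTC1Ny iq1 lq)) => x [dF EF] xk kx.
  set F := (fun y : R => \int[lam]_(t in `]-oo, y]) q t) in dF EF.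
  have FE y : - k%:R < y -> y <= k%:R -> F y = f y - f (- k%:R).
    move=> yk ky; rewrite (gkE k _ _ (lexx _) (ltW yk) ky).
    rewrite /F Rintegral_mkcond; apply: eq_Rintegral => t _; rewrite patchE /q /I !indic_itv_oc.
    rewrite [t \in _](_ : _ = (t <= y)); last by apply/idP/idP => [/set_mem/=|h]; [rewrite in_itv|apply/mem_set; rewrite /= in_itv].
    have [ty|ty] := leP t y; last by rewrite andbF mulr0.
    by rewrite (le_trans ty ky).
  have nF : \forall y \near x, F y + f (- k%:R) = f y.
    near=> y; rewrite FE ?subrK//; near: y; first exact: lt_nbhsr.
    by apply: filterS (lt_nbhsl kx) => z; exact: ltW.
  have d1 : is_derive x 1 (fun y => F y + f (- k%:R)) (q x + 0).
    by apply: is_deriveD; apply: DeriveDef; [exact: dF|rewrite -derive1E; exact: EF].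
  have d2 := near_eq_is_derive nF d1.
  have qx : q x + 0 = gk k x by rewrite addr0 /q /I indic_itv_oc xk (ltW kx) mulr1.
  by rewrite derive1E; split; [rewrite -qx; exact: derive_val|exact: ex_derive].
have DE : {ae lam, forall x, forall k : nat, - k%:R < x -> x < k%:R -> D x = gk k x}.
  have FF : Filter (almost_everywhere lam) by exact: ae_filter_ringOfSetsType.
  apply: (@filterS2 _ _ FF _ _ _ _ fb (ae_foralln AE)) => x fbx H k xk kx; have [E dx] := H k xk kx.
  by rewrite /D (dE _ _ dx E) -E indicE mem_set ?mulr1// /B /= (dE _ _ dx E) -E.
have key (k : nat) a b : - k%:R < a -> a <= b -> b < k%:R -> f b - f a = prim D b - prim D a.
  move=> ka ab bk; rewrite primB// (gkE k _ _ (ltW ka) ab (ltW bk)).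
  apply: Rint_ae.
  - by apply: measurable_funM; [case: (sgk k)|apply: measurable_indic; exact: measurable_itv].
  - by apply: measurable_funM => //; apply: measurable_indic; exact: measurable_itv.
  have FF : Filter (almost_everywhere lam) by exact: ae_filter_ringOfSetsType.
  apply: (@filterS _ _ FF _ _ _ DE) => t H; rewrite indic_itv_oc.
  have [/andP[at_ tb]|_] := boolP (a < t <= b); last by rewrite !mulr0.
  by rewrite (H k) ?(lt_trans ka)// (le_lt_trans tb).
exists D; split => //; apply/funext => s.
pose k := (Num.trunc `|s|).+1; have sk : `|s| < k%:R by exact: truncnS_gt.
move: (sk); rewrite ltr_norml => /andP[s1 s2]; have k0 : 0 < k%:R :> R by rewrite ltr0n.
have [h|/ltW h] := leP 0 s.
  by have := key k 0 s; rewrite f0 prim0 !subr0; apply => //; rewrite oppr_lt0.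
have := key k s 0 s1 h k0; rewrite f0 prim0 !sub0r; exact: oppr_inj.
Unshelve. all: by end_near. Qed.

End lipschitz_primitive.

(** * Young functions *)

Section young_functions.
Variable R : realType.
Local Notation lam := (@lebesgue_measure R).
Implicit Types (A B : R -> \bar R) (s t : R).

(** Convexity on the segment from 0, where [A] vanishes: [A(t)/t] is nondecreasing, in a form valid
    for infinite values. *)
Lemma young_scale A s t : young A -> 0 <= s -> s <= t -> 0 < t -> (A s <= (s / t)%:E * A t)%E.
Proof.
move=> yA s0 st t0; have a01 : 0 <= s / t <= 1 by rewrite divr_ge0 ?(ltW t0)//= ler_pdivrMr// mul1r.
have := young_convex yA (ltW t0) (lexx 0) a01.
by rewrite mulr0 addr0 divfK ?gt_eqF// (young0 yA) mule0 adde0.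
Qed.

Lemma young_nondec A s t : young A -> 0 <= s -> s <= t -> (A s <= A t)%E.
Proof.
move=> yA s0 st; move: (s0); rewrite le_eqVlt => /predU1P[<-|s1].
  by rewrite (young0 yA); apply: (young_ge0 yA); exact: le_trans st.
have t0 := lt_le_trans s1 st; apply: le_trans (young_scale yA s0 st t0) _.
have A0 := young_ge0 yA (ltW t0).
by rewrite -[leRHS]mul1e lee_wpmul2r// lee_fin ler_pdivrMr// mul1r.
Qed.

Lemma young_fin_point B : young B -> exists2 b, 0 < b & (B b < +oo)%E.
Proof.
move=> yB; have [s [t [s0 t0 st]]] := young_non_constant yB.
have [fs|fs] := eqVneq (B s) +oo%E; last by exists s => //; rewrite lt_neqAle fs leey.
exists t => //; rewrite lt_neqAle leey andbT; apply/eqP => ft; apply: st.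
by rewrite fs ft.
Qed.

(** If [A] were infinite at [t], the integrand would vanish on [[t, +oo[], against the divergence at
    infinity. *)
Lemma young_finite n A : (1 < n)%N -> young A -> diverges_at_infinity (Hn_integrand n A) ->
  forall t, 0 <= t -> (A t < +oo)%E.
Proof.
move=> n1 yA div t t0; rewrite lt_neqAle leey andbT; apply/eqP => At.
have t1 : 0 < t.
  by rewrite lt_neqAle t0 andbT; apply/eqP => E; move: At; rewrite -E (young0 yA).
have := div t t1; rewrite (@eq_integral _ _ _ lam _ (cst 0%E)) ?integral0// => s.
rewrite inE/= in_itv/= andbT => ts; rewrite /Hn_integrand.
have -> : A s = +oo%E by apply/eqP; rewrite -leye_eq -At; exact: young_nondec.
by rewrite invey mule0 poweR0r// invr_eq0 pnatr_eq0 -lt0n -ltnS prednK// ltnW.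
Qed.

(** A finite Young function as a nondecreasing function on the whole line; the value 0 at negative
    arguments is the one that [capacity] prescribes. *)
Definition yreal A t : R := if 0 < t then fine (A t) else 0.
Definition ycap n A t : R := (t / yreal A t) `^ (n.-1%:R^-1).

Lemma measurable_ge0_inv (f : R -> R) : measurable_fun setT f -> (forall t, 0 <= f t) ->
  measurable_fun setT (fun t => (f t)^-1).
Proof.
move=> mf f0; under eq_fun do rewrite -powR_inv1//.
exact: (measurableT_comp (measurable_powR (-1)) mf).
Qed.

Lemma lebesgue_measure_scale (c : R) (S : set R) : 0 < c -> measurable S ->
  (c%:E * lam [set x | S (c * x)%R] = lam S)%E.
Proof.
move=> c0 mS.
have ms : measurable_fun [set: measurableTypeR R] (fun x : measurableTypeR R => c * x : measurableTypeR R).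
  exact: measurable_funM.
pose nu := (measure_function_pushforward__canonical__measure_function_Measure lam ms).
pose cn := NngNum (ltW c0).
have := @lebesgue_measure_unique R (mscale cn nu).
move=> /(_ _ S mS) -> // X [[a b] /= ab <-].
rewrite /mscale /nu /= /pushforward.
have -> : (fun x => c * x) @^-1` `]a, b]%classic = `]a / c, b / c]%classic.
  by apply/seteqP; split => x /=; rewrite !in_itv/= ltr_pdivrMr// ler_pdivlMr// [x * c]mulrC.
rewrite !lebesgue_measure_itv/= !lte_fin ltr_pM2r ?invr_gt0//; case: ifPn => [_|_]; last by rewrite mule0.
by rewrite -!EFinD -EFinM; congr EFin; field; rewrite gt_eqF.
Qed.

Lemma ge0_integral_scale (c : R) (f : R -> \bar R) : 0 < c -> measurable_fun setT f ->
  (forall x, 0 <= f x)%E -> (c%:E * \int[lam]_x f (c * x)%R = \int[lam]_x f x)%E.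
Proof.
move=> c0 mf f0.
have ms : measurable_fun [set: measurableTypeR R] (fun x : measurableTypeR R => c * x : measurableTypeR R).
  exact: measurable_funM.
have := @ge0_integral_pushforward _ _ _ _ R _ ms lam setT f measurableT mf (fun x _ => f0 x).
rewrite preimage_setT /= => <-.
pose cn := NngNum (ltW c0).
rewrite -[c]/(cn%:num) -(ge0_integral_mscale _ _ cn)//.
by apply: eq_measure_integral => A mA _; rewrite /mscale /pushforward /= -[RHS](lebesgue_measure_scale c0).
Qed.

End young_functions.

Section young_capacity.
Variables (R : realType) (n : nat) (A : R -> \bar R).
Local Notation lam := (@lebesgue_measure R).
Hypotheses (n1 : (1 < n)%N) (yA : young A) (finA : forall t, 0 <= t -> (A t < +oo)%E)
  (posA : non_degenerate A).
Local Notation al := (yreal A).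
Local Notation h := (ycap n A).

Let n10 : n.-1%:R != 0 :> R.
Proof. by rewrite pnatr_eq0 -lt0n -ltnS prednK// ltnW. Qed.

Lemma yrealE t : 0 <= t -> A t = (al t)%:E.
Proof.
move=> t0; rewrite /yreal; case: ltP => [_|t1].
  by rewrite fineK// ge0_fin_numE ?finA//; exact: young_ge0 yA _ t0.
by have -> : t = 0 by [apply/le_anti; rewrite t0 t1]; rewrite (young0 yA).
Qed.

Lemma yreal_gt0 t : 0 < t -> 0 < al t.
Proof. by move=> t0; rewrite -lte_fin -yrealE ?ltW//; exact: posA. Qed.

Lemma yreal_ge0 t : 0 <= al t.
Proof.
have [t0|t0] := ltP 0 t; first exact: ltW (yreal_gt0 t0).
by rewrite /yreal ltNge t0.
Qed.

Lemma yreal_nondec : {homo al : s t / s <= t}.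
Proof.
move=> s t st; have [s0|s0] := ltP 0 s; last by rewrite {1}/yreal ltNge s0; exact: yreal_ge0.
have t0 := lt_le_trans s0 st.
by rewrite -lee_fin -!yrealE ?(ltW t0) ?(ltW s0)//; exact: (young_nondec yA (ltW s0) st).
Qed.

Lemma yreal_ratio s t : 0 < s -> s <= t -> t / al t <= s / al s.
Proof.
move=> s0 st; have t0 := lt_le_trans s0 st.
have := young_scale yA (ltW s0) st t0; rewrite (yrealE (ltW s0)) (yrealE (ltW t0)) -EFinM lee_fin => H.
rewrite ler_pdivrMr ?yreal_gt0// mulrAC ler_pdivlMr ?yreal_gt0//.
move: H; rewrite mulrAC ler_pdivlMr// => H.
by rewrite mulrC [X in _ <= X](_ : _ = s * al t)//; lra.
Qed.

Lemma ycapE t : 0 <= t -> Hn_integrand n A t = (h t)%:E.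
Proof.
rewrite le_eqVlt => /predU1P[<-|t0]; rewrite /Hn_integrand /ycap.
  by rewrite mul0e mul0r poweR0r ?invr_eq0// powR0// invr_eq0.
by rewrite yrealE ?ltW// inver gt_eqF ?yreal_gt0// -EFinM poweR_EFin.
Qed.

Lemma ycap_ge0 t : 0 <= h t.
Proof. exact: powR_ge0. Qed.

Lemma measurable_ycap : measurable_fun setT h.
Proof.
have ma : measurable_fun setT al by apply: nondecreasing_measurable => //; exact: yreal_nondec.
apply: (@measurableT_comp _ _ _ _ _ _ (fun x : R => x `^ (n.-1%:R^-1)) _ (fun t : R => t / al t)).
  exact: measurable_powR.
by apply: measurable_funM => //; apply: measurable_ge0_inv => // t; exact: yreal_ge0.
Qed.

Lemma ycap_noninc s t : 0 < s -> s <= t -> h t <= h s.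
Proof.
move=> s0 st; have t0 := lt_le_trans s0 st.
rewrite /ycap ge0_ler_powR ?invr_ge0 ?nnegrE ?divr_ge0 ?yreal_ge0 ?(ltW t0) ?(ltW s0)//.
exact: yreal_ratio.
Qed.

Lemma ycap_gt0 s : 0 < s -> 0 < h s.
Proof. by move=> s0; rewrite /ycap powR_gt0// divr_gt0// yreal_gt0. Qed.

Lemma Hn_integrand_patch a : Hn_integrand n A \_ `[0, a] = fun x : R => (h x * \1_`]0, a]%classic x)%:E.
Proof.
apply/funext => x; rewrite patchE indic_itv_oc.
rewrite [x \in _](_ : _ = (0 <= x <= a)); last first.
  by apply/idP/idP => [/set_mem/=|H]; [rewrite in_itv|apply/mem_set; rewrite /= in_itv].
rewrite [0 <= x]le_eqVlt; have [<-|x0] := eqVneq 0 x.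
  by rewrite ltxx mulr0 /=; case: ifP => // _; rewrite ycapE// /ycap mul0r powR0// invr_eq0.
by case: ifP => [/andP[x1 _]|_]; rewrite ?mulr0// mulr1 ycapE// ltW.
Qed.

(** Convergence at zero gives summability on []0, a]]; beyond [a] the nonincreasing [h] is at most
    [h a]. *)
Lemma ycap_capacity : converges_at_zero (Hn_integrand n A) -> capacity n al h.
Proof.
move=> [a a0 Ha]; split.
- exact: yreal_nondec.
- by move=> s s0; rewrite /yreal ltNge s0.
- exact: ycap_gt0.
- exact: ycap_noninc.
- move=> s s0; rewrite /ycap -powR_mulrn ?powR_ge0// -powRrM mulVf// powRr1 ?divr_ge0 ?yreal_ge0 ?ltW//.
  by rewrite divfK// gt_eqF// yreal_gt0.
- exact: measurable_ycap.
move=> t.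
have mI (x y : R) : measurable_fun setT (\1_`]x, y]%classic : measurableTypeR R -> R).
  by apply: measurable_indic; exact: measurable_itv.
have sa : summable_fun lam (fun s => h s * \1_`]0, a]%classic s).
  split; first by apply: measurable_funM; [exact: measurable_ycap|exact: mI].
  apply: le_lt_trans Ha; rewrite [leRHS]integral_mkcond Hn_integrand_patch le_eqVlt; apply/orP; left; apply/eqP.
  by apply: eq_integral => s _; rewrite ger0_norm// mulr_ge0// ycap_ge0.
apply: (@summable_le _ _ R lam _ (fun s : measurableTypeR R => h s * \1_`]0, a]%classic s + h a * \1_`]a, t]%classic s)).
- by apply: measurable_funM; [exact: measurable_ycap|exact: mI].
- move=> s; rewrite !indic_itv_oc ger0_norm ?mulr_ge0 ?ycap_ge0//.
  have [/andP[s0 st]|_] := boolP (0 < s <= t); last by rewrite mulr0 addr_ge0 ?mulr_ge0 ?ycap_ge0.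
  rewrite s0 st /= andbT; have [sa'|sa'] := leP s a; first by rewrite lerDl mulr_ge0 ?ycap_ge0.
  by rewrite mulr0 add0r !mulr1 ycap_noninc// ltW.
- by apply: summableD => //; apply: summableZ; exact: summable_itv.
Qed.

(** Raising [H_n], the power [(n-1)/n] of [cap_int h], to the power [n] leaves integer exponents
    only, so that no roots appear in the comparison with [T]. *)
Lemma Hn_ycap s : converges_at_zero (Hn_integrand n A) -> Hn n A s ^+ n = cap_int h s ^+ n.-1.
Proof.
move=> /ycap_capacity C.
have G0 : 0 <= cap_int h s by apply: Rintegral_ge0 => x _; rewrite mulr_ge0 ?ycap_ge0.
rewrite /Hn (_ : (\int[_]_(t in _) _ = (cap_int h s)%:E)%E); last first.
  rewrite [LHS]integral_mkcond Rint_EFin; last exact: cap_summable C s.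
  by rewrite Hn_integrand_patch.
rewrite poweR_EFin /= -powR_mulrn ?powR_ge0// -powRrM -[RHS]powR_mulrn//; congr (_ `^ _).
by rewrite /conjugate_exponent invf_div divfK// pnatr_eq0 -lt0n ltnW.
Qed.

(** A bound on the integrals up to every integer would pass, by Fatou, to the integral over the
    half-line. *)
Lemma cap_int_unbounded : diverges_at_infinity (Hn_integrand n A) -> converges_at_zero (Hn_integrand n A) ->
  forall c : R, exists2 t, 0 < t & c <= cap_int h t.
Proof.
move=> div conv c; have C := ycap_capacity conv; apply: contrapT => H.
have Hc (k : nat) : cap_int h k.+1%:R <= c.
  by rewrite leNgt; apply/negP => ck; apply: H; exists k.+1%:R => //; exact: ltW.
have mhI (t : R) : measurable_fun setT (fun s => (h s * \1_`]0, t]%classic s)%:E).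
  by apply/measurable_EFinP; have [] := cap_summable C t.
pose g s : \bar R := (h s * \1_[set x : R | 0 < x] s)%:E.
have mg : measurable_fun setT g.
  apply/measurable_EFinP; apply: measurable_funM; first exact: measurable_ycap.
  by apply: measurable_indic; exact: measurable_lt_set.
have : (\int[lam]_s g s <= c%:E)%E.
  apply: (@fatou_le _ _ _ lam (fun (k : nat) s => (h s * \1_`]0, k.+1%:R]%classic s)%:E)).
  - by move=> k; exact: mhI.
  - by move=> k s; rewrite lee_fin mulr_ge0 ?ycap_ge0.
  - apply: aeW => s; apply: cvg_near_cst.
    exists (Num.trunc s) => // k /= sk; rewrite /g indic_itv_oc indicE.
    congr (_ * _)%:E; congr (nat_of_bool _)%:R; rewrite [RHS](_ : _ = (0 < s)); last first.
      by apply/idP/idP => [/set_mem|/mem_set].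
    rewrite (_ : s <= k.+1%:R) ?andbT// ltW// (lt_le_trans (truncnS_gt s))// ler_nat //.
  - exact: mg.
  - by move=> k; rewrite -Rint_EFin ?lee_fin ?Hc//; exact: cap_summable C _.
have [a a0 _] : exists2 a : R, 0 < a & True by exists 1.
have : (\int[lam]_(t in `[a, +oo[) Hn_integrand n A t <= \int[lam]_s g s)%E.
  have -> : (\int[lam]_(t in `[a, +oo[) Hn_integrand n A t = \int[lam]_s (h s * \1_[set x | a <= x] s)%:E)%E.
    rewrite integral_mkcond; apply: eq_integral => s _; rewrite patchE indicE.
    have [sa|sa] := leP a s.
      rewrite !mem_set//= ?in_itv/= ?sa// mulr1 ycapE//; exact: le_trans (ltW a0) sa.
    by rewrite !memNset ?mulr0//= ?in_itv/= ?andbT leNgt sa.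
  apply: ge0_le_integralT.
  - apply/measurable_EFinP; apply: measurable_funM; first exact: measurable_ycap.
    by apply: measurable_indic; exact: measurable_le_set.
  - exact: mg.
  - by move=> s; rewrite lee_fin mulr_ge0 ?ycap_ge0.
  move=> s; rewrite lee_fin ler_wpM2l ?ycap_ge0// !indicE ler_nat.
  have [sa|sa] := leP a s; first by rewrite [in X in (_ <= X)%N]mem_set ?leq_b1//= (lt_le_trans a0).
  by rewrite memNset//= leNgt sa.
by rewrite div// => H1 /(le_trans H1); rewrite leye_eq.
Qed.

End young_capacity.

Section capacity_inverse.
Variables (R : realType) (n : nat) (al h : R -> R).
Local Notation lam := (@lebesgue_measure R).
Hypotheses (n1 : (1 < n)%N) (C : capacity n al h).
Local Notation G := (cap_int h).

Lemma cap_int0 : G 0 = 0.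
Proof.
rewrite /cap_int; under eq_Rintegral => s _.
  rewrite indic_itv_oc (_ : 0 < s <= 0 = false); last first.
    by apply/negP => /andP[a b]; have := lt_le_trans a b; rewrite ltxx.
  rewrite mulr0; over.
by rewrite Rintegral_cst// mul0r.
Qed.

Lemma cap_intB s t : 0 <= s -> s <= t -> h t * (t - s) <= G t - G s.
Proof.
rewrite le_eqVlt => /predU1P[<-|s0] st.
  rewrite cap_int0 !subr0; move: st; rewrite le_eqVlt => /predU1P[<-|t0]; first by rewrite mulr0 cap_int0.
  by rewrite mulrC; exact: (cap_int_ge C t0).
have t0 := lt_le_trans s0 st.
rewrite -(Rint_itv st) -RintZ; last exact: summable_itv.
rewrite /cap_int -RintB; [|exact: cap_summable C t|exact: cap_summable C s].
apply: Rint_le; [by apply: summableZ; exact: summable_itv|by apply: summableB; exact: cap_summable C _|].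
move=> r; rewrite -mulrBr !indic_itv_oc; have [r0|r0] := ltP 0 r; last first.
  by rewrite /= subrr mulr0 [s < r]ltNge (le_trans r0 (ltW s0)) mulr0.
have [rs|sr] := leP r s => /=; first by rewrite (le_trans rs st) subrr !mulr0.
have [rt|rt] := leP r t; last by rewrite subrr !mulr0.
by rewrite subr0 !mulr1; exact: (cap_noninc C r0 rt).
Qed.

Lemma cap_int_lt s t : 0 <= s -> s < t -> G s < G t.
Proof.
move=> s0 st; rewrite -subr_gt0; apply: lt_le_trans (cap_intB s0 (ltW st)).
by rewrite mulr_gt0 ?subr_gt0//; apply: (cap_gt0 C); exact: le_lt_trans st.
Qed.

Lemma cap_int_ge0 t : 0 <= t -> 0 <= G t.
Proof.
rewrite le_eqVlt => /predU1P[<-|t0]; first by rewrite cap_int0.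
by rewrite -cap_int0 ltW// cap_int_lt.
Qed.

Lemma cap_int_le s t : 0 <= s -> s <= t -> G s <= G t.
Proof. by move=> s0; rewrite le_eqVlt => /predU1P[->//|st]; rewrite ltW// cap_int_lt. Qed.

Lemma cap_int_continuous b : 0 <= b -> {within `[0, b], continuous G}.
Proof.
move=> b0; have sb := cap_summable C b.
pose q (t : measurableTypeR R) := h t * \1_`]0, b]%classic t.
have ih : lam.-integrable `[0, b]%classic (EFin \o q).
  by apply: (@integrableS _ _ _ _ setT) => //; exact: summable_integrable1.
have := @parameterized_integral_continuous R 0 b q b0 ih.
apply: subspace_eq_continuous => t; rewrite inE/= in_itv/= => /andP[t0 tb].
rewrite /from_subspace /parameterized_integral -Rintegral_itv_obnd_cbnd.
  rewrite Rintegral_mkcond; apply: eq_Rintegral => r _; rewrite patchE /q !indic_itv_oc.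
  rewrite [r \in _](_ : _ = (0 < r <= t)); last first.
    by apply/idP/idP => [/set_mem/=|H]; [rewrite in_itv|apply/mem_set; rewrite /= in_itv].
  have [/andP[-> rt]|_] := boolP (0 < r <= t); last by rewrite mulr0.
  by rewrite (le_trans rt tb).
by apply: (@integrableS _ _ _ _ setT) => //; exact: summable_integrable1.
Qed.

(** [T] is the inverse of [H_n], extended by 0: the intermediate value theorem applies to the
    continuous unbounded [G], and strict monotonicity of [G] makes [T] monotone. *)
Lemma capacity_inverse : (forall c, exists2 t, 0 < t & c <= G t) -> exists T : R -> R, [/\ {homo T : s t / s <= t}, forall s, 0 < s -> 0 < T s,
  forall s, s <= 0 -> T s = 0 & forall s, 0 < s -> G (T s) ^+ n.-1 = s ^+ n].
Proof.
move=> G_unbounded; have n10 : n.-1%:R != 0 :> R by rewrite pnatr_eq0 -lt0n -ltnS prednK// ltnW.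
have ex (s : R) : exists t, (s <= 0 -> t = 0) /\ (0 < s -> 0 < t /\ G t ^+ n.-1 = s ^+ n).
  have [s0|s0] := ltP 0 s; last by exists 0; split.
  pose y := (s ^+ n) `^ (n.-1%:R^-1).
  have y0 : 0 < y by rewrite powR_gt0// exprn_gt0.
  have yE : y ^+ n.-1 = s ^+ n.
    by rewrite -powR_mulrn ?powR_ge0// -powRrM mulVf// powRr1// exprn_ge0// ltW.
  have [b b0 yb] := G_unbounded y.
  have [|t] := @IVT R G 0 b y (ltW b0) (cap_int_continuous (ltW b0)).
    by rewrite cap_int0 ge_min le_max (ltW y0) yb orbT.
  rewrite in_itv/= => /andP[t0 tb] Gt; exists t; split => // _; split; last by rewrite Gt.
  rewrite lt_neqAle t0 andbT; apply/eqP => t0'; move: Gt y0; rewrite -t0' cap_int0 => <-.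
  by rewrite ltxx.
have [T TP] := choice ex; exists T; split => [s t st|s s0|s s0|s s0].
- have [s0|s0] := ltP 0 s; last first.
    rewrite (TP s).1//; have [t0|t0] := ltP 0 t; last by rewrite (TP t).1.
    by have [/ltW] := (TP t).2 t0.
  have t0 := lt_le_trans s0 st; have [Ts GTs] := (TP s).2 s0; have [Tt GTt] := (TP t).2 t0.
  rewrite leNgt; apply/negP => /(cap_int_lt (ltW Tt)) H.
  have : G (T t) ^+ n.-1 < G (T s) ^+ n.-1.
    by rewrite ltrXn2r ?nnegrE ?cap_int_ge0 ?ltW// -lt0n -ltnS prednK// ltnW.
  by rewrite GTt GTs ltNge lerXn2r ?nnegrE ?(ltW s0) ?(ltW t0).
- by have [] := (TP s).2 s0.
- exact: (TP s).1.
- by have [] := (TP s).2 s0.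
Qed.

(** Since [h] is nonincreasing, [G(c t) <= c G(t)], so [H_n] grows at most linearly under dilation
    and its inverse at least linearly. A factor inside a Young function can thus be moved inside
    [T]. *)
Lemma capacity_inverse_scale (T : R -> R) (c : R) : (forall s, 0 < s -> 0 < T s) ->
  (forall s, s <= 0 -> T s = 0) -> (forall s, 0 < s -> G (T s) ^+ n.-1 = s ^+ n) ->
  1 <= c -> forall s, 0 <= s -> c * T s <= T (c * s).
Proof.
move=> T0 Tn TE c1 s; rewrite le_eqVlt => /predU1P[<-|s0]; first by rewrite mulr0 Tn// mulr0.
have c0 : 0 < c by exact: lt_le_trans c1.
have Ts := T0 s s0; have cs : 0 < c * s by rewrite mulr_gt0.
have n10 : (0 < n.-1)%N by rewrite -ltnS prednK// ltnW.
have GcT : G (c * T s) <= c * G (T s).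
  have st : T s <= c * T s by rewrite ler_peMl// ltW.
  have up : G (c * T s) - G (T s) <= h (T s) * (c * T s - T s).
    rewrite -(Rint_itv st) -RintZ; last exact: summable_itv.
    rewrite /cap_int -RintB; [|exact: cap_summable C _|exact: cap_summable C _].
    apply: Rint_le; [by apply: summableB; exact: cap_summable C _|by apply: summableZ; exact: summable_itv|].
    move=> r; rewrite -mulrBr !indic_itv_oc; have [r0|r0] := ltP 0 r; last first.
      by rewrite /= subrr mulr0 [T s < r]ltNge (le_trans r0 (ltW Ts)) mulr0.
    have [rs|sr] := leP r (T s) => /=; first by rewrite (le_trans rs st) subrr !mulr0.
    have [rt|rt] := leP r (c * T s); last by rewrite subrr !mulr0.
    by rewrite subr0 !mulr1; exact: (cap_noninc C Ts (ltW sr)).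
  have := cap_int_ge C Ts => H.
  have : (c - 1) * (T s * h (T s)) <= (c - 1) * G (T s) by rewrite ler_wpM2l// subr_ge0.
  by move: up; lra.
rewrite leNgt; apply/negP => /(cap_int_lt (ltW (T0 _ cs))) H.
have : G (T (c * s)) ^+ n.-1 < (c * G (T s)) ^+ n.-1.
  rewrite ltrXn2r ?nnegrE ?mulr_ge0 ?cap_int_ge0 ?(ltW c0) ?(ltW (T0 _ _))// -?lt0n//.
  exact: lt_le_trans H GcT.
rewrite TE// !exprMn TE// ltNge ler_wpM2r ?exprn_ge0 ?(ltW s0)//.
by rewrite ler_weXn2l// leq_pred.
Qed.

End capacity_inverse.

(** * Consequences of the growth condition *)

Section embedding_data.
Variables (R : realType) (n : nat).
Implicit Types (A B Ah : R -> \bar R) (E : R -> R).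

(* [slack] is false in the case where the inequality between A and B holds for every t >= 0
   and Ah = A; otherwise additive constants are allowed, and harmless on sets of finite measure. *)
Lemma embedding_data (slack : bool) A Ah B E (t0 t1 c : R) : (1 < n)%N -> young A -> young B -> young Ah ->
  (forall t, 0 <= t -> (A t < +oo)%E) -> (forall t, 0 <= t -> (Ah t < +oo)%E) ->
  non_degenerate A -> non_degenerate Ah -> converges_at_zero (Hn_integrand n Ah) ->
  diverges_at_infinity (Hn_integrand n Ah) ->
  (forall s, 0 <= s -> 0 <= E s) -> {in `[0, +oo[ &, {homo E : s t / s <= t}} ->
  0 <= t0 -> 0 <= t1 -> 1 <= c -> (slack || (t0 == 0) && (t1 == 0)) ->
  (forall t, t0 <= t -> (B (t * E (Hn n Ah t))%R <= A t)%E) ->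
  (forall t, t1 <= t -> (A t <= Ah (c * t)%R)%E /\ (Ah t <= A (c * t)%R)%E) ->
  exists al h T c0, [/\ capacity n al h,
    [/\ {homo T : s t / s <= t}, forall s, 0 < s -> 0 < T s, T 0 = 0 &
      forall s, 0 < s -> cap_int h (T s) ^+ n.-1 <= s ^+ n],
    0 <= c0 /\ (~~ slack -> c0 = 0),
    (forall tau s, 0 <= tau -> 0 <= s -> (B (tau * E s)%R <= (yreal A tau + al (T (c * s)%R) + c0)%:E)%E) &
    forall d, 0 < d -> exists2 C, 0 <= C & forall t, 0 <= t -> al t <= C * yreal A (c * t) + d * slack%:R].
Proof.
move=> n1 yA yB yAh fA fAh pA pAh conv div E0 Emon t00 t10 c1 sl HB HE.
have n0 := ltnW n1; have c0 := lt_le_trans ltr01 c1.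
pose al := yreal Ah; pose h := ycap n Ah.
have C : capacity n al h := ycap_capacity n1 yAh fAh pAh conv.
have [T [Tnd T0 Tn TE]] := capacity_inverse n1 C (cap_int_unbounded n1 yAh fAh pAh div conv).
have Tge s : 0 <= T s by have [/T0/ltW//|/Tn->] := ltP 0 s.
have a_mon := yreal_nondec yA fA pA; have a0 := yreal_ge0 yA fA pA.
exists al, h, T, (yreal A t0 + yreal A t1); split.
- exact: C.
- by split => //; [exact: Tn|move=> s /TE ->].
- split; first exact: addr_ge0.
  by move=> nsl; move: sl; rewrite (negbTE nsl)/= => /andP[/eqP-> /eqP->]; rewrite /yreal ltxx addr0.
- move=> tau s tau0 s0.
  (* At [tm] the growth condition applies, [s <= H_n(tm)] because [tm >= T s], and [tau <= tm].
     Hence [tau E(s) <= tm E(H_n(tm))], and [A(tm)] is at most the sum of the values of [A] at the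
     three points. *)
  pose tm := Num.max t0 (Num.max (T s) tau).
  have tm0 : t0 <= tm by rewrite le_max lexx.
  have tmT : T s <= tm by rewrite !le_max lexx orbT.
  have tmt : tau <= tm by rewrite !le_max lexx !orbT.
  have tmge : 0 <= tm := le_trans t00 tm0.
  have Hge : 0 <= Hn n Ah tm.
    by rewrite /Hn fine_ge0// poweR_ge0.
  have sH : s <= Hn n Ah tm.
    move: (s0); rewrite le_eqVlt => /predU1P[<-//|s1].
    rewrite leNgt; apply/negP => H.
    have : Hn n Ah tm ^+ n < s ^+ n by rewrite ltrXn2r ?nnegrE// -lt0n.
    rewrite (Hn_ycap n1 yAh fAh pAh _ conv) -TE// ltNge lerXn2r ?nnegrE ?(cap_int_ge0 C)//.
    exact: (cap_int_le C).
  have Es : E s <= E (Hn n Ah tm) by apply: Emon => //; rewrite in_itv/= andbT.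
  apply: (@le_trans _ _ (B (tm * E (Hn n Ah tm))%R)).
    apply: (young_nondec yB); first by rewrite mulr_ge0// E0.
    by apply: ler_pM => //; exact: E0.
  apply: le_trans (HB _ tm0) _; rewrite (yrealE yA fA tmge) lee_fin.
  (* Above [t1], passing from [A] to [Ah] costs a factor [c], which moves inside [T]; below [t1] it
     costs the constant [A(t1)]. *)
  have ATs : yreal A (T s) <= al (T (c * s)) + yreal A t1.
    have [H|H] := leP t1 (T s); last by apply: ler_wpDl; [exact: yreal_ge0|exact: a_mon (ltW H)].
    have [H1 _] := HE _ H.
    apply: ler_wpDr => //; apply: (@le_trans _ _ (al (c * T s))).
      rewrite -lee_fin -(yrealE yA fA (Tge s)) -(yrealE yAh fAh)//.
      by rewrite mulr_ge0// ltW.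
    by apply: (yreal_nondec yAh fAh pAh); exact: (capacity_inverse_scale n1 C T0 Tn TE).
  have : yreal A tm <= yreal A t0 + yreal A (T s) + yreal A tau.
    have mx x y : yreal A (Num.max x y) <= yreal A x + yreal A y.
      by have [_|_] := leP x y; rewrite ?lerDl ?lerDr a0.
    by rewrite /tm -addrA; apply: le_trans (mx _ _) _; rewrite lerD2l.
  by move=> H; apply: (le_trans H); lra.
move=> d d0; case: slack sl => [_|/andP[_ /eqP t1E]]; last first.
  exists 1 => // t tge; have tt1 : t1 <= t by rewrite t1E.
  have [_] := HE t tt1.
  rewrite mul1r mulr0 addr0 -lee_fin -(yrealE yA fA)// ?mulr_ge0 ?(ltW c0)//.
  by rewrite -(yrealE yAh fAh).
have al1 := yreal_gt0 yAh fAh pAh ltr01; have alge := yreal_ge0 yAh fAh pAh.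
(* Three ranges of [t]: above [t1] the equivalence applies; below [td] convexity gives [al t <= d],
   since [al t <= t al(1)] there; in between [al(t1)] is compared with the positive number
   [A(c td)]. *)
pose td := Num.min 1 (d / al 1).
have td0 : 0 < td by rewrite lt_min ltr01 divr_gt0.
have Atd : 0 < yreal A (c * td) by apply: (yreal_gt0 yA fA pA); rewrite mulr_gt0.
exists (1 + al t1 / yreal A (c * td)); first by rewrite addr_ge0// divr_ge0// ltW.
move=> t tge; rewrite mulr1.
have P1 : 0 <= al t1 / yreal A (c * td) by rewrite divr_ge0// ltW.
have P2 := a0 (c * t).
have P3 : 0 <= al t1 / yreal A (c * td) * yreal A (c * t) by exact: mulr_ge0.
rewrite mulrDl mul1r.
have [tt1|tt1] := leP t1 t.
  have [_ H] := HE _ tt1.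
  have : al t <= yreal A (c * t).
    by rewrite -lee_fin -(yrealE yA fA) ?mulr_ge0 ?(ltW c0)// -(yrealE yAh fAh).
  by move: d0 P3; lra.
have [ttd|ttd] := leP t td; last first.
  have A1 : al t <= al t1 by apply: (yreal_nondec yAh fAh pAh); exact: ltW.
  have A2 : yreal A (c * td) <= yreal A (c * t) by apply: a_mon; rewrite ler_wpM2l ?ltW.
  have : al t1 <= al t1 / yreal A (c * td) * yreal A (c * t).
    by rewrite mulrAC ler_pdivlMr// ler_wpM2l.
  by move: d0 P2 A1; lra.
have : al t <= d.
  move: (tge); rewrite le_eqVlt => /predU1P[<-|t_0]; first by rewrite /al /yreal ltxx ltW.
  have tone : t <= 1 by apply: le_trans ttd _; rewrite ge_min lexx.
  have := young_scale yAh tge tone ltr01; rewrite divr1 (yrealE yAh fAh tge) (yrealE yAh fAh ler01) -EFinM lee_fin.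
  move=> /le_trans; apply; rewrite -ler_pdivlMr//; apply: le_trans ttd _; by rewrite ge_min lexx orbT.
by move: P2 P3; lra.
Qed.

End embedding_data.

(** * Chain rule for locally bounded derivatives *)

Section layers.
Context {R : realType} {n : nat}.
Local Notation V := 'rV[R]_n.
Local Notation m := (borel_lebesgue R n).
Local Notation lam := (@lebesgue_measure R).
Implicit Types (u w : V -> R) (g : 'I_n -> V -> R) (D : R -> R).

Lemma layer_sum (d y : R) N : 0 < d ->
  Num.min (Num.max 0 y) (d * N%:R) <= \sum_(j < N) d * (nat_of_bool (d * j%:R <= y)%R)%:R.
Proof.
move=> d0; elim: N => [|N IH]; first by rewrite big_ord0 mulr0 ge_min lexx orbT.
rewrite big_ord_recr/=; have [H|H] := leP (d * N%:R) y.
  have y0 : 0 <= y by apply: le_trans H; rewrite mulr_ge0// ltW.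
  move: IH; rewrite max_r// [X in X <= _ -> _]min_r// => IH.
  apply: le_trans (lerD IH (lexx _)); rewrite mulr1 -natr1 mulrDr mulr1 ge_min lexx orbT//.
rewrite mulr0 addr0; apply: le_trans IH; rewrite le_min ge_min lexx/= ge_min.
by apply/orP; left; rewrite ge_max (ltW H) mulr_ge0// ltW.
Qed.

(* Summing the isoperimetric inequality over layers of thickness d gives an L^1 bound. *)
Lemma layer_bound w g (a d l : R) : (0 < n)%N -> (forall i, wder i w (g i)) -> 0 <= a -> 0 < d -> 0 < l ->
  (m [set x | (a < `|w x|)%R] <= (l ^+ n)%:E)%E ->
  (\int[m]_x (Num.max 0 (`|w x| - (a + d)))%:E <=
   (2 ^+ n.+1 * l)%:E * \int[m]_(x in [set x | (a < `|w x|)%R]) (gnorm g x)%:E)%E.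
Proof.
move=> n0 wg a0 d0 l0 ml.
have [mw _] : loc_summable w by have [] := wg (Ordinal n0).
have mG : measurable_fun setT (fun x => (gnorm g x)%:E).
  by apply/measurable_EFinP; apply: measurable_gnorm => i; have [_ []] := wg i.
have maw : measurable_fun setT (fun x => `|w x|) by exact: measurableT_comp.
have mT (r : R) : measurable [set x | r <= `|w x|] by exact: measurable_le_set.
have mA (r s : R) : measurable [set x | r < `|w x| <= s].
  rewrite (_ : [set x | _] = [set x | r < `|w x|] `&` [set x | `|w x| <= s]).
    by apply: measurableI; [exact: measurable_lt_set|exact: measurable_le_set].
  by apply/seteqP; split => x /= => [/andP|[-> ->]].
pose b (j : nat) := a + d * j%:R.
have b0 j : a <= b j by rewrite lerDl mulr_ge0// ltW.
have bS j : b j.+1 = b j + d by rewrite /b -natr1; ring.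
pose J (N : nat) : \bar R := (\int[m]_(x in [set x | (a < `|w x| <= b N)%R]) (gnorm g x)%:E)%E.
have gge x : (0 <= (gnorm g x)%:E)%E by rewrite lee_fin gnorm_ge0.
have step N : (\sum_(j < N) d%:E * m [set x | (b j.+1 <= `|w x|)%R] <= (2 ^+ n.+1 * l)%:E * J N)%E.
  elim: N => [|N IH].
    by rewrite big_ord0 mule_ge0 ?integral_ge0// lee_fin mulr_ge0 ?exprn_ge0// ltW.
  have -> : J N.+1 = (J N + \int[m]_(x in [set x | (b N < `|w x| <= b N.+1)%R]) (gnorm g x)%:E)%E.
    rewrite /J -ge0_integral_setU//.
    - congr (integral _ _ _); apply/seteqP; split => x /=.
        by move=> /andP[-> ->]; have [?|?] := leP `|w x| (b N); [left|right].
      move=> [/andP[-> H]|/andP[H ->]]; last by rewrite (le_lt_trans (b0 N) H).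
      by rewrite (le_trans H)// bS lerDl ltW.
    - exact: measurable_funS mG.
    - apply/disj_set2P; apply/seteqP; split => x //= -[/andP[_ A] /andP[B _]].
      by have := le_lt_trans A B; rewrite ltxx.
  rewrite big_ord_recr/= muleDr ?ge0_adde_def ?inE ?integral_ge0//.
  apply: leeD => //.
  have := isoperimetric n0 wg (le_trans a0 (b0 N)) (_ : b N < b N.+1) l0 (_ : (m _ <= _)%E).
  rewrite {2}bS addrC addKr; apply; first by rewrite bS ltrDl.
  apply: le_trans ml; apply: le_measure; rewrite ?inE; [exact: measurable_lt_set|exact: measurable_lt_set|].
  by move=> x /=; exact: le_lt_trans.
pose f (N : nat) x : \bar R := (Num.min (Num.max 0 (`|w x| - (a + d))) (d * N%:R))%:E.
have mm : measurable_fun setT (fun x => Num.max 0 (`|w x| - (a + d))).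
  by apply: measurable_maxr => //; exact: measurable_funB.
apply: (@fatou_le _ _ _ m f).
- by move=> N; apply/measurable_EFinP; apply: measurable_minr.
- by move=> N x; rewrite lee_fin le_min le_max lexx/= mulr_ge0// ltW.
- apply: aeW => x; apply: cvg_near_cst; set y := Num.max _ _.
  exists (Num.trunc (y / d)).+1 => // N /= yN; rewrite /f -/y min_l//.
  rewrite mulrC -ler_pdivrMr//; apply: le_trans (ltW (truncnS_gt _)) _.
  by rewrite ler_nat.
- by apply/measurable_EFinP.
move=> N; apply: (@le_trans _ _ ((2 ^+ n.+1 * l)%:E * J N)%E); last first.
  apply: lee_wpmul2l; first by rewrite lee_fin mulr_ge0 ?exprn_ge0// ltW.
  apply: ge0_subset_integral => //; [exact: measurable_lt_set|exact: measurable_funS mG|].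
  by move=> x /= /andP[].
apply: le_trans (step N).
apply: (@le_trans _ _ (\int[m]_x (\sum_(j < N) d%:E * (\1_[set x | (b j.+1 <= `|w x|)%R] x)%:E))%E).
  apply: ge0_le_integralT.
  - by apply/measurable_EFinP; apply: measurable_minr.
  - apply: emeasurable_sum => j; apply: emeasurable_funM; first exact: measurable_cst.
    exact: measurable_EFin_indic.
  - by move=> x; rewrite lee_fin le_min le_max lexx/= mulr_ge0// ltW.
  move=> x; under eq_bigr do rewrite -EFinM; rewrite sumEFin lee_fin.
  apply: le_trans (layer_sum _ _ d0) _; apply: ler_sum => j _; rewrite indicE.
  have [H|H] := boolP (d * j%:R <= `|w x| - (a + d)); last by rewrite mulr0 mulr_ge0// ltW.
  rewrite mem_set//= bS /b; move: H; lra.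
rewrite ge0_integral_sum//; last 2 first.
- move=> j; apply: emeasurable_funM; first exact: measurable_cst.
  exact: measurable_EFin_indic.
- by move=> j x _; rewrite -EFinM lee_fin mulr_ge0// ltW.
apply: lee_sum => j _; rewrite ge0_integralZlT.
- by apply: lee_wpmul2l; [rewrite lee_fin ltW|rewrite (integral_indicT m (mT _))].
- exact: measurable_EFin_indic.
- by move=> x; rewrite lee_fin.
- by rewrite lee_fin ltW.
Qed.

End layers.

Section truncation.
Variable R : realType.
Local Notation lam := (@lebesgue_measure R).
Implicit Types (D : R -> R) (s t : R).

Definition trunc_fun (k : nat) D t : R := D t * \1_[set s : R | `|s| <= k%:R] t.

(** The sign compensates that of [kern]: [prim (sgn_fun D) s] is the integral of [|D|] over the
    interval between 0 and [s], nonnegative for both signs of [s]. *)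
Definition sgn_fun D t : R := `|D t| * (if 0 < t then 1 else -1).

Lemma trunc_funE k D t : `|t| <= k%:R -> trunc_fun k D t = D t.
Proof. by move=> tk; rewrite /trunc_fun indicE mem_set// mulr1. Qed.

Lemma trunc_fun_le k D t : `|trunc_fun k D t| <= `|D t|.
Proof. by rewrite /trunc_fun normrM indicE ler_piMr// ger0_norm// lern1 leq_b1. Qed.

Lemma sgn_fun_norm D t : `|sgn_fun D t| = `|D t|.
Proof. by rewrite /sgn_fun normrM normr_id; case: ifP => _; rewrite ?normrN normr1 mulr1. Qed.

Lemma trunc_bounded k D : locally_bounded D -> bounded_measurable (trunc_fun k D).
Proof.
move=> [mD bD]; split.
  apply: measurable_funM => //; apply: measurable_indic; apply: measurable_le_set => //.
have [C HC] := bD k%:R; exists (Num.max 0 C) => t; rewrite /trunc_fun indicE le_max.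
have [tk|tk] := pselect (`|t| <= k%:R); last by rewrite memNset// mulr0 normr0 lexx.
by rewrite mem_set// mulr1 HC// orbT.
Qed.

Lemma sgn_locally_bounded D : locally_bounded D -> locally_bounded (sgn_fun D).
Proof.
move=> [mD bD]; split; last first.
  by move=> r; have [C HC] := bD r; exists C => s /HC; rewrite sgn_fun_norm.
apply: measurable_funM; first exact: measurableT_comp.
rewrite (_ : (fun t : R => _) = fun t => 2 * \1_[set t : R | 0 < t] t - 1).
  apply: measurable_funB => //; apply: measurable_funM => //.
  by apply: measurable_indic; exact: measurable_lt_set.
apply/funext => t; rewrite indicE; case: ifP => t0; first by rewrite mem_set// mulr1; lra.
by rewrite memNset ?mulr0 ?sub0r//= t0.
Qed.

Lemma kern_norm s t : (if 0 < t then 1 else -1) * kern s t = `|kern s t|.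
Proof.
rewrite /kern !indic_itv_oc; have [t0|t0] := ltP 0 t => /=.
  by rewrite andbF subr0 mul1r ger0_norm.
by rewrite andbT sub0r mulrN mulN1r opprK normrN ger0_norm.
Qed.

Lemma kern_out s t : `|s| < `|t| -> kern s t = 0.
Proof.
move=> st; rewrite /kern !indic_itv_oc.
have -> : (0 < t <= s) = false.
  apply/negP => /andP[h1 h2]; move: st; rewrite (gtr0_norm h1) ltNge => /negP; apply.
  by rewrite gtr0_norm// (lt_le_trans h1).
have -> : (s < t <= 0) = false; last exact: subrr.
apply/negP => /andP[h1 h2]; move: st; rewrite (ler0_norm h2) ltNge => /negP; apply.
by rewrite ler0_norm ?lerN2 ?(ltW h1)// (le_trans (ltW h1)).
Qed.

Lemma prim_trunc k D s : `|s| <= k%:R -> prim (trunc_fun k D) s = prim D s.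
Proof.
move=> sk; apply: eq_Rintegral => t _; have [ts|st] := leP `|t| `|s|.
  by rewrite trunc_funE// (le_trans ts sk).
by rewrite kern_out// !mulr0.
Qed.

Lemma prim_sgn_ge D s : locally_bounded D -> `|prim D s| <= prim (sgn_fun D) s.
Proof.
move=> lD; have ss := kern_summable s lD; apply: le_trans (Rint_abs ss) _.
apply: Rint_le; [exact: summable_abs|exact: kern_summable (sgn_locally_bounded lD)|].
by move=> t; rewrite normrM /sgn_fun -mulrA kern_norm.
Qed.

Lemma prim_sgn_le D1 D2 s : locally_bounded D1 -> locally_bounded D2 -> (forall t, `|D1 t| <= `|D2 t|) ->
  prim (sgn_fun D1) s <= prim (sgn_fun D2) s.
Proof.
move=> l1 l2 D12; apply: Rint_le; [exact: kern_summable (sgn_locally_bounded l1)|exact: kern_summable (sgn_locally_bounded l2)|].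
by move=> t; rewrite /sgn_fun -!mulrA kern_norm ler_wpM2r.
Qed.

Lemma prim_sgn_unit D C : locally_bounded D -> (forall t, `|t| <= 1 -> `|D t| <= C) ->
  forall s, `|s| <= 1 -> prim (sgn_fun D) s <= C.
Proof.
move=> lD DC s s1; have C0 : 0 <= C by apply: le_trans (DC 0 _); rewrite ?normr0.
rewrite -(@prim_trunc 1)//; apply: le_trans (ler_norm _) _.
have lS := sgn_locally_bounded lD.
have bT : forall t, `|trunc_fun 1 (sgn_fun D) t| <= C.
  move=> t; rewrite /trunc_fun indicE; have [t1|t1] := pselect (`|t| <= 1).
    by rewrite mem_set// mulr1 sgn_fun_norm DC.
  by rewrite memNset// mulr0 normr0.
apply: le_trans (prim_continuous_bound _ (trunc_bounded 1 lS) bT) _.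
by rewrite ler_piMr.
Qed.

End truncation.

Section chain_rule_locally_bounded.
Context {R : realType} {n : nat}.
Local Notation V := 'rV[R]_n.
Local Notation m := (borel_lebesgue R n).
Implicit Types (u w : V -> R) (g : 'I_n -> V -> R) (D : R -> R).

(** Local summability of [prim D (u)] has to be proved, as only its formal gradient is controlled.
    The primitives of [|D|], truncated to arguments of size at most [k], satisfy the bounded chain
    rule, and the layer bound controls their excess over [a + 1] in [L^1] uniformly in [k]. Fatou
    turns this into a locally summable majorant. *)
Lemma wder_prim u g D : (0 < n)%N -> (forall i, wder i u (g i)) -> locally_bounded D ->
  (m [set x | (1 < `|u x|)%R] < +oo)%E ->
  (forall i, loc_summable (fun x => g i x * D (u x))) ->
  (\int[m]_(x in [set x | (1 < `|u x|)%R]) (gnorm (fun i y => (g i y * D (u y))%R) x)%:E < +oo)%E ->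
  forall i, wder i (fun x => prim D (u x)) (fun x => g i x * D (u x)).
Proof.
move=> n0 ug lD m1 lg fin i; have [mu _] : loc_summable u by have [] := ug (Ordinal n0).
have mg j : measurable_fun setT (g j) by have [_ []] := ug j.
have lS := sgn_locally_bounded lD.
(* Where [|u| <= 1] the primitives are at most [a]; their superlevel sets above [a] thus lie in the
   set [|u| > 1], of finite measure. *)
have [C DC] := lD.2 1; pose a := Num.max 0 C.
have Da t : `|t| <= 1 -> `|D t| <= a by move=> /DC H; rewrite le_max H orbT.
have a0 : 0 <= a by rewrite le_max lexx.
pose P := prim (sgn_fun D); pose Pk (k : nat) := prim (trunc_fun k (sgn_fun D)).
have bk k : bounded_measurable (trunc_fun k (sgn_fun D)) by exact: trunc_bounded.
have mPk k : measurable_fun setT (fun x => Pk k (u x)) by apply: measurableT_comp => //; exact: measurable_prim.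
have PkE k : trunc_fun k (sgn_fun D) = sgn_fun (trunc_fun k D).
  by apply/funext => t; rewrite /trunc_fun /sgn_fun normrM [`|\1__ _|]ger0_norm// mulrAC.
have lk k : locally_bounded (trunc_fun k D) by apply: bounded_locally_bounded; exact: trunc_bounded.
have Pk_ge k s : `|prim (trunc_fun k D) s| <= Pk k s by rewrite /Pk PkE; exact: prim_sgn_ge.
have Pk_le k s : Pk k s <= P s.
  by rewrite /Pk PkE; apply: prim_sgn_le => // t; exact: trunc_fun_le.
have Pk0 k s : 0 <= Pk k s by exact: le_trans (Pk_ge k s).
have Pk1 k s : `|s| <= 1 -> Pk k s <= a by move=> s1; apply: le_trans (Pk_le k s) _; exact: prim_sgn_unit.
have near_trunc (x : V) : exists N : nat, forall k, (N <= k)%N -> `|u x| <= k%:R.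
  exists (Num.trunc `|u x|).+1 => k Nk; apply: le_trans (ltW (truncnS_gt _)) _.
  by rewrite ler_nat.
have cP (x : V) : Pk k (u x) @[k --> \oo] --> P (u x).
  apply: cvg_near_cst; have [N HN] := near_trunc x; exists N => // k /= /HN; exact: prim_trunc.
have mP : measurable_fun setT (fun x => P (u x)).
  by apply: (@measurable_fun_cvg _ _ R setT (fun k x => Pk k (u x))) => // x _; exact: cP.
have [l l0 ml] : exists2 l : R, 0 < l & (m [set x | (1 < `|u x|)%R] <= (l ^+ n)%:E)%E.
  have f1 : m [set x | 1 < `|u x|] \is a fin_num by rewrite ge0_fin_numE.
  have f0 : 0 <= fine (m [set x | 1 < `|u x|]) by rewrite fine_ge0.
  exists (1 + fine (m [set x | 1 < `|u x|])); first by rewrite ltr_wpDr.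
  rewrite -[leLHS]fineK// lee_fin; set c := fine _ in f0 *.
  apply: (@le_trans _ _ (1 + c)); first by rewrite lerDr.
  by rewrite -[leLHS]expr1 ler_weXn2l// lerDl.
set M := (\int[m]_(x in _) _)%E in fin.
have mS : measurable [set x | 1 < `|u x|] by apply: measurable_lt_set => //; exact: measurableT_comp.
have mGD : measurable_fun setT (fun x => (gnorm (fun j y => g j y * D (u y)) x)%:E).
  by apply/measurable_EFinP; apply: measurable_gnorm => j; have [] := lg j.
have bound k : (\int[m]_x (Num.max 0 (Pk k (u x) - (a + 1)))%:E <= (2 ^+ n.+1 * l)%:E * M)%E.
  have wk j : wder j (fun x => Pk k (u x)) (fun x => g j x * trunc_fun k (sgn_fun D) (u x)).
    exact: wder_prim_bounded.
  have sub : [set x | a < `|Pk k (u x)|] `<=` [set x | 1 < `|u x|].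
    move=> x /=; rewrite ger0_norm// !ltNge; apply: contra; exact: Pk1.
  have mSk : measurable [set x | a < `|Pk k (u x)|].
    by apply: measurable_lt_set => //; exact: measurableT_comp.
  have H := @layer_bound R n (fun x => Pk k (u x)) _ a 1 l n0 wk a0 ltr01 l0.
  under eq_integral => x _ do rewrite -[Pk k (u x)]ger0_norm//.
  apply: (le_trans (H _)); first by apply: le_trans ml; apply: le_measure; rewrite ?inE.
  apply: lee_wpmul2l; first by rewrite lee_fin mulr_ge0 ?exprn_ge0// ltW.
  have mk : measurable_fun setT (fun x => (gnorm (fun j y => g j y * trunc_fun k (sgn_fun D) (u y)) x)%:E).
    by apply/measurable_EFinP; apply: measurable_gnorm => j; have [_ []] := wk j.
  apply: (@le_trans _ _ (\int[m]_(x in [set x | (a < `|Pk k (u x)|)%R])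
      (gnorm (fun j y => (g j y * D (u y))%R) x)%:E)%E).
    apply: ge0_le_integral => //.
    - by move=> x _; rewrite lee_fin gnorm_ge0.
    - exact: measurable_funS mk.
    - exact: measurable_funS mGD.
    - move=> x _; rewrite lee_fin; apply: ler_sum => j _; rewrite normrM [leRHS]normrM ler_wpM2l//.
      by rewrite PkE sgn_fun_norm trunc_fun_le.
  apply: ge0_subset_integral => //; first exact: measurable_funS mGD.
  by move=> x _; rewrite lee_fin gnorm_ge0.
pose W x := Num.max 0 (P (u x) - (a + 1)).
have mW : measurable_fun setT W by apply: measurable_maxr => //; exact: measurable_funB.
have sW : summable_fun m W.
  split => //; apply: (@le_lt_trans _ _ ((2 ^+ n.+1 * l)%:E * M)%E); last first.
    by rewrite lte_mul_pinfty// lee_fin mulr_ge0 ?exprn_ge0// ltW.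
  apply: (@fatou_le _ _ _ m (fun k x => (Num.max 0 (Pk k (u x) - (a + 1)))%:E)).
  - by move=> k; apply/measurable_EFinP; apply: measurable_maxr => //; exact: measurable_funB.
  - by move=> k x; rewrite lee_fin le_max lexx.
  - apply: aeW => x; apply: cvg_near_cst; have [N HN] := near_trunc x; exists N => // k /= /HN H.
    by rewrite /W ger0_norm ?le_max ?lexx// /P /Pk prim_trunc.
  - by apply/measurable_EFinP; exact: measurableT_comp.
  - exact: bound.
apply: (@wder_cvg _ _ i (fun k x => prim (trunc_fun k D) (u x)) (fun k x => g i x * trunc_fun k D (u x)) _ _
  (fun x => W x + 1 * (a + 1)) (fun x => `|g i x * D (u x)|)).
- by move=> k; apply: wder_prim_bounded => //; exact: trunc_bounded.
- apply: (@measurable_fun_cvg _ _ R setT (fun k x => prim (trunc_fun k D) (u x))) => //.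
    by move=> k; apply: measurableT_comp => //; apply: measurable_prim; exact: trunc_bounded.
  move=> x _; apply: cvg_near_cst; have [N HN] := near_trunc x; exists N => // k /= /HN; exact: prim_trunc.
- by have [] := lg i.
- by apply: loc_summableD; [exact: summable_loc|exact/loc_summable_bounded/bounded_measurable_cst].
- exact: loc_summable_abs.
- move=> k x; apply: le_trans (Pk_ge k _) _; apply: le_trans (Pk_le k _) _.
  by rewrite mul1r -lerBlDr le_max lexx orbT.
- by move=> k x; rewrite normrM [leRHS]normrM ler_wpM2l// trunc_fun_le.
- move=> x; apply: cvg_near_cst; have [N HN] := near_trunc x; exists N => // k /= /HN; exact: prim_trunc.
- move=> x; apply: cvg_near_cst; have [N HN] := near_trunc x; exists N => // k /= /HN H.
  by rewrite trunc_funE.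
Qed.

End chain_rule_locally_bounded.

(** * Potential estimates *)

Lemma ge0_integral_setU_le d (T : measurableType d) (R : realType) (mu : {measure set T -> \bar R})
    (f : T -> \bar R) (A B : set T) : measurable_fun setT f -> (forall x, 0 <= f x)%E ->
  measurable A -> measurable B ->
  (\int[mu]_(x in A `|` B) f x <= \int[mu]_(x in A) f x + \int[mu]_(x in B) f x)%E.
Proof.
move=> mf f0 mA mB; rewrite (ge0_integral_mkindic mu (A `|` B)) (ge0_integral_mkindic mu A) (ge0_integral_mkindic mu B).
have mI (S : set T) : measurable S -> measurable_fun setT (fun x => (\1_S x)%:E * f x)%E.
  by move=> mS; apply: emeasurable_funM => //; exact: measurable_EFin_indic.
have I0 (S : set T) x : (0 <= (\1_S x)%:E * f x)%E by rewrite mule_ge0// lee_fin.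
rewrite -ge0_integralD//; [|exact: mI|exact: mI].
apply: ge0_le_integralT => //; [exact/mI/measurableU|apply: emeasurable_funD; exact: mI|].
move=> x; rewrite -ge0_muleDl ?lee_fin//; apply: lee_wpmul2r => //; rewrite -EFinD lee_fin !indicE -natrD ler_nat.
by rewrite in_setU; case: (x \in A); case: (x \in B).
Qed.

Section potential.
Context {R : realType} {n : nat}.
Local Notation V := 'rV[R]_n.
Local Notation m := (borel_lebesgue R n).
Implicit Types (u w : V -> R) (g : 'I_n -> V -> R).

Lemma wderZ i u (g : V -> R) (c : R) : wder i u g -> wder i (fun x => c * u x) (fun x => c * g x).
Proof.
move=> wu; have := wder_comb (c - 1) wu wu.
by congr wder; apply/funext => x; ring.
Qed.

Lemma small_integral_tail (f : V -> R) (S : nat -> set V) (M : R) : summable_fun m f -> (forall x, 0 <= f x) ->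
  (forall k, measurable (S k)) -> (forall x, exists N, forall k, (N <= k)%N -> ~ S k x) -> 0 < M ->
  exists k, (\int[m]_(x in S k) (f x)%:E <= M%:E)%E.
Proof.
move=> sf f0 mS SN M0.
have mf k : measurable_fun setT (fun x => f x * \1_(S k) x).
  by apply: measurable_funM; [case: sf|exact: measurable_indic].
have sS k : summable_fun m (fun x => f x * \1_(S k) x).
  apply: (@summableMb _ _ _ _ 1) => // x.
  by rewrite indicE ger0_norm// lern1 leq_b1.
have [|||||_ _] := @Rint_dominated _ _ _ m (fun k x => f x * \1_(S k) x) (fun=> 0) f.
- exact: mf.
- exact: measurable_cst.
- apply: aeW => x; apply: cvg_near_cst; have [N HN] := SN x; exists N => // k /= /HN H.
  by rewrite indicE (memNset H) mulr0.
- exact: sf.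
- move=> k x; rewrite ger0_norm ?mulr_ge0//; rewrite indicE ler_piMr// lern1 leq_b1//.
rewrite Rintegral_cst// mul0r => /cvgrPdist_le /(_ M M0) [N _ /(_ N (leqnn N))] /=.
rewrite sub0r normrN => H; exists N.
rewrite ge0_integral_mkindic.
have -> : (\int[m]_x ((\1_(S N) x)%:E * (f x)%:E) = (\int[m]_x (f x * \1_(S N) x))%:E)%E.
  by rewrite Rint_EFin//; apply: eq_integral => x _; rewrite -EFinM mulrC.
by rewrite lee_fin; apply: le_trans H; exact: ler_norm.
Qed.

Variables (al h T : R -> R).
Hypotheses (n1 : (1 < n)%N) (cap : capacity n al h).
Hypotheses (T_nondec : {homo T : s t / s <= t}) (T_gt0 : forall s, 0 < s -> 0 < T s) (T0 : T 0 = 0)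
  (T_inv : forall s, 0 < s -> cap_int h (T s) ^+ n.-1 <= s ^+ n).

Lemma strong_type_constant (K : R) : 0 < K -> exists2 M, 0 < M & @weak_const R n ^+ n * (M * (4 * K) ^+ n) < 1.
Proof.
move=> K0; have W0 : 0 < @weak_const R n by rewrite mulr_gt0 ?exprn_gt0// addr_gt0// exprn_gt0.
pose c := @weak_const R n ^+ n * (4 * K) ^+ n.
have c0 : 0 < c by rewrite mulr_gt0 ?exprn_gt0// mulr_gt0.
exists (2 * c)^-1; first by rewrite invr_gt0 mulr_gt0.
rewrite mulrCA -/c; have -> : (2 * c)^-1 * c = 2^-1 by field; rewrite gt_eqF.
lra.
Qed.

Section bounds.
Variables (u : V -> R) (g : 'I_n -> V -> R).
Hypothesis ug : forall i, wder i u (g i).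
Hypothesis u_level : forall s, 0 < s -> (m [set x | (s < `|u x|)%R] < +oo)%E.
Variable K : R.
Hypothesis K0 : 0 < K.

Let al0 := capacity_ge0 cap.
Let mabs : measurable_fun setT (fun x => `|u x|).
Proof. by have [[mu _] _ _] := ug (Ordinal (ltnW n1)); exact: measurableT_comp. Qed.

Let mden := measurable_density ug cap.

Lemma potential_small (M : R) : 0 < M -> @weak_const R n ^+ n * (M * (4 * K) ^+ n) < 1 ->
  (\int[m]_x (al (gnorm g x))%:E <= M%:E)%E -> (\int[m]_x (al (T (K * `|u x|)))%:E <= M%:E)%E.
Proof.
move=> M0 KM JM.
(* Energy levels between [2^-j] and [2^j] exhaust the set where [u] does not vanish. *)
apply: (@strong_type _ _ u g al h n1 ug cap T T_nondec T_gt0 T0 T_inv u_level K M K0 M0 KM setT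
  (fun j => (2 ^- j)) (fun j => (2 * j)%N)) => //.
- move=> j; apply: le_trans JM; apply: ge0_subset_integral => //.
  + exact: (measurable_annulus n1 ug).
  + by move=> x _; rewrite lee_fin.
move=> x _ /eqP ux; have u0 : 0 < `|u x| by rewrite normr_gt0.
have [N1 H1] : exists N : nat, 2 / `|u x| < 2 ^+ N.
  exists (Num.trunc (2 / `|u x|)).+1; apply: lt_le_trans (truncnS_gt _) _.
  by rewrite -natrX ler_nat ltnW// ltn_expl.
have [N2 H2] : exists N : nat, `|u x| < 2 ^+ N.
  exists (Num.trunc `|u x|).+1; apply: lt_le_trans (truncnS_gt _) _.
  by rewrite -natrX ler_nat ltnW// ltn_expl.
exists (maxn N1 N2) => j jN; have j1 := leq_trans (leq_maxl _ _) jN; have j2 := leq_trans (leq_maxr _ _) jN.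
have two j' j'' : (j' <= j'')%N -> 2 ^+ j' <= 2 ^+ j'' :> R by move=> ?; rewrite ler_weXn2l// ler1n.
apply/andP; split.
  rewrite ler_pdivrMr ?exprn_gt0// -ler_pdivrMl// mulrC.
  exact: ltW (lt_le_trans H1 (two _ _ j1)).
have -> : 2 ^+ (2 * j).+1 / 2 ^+ j = 2 * 2 ^+ j :> R.
  by rewrite exprS mul2n -addnn exprD; field; rewrite expf_neq0// pnatr_eq0.
apply: (lt_le_trans H2); apply: (le_trans (two _ _ j2)).
by rewrite ler_peMl ?exprn_ge0// ler1n.
Qed.

(** For given [K] the total energy may exceed the admissible [M], but by dominated convergence its
    parts above a high level and below a low positive level do not. Between the two levels the
    potential is bounded on a set of finite measure. *)
Lemma potential_finite : (\int[m]_x (al (gnorm g x))%:E < +oo)%E ->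
  (\int[m]_x (al (T (K * `|u x|)))%:E < +oo)%E.
Proof.
move=> Jfin; have [M M0 KM] := strong_type_constant K0.
have sf : summable_fun m (fun x => al (gnorm g x)).
  split; first exact/measurable_EFinP.
  by under eq_integral do rewrite ger0_norm//.
have mP : measurable_fun setT (fun x => (al (T (K * `|u x|)))%:E) := measurable_potential n1 ug cap T_nondec K.
have P0 x : (0 <= (al (T (K * `|u x|)))%:E)%E by rewrite lee_fin.
have mle (r : R) : measurable [set x | r <= `|u x|] by exact: measurable_le_set.
have mge (r : R) : measurable [set x | `|u x| <= r] by exact: measurable_le_set.
have two j : (0 < 2 ^+ j :> R) by rewrite exprn_gt0.
have [k1 Hk1] : exists k : nat, (\int[m]_(x in [set x | (k.+1%:R < `|u x|)%R]) (al (gnorm g x))%:E <= M%:E)%E.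
  apply: (@small_integral_tail _ (fun k => [set x | k.+1%:R < `|u x|])) => //.
    by move=> k; exact: measurable_lt_set.
  move=> x; exists (Num.trunc `|u x|) => k Nk /= H; have := lt_trans (truncnS_gt `|u x|) _.
  by have := lt_le_trans (truncnS_gt `|u x|) (_ : _ <= k.+1%:R); rewrite ler_nat ltnS Nk => /(_ isT) /(lt_trans H); rewrite ltxx.
have [k2 Hk2] : exists k : nat, (\int[m]_(x in [set x | (0 < `|u x| <= k.+1%:R^-1)%R]) (al (gnorm g x))%:E <= M%:E)%E.
  apply: (@small_integral_tail _ (fun k => [set x | 0 < `|u x| <= k.+1%:R^-1])) => //.
    by move=> k; exact: (measurable_annulus n1 ug).
  move=> x; exists (Num.trunc (`|u x|^-1)) => k Nk /= /andP[u0 uk].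
  have : `|u x|^-1 < k.+1%:R by apply: lt_le_trans (truncnS_gt _) _; rewrite ler_nat ltnS.
  by rewrite -[_ < _]ltf_pV2 ?posrE ?invr_gt0// invrK ltNge uk.
pose b : R := k1.+1%:R; pose e : R := k2.+1%:R^-1.
have b0 : 0 < b by rewrite ltr0n.
have e0 : 0 < e by rewrite invr_gt0 ltr0n.
have L : (\int[m]_(x in [set x | (2 * b <= `|u x|)%R]) (al (T (K * `|u x|)))%:E <= M%:E)%E.
  apply: (@strong_type _ _ u g al h n1 ug cap T T_nondec T_gt0 T0 T_inv u_level K M K0 M0 KM _
    (fun j => b) (fun j => j)) => //.
    move=> j; apply: le_trans Hk1; apply: ge0_subset_integral => //.
    + exact: (measurable_annulus n1 ug).
    + exact: measurable_lt_set.
    + exact: measurable_funS mden.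
    + by move=> x _; rewrite lee_fin.
    + by move=> x /= /andP[].
  move=> x /= bu _; exists (Num.trunc (`|u x| / b)).+1 => j jN; rewrite bu /= -ltr_pdivrMr//.
  apply: lt_trans (truncnS_gt _) _; rewrite -natrX ltr_nat (leq_ltn_trans jN)//.
  exact: ltn_trans (ltnSn j) (ltn_expl _ (ltnSn 1)).
have S : (\int[m]_(x in [set x | (`|u x| <= e)%R]) (al (T (K * `|u x|)))%:E <= M%:E)%E.
  apply: (@strong_type _ _ u g al h n1 ug cap T T_nondec T_gt0 T0 T_inv u_level K M K0 M0 KM _
    (fun j => e / 2 ^+ j) (fun j => j)) => //.
  - by move=> j; rewrite divr_gt0.
  - move=> j; rewrite [2 ^+ j * _]mulrC divfK ?gt_eqF//; apply: le_trans Hk2; apply: ge0_subset_integral => //.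
    + exact: (measurable_annulus n1 ug).
    + exact: (measurable_annulus n1 ug).
    + exact: measurable_funS mden.
    + by move=> x _; rewrite lee_fin.
    + by move=> x /= /andP[h1 ->]; rewrite andbT; apply: lt_trans h1; rewrite divr_gt0.
  move=> x /= ue /eqP ux; have u0 : 0 < `|u x| by rewrite normr_gt0.
  exists (Num.trunc (2 * e / `|u x|)).+1 => j jN; apply/andP; split.
    rewrite mulrA ler_pdivrMr// -ler_pdivrMl// mulrC.
    apply: ltW; apply: lt_trans (truncnS_gt _) _; rewrite -natrX ltr_nat (leq_ltn_trans jN)//.
    by rewrite ltn_expl.
  rewrite exprS -mulrA [2 ^+ j * _]mulrC divfK ?gt_eqF//; apply: le_lt_trans ue _.
  by rewrite ltr_pMl// ltr1n.
pose C := al (T (K * (2 * b))).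
have mid : (\int[m]_(x in [set x | (e < `|u x| < 2 * b)%R]) (al (T (K * `|u x|)))%:E <=
    C%:E * m [set x | (e < `|u x|)%R])%E.
  have mM : measurable [set x | e < `|u x| < 2 * b].
    rewrite (_ : [set x | _] = [set x | e < `|u x|] `&` [set x | `|u x| < 2 * b]).
      by apply: measurableI; exact: measurable_lt_set.
    by apply/seteqP; split => x /= => [/andP|[-> ->]].
  apply: (@le_trans _ _ (\int[m]_(x in [set x | (e < `|u x| < 2 * b)%R]) C%:E)%E).
    apply: ge0_le_integral => //; first exact: measurable_funS mP.
    move=> x /= /andP[_ xb]; rewrite lee_fin; apply: (cap_nondec cap); apply: T_nondec.
    by rewrite ler_wpM2l ?(ltW K0)// ltW.
  rewrite integral_cst//; apply: lee_wpmul2l; first by rewrite lee_fin; exact: al0.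
  apply: le_measure; rewrite ?inE//; first exact: measurable_lt_set.
  by move=> x /= /andP[].
have mM : measurable [set x | e < `|u x| < 2 * b].
  rewrite (_ : [set x | _] = [set x | e < `|u x|] `&` [set x | `|u x| < 2 * b]).
    by apply: measurableI; exact: measurable_lt_set.
  by apply/seteqP; split => x /= => [/andP|[-> ->]].
rewrite -(_ : [set x | 2 * b <= `|u x|] `|` ([set x | `|u x| <= e] `|` [set x | e < `|u x| < 2 * b]) = setT); last first.
  apply/seteqP; split => x //= _; have [?|?] := leP (2 * b) `|u x|; first by left.
  by right; have [?|?] := leP `|u x| e; [left|right].
apply: (@le_lt_trans _ _ (M%:E + (M%:E + C%:E * m [set x | (e < `|u x|)%R]))%E); last first.
  by rewrite !lte_add_pinfty ?ltry// lte_mul_pinfty ?u_level// lee_fin; exact: al0.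
apply: le_trans (ge0_integral_setU_le m mP P0 (mle _) (measurableU _ _ (mge _) mM)) _.
apply: leeD => //; apply: le_trans (ge0_integral_setU_le m mP P0 (mge _) mM) _.
exact: leeD.
Qed.

End bounds.
End potential.

(** * Euclidean length and sums of coordinates *)

Section euclidean.
Context {R : realType} {n : nat}.
Local Notation V := 'rV[R]_n.
Implicit Types (v w : V) (g : V -> V).
Local Notation en := (@euclidean_norm R n).

Definition coord g (i : 'I_n) (x : V) : R := g x ord0 i.

Lemma euclidean_norm_ge0 v : 0 <= en v.
Proof. exact: sqrtr_ge0. Qed.

Lemma euclidean_norm_coord v i : `|v ord0 i| <= en v.
Proof.
rewrite -sqrtr_sqr; apply: ler_wsqrtr; rewrite (bigD1 i)//= lerDl.
by apply: sumr_ge0 => j _; exact: sqr_ge0.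
Qed.

Lemma euclidean_norm_le_sum v : en v <= \sum_i `|v ord0 i|.
Proof.
have s0 (l : seq 'I_n) : 0 <= \sum_(i <- l) `|v ord0 i| by exact: sumr_ge0.
rewrite -[leRHS]ger0_norm ?sumr_ge0// -sqrtr_sqr; apply: ler_wsqrtr.
elim: (index_enum 'I_n) => [|i l IH]; first by rewrite !big_nil expr0n.
rewrite !big_cons sqrrD -normrX ger0_norm ?sqr_ge0// -addrA lerD2l.
by apply: le_trans IH _; rewrite lerDr mulrn_wge0// mulr_ge0.
Qed.

Lemma euclidean_norm_sum_le v : \sum_i `|v ord0 i| <= n%:R * en v.
Proof.
apply: (@le_trans _ _ (\sum_(i < n) en v)); first by apply: ler_sum => i _; exact: euclidean_norm_coord.
by rewrite sumr_const card_ord mulr_natl.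
Qed.

Lemma euclidean_normZ (c : R) v : en (c *: v) = `|c| * en v.
Proof.
rewrite /euclidean_norm -sqrtr_sqr -sqrtrM ?sqr_ge0// mulr_sumr.
by congr Num.sqrt; apply: eq_bigr => i _; rewrite mxE exprMn.
Qed.

Lemma euclidean_norm0 : en 0 = 0.
Proof. by rewrite -(scale0r (0 : V)) euclidean_normZ normr0 mul0r. Qed.

(** The factor [n] comes from passing through the sum of the coordinates; it is absorbed later in
    the parameter of the modular. *)
Lemma euclidean_normD v w : en (v + w) <= n%:R * (en v + en w).
Proof.
apply: le_trans (euclidean_norm_le_sum _) _; rewrite mulrDr.
apply: le_trans (lerD (euclidean_norm_sum_le v) (euclidean_norm_sum_le w)).
by rewrite -big_split/=; apply: ler_sum => i _; rewrite mxE ler_normD.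
Qed.

Lemma euclidean_normB v w : en (v - w) <= n%:R * (en v + en w).
Proof.
have -> : en w = en (- w) by rewrite -scaleN1r euclidean_normZ normrN1 mul1r.
exact: euclidean_normD.
Qed.

Lemma measurable_euclidean_norm g : (forall i, measurable_fun setT (coord g i)) ->
  measurable_fun setT (fun x => en (g x)).
Proof.
move=> mg; apply: (@measurableT_comp _ _ _ _ _ _ (@Num.sqrt R) _ (fun x => \sum_i g x ord0 i ^+ 2)).
  by apply: nondecreasing_measurable => // s t; exact: ler_wsqrtr.
by apply: measurable_sum => i; exact: (measurable_funX _ (mg i)).
Qed.

Lemma gnorm_euclidean g x : gnorm (coord g) x <= n%:R * en (g x).
Proof. exact: euclidean_norm_sum_le. Qed.

End euclidean.

Section more_young.
Variable R : realType.
Implicit Types (B : R -> \bar R).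

(** From a point [t1] with [B t1 > 0] on, convexity gives a linear lower bound; if [B t1] is
    infinite, so is [B] beyond it and the bound is trivial there. *)
Lemma young_linear B : young B -> exists t1 c, [/\ 0 < t1, 0 < c &
  forall t, 0 <= t -> (t%:E <= t1%:E + c%:E * B t)%E].
Proof.
move=> yB; have [t1 t10 Bt] : exists2 t1, 0 < t1 & (0 < B t1)%E.
  have [s [t [s0 t0 st]]] := young_non_constant yB.
  have [E|E] := eqVneq (B s) 0%E; last by exists s => //; rewrite lt0e E (young_ge0 yB)// ltW.
  exists t => //; rewrite lt0e (young_ge0 yB) ?ltW// andbT; apply/eqP => E'; apply: st.
  by rewrite E E'.
have [Bf|Bf] := eqVneq (B t1) +oo%E.
  exists t1, 1; split => // t tge; rewrite mul1e; have [tt|/ltW tt] := leP t t1.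
    apply: (@le_trans _ _ t1%:E); first by rewrite lee_fin.
    exact: (leeDl _ (young_ge0 yB tge)).
  have -> : B t = +oo%E by apply/eqP; rewrite -leye_eq -Bf; exact: (young_nondec yB (ltW t10)).
  by rewrite addey// leey.
have fB : B t1 \is a fin_num by rewrite ge0_fin_numE ?ltW// lt_neqAle Bf leey.
pose b := fine (B t1); have b0 : 0 < b by rewrite fine_gt0// Bt lt_neqAle Bf leey.
exists t1, (t1 / b); split => //; first by rewrite divr_gt0.
move=> t tge; have Bt0 := young_ge0 yB tge.
have cB : (0 <= (t1 / b)%:E * B t)%E by rewrite mule_ge0// lee_fin divr_ge0 ?ltW.
have [tt|/ltW tt] := leP t t1.
  by apply: (@le_trans _ _ t1%:E); [rewrite lee_fin | exact: (leeDl _ cB)].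
have t0 := lt_le_trans t10 tt.
apply: (@le_trans _ _ ((t1 / b)%:E * B t)%E); last by rewrite leeDr// lee_fin ltW.
have := young_scale yB (ltW t10) tt t0; rewrite -[B t1]fineK// -/b.
move: Bt0 cB; case: (B t) => [r||] // _ _.
  rewrite -!EFinM !lee_fin => H.
  rewrite mulrAC ler_pdivlMr// mulrC -ler_pdivlMr// mulrC.
  by rewrite [leRHS](_ : _ = t1 / t * r)//; ring.
by move=> _; rewrite gt0_muley ?leey// lte_fin divr_gt0.
Qed.

Lemma ae_forall_fin d (T : measurableType d) (mu : {measure set T -> \bar R}) (I : finType) (P : I -> T -> Prop) :
  (forall i, {ae mu, forall x, P i x}) -> {ae mu, forall x, forall i, P i x}.
Proof.
move=> H; have := @ae_foralln _ _ _ mu (fun k x => forall i, enum_rank i = k :> nat -> P i x).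
move=> /(_ (fun k => _)) F.
have {}F : (forall k : nat, {ae mu, forall x, forall i : I, enum_rank i = k :> nat -> P i x}) ->
    {ae mu, forall x, forall k : nat, forall i : I, enum_rank i = k :> nat -> P i x}.
  by move=> h; exact: ae_foralln.
apply: filterS (F _) => [x Hx i|k]; first exact: (Hx (enum_rank i) i).
have [[i ik]|no] := pselect (exists i : I, enum_rank i = k :> nat).
  apply: filterS (H i) => x Px j jk; suff -> : j = i by [].
  by apply: enum_rank_inj; apply: val_inj; rewrite /= jk ik.
by apply: aeW => x i ik; exfalso; apply: no; exists i.
Qed.

End more_young.

(** * Almost everywhere convergence along subsequences *)

Section vanishing.
Context {R : realType} {n : nat}.
Local Notation V := 'rV[R]_n.
Local Notation m := (borel_lebesgue R n).

(** Convergence to 0 for sequences of integrals whose early terms may be infinite; for nonnegative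
    sequences it is the usual convergence. *)
Definition vanishing (s : nat -> \bar R) := forall e : R, 0 < e -> exists N, forall k, (N <= k)%N -> (s k <= e%:E)%E.

Lemma vanishing_cvg s : (forall k, 0 <= s k)%E -> vanishing s <-> (s k @[k --> \oo] --> 0%E).
Proof.
move=> s0; split=> H.
  have fs : \forall k \near \oo, s k \is a fin_num.
    have [N HN] := H 1 ltr01; exists N => // k /= /HN sk.
    by rewrite ge0_fin_numE// (le_lt_trans sk)// ltry.
  apply/fine_cvgP; split => //; apply/cvgrPdist_le => e e0; have [N HN] := H e e0.
  exists N => // k /= /HN sk; rewrite sub0r normrN ger0_norm ?fine_ge0//.
  by rewrite -lee_fin fineK// ge0_fin_numE// (le_lt_trans sk)// ltry.
move=> e e0; have /fine_cvgP[fs /cvgrPdist_le/(_ e e0) se] := H.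
have [N _ HN] := filterI fs se; exists N => k /HN[fk /=].
by rewrite sub0r normrN ger0_norm ?fine_ge0// -lee_fin fineK.
Qed.

Lemma vanishing_le s t : (forall k, t k <= s k)%E -> vanishing s -> vanishing t.
Proof. by move=> st H e /H[N HN]; exists N => k /HN; exact: le_trans (st k). Qed.

Lemma vanishingD s t : vanishing s -> vanishing t -> vanishing (fun k => s k + t k)%E.
Proof.
move=> Hs Ht e e0; have e2 : 0 < e / 2 by rewrite divr_gt0.
have [N1 H1] := Hs _ e2; have [N2 H2] := Ht _ e2; exists (maxn N1 N2) => k.
rewrite geq_max => /andP[/H1 h1 /H2 h2]; have -> : e = e / 2 + e / 2 by field.
by rewrite EFinD; exact: leeD.
Qed.

Lemma vanishingZ s (C : R) : 0 <= C -> vanishing s -> vanishing (fun k => C%:E * s k)%E.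
Proof.
move=> C0 Hs e e0; have C1 : 0 < C + 1 by rewrite ltr_wpDl.
have [N HN] := Hs _ (divr_gt0 e0 C1); exists N => k /HN sk.
apply: le_trans (lee_wpmul2l _ sk) _; first by rewrite lee_fin.
rewrite -EFinM lee_fin mulrA ler_pdivrMr// mulrC ler_wpM2l ?(ltW e0)//.
by rewrite lerDl.
Qed.

Lemma vanishing_subseq s (sig : nat -> nat) : (forall k, (k <= sig k)%N) -> vanishing s -> vanishing (s \o sig).
Proof. by move=> ks Hs e /Hs[N HN]; exists N => k Nk; apply: HN; exact: leq_trans (ks k). Qed.

Lemma geometric_half_sum : (\sum_(0 <= j <oo) (2^-1 ^+ j : R)%:E)%E = (2 : R)%:E.
Proof.
apply: cvg_lim => //; rewrite (_ : (fun _ => _) = EFin \o (series (geometric 1 2^-1))); last first.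
  apply/funext => k /=; rewrite /series/= sumEFin.
  by congr EFin; apply: eq_bigr => i _; rewrite mul1r.
apply: cvg_EFin; first exact: nearW.
have := @cvg_geometric_series R 1 2^-1; rewrite ger0_norm//.
have -> : 1 / (1 - 2^-1) = 2 :> R by field.
by apply; rewrite invf_lt1// ltr1n.
Qed.

(** Diagonal choice: the [j]-th selected function has integral at most [2^-j] over the cube of index
    [j]. The sum of these restrictions is integrable, hence finite almost everywhere, and each point
    belongs to all cubes from some index on. *)
Lemma ae_subsequence (F : nat -> V -> R) : (forall k, measurable_fun setT (F k)) -> (forall k x, 0 <= F k x) ->
  (forall J : nat, vanishing (fun k => \int[m]_(x in cube J%:R) (F k x)%:E)%E) ->
  exists2 sig : nat -> nat, {homo sig : i j / (i < j)%N} &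
    {ae m, forall x, F (sig k) x @[k --> \oo] --> (0 : R)}.
Proof.
move=> mF F0 van.
have pick J p : exists q, (p < q)%N && `[< (\int[m]_(x in cube J%:R) (F q x)%:E <= (2^-1 ^+ J : R)%:E)%E >].
  have e0 : 0 < 2^-1 ^+ J :> R by rewrite exprn_gt0.
  have [N HN] := van J _ e0; exists (maxn N p.+1); rewrite leq_max ltnSn orbT/=; apply/asboolP.
  by apply: HN; exact: leq_maxl.
pose sig := fix sig j := if j is i.+1 then xchoose (pick j (sig i)) else xchoose (pick 0%N 0%N).
have sigP j : (\int[m]_(x in cube j%:R) (F (sig j) x)%:E <= (2^-1 ^+ j : R)%:E)%E.
  by case: j => [|j]; [have := xchooseP (pick 0%N 0%N)|have := xchooseP (pick j.+1 (sig j))];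
    move=> /andP[_ /asboolP].
have sigS j : (sig j < sig j.+1)%N.
  by have := xchooseP (pick j.+1 (sig j)); move=> /andP[].
exists sig; first by apply: homo_ltn => //; exact: ltn_trans.
pose f j x := ((F (sig j) x)%:E * (\1_(cube j%:R) x)%:E)%E.
have mc (j : nat) : measurable (cube j%:R : set V) by exact: measurable_cube.
have mf j : measurable_fun setT (f j).
  by apply: emeasurable_funM; [exact/measurable_EFinP|exact: measurable_EFin_indic].
have f0 j x : (0 <= f j x)%E by rewrite mule_ge0// lee_fin.
have fin : (\int[m]_x (\sum_(0 <= j <oo) f j x) < +oo)%E.
  rewrite integral_nneseries//.
  apply: (@le_lt_trans _ _ (\sum_(0 <= j <oo) (2^-1 ^+ j : R)%:E)%E); last first.
    by rewrite geometric_half_sum ltry.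
  apply: lee_nneseries => j _; first by move=> _; exact: integral_ge0.
  apply: le_trans (sigP j); rewrite [leRHS]ge0_integral_mkindic.
  by under eq_integral => x _ do rewrite /f muleC.
have mS : measurable_fun setT (fun x => \sum_(0 <= j <oo) f j x)%E.
  by apply: ge0_emeasurable_sum.
have S0 x : (0 <= \sum_(0 <= j <oo) f j x)%E by apply: nneseries_ge0.
have /integrable_ae-/(_ measurableT) : m.-integrable setT (fun x => \sum_(0 <= j <oo) f j x)%E.
  apply/integrableP; split => //.
  by under eq_integral => x _ do rewrite gee0_abs//.
apply: filterS => x /(_ I); rewrite ge0_fin_numE// => Sx.
have tail := nneseries_tail_cvg Sx (fun k _ => f0 k x).
have cf : f k x @[k --> \oo] --> 0%E.
  apply: squeeze_cvge (cvg_cst 0%E) tail; apply: nearW => k; rewrite f0/=.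
  apply: le_trans (nneseries_lim_ge k.+1 _); last by move=> *; exact: f0.
  by rewrite big_nat1.
have [J xJ] := cube_cover x.
have /fine_cvgP[_ cf'] := cf.
apply: cvg_trans cf'; apply: near_eq_cvg; exists J => // k /= Jk.
have xk : cube k%:R x by apply: (@cubeS _ _ J%:R k%:R _ x xJ); rewrite ler_nat.
by rewrite /f/= indicE (mem_set xk) mulr1.
Qed.

(** The majorant [h_k + G] moves with [k]. The truncation of [f k] at the fixed [G] is treated by
    dominated convergence, and the part cut off is at most [h_k], whose integral vanishes. *)
Lemma generalized_dominated (f : nat -> V -> \bar R) (h_ : nat -> V -> R) (G : V -> R) :
  (forall k, measurable_fun setT (f k)) -> (forall k x, 0 <= f k x)%E ->
  (forall k, measurable_fun setT (h_ k)) -> (forall k x, 0 <= h_ k x) ->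
  summable_fun m G -> (forall x, 0 <= G x) ->
  (forall k, {ae m, forall x, (f k x <= (h_ k x + G x)%:E)%E}) ->
  vanishing (fun k => \int[m]_x (h_ k x)%:E)%E -> {ae m, forall x, vanishing (fun k => f k x)} ->
  vanishing (fun k => \int[m]_x f k x)%E.
Proof.
move=> mf f0 mh h0 sG G0 dom vh vf.
pose p k x := fine (mine (f k x) (G x)%:E).
have pE k x : (p k x)%:E = mine (f k x) (G x)%:E.
  rewrite /p fineK// ge0_fin_numE; last by rewrite le_min f0 lee_fin G0.
  by rewrite gt_min ltry orbT.
have p0 k x : 0 <= p k x by rewrite -lee_fin pE le_min f0 lee_fin G0.
have pG k x : p k x <= G x by rewrite -lee_fin pE ge_min lexx orbT.
have [mG _] := sG.
have mp k : measurable_fun setT (p k).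
  apply/measurable_EFinP; rewrite (_ : EFin \o p k = fun x => mine (f k x) (G x)%:E).
    by apply: measurable_mine => //; exact/measurable_EFinP.
  by apply/funext => x; exact: pE.
have cp : {ae m, forall x, p k x @[k --> \oo] --> (0 : R)}.
  apply: filterS vf => x vx; apply/cvgrPdist_le => e e0; have [N HN] := vx e e0.
  exists N => // k /= /HN H; rewrite sub0r normrN ger0_norm// -lee_fin pE.
  by rewrite ge_min H.
have [|||||sz cz _] := @Rint_dominated _ _ _ m p (fun=> 0) G.
- exact: mp.
- exact: measurable_cst.
- exact: cp.
- exact: sG.
- by move=> k x; rewrite ger0_norm.
have sp k : summable_fun m (p k) by apply: summable_le sG => // x; rewrite ger0_norm.
have vp : vanishing (fun k => \int[m]_x (p k x)%:E)%E.
  move=> e e0; have /cvgrPdist_le/(_ e e0)[N _ HN] := cz; exists N => k /HN /=.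
  rewrite sub0r normrN ger0_norm; last by apply: Rintegral_ge0 => x _; exact: normr_ge0.
  have -> : \int[m]_x `|p k x - 0| = \int[m]_x p k x.
    by apply: eq_Rintegral => x _; rewrite subr0 ger0_norm.
  by rewrite -lee_fin (Rint_EFin (sp k)).
apply: vanishing_le (vanishingD vp vh) => k.
have mpE : measurable_fun setT (fun x => (p k x)%:E) by exact/measurable_EFinP.
have mhE : measurable_fun setT (fun x => (h_ k x)%:E) by exact/measurable_EFinP.
rewrite -ge0_integralD//; [|by move=> x _; rewrite lee_fin|by move=> x _; rewrite lee_fin].
apply: ae_ge0_le_integral => //.
- by move=> x _; rewrite -EFinD lee_fin addr_ge0.
- exact: emeasurable_funD.
apply: filterS (dom k) => x H _; rewrite pE; have [fG|Gf] := leP (f k x) (G x)%:E.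
  by apply: leeDl; rewrite lee_fin h0.
by rewrite -EFinD addrC.
Qed.

End vanishing.

(** * Weak continuity of the densities of compositions *)

Section weak_limit.
Context {R : realType} {n : nat}.
Local Notation V := 'rV[R]_n.
Local Notation m := (borel_lebesgue R n).

Definition loc_cvg (w_ : nat -> V -> R) (w : V -> R) :=
  forall J : nat, vanishing (fun k => \int[m]_(x in cube J%:R) `|w_ k x - w x|%:E)%E.

(** The test function may vary with [k], with a common bound and support, since the products
    [theta(u_k) phi] play this role. *)
Lemma loc_cvg_integral w_ w (phi : nat -> V -> R) (C : R) (J : nat) : (forall k, loc_summable (w_ k)) ->
  loc_summable w -> loc_cvg w_ w -> (forall k, measurable_fun setT (phi k)) -> (forall k x, `|phi k x| <= C) ->
  (forall k x, ~ cube J%:R x -> phi k x = 0) ->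
  \int[m]_x (w_ k x * phi k x) - \int[m]_x (w x * phi k x) @[k --> \oo] --> (0 : R).
Proof.
move=> lw_ lw cw mp pC p0; have C0 : 0 <= C by apply: le_trans (pC 0%N 0).
have bp k : bounded_measurable (phi k) by split => //; exists C.
have sp k : cube_supported (phi k) by exists J; exact: p0.
apply/cvgrPdist_le => e e0; have C1 : 0 < C + 1 by rewrite ltr_wpDl.
have [N HN] := cw J _ (divr_gt0 e0 C1); exists N => // k /= /HN H.
have s_ := loc_summableM (lw_ k) (bp k) (sp k); have s := loc_summableM lw (bp k) (sp k).
rewrite sub0r normrN -RintB//.
have E : (fun x => w_ k x * phi k x - w x * phi k x) = fun x => (w_ k x - w x) * phi k x.
  by apply/funext => x; rewrite mulrBl.
have sB : summable_fun m (fun x => (w_ k x - w x) * phi k x) by rewrite -E; exact: summableB.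
rewrite E; apply: le_trans (Rint_abs sB) _; rewrite -lee_fin (Rint_EFin (summable_abs sB)).
have mc : measurable (cube J%:R : set V) by exact: measurable_cube.
have md : measurable_fun setT (fun x => `|w_ k x - w x|%:E).
  by apply/measurable_EFinP/measurableT_comp => //; apply: measurable_funB; [case: (lw_ k)|case: lw].
apply: (@le_trans _ _ (C%:E * \int[m]_(x in cube J%:R) `|w_ k x - w x|%:E)%E).
  rewrite -ge0_integralZl//; last exact: measurable_funS md.
  rewrite [leRHS]ge0_integral_mkindic; apply: ge0_le_integralT.
  - by apply/measurable_EFinP; have [? _] := summable_abs sB.
  - apply: emeasurable_funM; first exact: measurable_EFin_indic.
    exact: emeasurable_funM.
  - by move=> x; rewrite lee_fin.
  move=> x; rewrite indicE; have [xJ|xJ] := pselect (cube J%:R x).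
    by rewrite (mem_set xJ) mul1e -EFinM lee_fin normrM mulrC ler_wpM2r.
  by rewrite (p0 k x xJ) mulr0 normr0 (memNset xJ) mul0e.
apply: le_trans (lee_wpmul2l (_ : (0 <= C%:E)%E) H) _; first by rewrite lee_fin.
rewrite -EFinM lee_fin mulrA ler_pdivrMr// mulrC ler_wpM2l ?(ltW e0)//.
by rewrite lerDl.
Qed.

Variables (i : 'I_n) (u_ a_ : nat -> V -> R) (u a : V -> R).
Hypotheses (wu_ : forall k, wder i (u_ k) (a_ k)) (wu : wder i u a) (cu : loc_cvg u_ u) (ca : loc_cvg a_ a).

(* Composition with theta is not weakly continuous, but the measure theta(u_k) du_k is: it is the
   weak derivative of a primitive of theta along u_k, and primitives are Lipschitz. *)
Lemma weak_limit_test theta (phi : V -> R) : bounded_measurable theta -> test_function phi ->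
  \int[m]_x (a x * theta (u_ k x) * phi x) @[k --> \oo] --> \int[m]_x (a x * theta (u x) * phi x).
Proof.
move=> bt tphi; have [mt [C tC]] := bt; have C0 : 0 <= C by apply: le_trans (tC 0).
have [J [bphi bdphi phi0 dphi0]] := test_function_bounds i tphi.
have [mphi [Cp pC]] := bphi; have [mdphi [Cd dC]] := bdphi.
have Cp0 : 0 <= Cp by apply: le_trans (pC 0).
have la : loc_summable a by case: wu. have la_ k : loc_summable (a_ k) by case: (wu_ k).
have lu : loc_summable u by case: wu. have lu_ k : loc_summable (u_ k) by case: (wu_ k).
have mtu k : measurable_fun setT (fun x => theta (u_ k x)) by apply: measurableT_comp => //; case: (lu_ k).
have mtu0 : measurable_fun setT (fun x => theta (u x)) by apply: measurableT_comp => //; case: lu.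
have wp k := wder_prim_bounded (wu_ k) bt; have wp0 := wder_prim_bounded wu bt.
have H1 := @loc_cvg_integral a_ a (fun k x => theta (u_ k x) * phi x) (C * Cp) J la_ la ca _ _ _.
have {}H1 : \int[m]_x (a_ k x * (theta (u_ k x) * phi x)) -
    \int[m]_x (a x * (theta (u_ k x) * phi x)) @[k --> \oo] --> (0 : R).
  apply: H1.
  - by move=> k; exact: measurable_funM.
  - by move=> k x; rewrite normrM ler_pM.
  - by move=> k x /phi0 ->; rewrite mulr0.
have cp : loc_cvg (fun k x => prim theta (u_ k x)) (fun x => prim theta (u x)).
  move=> J'; apply: vanishing_le (vanishingZ C0 (cu J')) => k.
  have mc : measurable (cube J'%:R : set V) by exact: measurable_cube.
  have md : measurable_fun setT (fun x => `|u_ k x - u x|%:E).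
    by apply/measurable_EFinP/measurableT_comp => //; apply: measurable_funB; [case: (lu_ k)|case: lu].
  rewrite -ge0_integralZl//; last exact: measurable_funS md.
  apply: ge0_le_integral => //.
  - apply: (@measurable_funS _ _ _ _ setT) => //; apply/measurable_EFinP/measurableT_comp => //.
    by apply: measurable_funB; [case: (wp k) => -[]|case: wp0 => -[]].
  - by apply: (@measurable_funS _ _ _ _ setT) => //; exact: emeasurable_funM.
  move=> x _; rewrite -EFinM lee_fin; apply: prim_bound tC; exact: bounded_locally_bounded.
have lp k : loc_summable (fun x => prim theta (u_ k x)) by case: (wp k).
have lp0 : loc_summable (fun x => prim theta (u x)) by case: wp0.
have H2 := @loc_cvg_integral _ _ (fun k => partial_derive i phi) Cd J lp lp0 cp (fun _ => mdphi) (fun _ => dC) (fun _ => dphi0).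
have E1 k : \int[m]_x (prim theta (u_ k x) * partial_derive i phi x) =
    - \int[m]_x (a_ k x * (theta (u_ k x) * phi x)).
  by rewrite (weak_of_wder (wp k) tphi); congr (- _); apply: eq_Rintegral => x _; rewrite mulrA.
have E0 : \int[m]_x (prim theta (u x) * partial_derive i phi x) = - \int[m]_x (a x * theta (u x) * phi x).
  exact: weak_of_wder wp0 tphi.
move: H2; under eq_fun do rewrite E1 E0; move=> H2.
apply/cvgrPdist_le => e e0; have e2 : 0 < e / 2 by rewrite divr_gt0.
have /cvgrPdist_le/(_ _ e2) := H1; have /cvgrPdist_le/(_ _ e2) := H2.
apply: filterS2 => k; rewrite !sub0r !normrN opprK => h2 h1.
rewrite (_ : \int[m]_x (a x * theta (u_ k x) * phi x) = \int[m]_x (a x * (theta (u_ k x) * phi x))); last first.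
  by apply: eq_Rintegral => x _; rewrite mulrA.
have -> : e = e / 2 + e / 2 by field.
apply: le_trans (lerD h2 h1); apply: le_trans (ler_normD _ _); rewrite le_eqVlt; apply/orP; left; apply/eqP.
by congr (`|_|); ring.
Qed.

(** The fixed majorant [C |a|] allows the extension from smooth products to bounded Borel test
    functions. *)
Lemma weak_limit theta (phi : V -> R) : bounded_measurable theta -> bounded_measurable phi -> cube_supported phi ->
  \int[m]_x (a x * theta (u_ k x) * phi x) @[k --> \oo] --> \int[m]_x (a x * theta (u x) * phi x).
Proof.
move=> bt; have [mt [C tC]] := bt.
have [ma _] : loc_summable a by case: wu. have [mu _] : loc_summable u by case: wu.
have mu_ k : measurable_fun setT (u_ k) by case: (wu_ k) => -[].
have la : loc_summable (fun x => `|a x| * C).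
  apply: loc_summableMb; last exact: bounded_measurable_cst.
  by apply: loc_summable_abs; case: wu.
apply: (@separating_bounded _ _ (fun k x => a x * theta (u_ k x)) _ (fun x => `|a x| * C)) => //.
- by move=> k; apply: measurable_funM => //; exact: measurableT_comp.
- by apply: measurable_funM => //; exact: measurableT_comp.
- by move=> k x; rewrite normrM ler_wpM2l.
- by move=> x; rewrite normrM ler_wpM2l.
- by move=> F sF [r rF]; apply: weak_limit_test => //; exact: (test_function_prodf sF rF).
Qed.

(** The square is expanded. The terms in [theta(u_k)^2] and [theta(u_k)] are tested against
    [sign(a)] and [theta(u) sign(a)] on the cube, which are merely Borel; the limit is
    [I - 2 I + I = 0]. *)
Lemma density_square_cvg theta (J : nat) : bounded_measurable theta ->
  vanishing (fun k => \int[m]_(x in cube J%:R) ((theta (u_ k x) - theta (u x)) ^+ 2 * `|a x|)%:E)%E.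
Proof.
move=> bt; have [mt [C tC]] := bt; have C0 : 0 <= C by apply: le_trans (tC 0).
have bt2 : bounded_measurable (fun s => theta s ^+ 2).
  by split; [exact: measurable_funX|exists (C ^+ 2) => x; rewrite normrX lerXn2r ?nnegrE].
have [ma _] : loc_summable a by case: wu. have [mu _] : loc_summable u by case: wu.
have mu_ k : measurable_fun setT (u_ k) by case: (wu_ k) => -[].
have la : loc_summable a by case: wu.
have mc : measurable (cube J%:R : set V) by exact: measurable_cube.
have bI : bounded_measurable (\1_(cube J%:R) : V -> R) by exact: bounded_measurable_indic.
pose sg x : R := if 0 < a x then 1 else -1.
have bsg : bounded_measurable sg.
  split; last by exists 1 => x; rewrite /sg; case: ifP => _; rewrite ?normrN normr1.
  apply: (@measurableT_comp _ _ _ _ _ _ (fun s : R => if 0 < s then 1 else -1 : R) _ a) => //.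
  apply: nondecreasing_measurable => // s t st; case: ifP => [s0|_]; first by rewrite (lt_le_trans s0 st).
  by case: ifP => _; lra.
have abs_sg x : `|a x| = a x * sg x.
  by rewrite /sg; case: ltP => a0; [rewrite gtr0_norm// mulr1|rewrite ler0_norm// mulrN1].
have btu : bounded_measurable (fun x => theta (u x)).
  by split; [exact: measurableT_comp|exists C].
have btu_ k : bounded_measurable (fun x => theta (u_ k x)).
  by split; [exact: measurableT_comp|exists C].
pose p1 x := sg x * \1_(cube J%:R) x; pose p2 x := theta (u x) * p1 x.
have b1 : bounded_measurable p1 by exact: bounded_measurableM.
have b2 : bounded_measurable p2 by exact: bounded_measurableM.
have s1 : cube_supported p1 by exact/cube_supportedMl/cube_supported_indic.
have s2 : cube_supported p2 by exact/cube_supportedMl.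
have L1 := weak_limit bt2 b1 s1; have L2 := weak_limit bt b2 s2.
have sq (w v : V -> R) (p : V -> R) : bounded_measurable v -> bounded_measurable p -> cube_supported p ->
    summable_fun m (fun x => a x * v x * p x).
  move=> bv bp sp; rewrite (_ : (fun x => _) = fun x => a x * (v x * p x)); last by apply/funext => x; rewrite mulrA.
  by apply: loc_summableM => //; [exact: bounded_measurableM|exact: cube_supportedMl].
have btu2_ k : bounded_measurable (fun x => theta (u_ k x) ^+ 2) by exact: (bounded_measurableM (btu_ k) (btu_ k)).
have btu2 : bounded_measurable (fun x => theta (u x) ^+ 2) by exact: (bounded_measurableM btu btu).
have S1 k := sq a _ _ (btu2_ k) b1 s1; have S2 k := sq a _ _ (btu_ k) b2 s2; have S3 := sq a _ _ btu2 b1 s1.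
pose d k x := (theta (u_ k x) - theta (u x)) ^+ 2 * `|a x| * \1_(cube J%:R) x.
have dE k : d k = fun x => (a x * theta (u_ k x) ^+ 2 * p1 x - 2 * (a x * theta (u_ k x) * p2 x)) + a x * theta (u x) ^+ 2 * p1 x.
  apply/funext => x; rewrite /d /p2 /p1 abs_sg; ring.
have sd k : summable_fun m (d k).
  by rewrite dE; apply: summableD => //; apply: summableB => //; exact: summableZ.
have E : (\int[m]_x (d k x) @[k --> \oo] --> (0 : R)).
  have -> : (fun k => \int[m]_x d k x) = fun k => (\int[m]_x (a x * theta (u_ k x) ^+ 2 * p1 x) -
      2 * \int[m]_x (a x * theta (u_ k x) * p2 x)) + \int[m]_x (a x * theta (u x) ^+ 2 * p1 x).
    apply/funext => k; rewrite dE RintD//; last by apply: summableB => //; exact: summableZ.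
    by rewrite RintB//; [rewrite RintZ|exact: summableZ].
  have E3 : \int[m]_x (a x * theta (u x) * p2 x) = \int[m]_x (a x * theta (u x) ^+ 2 * p1 x).
    by apply: eq_Rintegral => x _; rewrite /p2; ring.
  pose I := \int[m]_x (a x * theta (u x) ^+ 2 * p1 x).
  have K : (\int[m]_x (a x * theta (u_ k x) ^+ 2 * p1 x) - 2 * \int[m]_x (a x * theta (u_ k x) * p2 x)) + I
      @[k --> \oo] --> (I - 2 * I) + I.
    apply: cvgD (cvg_cst _); apply: cvgB L1 _; apply: cvgM (cvg_cst _) _.
    by rewrite /I -E3; exact: L2.
  by rewrite (_ : I - 2 * I + I = 0) in K; last by ring.
move=> e e0; have /cvgrPdist_le/(_ e e0)[N _ HN] := E; exists N => k /HN /=.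
have d0 x : 0 <= d k x by apply: mulr_ge0 => //; apply: mulr_ge0 => //; exact: sqr_ge0.
rewrite sub0r normrN ger0_norm; last by apply: Rintegral_ge0 => x _; exact: d0.
rewrite -lee_fin (Rint_EFin (sd k)); apply: le_trans; rewrite [leLHS]ge0_integral_mkindic.
by rewrite le_eqVlt; apply/orP; left; apply/eqP/eq_integral => x _; rewrite -EFinM mulrC.
Qed.

End weak_limit.

(** * Superposition operators *)

Section superposition.
Context {R : realType} {n : nat}.
Local Notation V := 'rV[R]_n.
Local Notation m := (borel_lebesgue R n).
Local Notation en := (@euclidean_norm R n).
Implicit Types (u w : V -> R) (g : V -> V).

(** Values at negative arguments are arbitrary; composing with [Num.max 0] gives a monotone
    function, whose superlevel sets are intervals. *)
Lemma measurable_young B : young B -> measurable_fun setT (fun t : R => B (Num.max 0 t)).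
Proof.
move=> yB; apply: (measurability _ (ErealGenOInfty.measurableE R)) => _ [_ [r ->]] <-.
apply: measurableI => //; apply: is_interval_measurable => s t /=.
rewrite !in_itv/= !andbT => fs ft v /andP[sv vt].
rewrite in_itv/= andbT (lt_le_trans fs)//; apply: (young_nondec yB); first by rewrite le_max lexx.
by rewrite ge_max !le_max lexx/= sv orbT.
Qed.

Lemma measurable_young_norm B g (l : R) : young B -> 0 <= l -> (forall i, measurable_fun setT (coord g i)) ->
  measurable_fun setT (fun x => B (en (g x) / l)).
Proof.
move=> yB l0 mg; rewrite (_ : (fun x => _) = (fun t : R => B (Num.max 0 t)) \o (fun x => en (g x) / l)).
  apply: measurableT_comp; first exact: measurable_young.
  by apply: measurable_funM => //; exact: measurable_euclidean_norm.
by apply/funext => x /=; rewrite max_r// divr_ge0// euclidean_norm_ge0.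
Qed.

(** Borel versions of the zero extension and of its gradient. The energy is left out because its
    parameter changes from one statement to the next. *)
Record admissible (Om : set V) u g : Prop := Admissible {
  adm_wder : forall i, wder i u (coord g i) ;
  adm_level : forall t, 0 < t -> (m [set x | (t < `|u x|)%R] < +oo)%E ;
  adm_off : forall x, ~ Om x -> u x = 0
}.

(** The complement of [Om] may have a boundary of positive measure; there [u] is 0, and the gradient
    vanishes almost everywhere on the zero set of [u]. *)
Lemma gradient_off Om u g : admissible Om u g -> {ae m, forall x, ~ Om x -> g x = 0}.
Proof.
move=> [wu _ uoff].
have H (i : 'I_n) : {ae m, forall x, u x = 0 -> coord g i x = 0}.
  exact: (wder_null (wu i) (measurable_set1 0) (lebesgue_measure_set1 0)).
apply: filterS (ae_forall_fin H) => x Hx /uoff ux.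
by apply/rowP => i; rewrite mxE; exact: Hx.
Qed.

Variables (slack : bool) (A B : R -> \bar R) (al h T E D : R -> R) (c c0 kappa : R) (Om : set V).
Hypotheses (n1 : (1 < n)%N) (yA : young A) (finA : forall t, 0 <= t -> (A t < +oo)%E)
  (posA : non_degenerate A) (yB : young B) (cap : capacity n al h).
Hypotheses (T_nondec : {homo T : s t / s <= t}) (T_gt0 : forall s, 0 < s -> 0 < T s) (T0 : T 0 = 0)
  (T_inv : forall s, 0 < s -> cap_int h (T s) ^+ n.-1 <= s ^+ n).
Hypotheses (c0_ge0 : 0 <= c0) (c0_slack : ~~ slack -> c0 = 0) (c1 : 1 <= c).
Hypothesis Q1 : forall tau s, 0 <= tau -> 0 <= s ->
  (B (tau * E s)%R <= (yreal A tau + al (T (c * s)%R) + c0)%:E)%E.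
Hypothesis Q2 : forall d, 0 < d -> exists2 C, 0 <= C &
  forall t, 0 <= t -> al t <= C * yreal A (c * t) + d * slack%:R.
Hypotheses (k0 : 0 < kappa) (lD : locally_bounded D) (DE : forall t, `|D t| <= kappa * E (kappa * `|t|)).
Hypotheses (mOm : measurable Om) (Om_fin : slack -> (m Om < +oo)%E).

Let n_gt0 : 0 < n%:R :> R. Proof. by rewrite ltr0n ltnW. Qed.
Let c_gt0 : 0 < c. Proof. exact: lt_le_trans ltr01 c1. Qed.

Definition gradient_energy g (l : R) : \bar R := (\int[m]_x (yreal A (en (g x) / l))%:E)%E.

Lemma measurable_gradient_density g (l : R) : (forall i, measurable_fun setT (coord g i)) ->
  measurable_fun setT (fun x => (yreal A (en (g x) / l))%:E).
Proof.
move=> mg; apply/measurable_EFinP; apply: (@measurableT_comp _ _ _ _ _ _ (yreal A) _ (fun x => en (g x) / l)).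
  by apply: nondecreasing_measurable => //; exact: yreal_nondec.
by apply: measurable_funM => //; exact: measurable_euclidean_norm.
Qed.

(** On [Om] the comparison [Q2] applies, its additive term being integrated over [Om] only; outside
    [Om] the density vanishes almost everywhere. The factor [n] in the scaling turns the coordinate
    sum into the Euclidean length. *)
Lemma density_energy (d : R) : 0 < d -> exists2 C, 0 <= C & forall u g (l : R), admissible Om u g -> 0 < l ->
  (\int[m]_x (al (gnorm (coord g) x / (n%:R * c * l)))%:E <=
   C%:E * gradient_energy g l + (d * slack%:R)%:E * m Om)%E.
Proof.
move=> d0; have [C C0 HC] := Q2 d0; exists C => // u g l adm l0.
have mg i : measurable_fun setT (coord g i) by have [_ [? _] _] := adm_wder adm i.
have mI : measurable_fun setT (fun x => ((d * slack%:R)%:E * (\1_Om x)%:E)%E).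
  by apply: emeasurable_funM => //; exact: measurable_EFin_indic.
have mY := @measurable_gradient_density g l mg.
have mCY : measurable_fun setT (fun x => (C%:E * (yreal A (en (g x) / l))%:E)%E) by exact: emeasurable_funM.
have Y0 x : (0 <= (yreal A (en (g x) / l))%:E)%E by rewrite lee_fin yreal_ge0.
have ds0 : 0 <= d * slack%:R by rewrite mulr_ge0// ltW.
apply: (@le_trans _ _ (\int[m]_x (C%:E * (yreal A (en (g x) / l))%:E + (d * slack%:R)%:E * (\1_Om x)%:E))%E); last first.
  rewrite ge0_integralD//; last 2 first.
  - by move=> x _; rewrite mule_ge0// lee_fin.
  - by move=> x _; rewrite mule_ge0// lee_fin.
  rewrite (ge0_integralZlT m mY Y0)//; apply: leeD => //.
  rewrite ge0_integralZlT//; last exact: measurable_EFin_indic.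
  have -> : (\int[m]_x (\1_Om x)%:E = m Om)%E by exact: integral_indicT.
  exact: lexx.
apply: ae_ge0_le_integral => //.
- by move=> x _; rewrite lee_fin; exact: capacity_ge0 cap _.
- apply/measurable_EFinP; apply: (@measurableT_comp _ _ _ _ _ _ al _ (fun x => gnorm (coord g) x / (n%:R * c * l))).
    exact: capacity_measurable cap.
  by apply: measurable_funM => //; exact: measurable_gnorm.
- by move=> x _; rewrite adde_ge0// mule_ge0// lee_fin.
- exact: emeasurable_funD.
apply: filterS (gradient_off adm) => x gx _; have [xO|xO] := pselect (Om x).
  rewrite indicE (mem_set xO) mule1 -EFinM -EFinD lee_fin.
  have e0 := euclidean_norm_ge0 (g x).
  apply: (@le_trans _ _ (al (en (g x) / (c * l)))).
    apply: (cap_nondec cap); rewrite ler_pdivrMr ?mulr_gt0//.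
    apply: le_trans (gnorm_euclidean g x) _.
    have -> : en (g x) / (c * l) * (n%:R * c * l) = n%:R * en (g x).
      by field; rewrite !gt_eqF.
    exact: lexx.
  apply: le_trans (HC _ _) _; first by rewrite divr_ge0// mulr_ge0// ltW.
  rewrite lerD2r ler_wpM2l//; have -> : c * (en (g x) / (c * l)) = en (g x) / l by field; rewrite !gt_eqF.
  exact: lexx.
rewrite [X in al X](_ : _ = 0); last first.
  have := gnorm_euclidean g x; rewrite (gx xO) euclidean_norm0 mulr0 => G0.
  have -> : gnorm (coord g) x = 0 by apply/eqP; rewrite eq_le G0 gnorm_ge0.
  exact: mul0r.
rewrite (cap_neg cap (lexx 0)); apply: adde_ge0; first by rewrite mule_ge0// lee_fin.
by rewrite mule_ge0// lee_fin.
Qed.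

Section scaled.
Variables (u : V -> R) (g : V -> V) (l : R).
Hypotheses (adm : admissible Om u g) (l0 : 0 < l).
Let L := n%:R * c * l.
Let L0 : 0 < L. Proof. by rewrite !mulr_gt0. Qed.
Let u' x := L^-1 * u x.
Let g' i x := L^-1 * coord g i x.
Let ug' i : wder i u' (g' i). Proof. exact: wderZ (adm_wder adm i). Qed.
Let ule s : 0 < s -> (m [set x | (s < `|u' x|)%R] < +oo)%E.
Proof.
move=> s0; rewrite (_ : [set x | _] = [set x | s * L < `|u x|]).
  by apply: (adm_level adm); rewrite mulr_gt0.
by apply/seteqP; split => x /=; rewrite /u' normrM gtr0_norm ?invr_gt0// [L^-1 * _]mulrC ltr_pdivlMr.
Qed.

Let gnorm' x : gnorm g' x = gnorm (coord g) x / L.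
Proof.
rewrite /gnorm mulr_suml; apply: eq_bigr => i _.
by rewrite /g' normrM gtr0_norm ?invr_gt0// mulrC.
Qed.

Let potential' (K : R) x : al (T (K * L * `|u' x|)) = al (T (K * `|u x|)).
Proof.
rewrite /u' normrM gtr0_norm ?invr_gt0//; congr (al (T _)).
by field; rewrite gt_eqF.
Qed.

Let densityE : (\int[m]_x (al (gnorm g' x))%:E = \int[m]_x (al (gnorm (coord g) x / L))%:E)%E.
Proof. by apply: eq_integral => x _; rewrite gnorm'. Qed.

(** Dividing [u] by [L = n c l] turns a finite energy with parameter [l] into a finite integral of
    [al]; the potential of [u] at [K] is that of the quotient at [K L], and [K] is arbitrary. *)
Lemma scaled_potential_finite (K : R) : 0 < K -> (gradient_energy g l < +oo)%E ->
  (\int[m]_x (al (T (K * `|u x|)))%:E < +oo)%E.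
Proof.
move=> K0 fin; have KL : 0 < K * L by rewrite mulr_gt0.
have H := @potential_finite _ _ al h T n1 cap T_nondec T_gt0 T0 T_inv u' g' ug' ule (K * L) KL.
under eq_integral => x _ do rewrite -potential'.
apply: H; rewrite densityE; have [C C0 HC] := density_energy ltr01.
apply: le_lt_trans (HC _ _ _ adm l0) _; apply: lte_add_pinfty.
  exact: lte_mul_pinfty.
rewrite mul1r; case: (boolP slack) Om_fin => _ H'; last by rewrite mul0e.
by rewrite mul1e; exact: H'.
Qed.

Lemma scaled_potential_small (K M : R) : 0 < K -> 0 < M ->
  @weak_const R n ^+ n * (M * (4 * (K * L)) ^+ n) < 1 ->
  (\int[m]_x (al (gnorm (coord g) x / L))%:E <= M%:E)%E ->
  (\int[m]_x (al (T (K * `|u x|)))%:E <= M%:E)%E.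
Proof.
move=> K0 M0 KM; rewrite -densityE => HM; have KL : 0 < K * L by rewrite mulr_gt0.
have H := @potential_small _ _ al h T n1 cap T_nondec T_gt0 T0 T_inv u' g' ug' ule (K * L) KL M M0 KM HM.
by under eq_integral => x _ do rewrite -potential'.
Qed.

End scaled.

(** The outer factor [kappa] in the bound on [D] cancels against the parameter [kappa l]; the inner
    one passes into the potential. *)
Lemma growth_bound (s v l : R) : 0 <= v -> 0 < l ->
  (B (`|D s| * v / (kappa * l))%R <= (yreal A (v / l) + al (T (c * kappa * `|s|)) + c0)%:E)%E.
Proof.
move=> v0 l0; have vl : 0 <= v / l by rewrite divr_ge0// ltW.
apply: le_trans (_ : B (v / l * E (kappa * `|s|))%R <= _)%E; last first.
  by rewrite -[c * kappa * _]mulrA; apply: Q1 => //; rewrite mulr_ge0// ltW.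
apply: (young_nondec yB); first by rewrite divr_ge0 ?mulr_ge0 ?(ltW k0) ?(ltW l0).
rewrite ler_pdivrMr ?mulr_gt0//.
have -> : v / l * E (kappa * `|s|) * (kappa * l) = kappa * E (kappa * `|s|) * v by field; rewrite gt_eqF.
exact: ler_wpM2r.
Qed.

Definition chain_gradient u g : V -> V := fun x => D (u x) *: g x.

Lemma coord_chain_gradient u g i x : coord (chain_gradient u g) i x = coord g i x * D (u x).
Proof. by rewrite /coord mxE mulrC. Qed.

Lemma measurable_chain_gradient Om' u g i : admissible Om' u g -> measurable_fun setT (coord (chain_gradient u g) i).
Proof.
move=> adm; have [[mu _] [mg _] _] := adm_wder adm i.
rewrite (_ : coord _ i = fun x => coord g i x * D (u x)); last by apply/funext => x; exact: coord_chain_gradient.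
by apply: measurable_funM => //; apply: measurableT_comp => //; case: lD.
Qed.

Lemma growth_bound_norm u g (l : R) x : 0 < l ->
  (B (en (chain_gradient u g x) / (kappa * l))%R <= (yreal A (en (g x) / l) + al (T (c * kappa * `|u x|)) + c0)%:E)%E.
Proof. by move=> l0; rewrite /chain_gradient euclidean_normZ; apply: growth_bound => //; exact: euclidean_norm_ge0. Qed.

Lemma growth_bound_ae u g (l : R) : admissible Om u g -> 0 < l -> {ae m, forall x,
  (B (en (chain_gradient u g x) / (kappa * l))%R <=
   (yreal A (en (g x) / l) + al (T (c * kappa * `|u x|)) + c0 * \1_Om x)%:E)%E}.
Proof.
move=> adm l0; apply: filterS (gradient_off adm) => x gx; have [xO|xO] := pselect (Om x).
  by rewrite indicE (mem_set xO) mulr1; exact: growth_bound_norm.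
rewrite /chain_gradient (gx xO) scaler0 euclidean_norm0 mul0r (young0 yB) lee_fin.
by rewrite !addr_ge0 ?mulr_ge0// ?(capacity_ge0 cap)// yreal_ge0.
Qed.

Lemma c0_indic_summable : summable_fun m (fun x => c0 * \1_Om x).
Proof.
case: (boolP slack) Om_fin c0_slack => _ H c00; first by apply: summableZ; exact: (summable_indic mOm (H isT)).
rewrite c00// (_ : (fun _ => _) = fun=> 0); first exact: summable0.
by apply/funext => x; rewrite mul0r.
Qed.

Lemma gradient_summable u g (l : R) : admissible Om u g -> (gradient_energy g l < +oo)%E ->
  summable_fun m (fun x => yreal A (en (g x) / l)).
Proof.
move=> adm fin; split.
  by apply/measurable_EFinP; apply: measurable_gradient_density => i; have [_ []] := adm_wder adm i.
rewrite (_ : (fun x => _) = fun x => (yreal A (en (g x) / l))%:E); first exact: fin.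
by apply/funext => x; rewrite ger0_norm// yreal_ge0.
Qed.

Lemma potential_summable u g (l K : R) : admissible Om u g -> 0 < l -> 0 < K -> (gradient_energy g l < +oo)%E ->
  summable_fun m (fun x => al (T (K * `|u x|))).
Proof.
move=> adm l0 K0 fin; have [[mu _] _ _] := adm_wder adm (Ordinal (ltnW n1)); split.
  apply: (@measurableT_comp _ _ _ _ _ _ (fun s : R => al (T (K * s))) _ (fun x => `|u x|)).
    apply: nondecreasing_measurable => // s t st; apply: (cap_nondec cap); apply: T_nondec.
    by rewrite ler_wpM2l// ltW.
  exact: measurableT_comp.
rewrite (_ : (fun x => _) = fun x => (al (T (K * `|u x|)))%:E); first exact: (scaled_potential_finite adm l0 K0 fin).
by apply/funext => x; rewrite ger0_norm//; exact: (capacity_ge0 cap).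
Qed.

Definition growth_density u g (l : R) x := yreal A (en (g x) / l) + al (T (c * kappa * `|u x|)) + c0 * \1_Om x.

Lemma growth_density_summable u g (l : R) : admissible Om u g -> 0 < l -> (gradient_energy g l < +oo)%E ->
  summable_fun m (growth_density u g l).
Proof.
move=> adm l0 fin; apply: summableD c0_indic_summable.
apply: summableD; first exact: (gradient_summable adm fin).
by apply: (potential_summable adm l0 _ fin); rewrite mulr_gt0.
Qed.

Lemma growth_density_ge0 u g l x : 0 <= growth_density u g l x.
Proof. by rewrite /growth_density !addr_ge0 ?mulr_ge0// ?(capacity_ge0 cap)// yreal_ge0. Qed.

Lemma chain_gradient_energy u g (l : R) : admissible Om u g -> 0 < l -> (gradient_energy g l < +oo)%E ->
  (\int[m]_x B (en (chain_gradient u g x) / (kappa * l))%R < +oo)%E.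
Proof.
move=> adm l0 fin; have [md ifin] := growth_density_summable adm l0 fin.
apply: le_lt_trans _ ifin; apply: ae_ge0_le_integral => //.
- by move=> x _; apply: (young_ge0 yB); rewrite divr_ge0 ?euclidean_norm_ge0// mulr_ge0// ltW.
- apply: measurable_young_norm => //; first by rewrite mulr_ge0// ltW.
  by move=> i; exact: (measurable_chain_gradient i adm).
- by apply/measurable_EFinP; exact: measurableT_comp.
apply: filterS (growth_bound_ae adm l0) => x H _; apply: le_trans H _.
by rewrite lee_fin; exact: ler_norm.
Qed.

(* Since B grows at least linearly, a finite B-energy gives integrability on sets of finite measure. *)
Lemma chain_gradient_local u g (l : R) (S : set V) : admissible Om u g -> 0 < l -> (gradient_energy g l < +oo)%E ->
  measurable S -> (m S < +oo)%E -> (\int[m]_(x in S) (en (chain_gradient u g x))%:E < +oo)%E.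
Proof.
move=> adm l0 fin mS Sfin; have [t1 [b [t10 b0 tB]]] := young_linear yB.
have kl0 : 0 < kappa * l by rewrite mulr_gt0.
have mg i := measurable_chain_gradient i adm.
have mB : measurable_fun setT (fun x => B (en (chain_gradient u g x) / (kappa * l))).
  by apply: measurable_young_norm => //; exact: ltW.
have B0 x : (0 <= B (en (chain_gradient u g x) / (kappa * l)))%E.
  by apply: (young_ge0 yB); rewrite divr_ge0 ?euclidean_norm_ge0// ltW.
have men : measurable_fun setT (fun x => (en (chain_gradient u g x))%:E).
  by apply/measurable_EFinP; exact: measurable_euclidean_norm.
have mbB : measurable_fun setT (fun x => (b%:E * B (en (chain_gradient u g x) / (kappa * l)))%E).
  exact: emeasurable_funM.
have bB0 x : (0 <= b%:E * B (en (chain_gradient u g x) / (kappa * l)))%E.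
  by rewrite mule_ge0// lee_fin ltW.
have mtB : measurable_fun setT (fun x => (t1%:E + b%:E * B (en (chain_gradient u g x) / (kappa * l)))%E).
  exact: emeasurable_funD.
have tB0 x : (0 <= t1%:E + b%:E * B (en (chain_gradient u g x) / (kappa * l)))%E.
  by rewrite adde_ge0// lee_fin ltW.
have EB := chain_gradient_energy adm l0 fin.
have klE : (0 <= (kappa * l)%:E)%E by rewrite lee_fin ltW.
have bE : (0 <= b%:E)%E by rewrite lee_fin ltW.
have t1E : (0 <= t1%:E)%E by rewrite lee_fin ltW.
apply: (@le_lt_trans _ _ ((kappa * l)%:E * (t1%:E * m S + b%:E * \int[m]_x B (en (chain_gradient u g x) / (kappa * l))%R))%E).
  apply: (@le_trans _ _ (\int[m]_(x in S) ((kappa * l)%:E * (t1%:E + b%:E * B (en (chain_gradient u g x) / (kappa * l)))))%E).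
    apply: ge0_le_integral => //.
    - by move=> x _; rewrite lee_fin euclidean_norm_ge0.
    - exact: measurable_funS men.
    - by apply: (@measurable_funS _ _ _ _ setT) => //; exact: emeasurable_funM.
    move=> x _; have e0 := euclidean_norm_ge0 (chain_gradient u g x).
    have H := tB _ (divr_ge0 e0 (ltW kl0)).
    have -> : (en (chain_gradient u g x))%:E = ((kappa * l)%:E * (en (chain_gradient u g x) / (kappa * l))%:E)%E.
      by rewrite -EFinM mulrC divfK// gt_eqF.
    exact: lee_wpmul2l.
  rewrite ge0_integralZl//; last exact: measurable_funS mtB.
  apply: lee_wpmul2l => //.
  rewrite ge0_integralD//; last exact: measurable_funS mbB.
  rewrite integral_cst// ge0_integralZl//; last exact: measurable_funS mB.
  apply: leeD => //; apply: lee_wpmul2l => //.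
  exact: ge0_subset_integral.
by apply: lte_mul_pinfty => //; apply: lte_add_pinfty; exact: lte_mul_pinfty.
Qed.

(** A finite [B]-energy makes the formal gradient summable on cubes and on the set [|u| > 1], which
    is what the chain rule for locally bounded [D] requires. *)
Lemma chain_admissible u g (l : R) : admissible Om u g -> 0 < l -> (gradient_energy g l < +oo)%E ->
  admissible Om (fun x => prim D (u x)) (chain_gradient u g).
Proof.
move=> adm l0 fin; have n0 := ltnW n1; have [[mu _] _ _] := adm_wder adm (Ordinal n0).
have mg i := measurable_chain_gradient i adm.
have m1 := adm_level adm ltr01.
have mG : measurable_fun setT (fun x => (en (chain_gradient u g x))%:E).
  by apply/measurable_EFinP; exact: measurable_euclidean_norm.
have H0 : forall i, wder i (fun x => prim D (u x)) (coord (chain_gradient u g) i).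
  have H : forall i, wder i (fun x => prim D (u x)) (fun x => coord g i x * D (u x)).
    apply: (@wder_prim _ _ u (coord g) D n0 (adm_wder adm) lD m1).
      move=> i; rewrite (_ : (fun x => _) = coord (chain_gradient u g) i); last first.
        by apply/funext => x; rewrite coord_chain_gradient.
      split=> // k; split; first by apply: measurable_funM => //; exact: measurable_indic (measurable_cube _).
      have mk : measurable (cube k%:R : set V) by exact: measurable_cube.
      have mkf : (m (cube k%:R) < +oo)%E by exact: cube_lty.
      apply: le_lt_trans _ (chain_gradient_local adm l0 fin mk mkf).
      rewrite [leRHS]integral_mkcond; apply: ge0_le_integralT.
      - by apply/measurable_EFinP; apply: measurableT_comp => //; apply: measurable_funM => //; exact: measurable_indic.
      - by apply/(measurable_restrictT _ _).1 => //; exact: measurable_funS mG.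
      - by move=> x; rewrite lee_fin.
      move=> x; rewrite patchE indicE; case: ifPn => xk; last by rewrite mulr0 normr0.
      by rewrite mulr1 lee_fin euclidean_norm_coord.
    have mS : measurable [set x | 1 < `|u x|] by apply: measurable_lt_set => //; exact: measurableT_comp.
    apply: le_lt_trans _ (lte_mul_pinfty (_ : 0 <= n%:R%:E)%E _ (chain_gradient_local adm l0 fin mS m1)) => //.
    rewrite -ge0_integralZl//; [|exact: measurable_funS mG|by move=> x _; rewrite lee_fin euclidean_norm_ge0].
    apply: ge0_le_integral => //.
    - by move=> x _; rewrite lee_fin gnorm_ge0.
    - apply: (@measurable_funS _ _ _ _ setT) => //; apply/measurable_EFinP; apply: measurable_gnorm => i.
      rewrite (_ : (fun x => _) = coord (chain_gradient u g) i)//.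
      by apply/funext => x; rewrite coord_chain_gradient.
    - by apply: (@measurable_funS _ _ _ _ setT) => //; exact: emeasurable_funM.
    move=> x _; rewrite -EFinM lee_fin; apply: le_trans (gnorm_euclidean _ _).
    by apply: ler_sum => i _; rewrite coord_chain_gradient.
  move=> i; rewrite (_ : coord _ i = fun x => coord g i x * D (u x)); first exact: H.
  by apply/funext => x; exact: coord_chain_gradient.
have [[mP _] _ _] := H0 (Ordinal n0).
split; first exact: H0.
(* Where [|u| <= d <= 1], the primitive is at most [|C| d <= t]; its superlevel set at [t] is
   contained in that of [u] at [d]. *)
- move=> t t0; have [C HC] := lD.2 1; pose d := Num.min 1 (t / (1 + `|C|)).
  have C1 : 0 < 1 + `|C| by rewrite ltr_pwDl.
  have d0 : 0 < d by rewrite lt_min ltr01 divr_gt0.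
  apply: le_lt_trans (adm_level adm d0); apply: le_measure; rewrite ?inE.
  + by apply: measurable_lt_set => //; exact: measurableT_comp.
  + by apply: measurable_lt_set => //; exact: measurableT_comp.
  move=> x /=; rewrite !ltNge; apply: contra => ud.
  have u1 : `|u x| <= 1 by apply: le_trans ud _; rewrite ge_min lexx.
  have bT : forall s, `|trunc_fun 1 D s| <= `|C|.
    move=> s; rewrite /trunc_fun indicE; have [s1|s1] := pselect (`|s| <= 1).
      by rewrite mem_set// mulr1; apply: le_trans (HC _ s1) (ler_norm _).
    by rewrite memNset// mulr0 normr0.
  rewrite -(@prim_trunc _ 1 D (u x) u1); apply: le_trans (prim_continuous_bound _ (trunc_bounded 1 lD) bT) _.
  apply: (@le_trans _ _ ((1 + `|C|) * d)); first by apply: ler_pM => //; rewrite lerDr.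
  by rewrite mulrC -ler_pdivlMr// ge_min lexx orbT.
- by move=> x /(adm_off adm) ->; exact: prim0.
Qed.


Lemma admissibleB u w g q : admissible Om u g -> admissible Om w q ->
  admissible Om (fun x => u x - w x) (fun x => g x - q x).
Proof.
move=> ug wq; split.
- move=> i; have := wder_comb (-1) (adm_wder ug i) (adm_wder wq i).
  rewrite (_ : (fun x => u x + -1 * w x) = fun x => u x - w x); last by apply/funext => x; rewrite mulN1r.
  rewrite (_ : (fun x => coord g i x + -1 * coord q i x) = coord (fun x => g x - q x) i)//.
  by apply/funext => x; rewrite /coord !mxE mulN1r.
- move=> t t0; have t2 : 0 < t / 2 by rewrite divr_gt0.
  have [[mu _] _ _] := adm_wder ug (Ordinal (ltnW n1)); have [[mw _] _ _] := adm_wder wq (Ordinal (ltnW n1)).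
  have mU : measurable [set x | t / 2 < `|u x|] by apply: measurable_lt_set => //; exact: measurableT_comp.
  have mW : measurable [set x | t / 2 < `|w x|] by apply: measurable_lt_set => //; exact: measurableT_comp.
  apply: (@le_lt_trans _ _ (m [set x | (t / 2 < `|u x|)%R] + m [set x | (t / 2 < `|w x|)%R])%E); last first.
    by apply: lte_add_pinfty; [exact: (adm_level ug)|exact: (adm_level wq)].
  apply: le_trans (@measureU2 _ _ _ m _ _ mU mW); apply: le_measure; rewrite ?inE.
  + by apply: measurable_lt_set => //; apply: measurableT_comp => //; exact: measurable_funB.
  + exact: measurableU.
  move=> x /= tx; have [ux|ux] := ltP (t / 2) `|u x|; first by left.
  right; rewrite ltNge; apply/negP => wx; move: tx; apply/negP; rewrite -leNgt.
  apply: le_trans (ler_normB _ _) _; have -> : t = t / 2 + t / 2 by field.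
  exact: lerD.
- by move=> x xO; rewrite (adm_off ug xO) (adm_off wq xO) subr0.
Qed.

(* Convexity of A gives [t <= d + (d / A d) A t]. *)
Lemma energy_L1 g (l d : R) (S : set V) : (forall i, measurable_fun setT (coord g i)) -> 0 < l -> 0 < d ->
  measurable S ->
  (\int[m]_(x in S) (en (g x))%:E <= l%:E * (d%:E * m S + (d / yreal A d)%:E * gradient_energy g l))%E.
Proof.
move=> mg l0 d0 mS; have Ad := yreal_gt0 yA finA posA d0.
have mY := @measurable_gradient_density g l mg.
have b0 : 0 <= d / yreal A d by rewrite divr_ge0 ?ltW.
have Y0 x : (0 <= (yreal A (en (g x) / l))%:E)%E by rewrite lee_fin yreal_ge0.
have lE : (0 <= l%:E)%E by rewrite lee_fin ltW.
have dE : (0 <= d%:E)%E by rewrite lee_fin ltW.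
have bE : (0 <= (d / yreal A d)%:E)%E by rewrite lee_fin.
have mbY : measurable_fun setT (fun x => ((d / yreal A d)%:E * (yreal A (en (g x) / l))%:E)%E).
  exact: emeasurable_funM.
have bY0 x : (0 <= (d / yreal A d)%:E * (yreal A (en (g x) / l))%:E)%E by exact: mule_ge0.
have mS' : measurable_fun setT (fun x => (d%:E + (d / yreal A d)%:E * (yreal A (en (g x) / l))%:E)%E).
  exact: emeasurable_funD.
have men : measurable_fun setT (fun x => (en (g x))%:E) by apply/measurable_EFinP; exact: measurable_euclidean_norm.
have pw x : ((en (g x))%:E <= l%:E * (d%:E + (d / yreal A d)%:E * (yreal A (en (g x) / l))%:E))%E.
  have e0 := euclidean_norm_ge0 (g x).
  rewrite -[X in (_ + X)%E]EFinM -EFinD -EFinM lee_fin -ler_pdivrMl// mulrC.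
  set t := en (g x) / l; have [td|/ltW dt] := leP t d.
    by apply: le_trans td _; rewrite lerDl mulr_ge0// yreal_ge0.
  have t0 := lt_le_trans d0 dt.
  apply: (@le_trans _ _ (d / yreal A d * yreal A t)); last by rewrite lerDr ltW.
  have := yreal_ratio yA finA posA d0 dt.
  by rewrite ler_pdivrMr ?(yreal_gt0 yA finA posA)// mulrC.
apply: (@le_trans _ _ (\int[m]_(x in S) (l%:E * (d%:E + (d / yreal A d)%:E * (yreal A (en (g x) / l))%:E)))%E).
  apply: ge0_le_integral => //.
  - by move=> x _; rewrite lee_fin euclidean_norm_ge0.
  - exact: measurable_funS men.
  - by apply: (@measurable_funS _ _ _ _ setT) => //; exact: emeasurable_funM.
rewrite ge0_integralZl//; [|exact: measurable_funS mS'|by move=> x _; exact: adde_ge0].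
apply: lee_wpmul2l => //.
rewrite ge0_integralD//; last exact: measurable_funS mbY.
rewrite integral_cst//; apply: leeD => //.
rewrite ge0_integralZl//; last exact: measurable_funS mY.
by apply: lee_wpmul2l => //; exact: ge0_subset_integral.
Qed.

Section vanishing_energy.
Variables (w_ : nat -> V -> R) (q_ : nat -> V -> V) (l : R).
Hypotheses (adm : forall k, admissible Om (w_ k) (q_ k)) (l0 : 0 < l)
  (van : vanishing (fun k => gradient_energy (q_ k) l)).

Let mq k i : measurable_fun setT (coord (q_ k) i). Proof. by have [_ []] := adm_wder (adm k) i. Qed.
Let mw k : measurable_fun setT (w_ k). Proof. by have [[]] := adm_wder (adm k) (Ordinal (ltnW n1)). Qed.

Lemma density_vanishing : vanishing (fun k => \int[m]_x (al (gnorm (coord (q_ k)) x / (n%:R * c * l)))%:E)%E.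
Proof.
move=> e e0; have e2 : 0 < e / 2 by rewrite divr_gt0.
(* The additive constant is made small on [Om] before the factor [C], which depends on [d], is
   known. *)
have [d d0 Hd] : exists2 d, 0 < d & ((d * slack%:R)%:E * m Om <= (e / 2)%:E)%E.
  case: (boolP slack) Om_fin => _ H; last by exists 1 => //; rewrite mulr0 mul0e lee_fin ltW.
  have fO : m Om \is a fin_num by rewrite ge0_fin_numE//; exact: H.
  have O0 : 0 <= fine (m Om) by exact: fine_ge0.
  exists (e / 2 / (1 + fine (m Om))); first by rewrite divr_gt0// ltr_wpDr.
  rewrite mulr1 -[m Om]fineK// -EFinM lee_fin mulrAC ler_pdivrMr ?ltr_wpDr//.
  by rewrite ler_wpM2l ?(ltW e2)// lerDr.
have [C C0 HC] := density_energy d0; have [N HN] := vanishingZ C0 van e2.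
exists N => k /HN H; apply: le_trans (HC _ _ _ (adm k) l0) _.
have -> : e = e / 2 + e / 2 by field.
by rewrite EFinD; exact: leeD.
Qed.

(** The threshold [M1] depends on [K] only, and below it the potential is bounded by the same number
    as the energy density, however small. *)
Lemma potential_vanishing (K : R) : 0 < K -> vanishing (fun k => \int[m]_x (al (T (K * `|w_ k x|)))%:E)%E.
Proof.
move=> K0 e e0; have KL : 0 < K * (n%:R * c * l) by rewrite !mulr_gt0.
have [M1 M10 KM1] := @strong_type_constant R n _ KL.
pose M := Num.min e M1; have M0 : 0 < M by rewrite lt_min e0 M10.
have [N HN] := density_vanishing M0; exists N => k /HN H.
apply: (@le_trans _ _ M%:E); last by rewrite lee_fin ge_min lexx.
apply: (scaled_potential_small (adm k) l0 K0 M0 _ H).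
apply: le_lt_trans KM1; apply: ler_wpM2l.
  by apply: exprn_ge0; apply: mulr_ge0; [exact: exprn_ge0|apply: addr_ge0 => //; exact: exprn_ge0].
apply: ler_wpM2r; last by rewrite ge_min lexx orbT.
by apply: exprn_ge0; apply: mulr_ge0 => //; exact: ltW.
Qed.

Lemma gradient_loc_vanishing (J : nat) : vanishing (fun k => \int[m]_(x in cube J%:R) (en (q_ k x))%:E)%E.
Proof.
move=> e e0; have e2 : 0 < e / 2 by rewrite divr_gt0.
have mc : measurable (cube J%:R : set V) by exact: measurable_cube.
have fJ : m (cube J%:R) \is a fin_num by rewrite ge0_fin_numE//; exact: cube_lty.
pose v := fine (m (cube J%:R)); have v0 : 0 <= v by exact: fine_ge0.
pose d := e / 2 / (l * (1 + v)); have d0 : 0 < d by rewrite divr_gt0// mulr_gt0// ltr_wpDr.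
have b0 : 0 <= l * (d / yreal A d) by rewrite mulr_ge0 ?(ltW l0)// divr_ge0 ?ltW// yreal_gt0.
have [N HN] := vanishingZ b0 van e2; exists N => k /HN H.
apply: le_trans (energy_L1 (mq k) l0 d0 mc) _.
rewrite ge0_muleDr; last 2 first.
- by rewrite mule_ge0// lee_fin ltW.
- by rewrite mule_ge0//; [rewrite lee_fin divr_ge0// ?ltW// yreal_gt0|apply: integral_ge0 => x _; rewrite lee_fin yreal_ge0].
rewrite [X in (_ + X)%E]muleA -EFinM.
have -> : e = e / 2 + e / 2 by field.
rewrite EFinD; apply: leeD H; rewrite -[m _]fineK// -!EFinM lee_fin -/v.
have -> : l * (d * v) = e / 2 * (v / (1 + v)) by rewrite /d; field; rewrite !gt_eqF// ltr_wpDr.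
by rewrite ler_piMr ?(ltW e2)// ler_pdivrMr ?ltr_wpDr// mul1r lerDr.
Qed.

(** Gradient convergence yields convergence of the functions. The potential forces [|w_k| > d] to
    have measure at most 1, the layer bound then estimates the excess of [|w_k|] over [2 d] by the
    gradient energy, and the rest is at most [2 d] on the cube. The numbers [d] and [s] make the two
    fixed contributions at most [e/2] and [e/4]. *)
Lemma function_loc_vanishing (J : nat) : vanishing (fun k => \int[m]_(x in cube J%:R) `|w_ k x|%:E)%E.
Proof.
move=> e e0; have n0 := ltnW n1; have e2 : 0 < e / 2 by rewrite divr_gt0.
have mc : measurable (cube J%:R : set V) by exact: measurable_cube.
have fJ : m (cube J%:R) \is a fin_num by rewrite ge0_fin_numE//; exact: cube_lty.
pose v := fine (m (cube J%:R)); have v0 : 0 <= v by exact: fine_ge0.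
have v1 : 0 < 1 + v by rewrite ltr_wpDr.
pose d := e / 2 / (2 * (1 + v)); have d0 : 0 < d by rewrite divr_gt0// mulr_gt0.
pose s := e / 2 / 2 / (2 ^+ n.+1 * n%:R * l); have W0 : 0 < 2 ^+ n.+1 * n%:R * l by rewrite !mulr_gt0// exprn_gt0.
have s0 : 0 < s by rewrite !divr_gt0.
have b0 : 0 <= 2 ^+ n.+1 * n%:R * l * (s / yreal A s).
  by rewrite mulr_ge0 ?(ltW W0)// divr_ge0 ?ltW// yreal_gt0.
have e4 : 0 < e / 2 / 2 by rewrite divr_gt0.
have [N1 H1] := vanishingZ b0 van e4.
have aT0 : 0 < al (T d).
  have := cap_dual cap (T_gt0 d0) => E0; rewrite lt_neqAle (capacity_ge0 cap) andbT.
  by apply/eqP => Z; move: E0; rewrite -Z mulr0 => /eqP; rewrite gt_eqF// T_gt0.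
have [N2 H2] := potential_vanishing ltr01 aT0.
exists (maxn N1 N2) => k; rewrite geq_max => /andP[/H1 h1 /H2 h2].
have mS : measurable [set x | d < `|w_ k x|] by apply: measurable_lt_set => //; exact: measurableT_comp.
(* Chebyshev's inequality: on this set the potential is at least [al(T d)], and its integral is at
   most that number. *)
have mS1 : (m [set x | (d < `|w_ k x|)%R] <= 1%:E)%E.
  have aE : (0 < (al (T d))%:E)%E by rewrite lte_fin.
  have aR : (al (T d))%:E \is a fin_num by [].
  rewrite -(@lee_pmul2l _ (al (T d))%:E)// mule1; apply: le_trans h2.
  have <- : (\int[m]_(x in [set x | (d < `|w_ k x|)%R]) (al (T d))%:E = (al (T d))%:E * m [set x | (d < `|w_ k x|)%R])%E.
    exact: integral_cst.
  have mP : measurable_fun setT (fun x => (al (T (1 * `|w_ k x|)))%:E).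
    apply/measurable_EFinP; apply: (@measurableT_comp _ _ _ _ _ _ (fun s : R => al (T (1 * s))) _ (fun x => `|w_ k x|)).
      apply: nondecreasing_measurable => // s1 s2 s12; apply: (cap_nondec cap); apply: T_nondec.
      by rewrite !mul1r.
    exact: measurableT_comp.
  apply: (@le_trans _ _ (\int[m]_(x in [set x | (d < `|w_ k x|)%R]) (al (T (1 * `|w_ k x|)))%:E)%E).
    apply: ge0_le_integral => //; first by move=> x _; rewrite lee_fin ltW.
      exact: measurable_funS mP.
    by move=> x /= dx; rewrite lee_fin; apply: (cap_nondec cap); apply: T_nondec; rewrite mul1r ltW.
  by apply: ge0_subset_integral => // x _; rewrite lee_fin; exact: (capacity_ge0 cap).
have mS1' : (m [set x | (d < `|w_ k x|)%R] <= (1 ^+ n : R)%:E)%E by rewrite expr1n.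
have LB := @layer_bound R n (w_ k) (coord (q_ k)) d d 1 n0 (adm_wder (adm k)) (ltW d0) d0 ltr01 mS1'.
have mG : measurable_fun setT (fun x => (gnorm (coord (q_ k)) x)%:E).
  by apply/measurable_EFinP; exact: measurable_gnorm.
have men : measurable_fun setT (fun x => (en (q_ k x))%:E).
  by apply/measurable_EFinP; exact: measurable_euclidean_norm.
have nE : (0 <= n%:R%:E :> \bar R)%E by rewrite lee_fin.
have GB : (\int[m]_(x in [set x | (d < `|w_ k x|)%R]) (gnorm (coord (q_ k)) x)%:E <=
    n%:R%:E * \int[m]_(x in [set x | (d < `|w_ k x|)%R]) (en (q_ k x))%:E)%E.
  rewrite -ge0_integralZl//; [|exact: measurable_funS men|by move=> x _; rewrite lee_fin euclidean_norm_ge0].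
  apply: ge0_le_integral => //.
  - by move=> x _; rewrite lee_fin gnorm_ge0.
  - exact: measurable_funS mG.
  - by apply: (@measurable_funS _ _ _ _ setT) => //; exact: emeasurable_funM.
  by move=> x _; rewrite -EFinM lee_fin; exact: gnorm_euclidean.
have EB := energy_L1 (mq k) l0 s0 mS.
have ge : (0 <= gradient_energy (q_ k) l)%E by apply: integral_ge0 => x _; rewrite lee_fin yreal_ge0.
have sA : 0 <= s / yreal A s by rewrite divr_ge0 ?ltW// yreal_gt0.
have T1 : (\int[m]_x (Num.max 0 (`|w_ k x| - (d + d)))%:E <= (e / 2)%:E)%E.
  apply: le_trans LB _; rewrite mulr1.
  have pE : (0 <= (2 ^+ n.+1 : R)%:E)%E by rewrite lee_fin exprn_ge0.
  apply: le_trans (lee_wpmul2l pE (le_trans GB (lee_wpmul2l nE EB))) _.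
  rewrite !muleA -!EFinM ge0_muleDr; last 2 first.
  - by rewrite mule_ge0// lee_fin ltW.
  - by rewrite mule_ge0.
  rewrite !muleA -!EFinM.
  have -> : e / 2 = e / 2 / 2 + e / 2 / 2 by field.
  rewrite EFinD; apply: leeD h1.
  have -> : 2 ^+ n.+1 * n%:R * l * s = e / 2 / 2 by rewrite /s mulrC divfK// gt_eqF.
  have e4E : (0 <= (e / 2 / 2)%:E)%E by rewrite lee_fin ltW.
  by apply: le_trans (lee_wpmul2l e4E mS1) _; rewrite mule1.
have mmax : measurable_fun setT (fun x => (Num.max 0 (`|w_ k x| - (d + d)))%:E).
  by apply/measurable_EFinP; apply: measurable_maxr => //; apply: measurable_funB => //; exact: measurableT_comp.
have max0 x : (0 <= (Num.max 0 (`|w_ k x| - (d + d)))%:E)%E by rewrite lee_fin le_max lexx.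
have mabs : measurable_fun setT (fun x => `|w_ k x|%:E) by apply/measurable_EFinP; exact: measurableT_comp.
apply: (@le_trans _ _ (\int[m]_(x in cube J%:R) ((Num.max 0 (`|w_ k x| - (d + d)))%:E + (d + d)%:E))%E).
  apply: ge0_le_integral => //.
  - exact: measurable_funS mabs.
  - by apply: (@measurable_funS _ _ _ _ setT) => //; exact: emeasurable_funD.
  by move=> x _; rewrite -EFinD lee_fin -lerBlDr le_max lexx orbT.
rewrite ge0_integralD//; [|exact: measurable_funS mmax|by move=> x _; rewrite lee_fin addr_ge0// ltW].
have -> : e = e / 2 + e / 2 by field.
rewrite [leRHS]EFinD; apply: leeD.
  by apply: le_trans T1; exact: ge0_subset_integral.
have -> : (\int[m]_(x in cube J%:R) (d + d)%:E = (d + d)%:E * m (cube J%:R))%E by exact: integral_cst.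
rewrite -[m _]fineK// -EFinM lee_fin -/v.
have -> : (d + d) * v = e / 2 * (v / (1 + v)) by rewrite /d; field; rewrite gt_eqF.
by rewrite ler_piMr ?(ltW e2)// ler_pdivrMr// mul1r lerDr.
Qed.

End vanishing_energy.

(** A point below the mean of [s] and [t] lies below the larger of them, so monotonicity alone gives
    subadditivity up to a factor 2 in the argument. *)
Lemma nondec_half (phi : R -> R) (z s t : R) : {homo phi : a b / a <= b} -> (forall a, 0 <= phi a) ->
  z <= (s + t) / 2 -> phi z <= phi s + phi t.
Proof.
move=> mono phi0 zst; have [st|/ltW ts] := leP s t.
  apply: (@le_trans _ _ (phi t)); last by rewrite lerDr.
  by apply: mono; apply: le_trans zst _; rewrite ler_pdivrMr//; lra.
apply: (@le_trans _ _ (phi s)); last by rewrite lerDl.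
by apply: mono; apply: le_trans zst _; rewrite ler_pdivrMr//; lra.
Qed.

Lemma young_half (z s t : R) : 0 <= z -> 0 <= s -> 0 <= t -> z <= (s + t) / 2 -> (B z <= B s + B t)%E.
Proof.
move=> z0 s0 t0 zst; have [st|/ltW ts] := leP s t.
  apply: (@le_trans _ _ (B t)); last exact: (leeDr _ (young_ge0 yB s0)).
  by apply: (young_nondec yB z0); apply: le_trans zst _; rewrite ler_pdivrMr//; lra.
apply: (@le_trans _ _ (B s)); last exact: (leeDl _ (young_ge0 yB t0)).
by apply: (young_nondec yB z0); apply: le_trans zst _; rewrite ler_pdivrMr//; lra.
Qed.

Section domination.
Variables (v u : V -> R) (q g : V -> V) (l l' : R).
Hypotheses (vq : admissible Om v q) (ug : admissible Om u g) (l0 : 0 < l) (l'0 : 0 < l').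

(** Large enough for [q = (q - g) + g] to be split into two terms with the parameters [l] and [l']:
    the factor [2 n] pays for the mean and the triangle inequality. *)
Let lam := 2 * n%:R * (l + l').
Let lam0 : 0 < lam. Proof. by rewrite !mulr_gt0// addr_gt0. Qed.
Let K := 2 * (c * kappa).

(** The majorant of the modular density of the difference is split into this part, whose integral
    tends to 0 along the sequence, and a fixed summable part. *)
Definition vanishing_part x := yreal A (en (q x - g x) / l) + al (T (K * `|v x - u x|)).
Definition fixed_part x := (yreal A (en (g x) / l') + al (T (K * `|u x|)) + c0 * \1_Om x) + growth_density u g lam x.

Lemma difference_bound : {ae m, forall x,
  (B (en (chain_gradient v q x - chain_gradient u g x)%R / (2 * n%:R * (kappa * lam)))%R <=
   (vanishing_part x + fixed_part x)%:E)%E}.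
Proof.
have kl0 : 0 < kappa * lam by rewrite mulr_gt0.
have nk0 : 0 < 2 * n%:R * (kappa * lam) by apply: mulr_gt0 => //; exact: mulr_gt0.
apply: filterS2 (growth_bound_ae vq lam0) (growth_bound_ae ug lam0) => x Hv Hu.
have e1 := euclidean_norm_ge0 (chain_gradient v q x); have e2 := euclidean_norm_ge0 (chain_gradient u g x).
have half : en (chain_gradient v q x - chain_gradient u g x) / (2 * n%:R * (kappa * lam)) <=
    (en (chain_gradient v q x) / (kappa * lam) + en (chain_gradient u g x) / (kappa * lam)) / 2.
  rewrite ler_pdivrMr//; apply: le_trans (euclidean_normB _ _) _.
  rewrite le_eqVlt; apply/orP; left; apply/eqP; field.
  by rewrite ?gt_eqF.
have := young_half (divr_ge0 (euclidean_norm_ge0 _) (ltW nk0)) (divr_ge0 e1 (ltW kl0)) (divr_ge0 e2 (ltW kl0)) half.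
move=> H; apply: le_trans H _; apply: le_trans (leeD Hv Hu) _.
rewrite -EFinD lee_fin /fixed_part [leRHS]addrA; apply: lerD; last exact: lexx.
rewrite /vanishing_part.
have q0 := euclidean_norm_ge0 (q x - g x); have g0 := euclidean_norm_ge0 (g x).
have hA : yreal A (en (q x) / lam) <= yreal A (en (q x - g x) / l) + yreal A (en (g x) / l').
  apply: nondec_half; [exact: (yreal_nondec yA finA posA)|exact: (yreal_ge0 yA finA posA)|].
  rewrite ler_pdivrMr//; apply: (@le_trans _ _ (n%:R * (en (q x - g x) + en (g x)))).
    by have := euclidean_normD (q x - g x) (g x); rewrite subrK.
  have -> : (en (q x - g x) / l + en (g x) / l') / 2 * lam =
      n%:R * ((en (q x - g x) + en (g x)) + (en (q x - g x) * (l' / l) + en (g x) * (l / l'))).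
    by rewrite /lam; field; rewrite !gt_eqF.
  by rewrite ler_pM2l// lerDl addr_ge0// mulr_ge0// divr_ge0// ltW.
have hT : al (T (c * kappa * `|v x|)) <= al (T (K * `|v x - u x|)) + al (T (K * `|u x|)).
  apply: (@nondec_half (fun s => al (T s))).
  - by move=> s t st; apply: (cap_nondec cap); exact: T_nondec.
  - by move=> s; exact: (capacity_ge0 cap).
  have ck : 0 <= c * kappa by rewrite mulr_ge0// ltW.
  have -> : (K * `|v x - u x| + K * `|u x|) / 2 = c * kappa * (`|v x - u x| + `|u x|) by rewrite /K; field.
  rewrite ler_wpM2l//; have := ler_normD (v x - u x) (u x); by rewrite subrK.
move: hA hT; lra.
Qed.

Lemma fixed_part_summable : (gradient_energy g l' < +oo)%E -> summable_fun m fixed_part.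
Proof.
move=> fin; have K0 : 0 < K by rewrite !mulr_gt0.
have finL : (gradient_energy g lam < +oo)%E.
  apply: le_lt_trans _ fin; apply: ge0_le_integralT.
  - by apply: measurable_gradient_density => i; have [_ []] := adm_wder ug i.
  - by apply: measurable_gradient_density => i; have [_ []] := adm_wder ug i.
  - by move=> x; rewrite lee_fin (yreal_ge0 yA finA posA).
  move=> x; rewrite lee_fin; apply: (yreal_nondec yA finA posA).
  rewrite ler_wpM2l ?euclidean_norm_ge0// lef_pV2 ?posrE//.
  rewrite /lam; apply: (@le_trans _ _ (l + l')); first by rewrite lerDr ltW.
  rewrite ler_peMl ?addr_ge0 ?(ltW l0) ?(ltW l'0)//.
  by rewrite -natrM ler1n muln_gt0 (ltnW n1).
apply: summableD; last exact: growth_density_summable.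
apply: summableD c0_indic_summable; apply: summableD; first exact: (gradient_summable ug fin).
exact: (potential_summable ug l'0 K0 fin).
Qed.

Lemma vanishing_part_ge0 x : 0 <= vanishing_part x.
Proof. by rewrite addr_ge0// ?(capacity_ge0 cap)// (yreal_ge0 yA finA posA). Qed.

Lemma fixed_part_ge0 x : 0 <= fixed_part x.
Proof.
by rewrite !addr_ge0 ?growth_density_ge0 ?mulr_ge0 ?(capacity_ge0 cap) ?(yreal_ge0 yA finA posA).
Qed.

End domination.

(* A bounded function of D s which determines D s. *)
Let theta (s : R) : R := D s * (1 + `|D s|)^-1.

Let theta_bounded : bounded_measurable theta.
Proof.
have [mD _] := lD; split.
  apply: measurable_funM => //; apply: measurable_ge0_inv; last by move=> s; rewrite addr_ge0.
  by apply: measurable_funD => //; exact: measurableT_comp.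
exists 1 => s; rewrite normrM normfV [`|1 + _|]ger0_norm ?addr_ge0//.
by rewrite ler_pdivrMr ?ltr_pwDl// mul1r lerDr.
Qed.

(** The map [x / (1 + |x|)] has the continuous inverse [y / (1 - |y|)] on []-1, 1[]. *)
Let theta_cvg (t_ : nat -> R) t : theta (t_ k) @[k --> \oo] --> theta t -> D (t_ k) @[k --> \oo] --> D t.
Proof.
move=> ct.
have DE' s : D s = theta s / (1 - `|theta s|).
  have p : 0 < 1 + `|D s| by rewrite ltr_pwDl.
  rewrite /theta normrM normfV [`|1 + _|]gtr0_norm//; field.
  by rewrite addrK oner_neq0 gt_eqF.
have nz : 1 - `|theta t| != 0.
  have p : 0 < 1 + `|D t| by rewrite ltr_pwDl.
  rewrite gt_eqF// subr_gt0 /theta normrM normfV [`|1 + _|]gtr0_norm//.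
  by rewrite ltr_pdivrMr// mul1r ltrDr.
rewrite DE'; under eq_fun do rewrite DE'.
have c1' : (1 - `|theta (t_ k)|) @[k --> \oo] --> 1 - `|theta t|.
  by apply: cvgB; [exact: cvg_cst|exact: (cvg_norm ct)].
have c2' : (1 - `|theta (t_ k)|)^-1 @[k --> \oo] --> (1 - `|theta t|)^-1 by exact: (cvgV nz c1').
exact: (cvgM ct c2').
Qed.

Section continuity.
Variables (u_ : nat -> V -> R) (g_ : nat -> V -> V) (u : V -> R) (g : V -> V) (l l' : R).
Hypotheses (adm_ : forall k, admissible Om (u_ k) (g_ k)) (adm : admissible Om u g) (l0 : 0 < l) (l'0 : 0 < l').
Hypotheses (van : vanishing (fun k => gradient_energy (fun x => g_ k x - g x) l)) (fin : (gradient_energy g l' < +oo)%E).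

Let admB k := admissibleB (adm_ k) adm.
Let z_ k x := chain_gradient (u_ k) (g_ k) x - chain_gradient u g x.
Let mg_ k i : measurable_fun setT (coord (g_ k) i). Proof. by have [_ []] := adm_wder (adm_ k) i. Qed.
Let mg i : measurable_fun setT (coord g i). Proof. by have [_ []] := adm_wder adm i. Qed.
Let mu_ k : measurable_fun setT (u_ k). Proof. by have [[]] := adm_wder (adm_ k) (Ordinal (ltnW n1)). Qed.
Let mu : measurable_fun setT u. Proof. by have [[]] := adm_wder adm (Ordinal (ltnW n1)). Qed.

Let loc_g i : loc_cvg (fun k => coord (g_ k) i) (coord g i).
Proof.
move=> J; apply: vanishing_le (gradient_loc_vanishing admB l0 van J) => k.
have mc : measurable (cube J%:R : set V) by exact: measurable_cube.
apply: ge0_le_integral => //.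
- apply: (@measurable_funS _ _ _ _ setT) => //; apply/measurable_EFinP/measurableT_comp => //.
  exact: measurable_funB.
- apply: (@measurable_funS _ _ _ _ setT) => //; apply/measurable_EFinP; apply: measurable_euclidean_norm => j.
  by have [_ []] := adm_wder (admB k) j.
by move=> x _; rewrite lee_fin; have := euclidean_norm_coord (g_ k x - g x) i; rewrite !mxE.
Qed.

Let loc_u : loc_cvg u_ u.
Proof. by move=> J; exact: (function_loc_vanishing admB l0 van J). Qed.

(** One nonnegative function [F k] gathers the differences of the functions, of the gradients, and
    the weighted squares of the differences of [theta], so that a single subsequence serves all of
    them. *)
Lemma chain_gradient_subsequence : exists2 sig : nat -> nat, {homo sig : i j / (i < j)%N} &
  {ae m, forall x, en (z_ (sig k) x) @[k --> \oo] --> (0 : R)}.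
Proof.
pose F k x := `|u_ k x - u x| + \sum_(i < n) (`|coord (g_ k) i x - coord g i x| +
  (theta (u_ k x) - theta (u x)) ^+ 2 * `|coord g i x|).
have [mt _] := theta_bounded.
have mF1 k : measurable_fun setT (fun x => `|u_ k x - u x|) by apply: measurableT_comp => //; exact: measurable_funB.
have mF2 k i : measurable_fun setT (fun x => `|coord (g_ k) i x - coord g i x|).
  by apply: measurableT_comp => //; exact: measurable_funB.
have mF3 k i : measurable_fun setT (fun x => (theta (u_ k x) - theta (u x)) ^+ 2 * `|coord g i x|).
  apply: measurable_funM; last exact: measurableT_comp.
  by apply: measurable_funX; apply: measurable_funB; exact: measurableT_comp.
have F3 k i x : 0 <= (theta (u_ k x) - theta (u x)) ^+ 2 * `|coord g i x|.
  by apply: mulr_ge0 => //; exact: sqr_ge0.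
have mF k : measurable_fun setT (F k).
  apply: measurable_funD => //; apply: measurable_sum => i; exact: measurable_funD.
have F0 k x : 0 <= F k x by rewrite addr_ge0// sumr_ge0// => i _; rewrite addr_ge0.
have vF J : vanishing (fun k => \int[m]_(x in cube J%:R) (F k x)%:E)%E.
  have mc : measurable (cube J%:R : set V) by exact: measurable_cube.
  pose S k i := (\int[m]_(x in cube J%:R) (`|coord (g_ k) i x - coord g i x|)%:E +
    \int[m]_(x in cube J%:R) ((theta (u_ k x) - theta (u x)) ^+ 2 * `|coord g i x|)%:E)%E.
  have vS : vanishing (fun k => \sum_(i < n) S k i)%E.
    have : forall i, vanishing (S ^~ i).
      move=> i; apply: vanishingD; first exact: loc_g.
      by apply: (density_square_cvg (fun k => adm_wder (adm_ k) i) (adm_wder adm i) loc_u (loc_g i) J theta_bounded).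
    move=> vS; elim: (index_enum 'I_n) => [|i s IH].
      by move=> e e0; exists 0%N => k _; rewrite big_nil lee_fin ltW.
    by apply: vanishing_le (vanishingD (vS i) IH) => k; rewrite big_cons.
  apply: vanishing_le (vanishingD (loc_u J) vS) => k.
  have EF x : (F k x)%:E = (`|u_ k x - u x|%:E + \sum_(i < n) (`|coord (g_ k) i x - coord g i x|%:E +
      ((theta (u_ k x) - theta (u x)) ^+ 2 * `|coord g i x|)%:E))%E.
    by rewrite /F EFinD -sumEFin; congr (_ + _)%E; apply: eq_bigr => i _; rewrite EFinD.
  under eq_integral => x _ do rewrite EF.
  have m2 i : measurable_fun (cube J%:R) (fun x : V => `|coord (g_ k) i x - coord g i x|%:E).
    by apply: (@measurable_funS _ _ _ _ setT) => //; exact/measurable_EFinP.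
  have m3 i : measurable_fun (cube J%:R) (fun x : V => ((theta (u_ k x) - theta (u x)) ^+ 2 * `|coord g i x|)%:E).
    by apply: (@measurable_funS _ _ _ _ setT) => //; exact/measurable_EFinP.
  have m1 : measurable_fun (cube J%:R) (fun x : V => `|u_ k x - u x|%:E).
    by apply: (@measurable_funS _ _ _ _ setT) => //; exact/measurable_EFinP.
  have m23 i : measurable_fun (cube J%:R) (fun x : V => (`|coord (g_ k) i x - coord g i x|%:E +
      ((theta (u_ k x) - theta (u x)) ^+ 2 * `|coord g i x|)%:E)%E) by exact: emeasurable_funD.
  have p23 i x : (0 <= `|coord (g_ k) i x - coord g i x|%:E +
      ((theta (u_ k x) - theta (u x)) ^+ 2 * `|coord g i x|)%:E)%E by rewrite adde_ge0// lee_fin.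
  rewrite ge0_integralD//; last 2 first.
  - by move=> x _; apply: sume_ge0.
  - exact: emeasurable_sum.
  rewrite leeD2l//; rewrite ge0_integral_sum//; apply: lee_sum => i _.
  by rewrite ge0_integralD// => x _; rewrite lee_fin.
have [sig sig_lt cF] := ae_subsequence mF F0 vF.
exists sig => //; apply: filterS cF => x cx.
have cu : u_ (sig k) x @[k --> \oo] --> u x.
  apply/cvgrPdist_le => e e0; have /cvgrPdist_le/(_ e e0) := cx; apply: filterS => k.
  rewrite sub0r normrN ger0_norm// distrC; apply: le_trans; rewrite lerDl.
  by apply: sumr_ge0 => i _; rewrite addr_ge0.
have part k i : `|coord (g_ (sig k)) i x - coord g i x| + (theta (u_ (sig k) x) - theta (u x)) ^+ 2 * `|coord g i x|
    <= F (sig k) x.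
  rewrite /F (bigD1 i)//= addrCA lerDl addr_ge0// sumr_ge0// => j _; exact: addr_ge0.
have cg i : coord (g_ (sig k)) i x @[k --> \oo] --> coord g i x.
  apply/cvgrPdist_le => e e0; have /cvgrPdist_le/(_ e e0) := cx; apply: filterS => k.
  rewrite sub0r normrN ger0_norm// distrC; apply: le_trans; apply: le_trans (part k i).
  by rewrite lerDl.
have cz i : coord (z_ (sig k)) i x @[k --> \oo] --> (0 : R).
  (* In the first term [D(u_k)] is bounded, because [u_k x] converges and [D] is locally bounded.
     The second vanishes where [coord g i] does, and elsewhere dividing the weighted square by
     [|coord g i x|] gives convergence of [theta]. *)
  have zE k : coord (z_ k) i x = D (u_ k x) * (coord (g_ k) i x - coord g i x) + (D (u_ k x) - D (u x)) * coord g i x.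
    by rewrite /z_ /chain_gradient /coord !mxE; ring.
  under eq_fun do rewrite zE.
  have c1' : D (u_ (sig k) x) * (coord (g_ (sig k)) i x - coord g i x) @[k --> \oo] --> (0 : R).
    have [C DC] := lD.2 (`|u x| + 1).
    have bnd : \forall k \near \oo, `|D (u_ (sig k) x)| <= C.
      have /cvgrPdist_le/(_ 1 ltr01) := cu; apply: filterS => k H; apply: DC.
      have -> : u_ (sig k) x = u x - (u x - u_ (sig k) x) by ring.
      by apply: le_trans (ler_normB _ _) _; rewrite lerD2l.
    have cd : `|coord (g_ (sig k)) i x - coord g i x| @[k --> \oo] --> (0 : R).
      rewrite -(normr0 R); apply: cvg_norm; rewrite -(subrr (coord g i x)).
      by apply: cvgB (cg i) (cvg_cst _).
    apply/cvgrPdist_le => e e0.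
    have C1 : 0 < `|C| + 1 by rewrite ltr_wpDl.
    have /cvgrPdist_le/(_ _ (divr_gt0 e0 C1)) := cd.
    apply: filterS2 bnd => k Hb; rewrite sub0r normrN normr_id => Hg.
    rewrite sub0r normrN normrM; apply: (@le_trans _ _ ((`|C| + 1) * (e / (`|C| + 1)))).
      by apply: ler_pM => //; apply: le_trans Hb _; apply: le_trans (ler_norm _) _; rewrite lerDl.
    by rewrite mulrC divfK// gt_eqF.
  rewrite -(addr0 (0 : R)); apply: cvgD => //.
  have [gi|gi] := eqVneq (coord g i x) 0.
    by under eq_fun do rewrite gi mulr0; exact: cvg_cst.
  rewrite -(mul0r (coord g i x)); apply: cvgM (cvg_cst _).
  rewrite -(subrr (D (u x))); apply: cvgB (cvg_cst _).
  apply: theta_cvg; apply/cvgrPdist_le => e e0.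
  have gi0 : 0 < `|coord g i x| by rewrite normr_gt0.
  have /cvgrPdist_le/(_ _ (mulr_gt0 (exprn_gt0 2 e0) gi0)) := cx; apply: filterS => k.
  rewrite sub0r normrN ger0_norm// => H.
  have {}H : (theta (u_ (sig k) x) - theta (u x)) ^+ 2 <= e ^+ 2.
    rewrite -(ler_pM2r gi0); apply: le_trans H; apply: le_trans (part k i).
    by rewrite lerDr.
  by rewrite distrC -(ler_pXn2r (ltn0Sn 1)) ?nnegrE ?(ltW e0)// -normrX ger0_norm// sqr_ge0.
have cs (r : seq 'I_n) : \sum_(i <- r) `|coord (z_ (sig k)) i x| @[k --> \oo] --> (0 : R).
  elim: r => [|i r IH]; first by under eq_fun do rewrite big_nil; exact: cvg_cst.
  under eq_fun do rewrite big_cons.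
  have ci : `|coord (z_ (sig k)) i x| @[k --> \oo] --> (0 : R).
    apply/cvgrPdist_le => e e0; have /cvgrPdist_le/(_ e e0) := cz i; apply: filterS => k.
    by rewrite !sub0r !normrN normr_id.
  have : `|coord (z_ (sig k)) i x| + \sum_(j <- r) `|coord (z_ (sig k)) j x| @[k --> \oo] --> (0 + 0 : R).
    exact: (cvgD ci IH).
  by rewrite addr0.
apply/cvgrPdist_le => e e0; have /cvgrPdist_le/(_ e e0) := cs (index_enum 'I_n); apply: filterS => k.
rewrite !sub0r !normrN ger0_norm; last by apply: sumr_ge0.
by move=> H; rewrite ger0_norm ?euclidean_norm_ge0//; apply: le_trans H; exact: euclidean_norm_le_sum.
Qed.

End continuity.

Section modular.
Variables (u_ : nat -> V -> R) (g_ : nat -> V -> V) (u : V -> R) (g : V -> V) (l l' : R).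
Hypotheses (adm_ : forall k, admissible Om (u_ k) (g_ k)) (adm : admissible Om u g) (l0 : 0 < l) (l'0 : 0 < l').
Hypotheses (van : vanishing (fun k => gradient_energy (fun x => g_ k x - g x) l)) (fin : (gradient_energy g l' < +oo)%E).

Let L := 2 * n%:R * (kappa * (2 * n%:R * (l + l'))).
Let f_ k x := B (en (chain_gradient (u_ k) (g_ k) x - chain_gradient u g x) / L).

Lemma chain_modulus_gt0 : 0 < L.
Proof. by rewrite !mulr_gt0// addr_gt0. Qed.

Let mz k i : measurable_fun setT (coord (fun x => chain_gradient (u_ k) (g_ k) x - chain_gradient u g x) i).
Proof.
rewrite (_ : coord _ i = fun x => coord (chain_gradient (u_ k) (g_ k)) i x - coord (chain_gradient u g) i x).
  by apply: measurable_funB; [exact: (measurable_chain_gradient i (adm_ k))|exact: (measurable_chain_gradient i adm)].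
by apply/funext => x; rewrite /coord !mxE.
Qed.

Let f0 k x : (0 <= f_ k x)%E.
Proof. by apply: (young_ge0 yB); rewrite divr_ge0 ?euclidean_norm_ge0// ltW// chain_modulus_gt0. Qed.

Let vH : vanishing (fun k => \int[m]_x (vanishing_part (u_ k) u (g_ k) g l x)%:E)%E.
Proof.
have K0 : 0 < 2 * (c * kappa) by rewrite !mulr_gt0.
have admB k := admissibleB (adm_ k) adm.
apply: vanishing_le (vanishingD van (potential_vanishing admB l0 van K0)) => k.
rewrite /gradient_energy -ge0_integralD//.
- by move=> x _; rewrite lee_fin (yreal_ge0 yA finA posA).
- by apply: measurable_gradient_density => i; have [_ []] := adm_wder (admB k) i.
- by move=> x _; rewrite lee_fin (capacity_ge0 cap).
have [[mv _] _ _] := adm_wder (admB k) (Ordinal (ltnW n1)).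
apply/measurable_EFinP; apply: (@measurableT_comp _ _ _ _ _ _ (fun s : R => al (T (2 * (c * kappa) * s))) _
  (fun x => `|u_ k x - u x|)).
  apply: nondecreasing_measurable => // s t st; apply: (cap_nondec cap); apply: T_nondec.
  by rewrite ler_wpM2l// ltW.
exact: measurableT_comp.
Qed.

Lemma chain_modular_subsequence : exists2 sig : nat -> nat, {homo sig : i j / (i < j)%N} &
  vanishing (fun k => \int[m]_x f_ (sig k) x)%E.
Proof.
have [sig sig_lt cz] := chain_gradient_subsequence adm_ adm l0 van; exists sig => //.
have sig_ge k : (k <= sig k)%N.
  by elim: k => // k IH; apply: leq_ltn_trans IH _; exact: sig_lt.
have admB k := admissibleB (adm_ k) adm.
have mvan k : measurable_fun setT (fun x => vanishing_part (u_ k) u (g_ k) g l x).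
  have [[mv _] _ _] := adm_wder (admB k) (Ordinal (ltnW n1)).
  apply: measurable_funD.
    by apply/measurable_EFinP; apply: measurable_gradient_density => i; have [_ []] := adm_wder (admB k) i.
  apply: (@measurableT_comp _ _ _ _ _ _ (fun s : R => al (T (2 * (c * kappa) * s))) _ (fun x => `|u_ k x - u x|)).
    apply: nondecreasing_measurable => // s t st; apply: (cap_nondec cap); apply: T_nondec.
    by rewrite ler_wpM2l// !mulr_ge0// ltW.
  exact: measurableT_comp.
apply: (@generalized_dominated _ _ (fun k => f_ (sig k)) (fun k => vanishing_part (u_ (sig k)) u (g_ (sig k)) g l)
  (fixed_part u g l l')).
- by move=> k; apply: measurable_young_norm => //; rewrite ltW// chain_modulus_gt0.
- by move=> k x; exact: f0.
- by move=> k; exact: mvan.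
- by move=> k x; exact: vanishing_part_ge0.
- exact: fixed_part_summable.
- by move=> x; exact: fixed_part_ge0.
- by move=> k; exact: (difference_bound (adm_ (sig k)) adm l0 l'0).
- exact: (vanishing_subseq sig_ge vH).
apply: filterS cz => x cx e e0.
(* [B] is finite at some [b > 0], hence by convexity at most linear on [[0, b]]; convergence of the
   gradients thus gives convergence of the densities. *)
have [b b0 Bb] := young_fin_point yB.
have fb : B b \is a fin_num by rewrite ge0_fin_numE//; exact: (young_ge0 yB (ltW b0)).
have Bb0 : 0 <= fine (B b) by rewrite fine_ge0// (young_ge0 yB (ltW b0)).
pose d := Num.min b (e * b / (1 + fine (B b))).
have p1 : 0 < 1 + fine (B b) by rewrite ltr_wpDr.
have d0 : 0 < d by rewrite lt_min b0/= divr_gt0// mulr_gt0.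
have /cvgrPdist_le/(_ _ (mulr_gt0 d0 chain_modulus_gt0))[N _ HN] := cx.
exists N => k /HN /=; rewrite sub0r normrN ger0_norm ?euclidean_norm_ge0// -ler_pdivrMr ?chain_modulus_gt0//.
rewrite /f_; set t := _ / L => td.
have t0 : 0 <= t by rewrite divr_ge0 ?euclidean_norm_ge0// ltW// chain_modulus_gt0.
have tb : t <= b by apply: le_trans td _; rewrite ge_min lexx.
apply: le_trans (young_scale yB t0 tb b0) _; rewrite -[B b]fineK// -EFinM lee_fin.
have te : t <= e * b / (1 + fine (B b)) by apply: le_trans td _; rewrite ge_min lexx orbT.
rewrite mulrAC ler_pdivrMr//; move: te; rewrite ler_pdivlMr// => te.
by apply: le_trans te; rewrite ler_wpM2l// lerDr.
Qed.

End modular.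

(** Subsequence principle: a subsequence along which the modulars stay above some [e] would satisfy
    the same hypotheses and have a further subsequence tending to 0. It applies because the
    parameter [L] depends on [l] and [l'] only, not on the subsequence. *)
Theorem chain_modular_continuity (u_ : nat -> V -> R) (g_ : nat -> V -> V) u g (l l' : R) :
  (forall k, admissible Om (u_ k) (g_ k)) -> admissible Om u g -> 0 < l -> 0 < l' ->
  vanishing (fun k => gradient_energy (fun x => g_ k x - g x) l) -> (gradient_energy g l' < +oo)%E ->
  exists2 L, 0 < L & vanishing (fun k => \int[m]_x B (en (chain_gradient (u_ k) (g_ k) x - chain_gradient u g x)%R / L)%R)%E.
Proof.
move=> adm_ adm l0 l'0 van fin; exists (2 * n%:R * (kappa * (2 * n%:R * (l + l')))); first exact: chain_modulus_gt0.
set f_ := fun k => _; apply: contrapT => /existsNP[e /not_implyP[e0 He]].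
have {}He N : exists k, (N <= k)%N && `[< ~ (f_ k <= e%:E)%E >].
  apply: contrapT => H; apply: He; exists N => k Nk; apply: contrapT => fk.
  by apply: H; exists k; rewrite Nk; exact/asboolP.
pose rho N := xchoose (He N).
have rho_ge N : (N <= rho N)%N by have := xchooseP (He N); move=> /andP[].
have rho_bad N : ~ (f_ (rho N) <= e%:E)%E by have := xchooseP (He N); move=> /andP[_ /asboolP].
have van' : vanishing (fun k => gradient_energy (fun x => g_ (rho k) x - g x) l) := vanishing_subseq rho_ge van.
have [sig _ vs] := chain_modular_subsequence (fun k => adm_ (rho k)) adm l0 l'0 van' fin.
by have [N /(_ N (leqnn N))] := vs e e0; exact: rho_bad.
Qed.

End superposition.

(** * Completion of a measure *)

Section completion.
Context d (T : measurableType d) (R : realType) (m : {measure set T -> \bar R}).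
Local Notation C := (caratheodory_type (m^*)%mu).
Local Notation mu := (@completed_measure_extension _ _ _ m).
Local Notation cara := ((m^*)%mu.-cara.-measurable).

Lemma completion_measurable (A : set T) : measurable A -> cara A.
Proof. exact: caratheodory_measurable_mu_ext. Qed.

Lemma completionE (A : set T) : measurable A -> mu A = m A.
Proof. exact: measurable_mu_extE. Qed.

(** A measurable hull: countable covers of excess at most [1/(k+1)] are intersected over [k]. *)
Lemma completion_cover (A : set T) : exists F, [/\ measurable F, A `<=` F & m F = mu A].
Proof.
have [Aoo|Afin] := eqVneq (mu A) +oo%E.
  exists setT; split => //; rewrite -(completionE measurableT) Aoo; apply/eqP; rewrite -leye_eq -Aoo.
  exact: le_mu_ext.
have fA : mu A \is a fin_num by rewrite ge0_fin_numE ?lt_neqAle ?Afin ?leey//; exact: mu_ext_ge0.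
have /choice[G HG] k : exists G : set T, [/\ measurable G, A `<=` G & (m G <= mu A + (k.+1%:R^-1)%:E)%E].
  have k0 : 0 < (k.+1%:R^-1 : R) by rewrite invr_gt0.
  have [x [B [mB AB] <-{x}] Bx] := lb_ereal_inf_adherent k0 fA.
  exists (\bigcup_j B j); split => //; first by apply: bigcup_measurable => j _; exact: mB.
  apply: le_trans _ (ltW Bx); apply: measure_sigma_subadditive => // .
  by apply: bigcup_measurable => j _; exact: mB.
exists (\bigcap_k G k); have mG : measurable (\bigcap_k G k).
  by apply: bigcap_measurable => // k _; have [] := HG k.
have AG : A `<=` \bigcap_k G k by move=> x Ax k _; have [_ /(_ x Ax)] := HG k.
split => //; apply/eqP; rewrite eq_le; apply/andP; split; last first.
  by rewrite -(completionE mG); exact: le_mu_ext.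
apply/lee_addgt0Pr => e e0; pose k := Num.trunc (e^-1).
have [mk _ Gk] := HG k; apply: (@le_trans _ _ (m (G k))).
  by apply: le_measure; rewrite ?inE// => x /(_ k I).
apply: le_trans Gk _; rewrite leeD2l// lee_fin.
rewrite -(invrK e) lef_pV2 ?posrE ?invr_gt0//; exact: ltW (truncnS_gt _).
Qed.

(** A null set of the completion has a measurable hull of measure 0. *)
Lemma completion_ae (P : T -> Prop) : {ae mu, forall x, P x} <-> {ae m, forall x, P x}.
Proof.
split=> -[A [mA A0 PA]].
  have [F [mF AF F0]] := completion_cover A; exists F; split => //; first by rewrite F0.
  exact: subset_trans PA AF.
exists A; split => //; first exact: completion_measurable.
by rewrite -A0; exact: completionE.
Qed.

Lemma measurable_completion d' (T' : measurableType d') (f : T -> T') :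
  measurable_fun setT f -> measurable_fun (setT : set C) f.
Proof.
move=> mf _ Y mY; rewrite setTI; apply: completion_measurable.
by rewrite -[X in measurable X]setTI; exact: mf.
Qed.

(** The measure [m] is the image of its completion under the identity, seen as a measurable map onto
    the smaller sigma-algebra. *)
Lemma completion_integral (f : T -> \bar R) : measurable_fun setT f -> (forall x, 0 <= f x)%E ->
  (\int[mu]_x f x = \int[m]_x f x)%E.
Proof.
move=> mf f0.
have mid : measurable_fun (setT : set C) (id : C -> T).
  by move=> _ Y mY; rewrite setTI; exact: completion_measurable.
have := @ge0_integral_pushforward _ _ C T R id mid mu setT f measurableT mf (fun x _ => f0 x).
rewrite preimage_setT => <-; apply: eq_measure_integral => A mA _.
exact: completionE.
Qed.

Lemma completion_integral_ae (f g : T -> \bar R) : measurable_fun (setT : set C) f -> measurable_fun setT g ->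
  (forall x, 0 <= f x)%E -> (forall x, 0 <= g x)%E -> {ae m, forall x, f x = g x} ->
  (\int[mu]_x f x = \int[m]_x g x)%E.
Proof.
move=> mf mg f0 g0 /completion_ae fg; rewrite -(completion_integral mg g0).
apply: ge0_ae_eq_integral => //; first exact: measurable_completion.
have FF : Filter (almost_everywhere mu) by exact: ae_filter_ringOfSetsType.
by apply: (@filterS _ _ FF _ _ _ fg) => x ->.
Qed.

Lemma completion_Rintegral (f g : T -> R) : measurable_fun (setT : set C) f -> measurable_fun setT g ->
  {ae m, forall x, f x = g x} -> \int[mu]_x f x = \int[m]_x g x.
Proof.
move=> mf mg fg; rewrite /Rintegral; congr fine; rewrite integralE [RHS]integralE.
have mfE : measurable_fun (setT : set C) (EFin \o f) by exact/measurable_EFinP.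
have mgE : measurable_fun setT (EFin \o g) by exact/measurable_EFinP.
congr (_ - _)%E; apply: completion_integral_ae => //.
- exact: measurable_funepos.
- exact: measurable_funepos.
- by apply: filterS fg => x fx; rewrite !funeposE /= fx.
- exact: measurable_funeneg.
- exact: measurable_funeneg.
- by apply: filterS fg => x fx; rewrite !funenegE /= fx.
Qed.

Variable S : nat -> set T.
Hypotheses (mS : forall k, measurable (S k)) (S_fin : forall k, (m (S k) < +oo)%E) (S_cover : forall x, exists k, S k x).

(** Inside each [S k] the measure is finite, so a hull of [E] there exceeds it by a null set only;
    the hulls are then glued. *)
Lemma completion_set (E : set T) : cara E -> exists2 F, measurable F & {ae m, forall x, E x <-> F x}.
Proof.
move=> mE.
have /choice[G HG] k : exists G : set T, [/\ measurable G, E `&` S k `<=` G, G `<=` S k & m.-negligible (G `\` (E `&` S k))].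
  have mES : cara (E `&` S k) by apply: measurableI => //; exact: completion_measurable.
  have [F [mF EF FE]] := completion_cover (E `&` S k).
  have mFS : measurable (F `&` S k) by exact: measurableI.
  have ES : E `&` S k `<=` F `&` S k by move=> x Ex; split; [exact: EF|case: Ex].
  have mu_fin : (mu (E `&` S k) < +oo)%E.
    by apply: le_lt_trans (S_fin k); rewrite -(completionE (mS k)); apply: le_mu_ext.
  have muE : mu (F `&` S k) = mu (E `&` S k).
    apply/eqP; rewrite eq_le; apply/andP; split; last exact: le_mu_ext.
    by rewrite (completionE mFS) -FE; apply: le_measure; rewrite ?inE.
  have D0 : mu ((F `&` S k) `\` (E `&` S k)) = 0%E.
    rewrite measureD//=; last 2 first.
    - exact: completion_measurable.
    - by rewrite muE.
    rewrite (setIidr ES); have fE : mu (E `&` S k) \is a fin_num by rewrite ge0_fin_numE//; exact: mu_ext_ge0.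
    exact: etrans (congr1 (fun z => (z - mu (E `&` S k))%E) muE) (subee fE).
  exists (F `&` S k); split => //.
  have [N [mN DN N0]] := completion_cover ((F `&` S k) `\` (E `&` S k)).
  by exists N; split => //; rewrite N0.
exists (\bigcup_k G k); first by apply: bigcup_measurable => k _; have [] := HG k.
have : m.-negligible (\bigcup_k (G k `\` (E `&` S k))) by apply: negligible_bigcup => k; have [] := HG k.
apply: negligibleS => x /= H; apply: contrapT => nx; apply: H; split=> [Ex|[k _ Gx]].
  by have [k Sx] := S_cover x; exists k => //; have [_ + _ _] := HG k; apply.
by apply: contrapT => nE; apply: nx; exists k => //; split => // -[].
Qed.

(** Each superlevel set at a nonnegative rational [q k] is replaced by a measurable version [F k],
    and the function is recovered as the supremum of the [q k] times the indicators of [F k]. *)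
Lemma completion_fun_ge0 (f : T -> R) : measurable_fun (setT : set C) f -> (forall x, 0 <= f x) ->
  exists2 g : T -> R, measurable_fun setT g & {ae m, forall x, f x = g x}.
Proof.
move=> mf f0; pose q k : R := `|ratr (odflt 0 (unpickle k) : rat)|.
have /choice[F HF] k : exists F : set T, measurable F /\ {ae m, forall x, q k < f x <-> F x}.
  have mE : cara [set x | q k < f x] by exact: (@measurable_lt_set _ C R (fun=> q k) f _ mf).
  by have [F mF HF] := completion_set mE; exists F.
pose h k x : \bar R := ((q k)%:E * (\1_(F k) x)%:E)%E.
have mh k : measurable_fun setT (h k).
  by apply: emeasurable_funM => //; apply: measurable_EFin_indic; have [] := HF k.
exists (fun x => fine (esups (h ^~ x) 0%N)).
  by apply: measurableT_comp => //; exact: measurable_fun_esups.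
have : {ae m, forall x, forall k, q k < f x <-> F k x} by apply: ae_foralln => k; have [] := HF k.
apply: filterS => x Hx; suff -> : esups (h ^~ x) 0%N = (f x)%:E by [].
apply/eqP; rewrite eq_le; apply/andP; split.
  apply: ge_ereal_sup => _ [k _ <-]; rewrite /h indicE -EFinM lee_fin.
  have [Fx|Fx] := pselect (F k x); last by rewrite (memNset Fx) mulr0.
  by rewrite (mem_set Fx) mulr1; apply: ltW; exact: (Hx k).2.
apply/lee_addgt0Pr => e e0.
have [fx0|fx0] := leP (f x) e.
  apply: (@le_trans _ _ e%:E); first by rewrite lee_fin.
  apply: leeDr; apply: le_trans (ereal_sup_ubound (ex_intro2 _ _ 0%N _ erefl)) => //.
  by rewrite /h -EFinM lee_fin mulr_ge0// /q normr_ge0.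
have fe : f x - e < f x by rewrite ltrBlDr ltrDl.
have [r] := rat_in_itvoo fe.
rewrite in_itv/= => /andP[r1 r2].
have r0 : 0 < ratr r :> R by apply: lt_trans r1; rewrite subr_gt0.
have qr : q (pickle r) = ratr r by rewrite /q pickleK/= gtr0_norm.
apply: (@le_trans _ _ ((ratr r : R)%:E + e%:E)%E); first by rewrite -EFinD lee_fin -lerBlDr ltW.
rewrite leeD2r//; apply: ereal_sup_ubound; exists (pickle r) => //.
rewrite /h indicE qr (mem_set (_ : F (pickle r) x)) ?mule1//.
by apply: (Hx (pickle r)).1; rewrite qr.
Qed.

Lemma completion_fun (f : T -> R) : measurable_fun (setT : set C) f ->
  exists2 g : T -> R, measurable_fun setT g & {ae m, forall x, f x = g x}.
Proof.
move=> mf.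
have [g1 mg1 H1] : exists2 g : T -> R, measurable_fun setT g & {ae m, forall x, Num.max 0 (f x) = g x}.
  by apply: completion_fun_ge0; [exact: measurable_maxr|move=> x; rewrite le_max lexx].
have [g2 mg2 H2] : exists2 g : T -> R, measurable_fun setT g & {ae m, forall x, Num.max 0 (- f x) = g x}.
  by apply: completion_fun_ge0; [exact: measurable_maxr (@measurable_cst _ _ C R setT 0) (measurable_funN mf)|move=> x; rewrite le_max lexx].
exists (fun x => g1 x - g2 x); first exact: measurable_funB.
apply: filterS2 H1 H2 => x <- <-; case: (leP 0 (f x)) => fx.
  by rewrite max_l ?oppr_le0// subr0.
by rewrite max_r ?oppr_ge0 ?ltW// sub0r opprK.
Qed.

End completion.

(** * Transfer between Lebesgue measurable functions and Borel versions *)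

Section bridge.
Context {R : realType} {n : nat}.
Local Notation V := 'rV[R]_n.
Local Notation m := (borel_lebesgue R n).
Local Notation mu := (lebesgue_rV R n).
Local Notation C := (caratheodory_type (borel_lebesgue R n)^*%mu).
Local Notation en := (@euclidean_norm R n).
Implicit Types (u w : V -> R) (g q : V -> V).

Lemma lebesgue_integral_ae (f h : V -> \bar R) : measurable_fun (setT : set C) f -> measurable_fun setT h ->
  (forall x, 0 <= f x)%E -> (forall x, 0 <= h x)%E -> {ae m, forall x, f x = h x} ->
  (\int[mu]_x f x = \int[m]_x h x)%E.
Proof. exact: completion_integral_ae. Qed.

Lemma lebesgue_Rintegral_ae (f h : V -> R) : measurable_fun (setT : set C) f -> measurable_fun setT h ->
  {ae m, forall x, f x = h x} -> \int[mu]_x f x = \int[m]_x h x.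
Proof. exact: completion_Rintegral. Qed.

Lemma lebesgue_version (f : V -> R) : measurable_fun (setT : set C) f ->
  exists2 h : V -> R, measurable_fun setT h & {ae m, forall x, f x = h x}.
Proof.
apply: (@completion_fun _ _ _ m (fun k => cube k%:R)).
- by move=> k; exact: measurable_cube.
- by move=> k; exact: cube_lty.
- by move=> x; exact: cube_cover.
Qed.

Lemma lebesgue_indic (A : set V) : measurable A -> measurable_fun (setT : set C) (fun x => (\1_A x : R)%:E).
Proof. by move=> mA; apply: measurable_completion; exact: measurable_EFin_indic. Qed.

Lemma lebesgue_fun (f : V -> R) : measurable_fun setT f -> measurable_fun (setT : set C) f.
Proof. exact: measurable_completion. Qed.

Lemma lebesgue_set (A : set V) : measurable A -> measurable (A : set C).
Proof. exact: completion_measurable. Qed.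

Lemma L1loc_measurable u : L1loc u -> measurable_fun (setT : set C) u.
Proof.
move=> Lu; have -> : (setT : set C) = \bigcup_k (cube k%:R : set C).
  by apply/seteqP; split => x _ //; have [k xk] := cube_cover x; exists k.
apply/measurable_fun_bigcup => k; first exact: lebesgue_set (measurable_cube _).
by have /integrableP[/measurable_EFinP] := Lu _ (@cube_compact R n k%:R).
Qed.

Lemma L1loc_version u : L1loc u -> exists2 w, loc_summable w & {ae m, forall x, u x = w x}.
Proof.
move=> Lu; have mu_ := L1loc_measurable Lu; have [w mw uw] := lebesgue_version mu_.
exists w => //; split => // k; have mc : measurable (cube k%:R : set V) by exact: measurable_cube.
have mwk : measurable_fun setT (fun x => w x * \1_(cube k%:R) x).
  by apply: measurable_funM => //; exact: measurable_indic.
split => //; have /integrableP[_] := Lu _ (@cube_compact R n k%:R).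
apply: le_lt_trans; rewrite [leRHS]ge0_integral_mkindic le_eqVlt; apply/orP; left; apply/eqP/esym.
apply: lebesgue_integral_ae.
- apply: emeasurable_funM; first exact: lebesgue_indic.
  by apply/measurable_EFinP; exact: measurableT_comp.
- by apply/measurable_EFinP; exact: measurableT_comp.
- by move=> x; rewrite mule_ge0// lee_fin.
- by move=> x; rewrite lee_fin.
by apply: filterS uw => x ux /=; rewrite ux -EFinM normrM mulrC [`|\1__ _|]ger0_norm.
Qed.

Lemma loc_summable_L1loc u w : measurable_fun (setT : set C) u -> loc_summable w -> {ae m, forall x, u x = w x} ->
  L1loc u.
Proof.
move=> mu_ [mw sw] uw K cK; have [k Kk] := compact_sub_cube cK.
have mc : measurable (cube k%:R : set V) by exact: measurable_cube.
have mK : measurable (K : set V) by exact: compact_measurable_rV.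
have mabs : measurable_fun (setT : set C) (fun x => `|u x|%:E).
  by apply/measurable_EFinP; exact: measurableT_comp.
apply/integrableP; split.
  have muE : measurable_fun (setT : set C) (EFin \o u) by exact/measurable_EFinP.
  exact: (measurable_funTS muE).
apply: (@le_lt_trans _ _ (\int[mu]_(x in cube k%:R) `|u x|%:E)%E).
  have abs0 (x : C) : (cube k%:R : set C) x -> (0 <= `|u x|%:E)%E by move=> _; rewrite lee_fin normr_ge0.
  exact: (@ge0_subset_integral _ C R mu _ _ (lebesgue_set mK) (lebesgue_set mc) _ (measurable_funTS mabs) abs0 Kk).
have [mwk fin] := sw k; apply: le_lt_trans fin.
rewrite [leLHS]ge0_integral_mkindic le_eqVlt; apply/orP; left; apply/eqP.
apply: lebesgue_integral_ae.
- by apply: emeasurable_funM; first exact: lebesgue_indic.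
- by apply/measurable_EFinP; exact: measurableT_comp.
- by move=> x; rewrite mule_ge0// lee_fin.
- by move=> x; rewrite lee_fin.
by apply: filterS uw => x ->; rewrite -EFinM normrM mulrC [`|\1__ _|]ger0_norm.
Qed.

Lemma test_function_measurable (phi : V -> R) i : test_function phi ->
  measurable_fun setT phi /\ measurable_fun setT (partial_derive i phi).
Proof. by move=> /(test_function_bounds i)[k [[? _] [? _] _ _]]. Qed.

Lemma weak_gradient_version u w g : L1loc u -> is_weak_gradient u g -> loc_summable w ->
  {ae m, forall x, u x = w x} ->
  exists2 q, {ae m, forall x, g x = q x} & forall i, wder i w (coord q i).
Proof.
move=> Lu [Lg ug] lw uw.
have /choice[q_ Hq] i : exists q : V -> R, loc_summable q /\ {ae m, forall x, coord g i x = q x}.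
  by have [q lq gq] := L1loc_version (Lg i); exists q.
pose q x : V := \row_i q_ i x; have qE i : coord q i = q_ i by apply/funext => x; rewrite /coord mxE.
have gq : {ae m, forall x, g x = q x}.
  apply: filterS (ae_forall_fin (fun i => (Hq i).2)) => x Hx.
  by apply/rowP => i; rewrite mxE -Hx.
exists q => // i; rewrite qE; have [lq gqi] := Hq i.
apply: wder_of_weak => // phi tphi; have [mphi mdphi] := test_function_measurable i tphi.
have [mw _] := lw; have [mq _] := lq.
have -> : \int[m]_x (w x * partial_derive i phi x) = \int[mu]_x (u x * partial_derive i phi x).
  apply/esym/lebesgue_Rintegral_ae.
  - exact: measurable_funM (L1loc_measurable Lu) (lebesgue_fun mdphi).
  - exact: measurable_funM.
  - by apply: filterS uw => x ->.
have -> : \int[m]_x (q_ i x * phi x) = \int[mu]_x (g x ord0 i * phi x).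
  apply/esym/lebesgue_Rintegral_ae.
  - exact: measurable_funM (L1loc_measurable (Lg i)) (lebesgue_fun mphi).
  - exact: measurable_funM.
  - by apply: filterS gqi => x <-.
exact: ug.
Qed.

Lemma wder_weak_gradient u w q : measurable_fun (setT : set C) u -> {ae m, forall x, u x = w x} ->
  (forall i, wder i w (coord q i)) -> is_weak_gradient u q.
Proof.
move=> mu_ uw wq; have mq i : measurable_fun setT (coord q i) by have [_ []] := wq i.
split=> [i|phi tphi i].
  apply: (@loc_summable_L1loc _ (coord q i)); first exact: (lebesgue_fun (mq i)).
    by case: (wq i).
  by apply: filterS (filterT : {ae m, forall x, True}) => x _.
have [mphi mdphi] := test_function_measurable i tphi.
have [[mw _] _ _] := wq i.
have -> : \int[mu]_x (u x * partial_derive i phi x) = \int[m]_x (w x * partial_derive i phi x).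
  apply: lebesgue_Rintegral_ae.
  - exact: measurable_funM mu_ (lebesgue_fun mdphi).
  - exact: measurable_funM.
  - by apply: filterS uw => x ->.
rewrite (weak_of_wder (wq i) tphi); congr (- _); apply/esym/lebesgue_Rintegral_ae.
- exact: measurable_funM (lebesgue_fun (mq i)) (lebesgue_fun mphi).
- exact: measurable_funM.
- by apply: filterS (filterT : {ae m, forall x, True}) => x _.
Qed.

Lemma weak_gradientP u : W11loc u -> is_weak_gradient u (weak_gradient u).
Proof. by move=> [_ [g ug]]; apply: (@xgetPex _ (fun=> 0) [set g | is_weak_gradient u g]); exists g. Qed.

Lemma lebesgue_level u w (t : R) : measurable_fun (setT : set C) u -> measurable_fun setT w ->
  {ae m, forall x, u x = w x} -> mu [set x | t < `|u x|] = m [set x | t < `|w x|].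
Proof.
move=> mu_ mw uw.
have mU : measurable ([set x | t < `|u x|] : set C).
  exact: (@measurable_lt_set _ C R (fun=> t) (fun x => `|u x|) (measurable_cst _) (measurableT_comp (@normr_measurable R setT) mu_)).
have mW : measurable [set x | t < `|w x|] by apply: measurable_lt_set => //; exact: measurableT_comp.
have <- : (\int[m]_x (\1_[set x | t < `|w x|] x)%:E = m [set x | (t < `|w x|)%R])%E by exact: integral_indicT.
have <- : (\int[mu]_x (\1_[set x | t < `|u x|] x)%:E = mu [set x | (t < `|u x|)%R])%E by exact: integral_indicT.
apply: lebesgue_integral_ae.
- exact: measurable_EFin_indic.
- exact: measurable_EFin_indic.
- by move=> x; rewrite lee_fin.
- by move=> x; rewrite lee_fin.
apply: filterS uw => x ux; congr (_%:E); rewrite !indicE; congr ((_ : bool)%:R).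
by apply/idP/idP => /set_mem /= H; apply/mem_set; rewrite /= ?ux// -ux.
Qed.

Lemma lebesgue_young_norm B g (l : R) : young B -> 0 <= l -> (forall i, measurable_fun (setT : set C) (coord g i)) ->
  measurable_fun (setT : set C) (fun x => B (en (g x) / l)).
Proof.
move=> yB l0 mg.
have msum : measurable_fun (setT : set C) (fun x => \sum_i g x ord0 i ^+ 2).
  by apply: measurable_sum => i; exact: (measurable_funX _ (mg i)).
have msq : measurable_fun (setT : set R) (@Num.sqrt R).
  by apply: nondecreasing_measurable => // s t; exact: ler_wsqrtr.
have men : measurable_fun (setT : set C) (fun x => en (g x) / l).
  exact: measurable_funM (measurableT_comp msq msum) (measurable_cst _).
rewrite (_ : (fun x => _) = (fun t : R => B (Num.max 0 t)) \o (fun x => en (g x) / l)).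
  exact: measurableT_comp (measurable_young yB) men.
by apply/funext => x /=; rewrite max_r// divr_ge0// euclidean_norm_ge0.
Qed.

(** Modulars over [Om] become integrals over the whole space, because the Borel gradient vanishes
    almost everywhere outside [Om]. *)
Lemma lebesgue_modular B (Om : set V) g q (l : R) : young B -> 0 < l -> measurable Om ->
  (forall i, measurable_fun (setT : set C) (coord g i)) -> (forall i, measurable_fun setT (coord q i)) ->
  {ae m, forall x, g x = q x} -> {ae m, forall x, ~ Om x -> q x = 0} ->
  (\int[mu]_(x in Om) B (en (g x) / l)%R = \int[m]_x B (en (q x) / l)%R)%E.
Proof.
move=> yB l0 mO mg mq gq q0.
have B0 (z : V) : (0 <= B (en z / l)%R)%E by apply: (young_ge0 yB); rewrite divr_ge0 ?euclidean_norm_ge0// ltW.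
have mBg := lebesgue_young_norm yB (ltW l0) mg.
rewrite ge0_integral_mkindic; apply: lebesgue_integral_ae.
- exact: emeasurable_funM (lebesgue_indic mO) mBg.
- exact: measurable_young_norm yB (ltW l0) mq.
- by move=> x; apply: mule_ge0 => //; rewrite lee_fin.
- by move=> x.
apply: filterS2 gq q0 => x -> qx; rewrite indicE; have [xO|xO] := pselect (Om x).
  by rewrite (mem_set xO) mul1e.
by rewrite (memNset xO) mul0e (qx xO) euclidean_norm0 mul0r (young0 yB).
Qed.

Lemma lebesgue_modularT B g q (l : R) : young B -> 0 < l ->
  (forall i, measurable_fun (setT : set C) (coord g i)) -> (forall i, measurable_fun setT (coord q i)) ->
  {ae m, forall x, g x = q x} ->
  (\int[mu]_(x in setT) B (en (g x) / l)%R = \int[m]_x B (en (q x) / l)%R)%E.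
Proof.
move=> yB l0 mg mq gq; apply: (lebesgue_modular yB l0 measurableT mg mq gq).
by apply: aeW => x /(_ I).
Qed.

Lemma gradient_energyE A q (l : R) : young A -> (forall t, 0 <= t -> (A t < +oo)%E) -> 0 < l ->
  gradient_energy A q l = (\int[m]_x A (en (q x) / l)%R)%E.
Proof.
move=> yA finA l0; apply: eq_integral => x _; rewrite (yrealE yA finA)//.
by rewrite divr_ge0 ?euclidean_norm_ge0// ltW.
Qed.

Lemma V01_version A (Om : set V) u : young A -> (forall t, 0 <= t -> (A t < +oo)%E) -> measurable Om -> V01 A Om u ->
  exists w q, [/\ admissible Om w q, {ae m, forall x, (u \_ Om) x = w x},
    {ae m, forall x, weak_gradient (u \_ Om) x = q x} & exists2 l, 0 < l & (gradient_energy A q l < +oo)%E].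
Proof.
move=> yA finA mO [_ Wu [_ [l l0 fin]] lev]; have wg := weak_gradientP Wu; have [Lu _] := Wu; have [Lg _] := wg.
(* [admissible] asks for the value 0 at every point outside [Om], whereas a version is determined
   almost everywhere only; hence the factor [\1_Om]. *)
have [w0 lw0 uw0] := L1loc_version Lu; pose w x := w0 x * \1_Om x.
have lw : loc_summable w by apply: loc_summableMb => //; exact: bounded_measurable_indic.
have uw : {ae m, forall x, (u \_ Om) x = w x}.
  apply: filterS uw0 => x ux; rewrite /w -ux patchE indicE; have [xO|xO] := pselect (Om x).
    by rewrite (mem_set xO) mulr1.
  by rewrite (memNset xO) mulr0.
have [q gq wq] := weak_gradient_version Lu wg lw uw.
have mu_ := L1loc_measurable Lu; have [mw _] := lw.
have mq i : measurable_fun setT (coord q i) by have [_ []] := wq i.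
have mg i : measurable_fun (setT : set C) (coord (weak_gradient (u \_ Om)) i) := L1loc_measurable (Lg i).
exists w, q; split => //.
- split => //; last by move=> x xO; rewrite /w indicE (memNset xO) mulr0.
  by move=> t t0; rewrite -(lebesgue_level t mu_ mw uw); exact: lev.
- by exists l => //; rewrite gradient_energyE// -(lebesgue_modularT yA l0 mg mq gq).
Qed.

Lemma version_V01 B (Om : set V) v w q (l : R) : young B -> measurable Om -> admissible Om w q ->
  measurable_fun (setT : set C) (v \_ Om) -> {ae m, forall x, (v \_ Om) x = w x} -> (0 < n)%N ->
  0 < l -> (\int[m]_x B (en (q x) / l)%R < +oo)%E ->
  V01 B Om v /\ {ae m, forall x, weak_gradient (v \_ Om) x = q x}.
Proof.
move=> yB mO adm mv vw n0 l0 fin; have wq := adm_wder adm; have [lw _ _] := wq (Ordinal n0).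
have [mw _] := lw.
have Lv : L1loc (v \_ Om) := loc_summable_L1loc mv lw vw.
have Wv : W11loc (v \_ Om) by split => //; exists q; exact: wder_weak_gradient mv vw wq.
have wg := weak_gradientP Wv; have [Lg _] := wg.
have [q2 gq2 wq2] := weak_gradient_version Lv wg lw vw.
(* [weak_gradient] is an arbitrary choice among the weak gradients; uniqueness, applied to the
   difference of two gradients of [w], identifies it with [q]. *)
have gq : {ae m, forall x, weak_gradient (v \_ Om) x = q x}.
  have H i : {ae m, forall x, coord q i x + -1 * coord q2 i x = 0}.
    have := wder_comb (-1) (wq i) (wq2 i).
    rewrite (_ : (fun x => w x + -1 * w x) = fun=> 0); first exact: wder_unique0.
    by apply/funext => x; rewrite mulN1r subrr.
  apply: filterS2 gq2 (ae_forall_fin H) => x -> Hx; apply/rowP => i.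
  by have := Hx i; rewrite mulN1r => /eqP; rewrite subr_eq0 => /eqP.
have mq i : measurable_fun setT (coord q i) by have [_ []] := wq i.
have mg i : measurable_fun (setT : set C) (coord (weak_gradient (v \_ Om)) i) := L1loc_measurable (Lg i).
split => //; split => //.
- by apply/(measurable_restrictT _ _).2 => //; exact: lebesgue_set.
- by split=> //; exists l => //; rewrite (lebesgue_modularT yB l0 mg mq gq).
- by move=> t t0; rewrite (lebesgue_level t mv mw vw); exact: (adm_level adm).
Qed.

End bridge.

(** * Mapping and continuity in the homogeneous spaces *)

Section conclusion.
Context {R : realType} {n : nat}.
Local Notation V := 'rV[R]_n.
Local Notation m := (borel_lebesgue R n).
Local Notation mu := (lebesgue_rV R n).
Local Notation C := (caratheodory_type (borel_lebesgue R n)^*%mu).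
Local Notation en := (@euclidean_norm R n).

Lemma restrict_comp (f : R -> R) (Om : set V) (u : V -> R) : f 0 = 0 -> (f \o u) \_ Om = f \o (u \_ Om).
Proof. by move=> f0; apply/funext => x; rewrite /= !patchE; case: ifP. Qed.

(** The common form of both parts, with [Ah] the function that defines [H_n]. Borel versions of [u]
    and of its gradient are chosen, the estimates are applied to them, and the identification of
    [weak_gradient] carries the result back. *)
Lemma superposition_conclusion (slack : bool) (Om : set V) (A Ah B : R -> \bar R) (f E : R -> R) (kappa t0 t1 c : R) :
  (1 < n)%N -> open Om -> young A -> young B -> young Ah ->
  (forall t, 0 <= t -> (A t < +oo)%E) -> (forall t, 0 <= t -> (Ah t < +oo)%E) ->
  non_degenerate A -> non_degenerate Ah -> converges_at_zero (Hn_integrand n Ah) ->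
  diverges_at_infinity (Hn_integrand n Ah) ->
  (forall x : R, exists2 U : set R, nbhs x U & [lipschitz f y | y in U]) -> f 0 = 0 -> 0 < kappa ->
  (forall s, 0 <= s -> 0 <= E s) -> {in `[0, +oo[ &, {homo E : s t / s <= t}} ->
  {ae @lebesgue_measure R, forall t : R, `|derive1 f t| <= kappa * E (kappa * `|t|)} ->
  0 <= t0 -> 0 <= t1 -> 1 <= c -> (slack || (t0 == 0) && (t1 == 0)) -> (slack -> (mu Om < +oo)%E) ->
  (forall t, t0 <= t -> (B (t * E (Hn n Ah t))%R <= A t)%E) ->
  (forall t, t1 <= t -> (A t <= Ah (c * t)%R)%E /\ (Ah t <= A (c * t)%R)%E) ->
  maps_V01 A B Om (fun u => f \o u) /\ modular_continuous A B Om (fun u => f \o u).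
Proof.
move=> n1 oO yA yB yAh finA finAh posA posAh conv div flip f0 k0 E0 Emon fb t00 t10 c1 sl Om_fin HB HE.
have n0 := ltnW n1; have mO : measurable Om by exact: open_measurable_rV.
have [al [h [T [c0 [cap [T_nondec T_gt0 T0 T_inv] [c00 c0s] Q1 Q2]]]]] :=
  embedding_data n1 yA yB yAh finA finAh posA posAh conv div E0 Emon t00 t10 c1 sl HB HE.
have Em (s t : R) : 0 <= s -> s <= t -> E s <= E t.
  by move=> s0 st; apply: Emon => //; rewrite in_itv/= andbT//; exact: le_trans st.
(* [E] is controlled on the positive half-line only; writing [be] through [Num.max 0] exhibits it as
   a monotone function of [|t|], hence Borel. *)
pose be (t : R) : R := kappa * E (kappa * `|t|).
have kt (t : R) : 0 <= kappa * `|t| by rewrite mulr_ge0// ltW.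
have be0 (t : R) : 0 <= be t by rewrite mulr_ge0 ?(ltW k0)// E0.
have mbe : measurable_fun setT be.
  rewrite (_ : be = (fun s => kappa * E (Num.max 0 s)) \o (fun t => kappa * `|t|)); last first.
    by apply/funext => t; rewrite /= max_r.
  apply: measurableT_comp; last by apply: measurable_funM => //; exact: measurable_normr.
  apply: nondecreasing_measurable => // s t st; rewrite ler_wpM2l ?(ltW k0)//.
  apply: Em; first by rewrite le_max lexx.
  by rewrite ge_max !le_max lexx/= st orbT.
have bel (r : R) : exists b, forall s, `|s| <= r -> be s <= b.
  exists (be r) => s sr; rewrite ler_wpM2l ?(ltW k0)//; apply: Em => //.
  by rewrite ler_wpM2l ?(ltW k0)//; apply: le_trans sr (ler_norm _).
have [D [lD DE fD]] := lipschitz_primitive flip f0 fb be0 mbe bel.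
have cf : continuous f.
  apply: lipschitz_itv_continuous => k; apply: lipschitz_compact => //; rewrite ge0_cp//.
have mf : measurable_fun setT f by exact: continuous_measurable_fun.
have mOfin : slack -> (m Om < +oo)%E by move=> /Om_fin; rewrite /lebesgue_rV; move: (completionE m mO) => ->.
have adm_chain w q l : admissible Om w q -> 0 < l -> (gradient_energy A q l < +oo)%E ->
    admissible Om (f \o w) (chain_gradient D w q).
  move=> adm l0 fin; rewrite fD.
  exact: (chain_admissible n1 yA finA posA yB cap T_nondec T_gt0 T0 T_inv c00 c0s c1 Q1 Q2 k0 lD DE mO mOfin adm l0 fin).
have energy_chain w q l : admissible Om w q -> 0 < l -> (gradient_energy A q l < +oo)%E ->
    (\int[m]_x B (en (chain_gradient D w q x) / (kappa * l))%R < +oo)%E.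
  move=> adm l0 fin.
  exact: (chain_gradient_energy n1 yA finA posA yB cap T_nondec T_gt0 T0 T_inv c00 c0s c1 Q1 Q2 k0 lD DE mO mOfin adm l0 fin).
have image u w q l : V01 A Om u -> admissible Om w q -> {ae m, forall x, (u \_ Om) x = w x} -> 0 < l ->
    (gradient_energy A q l < +oo)%E ->
    V01 B Om (f \o u) /\ {ae m, forall x, weak_gradient ((f \o u) \_ Om) x = chain_gradient D w q x}.
  move=> [_ [Lu _] _ _] adm uw l0 fin.
  have kl : 0 < kappa * l by rewrite mulr_gt0.
  apply: (version_V01 yB mO (adm_chain _ _ _ adm l0 fin) _ _ n0 kl (energy_chain _ _ _ adm l0 fin)).
    rewrite (restrict_comp Om u f0); exact: (measurableT_comp mf (L1loc_measurable Lu)).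
  by rewrite (restrict_comp Om u f0); apply: filterS uw => x /= ->.
split.
  move=> u Vu; have [w [q [adm uw _ [l l0 fin]]]] := V01_version yA finA mO Vu.
  by have [] := image _ _ _ _ Vu adm uw l0 fin.
move=> u_ u Vu_ Vu [l l0 cv].
have [w [q [adm uw gq [l' l'0 fin]]]] := V01_version yA finA mO Vu.
have /choice[wq Hk] k : exists p : (V -> R) * (V -> V), [/\ admissible Om p.1 p.2,
    {ae m, forall x, (u_ k \_ Om) x = p.1 x}, {ae m, forall x, weak_gradient (u_ k \_ Om) x = p.2 x} &
    exists2 l, 0 < l & (gradient_energy A p.2 l < +oo)%E].
  by have [wk [qk H]] := V01_version yA finA mO (Vu_ k); exists (wk, qk).
have mq i : measurable_fun setT (coord q i) by have [_ []] := adm_wder adm i.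
have mqk k i : measurable_fun setT (coord (wq k).2 i) by have [ak _ _ _] := Hk k; have [_ []] := adm_wder ak i.
have mg (v : V -> R) (P : R -> \bar R) i : V01 P Om v -> measurable_fun (setT : set C) (coord (weak_gradient (v \_ Om)) i).
  by move=> [_ /weak_gradientP[Lg _] _ _]; exact: (L1loc_measurable (Lg i)).
have van : vanishing (fun k => gradient_energy A (fun x => (wq k).2 x - q x) l).
  apply/vanishing_cvg; first by move=> k; apply: integral_ge0 => x _; rewrite lee_fin (yreal_ge0 yA finA posA).
  move: cv; apply: cvg_trans; apply: near_eq_cvg; apply: nearW => k.
  have [ak uk gk _] := Hk k.
  rewrite gradient_energyE//; apply: (lebesgue_modular yA l0 mO).
  - move=> i; rewrite (_ : coord _ i = fun x => coord (weak_gradient (u_ k \_ Om)) i x - coord (weak_gradient (u \_ Om)) i x).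
      by apply: measurable_funB; [exact: (mg _ _ _ (Vu_ k))|exact: (mg _ _ _ Vu)].
    by apply/funext => x; rewrite /coord !mxE.
  - move=> i; rewrite (_ : coord _ i = fun x => coord (wq k).2 i x - coord q i x); first exact: measurable_funB.
    by apply/funext => x; rewrite /coord !mxE.
  - by apply: filterS2 gk gq => x -> ->.
  - by apply: filterS2 (gradient_off ak) (gradient_off adm) => x H1 H2 xO; rewrite H1// H2// subr0.
have admk k : admissible Om (wq k).1 (wq k).2 by have [] := Hk k.
have [L L0 vL] := chain_modular_continuity n1 yA finA posA yB cap T_nondec T_gt0 T0 T_inv c00 c0s c1 Q1 Q2 k0 lD DE mO mOfin
  admk adm l0 l'0 van fin.
exists L => //.
have imk k : V01 B Om (f \o u_ k) /\
    {ae m, forall x, weak_gradient ((f \o u_ k) \_ Om) x = chain_gradient D (wq k).1 (wq k).2 x}.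
  by have [ak uk _ [lk lk0 fk]] := Hk k; exact: image (Vu_ k) ak uk lk0 fk.
have [Vfu gfu] := image _ _ _ _ Vu adm uw l'0 fin.
have ch_adm := adm_chain _ _ _ adm l'0 fin.
have ch_admk k : admissible Om (f \o (wq k).1) (chain_gradient D (wq k).1 (wq k).2).
  by have [ak _ _ [lk lk0 fk]] := Hk k; exact: adm_chain ak lk0 fk.
have /vanishing_cvg : forall k, (0 <= \int[m]_x B (en (chain_gradient D (wq k).1 (wq k).2 x - chain_gradient D w q x)%R / L)%R)%E.
  by move=> k; apply: integral_ge0 => x _; apply: (young_ge0 yB); rewrite divr_ge0 ?euclidean_norm_ge0// ltW.
move=> [/(_ vL) cL _]; move: cL; apply: cvg_trans; apply: near_eq_cvg; apply: nearW => k.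
have [Vk gk] := imk k; apply/esym; apply: (lebesgue_modular yB L0 mO).
- move=> i; rewrite (_ : coord _ i = fun x => coord (weak_gradient ((f \o u_ k) \_ Om)) i x - coord (weak_gradient ((f \o u) \_ Om)) i x).
    by apply: measurable_funB; [exact: (mg _ _ _ Vk)|exact: (mg _ _ _ Vfu)].
  by apply/funext => x; rewrite /coord !mxE.
- move=> i; rewrite (_ : coord _ i = fun x => coord (chain_gradient D (wq k).1 (wq k).2) i x - coord (chain_gradient D w q) i x).
    by apply: measurable_funB; [have [_ []] := adm_wder (ch_admk k) i|have [_ []] := adm_wder ch_adm i].
  by apply/funext => x; rewrite /coord !mxE.
- by apply: filterS2 gk gfu => x -> ->.
- by apply: filterS2 (gradient_off (ch_admk k)) (gradient_off ch_adm) => x H1 H2 xO; rewrite H1// H2// subr0.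
Qed.

End conclusion.

(** * Equivalent Young functions *)

Section equivalent_young.
Context {R : realType}.
Local Notation lam := (@lebesgue_measure R).
Implicit Types A Ah : R -> \bar R.

(** The integral of a nonnegative function is a supremum over the simple functions below it, so
    monotonicity extends to arbitrary functions, such as the integrand of a possibly degenerate
    Young function. *)
Lemma ge0_integral_mono (f g : R -> \bar R) : (forall x, 0 <= f x)%E -> (forall x, f x <= g x)%E ->
  (\int[lam]_x f x <= \int[lam]_x g x)%E.
Proof.
move=> f0 fg; rewrite !ge0_integralTE//; last by move=> x; exact: le_trans (fg x).
by apply: le_ereal_sup => _ [h hf <-]; exists h => // x; exact: le_trans (fg x).
Qed.

(** If [Ah] vanished at [t], it would vanish on []0, t]], and the integrand would be [+oo] near
    0. *)
Lemma converges_non_degenerate n Ah : (1 < n)%N -> young Ah -> converges_at_zero (Hn_integrand n Ah) -> non_degenerate Ah.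
Proof.
move=> n1 yAh [a a0 fin] t t0; rewrite lt0e (young_ge0 yAh (ltW t0)) andbT; apply/eqP => At.
pose r := Num.min a t; have r0 : 0 < r by rewrite lt_min a0.
have p0 : 0 < n.-1%:R^-1 :> R by rewrite invr_gt0 ltr0n -subn1 subn_gt0.
have hoo s : 0 < s -> s <= r -> Hn_integrand n Ah s = +oo%E.
  move=> s0 sr; have -> : Hn_integrand n Ah s = ((s%:E / Ah s) `^ (n.-1%:R^-1)%R)%E by [].
  have -> : Ah s = 0%E.
    apply/eqP; rewrite eq_le (young_ge0 yAh (ltW s0)) andbT -At; apply: (young_nondec yAh (ltW s0)).
    by apply: le_trans sr _; rewrite ge_min lexx orbT.
  by rewrite inve0 gt0_muley ?lte_fin// poweRyr ?gt_eqF.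
have I0 : (\int[lam]_(s in `]0%R, r]) +oo%E = +oo)%E.
  rewrite integral_cst//= lebesgue_measure_itv/= lte_fin r0 sube0 gt0_mulye//.
have h0 s : (0 <= Hn_integrand n Ah s)%E by exact: poweR_ge0.
suff : (+oo <= \int[lam]_(s in `[0%R, a]) Hn_integrand n Ah s)%E by rewrite leye_eq => /eqP H; rewrite H in fin.
rewrite -I0 integral_mkcond [leRHS]integral_mkcond; apply: ge0_integral_mono.
  by move=> s; rewrite patchE; case: ifP.
move=> s; rewrite !patchE; case: ifPn => [|_]; last by case: ifP.
rewrite inE/= in_itv/= => /andP[s0 sr]; rewrite hoo// mem_set//= in_itv/= (ltW s0).
by apply: le_trans sr _; rewrite ge_min lexx.
Qed.

(** From [Ah(s) <= A(c s)], the integrand of [A] at [c s] is at most [c^(1/(n-1))] times that of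
    [Ah] at [s] for large [s]; a change of scale transfers the divergence. *)
Lemma equivalent_diverges n A Ah (c t1 : R) : (1 < n)%N -> young A -> young Ah ->
  (forall t, 0 <= t -> (A t < +oo)%E) -> (forall t, 0 <= t -> (Ah t < +oo)%E) ->
  non_degenerate A -> non_degenerate Ah -> 0 < c -> (forall t, t1 <= t -> (Ah t <= A (c * t)%R)%E) ->
  diverges_at_infinity (Hn_integrand n A) -> diverges_at_infinity (Hn_integrand n Ah).
Proof.
move=> n1 yA yAh fA fAh pA pAh c0 HE div a a0; pose b := Num.max a t1; pose p : R := n.-1%:R^-1.
have p0 : 0 <= p by rewrite invr_ge0.
have ba : a <= b by rewrite le_max lexx.
have b0 : 0 < b by exact: lt_le_trans ba.
have mh := measurable_ycap n yA fA pA.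
have mhh := measurable_ycap n yAh fAh pAh.
pose k : R := c `^ p; have k0 : 0 < k by exact: powR_gt0.
pose f (s : R) : \bar R := (ycap n A s * \1_`[(c * b), +oo[%classic s)%:E.
have mf : measurable_fun setT f.
  by apply/measurable_EFinP; apply: measurable_funM => //; exact: measurable_indic.
have h0 s : 0 <= ycap n A s by exact: ycap_ge0.
have hh0 s : 0 <= ycap n Ah s by exact: ycap_ge0.
have f0 s : (0 <= f s)%E by rewrite lee_fin mulr_ge0.
have cb0 : 0 < c * b by rewrite mulr_gt0.
have foo : (\int[lam]_s f s = +oo)%E.
  rewrite -(div _ cb0) [RHS]integral_mkcond; apply: eq_integral => s _; rewrite patchE /f indicE.
  case: ifPn => sb; last by rewrite mulr0.
  have s0 : 0 <= s by move: sb; rewrite inE/= in_itv/= andbT; apply: le_trans; exact: ltW.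
  by rewrite mulr1 (ycapE n1 yA fA pA s0).
pose g (s : R) : \bar R := (ycap n Ah s * \1_`[a, +oo[%classic s)%:E.
have mg : measurable_fun setT g.
  by apply/measurable_EFinP; apply: measurable_funM => //; exact: measurable_indic.
have gE : (\int[lam]_s g s = \int[lam]_(s in `[a, +oo[) Hn_integrand n Ah s)%E.
  rewrite [RHS]integral_mkcond; apply: eq_integral => s _; rewrite patchE /g indicE.
  case: ifPn => sb; last by rewrite mulr0.
  have s0 : 0 <= s by move: sb; rewrite inE/= in_itv/= andbT; apply: le_trans; exact: ltW.
  by rewrite mulr1 (ycapE n1 yAh fAh pAh s0).
have fg s : (f (c * s)%R <= k%:E * g s)%E.
  rewrite /f /g -EFinM lee_fin !indicE; have [bs|sb] := leP b s; last first.
    rewrite memNset ?mulr0//; first by rewrite !mulr_ge0// ?ltW.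
    by rewrite /= in_itv/= andbT ler_pM2l// leNgt sb.
  have s0 : 0 < s by exact: lt_le_trans bs.
  rewrite !mem_set ?mulr1; [|by rewrite /= in_itv/= andbT (le_trans ba)|by rewrite /= in_itv/= andbT ler_pM2l].
  have cs0 : 0 < c * s by rewrite mulr_gt0.
  have a1 := yreal_gt0 yA fA pA cs0; have a2 := yreal_gt0 yAh fAh pAh s0.
  rewrite /ycap /k -powRM; [|exact: ltW|by rewrite divr_ge0 ?(ltW s0) ?(ltW a2)].
  apply: ge0_ler_powR => //.
  - by rewrite nnegrE (divr_ge0 (ltW cs0) (ltW a1)).
  - by rewrite nnegrE (mulr_ge0 (ltW c0) (divr_ge0 (ltW s0) (ltW a2))).
  rewrite mulrA ler_pM2l// lef_pV2 ?posrE//.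
  have := HE s (le_trans (_ : t1 <= b) bs); rewrite le_max lexx orbT => /(_ isT).
  by rewrite (yrealE yA fA (ltW cs0)) (yrealE yAh fAh (ltW s0)) lee_fin.
rewrite -gE; apply/eqP; rewrite -leye_eq leNgt; apply/negP => goo.
have g0 s : (0 <= g s)%E by rewrite lee_fin mulr_ge0.
have : (\int[lam]_s f (c * s)%R < +oo)%E.
  apply: (le_lt_trans (ge0_integral_mono (fun s => f0 (c * s)) fg)).
  have kE : (0 <= k%:E)%E by rewrite lee_fin (ltW k0).
  have -> : (\int[lam]_s (k%:E * g s) = k%:E * \int[lam]_s g s)%E by apply: ge0_integralZlT => //; exact: ltW.
  exact: (lte_mul_pinfty kE isT goo).
move=> I1; have := ge0_integral_scale c0 mf f0; rewrite foo => I2.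
have I0 : (0 <= \int[lam]_s f (c * s)%R)%E by exact: integral_ge0.
by have := lte_mul_pinfty (_ : (0 <= c%:E)%E) isT I1; rewrite I2 lee_fin (ltW c0) => /(_ isT).
Qed.

End equivalent_young.

Theorem theorem3p12 (R : realType) (n : nat) (Omega : set 'rV[R]_n)
    (A B : R -> \bar R) (f E : R -> R) (kappa : R)
    (n_ge2 : (2 <= n)%N)
    (Omega_open : open Omega)
    (A_young : young A) (B_young : young B)
    (A_nondeg : non_degenerate A)
    (A_div : diverges_at_infinity (Hn_integrand n A))
    (f_lip : forall x : R, exists2 U : set R, nbhs x U & [lipschitz f y | y in U])
    (f0 : f 0 = 0)
    (kappa_gt0 : 0 < kappa)
    (E_ge0 : forall s : R, 0 <= s -> 0 <= E s)
    (E_nondecr : {in `[0, +oo[ &, {homo E : s t / s <= t}})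
    (E_cont : {within `[0, +oo[, continuous E})
    (E_neq0 : exists2 s : R, 0 <= s & E s <> 0)
    (f_bound : {ae @lebesgue_measure R,
       forall t : R, `|derive1 f t| <= kappa * E (kappa * `|t|)}) :
  ((lebesgue_rV R n Omega < +oo)%E ->
   forall Ah : R -> \bar R, Hn_admissible n A Ah ->
   (exists2 t0 : R, 0 <= t0 &
      forall t : R, t0 <= t -> (B (t * E (Hn n Ah t))%R <= A t)%E) ->
   maps_V01 A B Omega (fun u => f \o u) /\
   modular_continuous A B Omega (fun u => f \o u)) /\
  (converges_at_zero (Hn_integrand n A) ->
   (forall t : R, 0 <= t -> (B (t * E (Hn n A t))%R <= A t)%E) ->
   maps_V01 A B Omega (fun u => f \o u) /\
   modular_continuous A B Omega (fun u => f \o u)).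
Proof.
have n1 : (1 < n)%N by exact: n_ge2.
have finA := young_finite n1 A_young A_div.
have HE A' t : (A' t <= A' (1 * t)%R)%E /\ (A' t <= A' (1 * t)%R)%E :> Prop by rewrite mul1r.
split=> [Ofin Ah [AhA Ah_eq] [t0 t00 HB]|conv HB].
  (* When the integral converges, [Ah] is [A] itself and the slack only serves for [t0]. *)
  have [conv|nconv] := pselect (converges_at_zero (Hn_integrand n A)).
    move: HB; rewrite (AhA conv) => HB.
    by apply: (@superposition_conclusion R n true Omega A A B f E kappa t0 0 1).
  have [yAh [c [t1 [c0 t10 Hc]]] conv] := Ah_eq nconv.
  have nd := converges_non_degenerate n1 yAh conv.
  (* The inequality [A(t/c) <= Ah(t)] is read at [c t], which requires [t >= t1 / c]; the maximum
     with 1 gives the constant [d >= 1] that dilation inside [T] demands. *)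
  pose t2 := Num.max t1 (t1 / c); pose d := Num.max c 1.
  have d1 : 1 <= d by rewrite le_max lexx orbT.
  have d0 := lt_le_trans ltr01 d1.
  have cd : c <= d by rewrite le_max lexx.
  have t12 : t1 <= t2 by rewrite le_max lexx.
  have t20 : 0 < t2 by exact: lt_le_trans t12.
  have up t : t2 <= t -> (A t <= Ah (d * t)%R)%E /\ (Ah t <= A (d * t)%R)%E.
    move=> t2t; have tpos := lt_le_trans t20 t2t; have t1t := le_trans t12 t2t.
    have ct : t1 <= c * t by rewrite mulrC -ler_pdivrMr// (le_trans _ t2t)// le_max lexx orbT.
    have cdt : c * t <= d * t by rewrite ler_wpM2r// ltW.
    have ct0 : 0 <= c * t by rewrite mulr_ge0// ltW.
    split.
      have [H _] := Hc _ ct; rewrite [c * t]mulrC mulfK ?gt_eqF// in H.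
      by apply: le_trans H _; rewrite mulrC; exact: (young_nondec yAh).
    have [_ H] := Hc _ t1t; apply: le_trans H _; exact: (young_nondec A_young).
  have finAh t : 0 <= t -> (Ah t < +oo)%E.
    move=> t0'; have tm : t <= Num.max t t2 by rewrite le_max lexx.
    apply: le_lt_trans (young_nondec yAh t0' tm) _.
    have [|_ H] := up (Num.max t t2); first by rewrite le_max lexx orbT.
    by apply: le_lt_trans H _; apply: finA; exact: mulr_ge0 (ltW d0) (le_trans t0' tm).
  have divh := equivalent_diverges n1 A_young yAh finA finAh A_nondeg nd d0 (fun t t2t => (up t t2t).2) A_div.
  exact: (@superposition_conclusion R n true Omega A Ah B f E kappa t0 t2 d n1 Omega_open A_young B_young yAh finA finAh
    A_nondeg nd conv divh f_lip f0 kappa_gt0 E_ge0 E_nondecr f_bound t00 (ltW t20) d1 isT (fun=> Ofin) HB up).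
(* Here the growth condition holds from 0 on and [Ah] is [A], so both thresholds are 0 and no
   additive constant arises. *)
apply: (@superposition_conclusion R n false Omega A A B f E kappa 0 0 1) => //.
by rewrite /= eqxx.
Qed.
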